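(* Let $(\mathbf{S}^3,J,[\theta_0])$ be the standard CR $3$-sphere, and let $\lambda_0$ be a real smooth function on $\mathbf{S}^3$ with $\int_{\mathbf{S}^3}e^{4\lambda_0}d\mu_0=\int_{\mathbf{S}^3}d\mu_0$. Then the solution $\lambda$ of the flow $$\frac{\partial\lambda}{\partial t}=-(Q_0+2P_0\lambda)+r,\qquad \lambda(\cdot,0)=\lambda_0,\qquad r=r(t)=\frac{\int_{\mathbf{S}^3} (Q_0+2P_0\lambda)\,e^{4\lambda}\,d\mu_0}{\int_{\mathbf{S}^3} e^{4\lambda}\,d\mu_0},$$ exists on $\mathbf{S}^3\times[0,\infty)$ and converges smoothly (as $t\to\infty$) to a function $\lambda_\infty$ such that $e^{2\lambda_\infty}\theta_0$ is a contact form of zero $Q$-curvature.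
   Context: Standard CR $3$-sphere: $\mathbf{S}^3=\{(z_0,z_1)\in\mathbf{C}^2: |z_0|^2+|z_1|^2=1\}$ with the CR structure $J$ induced from $\mathbf{C}^2$ and contact form $\theta_0=\frac{i(\bar\partial u-\partial u)}{2}\big|_{\mathbf{S}^3}$, $u=|z_0|^2+|z_1|^2-1$. Pseudohermitian geometry on a $3$-manifold with contact structure $\xi$ and CR structure $J:\xi\to\xi$, $J^2=-\mathrm{Id}$. For $(J,\theta)$: $T$ is the characteristic vector field, i.e. the unique vector field with $\theta(T)=1$, $d\theta(T,\cdot)=0$. Locally choose a complex frame $Z_1$ with $JZ_1=iZ_1$, $Z_{\bar1}=\overline{Z_1}$, and dual coframe $\{\theta,\theta^1,\theta^{\bar1}\}$ to $\{T,Z_1,Z_{\bar1}\}$ such that $d\theta=i\theta^1\wedge\theta^{\bar1}$. The connection form $\omega_1{}^1$ and torsion $A^1{}_{\bar1}$ are determined by $d\theta^1=\theta^1\wedge\omega_1{}^1+A^1{}_{\bar1}\theta\wedge\theta^{\bar1}$, $\omega_1{}^1+\omega_{\bar1}{}^{\bar1}=0$; $A_{\bar1\bar1}=A^1{}_{\bar1}$ and $A_{11}=\overline{A_{\bar1\bar1}}$. The Tanaka-Webster curvature $W$ is given by $d\omega_1{}^1=W\theta^1\wedge\theta^{\bar1}+2i\,\mathrm{Im}(A_{11,\bar1}\theta^1\wedge\theta)$. Indices denote covariant derivatives with respect to the pseudohermitian connection: $f_1=Z_1f$, $f_{1\bar1}=Z_{\bar1}Z_1f-\omega_1{}^1(Z_{\bar1})Z_1f$,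 etc. (commas for tensors). The sub-Laplacian is $\Delta_bf=f_{1\bar1}+f_{\bar11}$. The CR Paneitz operator (on real smooth functions) is $P\lambda=\Delta_b^2\lambda+T^2\lambda+4\,\mathrm{Im}(A_{\bar1\bar1}\lambda_{11}+A_{\bar1\bar1,1}\lambda_1)$ and the $Q$-curvature is $Q=-\frac23(\Delta_bW+2\,\mathrm{Im}\,A_{11,\bar1\bar1})$. $P_0$ and $Q_0$ denote these objects with respect to $(J,\theta_0)$; $d\mu_0=\theta_0\wedge d\theta_0$. For $\theta=e^{2\lambda}\theta_0$ one has $\theta\wedge d\theta=e^{4\lambda}d\mu_0$ and $Q=e^{-4\lambda}(Q_0+2P_0\lambda)$. Smooth convergence means convergence in the $C^\infty$ topology. *)

(* Defs.v *)
From Stdlib Require Import Reals List.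
From Coquelicot Require Import Coquelicot.

Open Scope R_scope.

(** * Smooth functions on a subset of a real normed space *)

(* Derivative of [f] at [x] along [v] with increments staying in [D]: two-sided
   at interior points, one-sided at boundary points such as t = 0 in [0,oo). *)
Definition is_deriv_within {V : NormedModule R_AbsRing} (D : V -> Prop)
    (f : V -> R) (x v : V) (l : R) : Prop :=
  filterlim (fun h : R => (f (plus x (scal h v)) - f x) / h)
    (within (fun h : R => D (plus x (scal h v))) (locally' 0)) (locally l).

(* [F s] is the iterated derivative of [f] along the vectors of [s], the head
   of [s] being the last direction of differentiation. *)
Definition smooth_on {V : NormedModule R_AbsRing} (D : V -> Prop)
    (f : V -> R) : Prop :=
  exists F : list V -> V -> R,
    (forall x, D x -> F nil x = f x) /\
    (forall s x, D x ->
       filterlim (F s) (within D (locally x)) (locally (F s x))) /\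
    (forall s v x, D x -> is_deriv_within D (F s) x v (F (v :: s) x)).

(** * The sphere in C^2 *)

Definition C2 : NormedModule R_AbsRing :=
  prod_NormedModule R_AbsRing C_R_NormedModule C_R_NormedModule.

Definition z0 (p : C2) : C := fst p.
Definition z1 (p : C2) : C := snd p.
Definition mk2 (a b : C) : C2 := (a, b).

Definition S3 (p : C2) : Prop := Cmod (z0 p) ^ 2 + Cmod (z1 p) ^ 2 = 1.

(* Functions, vector fields and forms on S^3 are represented by functions on
   C^2 of which only the values at points of S^3 matter. They are
   differentiated through the extension that is constant along rays. *)
Definition proj (x : C2) : C2 :=
  scal (/ sqrt (Cmod (z0 x) ^ 2 + Cmod (z1 x) ^ 2)) x.

Definition ext {A : Type} (f : C2 -> A) : C2 -> A := fun x => f (proj x).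

Definition cone (U : C2 -> Prop) (x : C2) : Prop := x <> zero /\ U (proj x).

Definition open_S3 (U : C2 -> Prop) : Prop := open (cone U).

Definition smooth_fun (U : C2 -> Prop) (f : C2 -> R) : Prop :=
  smooth_on (cone U) (ext f).

Definition smooth_cfun (U : C2 -> Prop) (f : C2 -> C) : Prop :=
  smooth_fun U (fun p => Re (f p)) /\ smooth_fun U (fun p => Im (f p)).

Definition smooth_S3 (f : C2 -> R) : Prop := smooth_fun (fun _ => True) f.

(** * Derivatives along vectors, complexified vectors *)

Definition dirD (v : C2) (f : C2 -> R) (x : C2) : R :=
  Derive (fun h => f (plus x (scal h v))) 0.

Definition cdirD (v : C2) (f : C2 -> C) (x : C2) : C :=
  (dirD v (fun y => Re (f y)) x, dirD v (fun y => Im (f y)) x).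

Fixpoint iterD (s : list C2) (f : C2 -> R) : C2 -> R :=
  match s with
  | nil => f
  | v :: s' => dirD v (iterD s' f)
  end.

Definition tangent (p v : C2) : Prop :=
  Re (Cconj (z0 p) * z0 v + Cconj (z1 p) * z1 v)%C = 0.

Definition Jmul (v : C2) : C2 := mk2 (Ci * z0 v)%C (Ci * z1 v)%C.

(* The pair (v, w) stands for v + i w in the complexification of C^2 = R^4;
   here i is the formal complex unit, and [Jmul] is the structure of C^2. *)
Definition CC2 : Type := (C2 * C2)%type.

Definition cplx (v : C2) : CC2 := (v, zero).
Definition Vconj (V : CC2) : CC2 := (fst V, opp (snd V)).
Definition imulV (V : CC2) : CC2 := (opp (snd V), fst V).
Definition JmulV (V : CC2) : CC2 := (Jmul (fst V), Jmul (snd V)).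
Definition ctangent (p : C2) (V : CC2) : Prop :=
  tangent p (fst V) /\ tangent p (snd V).

(* V f, for f on S^3 and V tangent to S^3 at p. *)
Definition dS (f : C2 -> C) (p : C2) (V : CC2) : C :=
  (cdirD (fst V) (ext f) p + Ci * cdirD (snd V) (ext f) p)%C.

(** * Complex-valued differential forms *)

(* Forms take a base point and real vectors of C^2; a form on S^3 is the
   restriction to tangent vectors, extended complex-linearly by [capp]. *)
Definition form1 := C2 -> C2 -> C.
Definition form2 := C2 -> C2 -> C2 -> C.
Definition form3 := C2 -> C2 -> C2 -> C2 -> C.

Definition capp (a : form1) (p : C2) (V : CC2) : C :=
  (a p (fst V) + Ci * a p (snd V))%C.

Definition fconj (a : form1) : form1 := fun p v => Cconj (a p v).

Definition wedge11 (a b : form1) : form2 :=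
  fun p v w => (a p v * b p w - a p w * b p v)%C.

Definition wedge12 (a : form1) (b : form2) : form3 :=
  fun p u v w => (a p u * b p v w - a p v * b p u w + a p w * b p u v)%C.

(* The form whose coefficients are constant along rays extends [a] off S^3;
   for tangent vectors this computes the exterior derivative on S^3, since d
   commutes with the restriction to S^3. *)
Definition d1 (a : form1) : form2 :=
  fun p v w =>
    (cdirD v (ext (fun q => a q w)) p - cdirD w (ext (fun q => a q v)) p)%C.

Definition linear_form (U : C2 -> Prop) (a : form1) : Prop :=
  forall p (c : R) (v w : C2), S3 p -> U p ->
    a p (plus (scal c v) w) = (RtoC c * a p v + a p w)%C.

Definition smooth_form (U : C2 -> Prop) (a : form1) : Prop :=
  linear_form U a /\ forall v, smooth_cfun U (fun p => a p v).

Definition contact_form (th : form1) : Prop :=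
  smooth_form (fun _ => True) th /\
  (forall p v, S3 p -> Im (th p v) = 0) /\
  (forall p, S3 p -> exists u v w,
     tangent p u /\ tangent p v /\ tangent p w /\
     wedge12 th (d1 th) p u v w <> RtoC 0).

(* The (1,0) and (0,1) parts of the differential of a function on C^2. *)
Definition del (f : C2 -> C) : form1 := fun p v =>
  ((cdirD v f p - Ci * cdirD (Jmul v) f p) / 2)%C.
Definition delbar (f : C2 -> C) : form1 := fun p v =>
  ((cdirD v f p + Ci * cdirD (Jmul v) f p) / 2)%C.

Definition u_def (x : C2) : C :=
  RtoC (Cmod (z0 x) ^ 2 + Cmod (z1 x) ^ 2 - 1).

Definition theta0 : form1 := fun p v =>
  (Ci * (delbar u_def p v - del u_def p v) / 2)%C.

Definition conformal (lambda : C2 -> R) : form1 := fun p v =>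
  (RtoC (exp (2 * lambda p)) * theta0 p v)%C.

(** * Pseudohermitian geometry of (J, theta) *)

Record frame_data := FrameData {
  fr_T : C2 -> C2;          (* T *)
  fr_Z : C2 -> CC2;         (* Z_1 *)
  fr_theta1 : form1;        (* theta^1 *)
  fr_omega : form1;         (* omega_1^1 *)
  fr_A : C2 -> C;           (* A^1_{1bar} = A_{1bar 1bar} *)
  fr_W : C2 -> R            (* Tanaka-Webster curvature *)
}.

Definition frZbar (F : frame_data) (p : C2) : CC2 := Vconj (fr_Z F p).
Definition frTc (F : frame_data) (p : C2) : CC2 := cplx (fr_T F p).

(* Covariant derivative along the vector field [V] of a tensor component [f]
   with [a] lower indices 1 and [b] lower indices 1bar; the connection form
   omega_{1bar}^{1bar} is the conjugate of omega_1^1. *)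
Definition cov (F : frame_data) (a b : nat) (V : C2 -> CC2) (f : C2 -> C)
    (p : C2) : C :=
  (dS f p (V p)
   - (RtoC (INR a) * capp (fr_omega F) p (V p)
      + RtoC (INR b) * capp (fconj (fr_omega F)) p (V p)) * f p)%C.

Definition f_1 (F : frame_data) (f : C2 -> C) : C2 -> C :=
  cov F 0 0 (fr_Z F) f.
Definition f_b (F : frame_data) (f : C2 -> C) : C2 -> C :=
  cov F 0 0 (frZbar F) f.
Definition f_1b (F : frame_data) (f : C2 -> C) : C2 -> C :=
  cov F 1 0 (frZbar F) (f_1 F f).
Definition f_b1 (F : frame_data) (f : C2 -> C) : C2 -> C :=
  cov F 0 1 (fr_Z F) (f_b F f).
Definition f_11 (F : frame_data) (f : C2 -> C) : C2 -> C :=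
  cov F 1 0 (fr_Z F) (f_1 F f).

Definition sublap (F : frame_data) (f : C2 -> C) : C2 -> C :=
  fun p => (f_1b F f p + f_b1 F f p)%C.

Definition T_deriv (F : frame_data) (f : C2 -> C) : C2 -> C :=
  fun p => dS f p (frTc F p).

Definition A_bb (F : frame_data) : C2 -> C := fr_A F.
Definition A_11 (F : frame_data) : C2 -> C := fun p => Cconj (A_bb F p).
Definition A_11_b (F : frame_data) : C2 -> C :=
  cov F 2 0 (frZbar F) (A_11 F).
Definition A_11_bb (F : frame_data) : C2 -> C :=
  cov F 2 1 (frZbar F) (A_11_b F).
Definition A_bb_1 (F : frame_data) : C2 -> C :=
  cov F 0 2 (fr_Z F) (A_bb F).

Definition Q_of (F : frame_data) (p : C2) : C :=
  (RtoC (- (2 / 3)) *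
   (sublap F (fun q => RtoC (fr_W F q)) p
    + RtoC (2 * Im (A_11_bb F p))))%C.

Definition P_of (F : frame_data) (lambda : C2 -> R) (p : C2) : C :=
  let l := fun q => RtoC (lambda q) in
  (sublap F (sublap F l) p + T_deriv F (T_deriv F l) p
   + RtoC (4 * Im (A_bb F p * f_11 F l p + A_bb_1 F p * f_1 F l p)%C))%C.

(* The data of [F] over the open set [U] of S^3 are the characteristic vector
   field, an admissible frame and coframe, and the connection form, torsion
   and curvature they determine. Forms are compared on real tangent vectors. *)
Record pseudohermitian_frame (U : C2 -> Prop) (th : form1) (F : frame_data)
    : Prop := {
  pf_smooth_T :
    smooth_cfun U (fun p => z0 (fr_T F p)) /\
    smooth_cfun U (fun p => z1 (fr_T F p));
  pf_smooth_Z :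
    smooth_cfun U (fun p => z0 (fst (fr_Z F p))) /\
    smooth_cfun U (fun p => z1 (fst (fr_Z F p))) /\
    smooth_cfun U (fun p => z0 (snd (fr_Z F p))) /\
    smooth_cfun U (fun p => z1 (snd (fr_Z F p)));
  pf_smooth_theta1 : smooth_form U (fr_theta1 F);
  pf_smooth_omega : smooth_form U (fr_omega F);
  pf_smooth_A : smooth_cfun U (fr_A F);
  pf_smooth_W : smooth_fun U (fr_W F);
  pf_T : forall p, S3 p -> U p ->
    tangent p (fr_T F p) /\ th p (fr_T F p) = RtoC 1 /\
    (forall v, tangent p v -> d1 th p (fr_T F p) v = RtoC 0);
  pf_Z : forall p, S3 p -> U p ->
    ctangent p (fr_Z F p) /\ JmulV (fr_Z F p) = imulV (fr_Z F p);
  pf_dual : forall p, S3 p -> U p ->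
    capp th p (fr_Z F p) = RtoC 0 /\
    capp th p (frZbar F p) = RtoC 0 /\
    fr_theta1 F p (fr_T F p) = RtoC 0 /\
    capp (fr_theta1 F) p (fr_Z F p) = RtoC 1 /\
    capp (fr_theta1 F) p (frZbar F p) = RtoC 0;
  pf_dtheta : forall p v w, S3 p -> U p -> tangent p v -> tangent p w ->
    d1 th p v w =
    (Ci * wedge11 (fr_theta1 F) (fconj (fr_theta1 F)) p v w)%C;
  pf_dtheta1 : forall p v w, S3 p -> U p -> tangent p v -> tangent p w ->
    d1 (fr_theta1 F) p v w =
    (wedge11 (fr_theta1 F) (fr_omega F) p v w
     + fr_A F p * wedge11 th (fconj (fr_theta1 F)) p v w)%C;
  pf_omega : forall p v, S3 p -> U p -> tangent p v ->
    (fr_omega F p v + fconj (fr_omega F) p v)%C = RtoC 0;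
  pf_domega : forall p v w, S3 p -> U p -> tangent p v -> tangent p w ->
    d1 (fr_omega F) p v w =
    (RtoC (fr_W F p)
       * wedge11 (fr_theta1 F) (fconj (fr_theta1 F)) p v w
     + 2 * Ci * RtoC (Im (A_11_b F p * wedge11 (fr_theta1 F) th p v w)%C))%C
}.

(* Q and P are computed near each point in a local frame; the result does not
   depend on the frame. *)
Definition is_Q_curvature (th : form1) (Q : C2 -> R) : Prop :=
  forall p, S3 p -> exists (U : C2 -> Prop) (F : frame_data),
    open_S3 U /\ U p /\ pseudohermitian_frame U th F /\
    RtoC (Q p) = Q_of F p.

Definition is_Paneitz (th : form1) (P : (C2 -> R) -> C2 -> R) : Prop :=
  forall lambda, smooth_S3 lambda ->
  forall p, S3 p -> exists (U : C2 -> Prop) (F : frame_data),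
    open_S3 U /\ U p /\ pseudohermitian_frame U th F /\
    RtoC (P lambda p) = P_of F lambda p.

(** * Integration *)

(* (a, b, eta) -> (cos eta e^{ia}, sin eta e^{ib}), for 0 <= a, b <= 2 PI and
   0 <= eta <= PI/2, covers S^3 and is injective off a null set. *)
Definition hopf (eta a b : R) : C2 :=
  mk2 (cos eta * cos a, cos eta * sin a) (sin eta * cos b, sin eta * sin b).
Definition hopf_eta (eta a b : R) : C2 :=
  mk2 (- sin eta * cos a, - sin eta * sin a) (cos eta * cos b, cos eta * sin b).
Definition hopf_a (eta a b : R) : C2 :=
  mk2 (- (cos eta * sin a), cos eta * cos a) (RtoC 0).
Definition hopf_b (eta a b : R) : C2 :=
  mk2 (RtoC 0) (- (sin eta * sin b), sin eta * cos b).

(* The order (a, eta, b) is positive for theta0 /\ d theta0. *)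
Definition int_S3 (m : form3) : R :=
  RInt (fun eta => RInt (fun a => RInt (fun b =>
    Re (m (hopf eta a b) (hopf_a eta a b) (hopf_eta eta a b) (hopf_b eta a b)))
    0 (2 * PI)) 0 (2 * PI)) 0 (PI / 2).

Definition int_mu0 (f : C2 -> R) : R :=
  int_S3 (fun p u v w => (RtoC (f p) * wedge12 theta0 (d1 theta0) p u v w)%C).

(** * The flow *)

Definition spacetime : NormedModule R_AbsRing :=
  prod_NormedModule R_AbsRing R_NormedModule C2.

Definition smooth_spacetime (lambda : R -> C2 -> R) : Prop :=
  smooth_on (V := spacetime) (fun y => 0 <= fst y /\ snd y <> zero)
    (fun y => ext (lambda (fst y)) (snd y)).

Definition flow_r (Q0 : C2 -> R) (P0 : (C2 -> R) -> C2 -> R)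
    (l : C2 -> R) : R :=
  int_mu0 (fun p => (Q0 p + 2 * P0 l p) * exp (4 * l p))
  / int_mu0 (fun p => exp (4 * l p)).

Definition flow_solution (Q0 : C2 -> R) (P0 : (C2 -> R) -> C2 -> R)
    (lambda0 : C2 -> R) (lambda : R -> C2 -> R) : Prop :=
  smooth_spacetime lambda /\
  (forall p, S3 p -> lambda 0 p = lambda0 p) /\
  (forall t p, 0 <= t -> S3 p ->
     is_deriv_within (V := R_NormedModule) (fun s => 0 <= s)
       (fun s => lambda s p) t 1
       (- (Q0 p + 2 * P0 (lambda t) p) + flow_r Q0 P0 (lambda t))).

(* Uniform convergence on S^3 of all derivatives. *)
Definition smooth_cvg (lambda : R -> C2 -> R) (linf : C2 -> R) : Prop :=
  forall (s : list C2) (eps : R), 0 < eps ->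
  exists t0, forall t, 0 <= t -> t0 <= t -> forall p, S3 p ->
    Rabs (iterD s (ext (lambda t)) p - iterD s (ext linf) p) < eps.

(* Main.v *)
Require Import Defs.
From Stdlib Require Import Reals List Lra Lia ClassicalEpsilon FunctionalExtensionality.
From Coquelicot Require Import Coquelicot.

Open Scope R_scope.

(* Every pseudohermitian frame of theta0 has A = 0 and W = 2, so Q_0 = 0 and
   P_0 = (X^2 + Y^2)^2 / 4 + T^2. The coefficients of a^p b^q in
   1 / (1 - z a - conj z b + a b), z = <x,y>, are the kernels of the projections
   pi_pq onto the spherical harmonics of bidegree (p, q), on which P_0 acts as
   4 p q (p+1) (q+1). Since r depends on time only, the flow is
     lambda(t) = sum_pq exp (- 8 t p q (p+1) (q+1)) pi_pq lambda0 + c(t),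
   where c(t) keeps the integral of e^(4 lambda) constant. The projections of a
   smooth function decay rapidly (integrate by parts), and they sum up to the
   function by Abel summation, because the Poisson kernel is an approximate
   identity. Only the terms with p q = 0 survive as t tends to infinity, so the
   limit f satisfies P_0 f = 0; and an explicit frame of e^(2f) theta0 shows
   that its Q-curvature is 2 e^(-4f) P_0 f. *)

(** * Smooth functions on a subset of a normed space *)

(** The equation is linear up to a function of time, so no a priori estimate enters; the difficulty
    is smoothness of the series in space and in time, down to t = 0. The fields X and Y do not
    commute with pi_pq, but the generators of U(2) do: T and the three su(2) rotations. Every
    derivative on the sphere is a combination of the rotations with smooth coefficients, and X^2 +
    Y^2 is the sum of the squares of the rotations minus T^2. Hence a derivative of the series built
    from g is a combination of the series built from rotated copies of g, and for d/dt from -2 P_0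
    g. The decay of the projections of a smooth function then suffices, without any help from the
    exponential factors. The rate is uniform because p q (p+1) (q+1) is at least 4 unless p q = 0.
    Uniqueness rests on two facts: a function of time is invisible to pi_pq for (p, q) other than
    (0, 0), and r does not change when a constant is added to lambda. The data Q_0 and P_0 are given
    through arbitrary local frames, so such a frame has to be determined up to its phase before any
    formula for them is available. *)

Definition line {V : NormedModule R_AbsRing} (D : V -> Prop) (x v : V) :
    (R -> Prop) -> Prop :=
  within (fun h : R => D (plus x (scal h v))) (locally' 0).

Global Instance line_filter {V : NormedModule R_AbsRing} (D : V -> Prop) (x v : V) :
  Filter (line D x v).
Proof. apply within_filter. apply within_filter. apply locally_filter. Qed.

Definition cont_on {V : NormedModule R_AbsRing} (D : V -> Prop) (f : V -> R) : Prop :=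
  forall x, D x -> filterlim f (within D (locally x)) (locally (f x)).

Global Instance within_locally_filter {V : UniformSpace} (D : V -> Prop) (x : V) :
  Filter (within D (locally x)).
Proof. apply within_filter. apply locally_filter. Qed.

Lemma line_intro {V : NormedModule R_AbsRing} (D : V -> Prop) (x v : V) (P : R -> Prop) :
  (exists d, 0 < d /\ forall h, h <> 0 -> Rabs h < d -> D (plus x (scal h v)) -> P h) ->
  line D x v P.
Proof.
  intros [d [Hd H]]. exists (mkposreal d Hd). intros h Hh Hn HD. apply H; auto.
  unfold ball in Hh; simpl in Hh; unfold AbsRing_ball, abs, minus, plus, opp in Hh; simpl in Hh.
  now rewrite Ropp_0, Rplus_0_r in Hh.
Qed.

Lemma line_elim {V : NormedModule R_AbsRing} (D : V -> Prop) (x v : V) (P : R -> Prop) :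
  line D x v P ->
  exists d, 0 < d /\ forall h, h <> 0 -> Rabs h < d -> D (plus x (scal h v)) -> P h.
Proof.
  intros [d H]. exists d; split; [apply cond_pos|]. intros h Hn Hh HD. apply H; auto.
  unfold ball; simpl; unfold AbsRing_ball, abs, minus, plus, opp; simpl.
  now rewrite Ropp_0, Rplus_0_r.
Qed.

Lemma filterlim_R {T : Type} (F : (T -> Prop) -> Prop) {FF : Filter F} (f : T -> R) (l : R) :
  filterlim f F (locally l) <-> forall eps, 0 < eps -> F (fun x => Rabs (f x - l) < eps).
Proof.
  split.
  - intros H eps He. apply (H (fun y => Rabs (y - l) < eps)).
    exists (mkposreal eps He). intros y Hy. exact Hy.
  - intros H P [d Hd]. unfold filtermap. generalize (H d (cond_pos d)).
    apply filter_imp. intros x Hx. apply Hd. exact Hx.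
Qed.

Lemma flim_elim {T : Type} {F : (T -> Prop) -> Prop} {FF : Filter F} {f : T -> R} {l : R} :
  filterlim f F (locally l) -> forall eps, 0 < eps -> F (fun x => Rabs (f x - l) < eps).
Proof. apply filterlim_R. exact FF. Qed.

Lemma filterlim_val {T : Type} (F : (T -> Prop) -> Prop) (f : T -> R) (a b : R) :
  filterlim f F (locally a) -> a = b -> filterlim f F (locally b).
Proof. now intros H <-. Qed.

Lemma filterlim_Rplus {T : Type} (F : (T -> Prop) -> Prop) {FF : Filter F} (f g : T -> R) (a b : R) :
  filterlim f F (locally a) -> filterlim g F (locally b) ->
  filterlim (fun x => f x + g x) F (locally (a + b)).
Proof.
  intros. eapply filterlim_comp_2; eauto. apply (@filterlim_plus _ R_NormedModule).
Qed.

Lemma filterlim_Rmult {T : Type} (F : (T -> Prop) -> Prop) {FF : Filter F} (f g : T -> R) (a b : R) :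
  filterlim f F (locally a) -> filterlim g F (locally b) ->
  filterlim (fun x => f x * g x) F (locally (a * b)).
Proof.
  intros. eapply filterlim_comp_2; eauto. apply (@filterlim_mult R_AbsRing).
Qed.

Ltac flim_plus := apply filterlim_Rplus; [typeclasses eauto| |].
Ltac flim_mult := apply filterlim_Rmult; [typeclasses eauto| |].

Lemma line_id {V : NormedModule R_AbsRing} (D : V -> Prop) (x v : V) :
  filterlim (fun h : R => h) (line D x v) (locally 0).
Proof.
  apply filterlim_R; [apply line_filter|]. intros eps He. apply line_intro.
  exists eps; split; auto. intros h _ Hh _. now rewrite Rminus_0_r.
Qed.

Lemma line_ne {V : NormedModule R_AbsRing} (D : V -> Prop) (x v : V) :
  line D x v (fun h => h <> 0 /\ D (plus x (scal h v))).
Proof. apply line_intro. exists 1; split; [lra|]; auto. Qed.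

Lemma dw_lim {V : NormedModule R_AbsRing} (D : V -> Prop) f (x v : V) (l : R) :
  is_deriv_within D f x v l <->
  filterlim (fun h : R => (f (plus x (scal h v)) - f x) / h) (line D x v) (locally l).
Proof. reflexivity. Qed.

Lemma dw_cont {V : NormedModule R_AbsRing} (D : V -> Prop) f (x v : V) (l : R) :
  is_deriv_within D f x v l ->
  filterlim (fun h : R => f (plus x (scal h v))) (line D x v) (locally (f x)).
Proof.
  intros H. apply dw_lim in H.
  apply filterlim_ext_loc with (fun h : R => f x + h * ((f (plus x (scal h v)) - f x) / h)).
  - generalize (line_ne D x v). apply filter_imp. intros h [Hn _]. field. exact Hn.
  - apply filterlim_val with (f x + 0 * l); [|ring].
    flim_plus; [apply filterlim_const|].
    flim_mult; auto. apply line_id.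
Qed.

Lemma dw_ext {V : NormedModule R_AbsRing} (D : V -> Prop) (f g : V -> R) (x v : V) (l : R) :
  (forall y, D y -> f y = g y) -> D x ->
  is_deriv_within D f x v l -> is_deriv_within D g x v l.
Proof.
  intros E Dx H. apply dw_lim in H. apply dw_lim.
  eapply filterlim_ext_loc; [|exact H].
  generalize (line_ne D x v). apply filter_imp. intros h [_ HD].
  now rewrite !E.
Qed.

Lemma dw_const {V : NormedModule R_AbsRing} (D : V -> Prop) (c : R) (x v : V) :
  is_deriv_within D (fun _ => c) x v 0.
Proof.
  apply dw_lim. apply filterlim_ext with (fun _ => 0); [intros h; unfold Rdiv; ring|].
  apply filterlim_const.
Qed.

Lemma dw_plus {V : NormedModule R_AbsRing} (D : V -> Prop) (f g : V -> R) (x v : V) (a b : R) :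
  is_deriv_within D f x v a -> is_deriv_within D g x v b ->
  is_deriv_within D (fun y => f y + g y) x v (a + b).
Proof.
  intros H1 H2. apply dw_lim in H1. apply dw_lim in H2. apply dw_lim.
  eapply filterlim_ext; [|flim_plus; [apply H1|apply H2]].
  intros h; unfold Rdiv; simpl; ring.
Qed.

Lemma dw_mult {V : NormedModule R_AbsRing} (D : V -> Prop) (f g : V -> R) (x v : V) (a b : R) :
  is_deriv_within D f x v a -> is_deriv_within D g x v b ->
  is_deriv_within D (fun y => f y * g y) x v (a * g x + f x * b).
Proof.
  intros H1 H2. assert (H3 := dw_cont _ _ _ _ _ H2).
  apply dw_lim in H1. apply dw_lim in H2. apply dw_lim.
  eapply filterlim_ext; [|flim_plus; [flim_mult; [apply H1|apply H3]|
   flim_mult; [apply (filterlim_const (f x))|apply H2]]].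
  intros h; unfold Rdiv; simpl; ring.
Qed.

Lemma dw_comp {V : NormedModule R_AbsRing} (D : V -> Prop) (f : V -> R) (phi : R -> R) (x v : V) (a b : R) :
  is_deriv_within D f x v a -> is_derive phi (f x) b ->
  is_deriv_within D (fun y => phi (f y)) x v (b * a).
Proof.
  intros H1 H2. assert (H3 := dw_cont _ _ _ _ _ H1).
  apply dw_lim in H1. apply dw_lim. apply is_derive_Reals in H2.
  (* The difference quotient of [phi], completed at 0 by its limit: the increment of [f] may vanish
     for nonzero [h]. *)
  set (psi := fun k => if Req_EM_T k 0 then b else (phi (f x + k) - phi (f x)) / k).
  assert (Hpsi : filterlim psi (locally 0) (locally b)).
  { apply filterlim_R; [apply locally_filter|]. intros eps He. destruct (H2 eps He) as [d Hd].
    exists d. intros k Hk. unfold psi. destruct (Req_EM_T k 0).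
    - rewrite Rminus_diag_eq; auto. now rewrite Rabs_R0.
    - apply Hd; auto.
      unfold ball in Hk; simpl in Hk; unfold AbsRing_ball, abs, minus, plus, opp in Hk; simpl in Hk.
      now rewrite Ropp_0, Rplus_0_r in Hk. }
  apply filterlim_ext with
    (fun h : R => psi (f (plus x (scal h v)) - f x) * ((f (plus x (scal h v)) - f x) / h)).
  - intros h. generalize (f (plus x (scal h v))). intros y.
    unfold psi. destruct (Req_EM_T (y - f x) 0) as [e|n].
    + rewrite e. replace y with (f x) by lra. unfold Rdiv; ring.
    + replace (f x + (y - f x)) with y by ring. unfold Rdiv.
      transitivity ((phi y - phi (f x)) * (/ (y - f x) * (y - f x)) * / h); [ring|].
      rewrite Rinv_l; auto. ring.
  - flim_mult; auto.
    eapply filterlim_comp; [|exact Hpsi].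
    apply filterlim_val with (f x + - f x); [|ring].
    flim_plus; auto. apply filterlim_const.
Qed.

Lemma cont_on_ext {V : NormedModule R_AbsRing} (D : V -> Prop) (f g : V -> R) :
  (forall y, D y -> f y = g y) -> cont_on D f -> cont_on D g.
Proof.
  intros E H x Dx. rewrite <- E; auto.
  eapply filterlim_ext_loc; [|apply H; auto].
  unfold within. apply filter_forall. intros y Dy. apply E; auto.
Qed.

Lemma cont_on_const {V : NormedModule R_AbsRing} (D : V -> Prop) (c : R) : cont_on D (fun _ => c).
Proof. intros x _. apply filterlim_const. Qed.

Lemma cont_on_plus {V : NormedModule R_AbsRing} (D : V -> Prop) f g :
  cont_on D f -> cont_on D g -> cont_on D (fun x => f x + g x).
Proof. intros H1 H2 x Dx. flim_plus; auto. Qed.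

Lemma cont_on_mult {V : NormedModule R_AbsRing} (D : V -> Prop) f g :
  cont_on D f -> cont_on D g -> cont_on D (fun x => f x * g x).
Proof. intros H1 H2 x Dx. flim_mult; auto. Qed.

Lemma cont_on_comp {V : NormedModule R_AbsRing} (D : V -> Prop) f (phi : R -> R) :
  cont_on D f -> (forall x, D x -> continuous phi (f x)) -> cont_on D (fun x => phi (f x)).
Proof. intros H1 H2 x Dx. eapply filterlim_comp; [apply H1; auto|apply H2; auto]. Qed.

(* [smooth_on] is the largest class of continuous functions that is closed
   under directional derivatives. *)
Lemma smooth_on_coind {V : NormedModule R_AbsRing} (D : V -> Prop) (K : (V -> R) -> Prop) :
  (forall f, K f -> cont_on D f) ->
  (forall f v, K f -> exists g, K g /\ forall x, D x -> is_deriv_within D f x v (g x)) ->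
  forall f, K f -> smooth_on D f.
Proof.
  intros Hc Hd f Kf.
  (* On this subtype a derivative can be chosen once for all members and directions; folding the
     choice along a list yields the family required by [smooth_on]. *)
  set (S := {g : V -> R | K g}).
  assert (Hd' : forall (f : S) v, exists g : S,
     forall x, D x -> is_deriv_within D (proj1_sig f) x v (proj1_sig g x)).
  { intros [h Kh] v. destruct (Hd h v Kh) as [g [Kg Hg]]. exists (exist _ g Kg). exact Hg. }
  set (next := fun (v : V) (f : S) =>
     proj1_sig (constructive_indefinite_description _ (Hd' f v))).
  exists (fun s => proj1_sig (fold_right next (exist _ f Kf) s)).
  refine (conj _ (conj _ _)); auto.
  - intros s x Dx. apply Hc; auto. apply proj2_sig.
  - intros s v x Dx. apply (proj2_sig (constructive_indefinite_description _ (Hd' (fold_right next (exist _ f Kf) s) v))). auto.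
Qed.

Lemma smooth_on_cont {V : NormedModule R_AbsRing} (D : V -> Prop) f : smooth_on D f -> cont_on D f.
Proof.
  intros [F [H0 [H1 _]]]. apply cont_on_ext with (F nil); auto. intros x Dx. apply H1; auto.
Qed.

Lemma smooth_on_deriv {V : NormedModule R_AbsRing} (D : V -> Prop) f v : smooth_on D f ->
  exists g, smooth_on D g /\ forall x, D x -> is_deriv_within D f x v (g x).
Proof.
  intros [F [H0 [H1 H2]]]. exists (F (v :: nil)). split.
  - exists (fun s => F (s ++ v :: nil)). refine (conj _ (conj _ _)).
    + reflexivity.
    + intros s x Dx. apply (H1 (s ++ v :: nil)); auto.
    + intros s w x Dx. apply (H2 (s ++ v :: nil)); auto.
  - intros x Dx. apply dw_ext with (F nil); auto.
Qed.

(** The Leibniz rule leaves a class of generators but stays inside the algebra they span. Taking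
    this algebra as the class in the coinduction reduces smoothness to a check on generators. *)
Inductive alg {V : Type} (B : (V -> R) -> Prop) : (V -> R) -> Prop :=
| alg_base f : B f -> alg B f
| alg_const c : alg B (fun _ => c)
| alg_plus f g : alg B f -> alg B g -> alg B (fun x => f x + g x)
| alg_mult f g : alg B f -> alg B g -> alg B (fun x => f x * g x).

Lemma smooth_alg {V : NormedModule R_AbsRing} (D : V -> Prop) (B : (V -> R) -> Prop) :
  (forall f, B f -> cont_on D f) ->
  (forall f v, B f -> exists g, alg B g /\ forall x, D x -> is_deriv_within D f x v (g x)) ->
  forall f, alg B f -> smooth_on D f.
Proof.
  intros Hc Hd. apply smooth_on_coind.
  - intros f Hf; induction Hf; auto using cont_on_const, cont_on_plus, cont_on_mult.
  - intros f v Hf; induction Hf as [f Hf|c|f g Hf [f' [Kf If]] Hg [g' [Kg Ig]]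
                                  |f g Hf [f' [Kf If]] Hg [g' [Kg Ig]]].
    + now apply Hd.
    + exists (fun _ => 0); split; [apply alg_const|]. intros; apply dw_const.
    + exists (fun x => f' x + g' x); split; [now apply alg_plus|]. intros; apply dw_plus; auto.
    + exists (fun x => f' x * g x + f x * g' x); split; [apply alg_plus; now apply alg_mult|].
      intros; apply dw_mult; auto.
Qed.

Lemma smooth_alg_smooth {V : NormedModule R_AbsRing} (D : V -> Prop) f :
  alg (smooth_on D) f -> smooth_on D f.
Proof.
  apply smooth_alg; [apply smooth_on_cont|]. intros g v Hg.
  destruct (smooth_on_deriv D g v Hg) as [g' [H1 H2]]. exists g'; split; auto. now apply alg_base.
Qed.

Lemma smooth_const {V : NormedModule R_AbsRing} (D : V -> Prop) c : smooth_on D (fun _ => c).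
Proof. apply smooth_alg_smooth. apply alg_const. Qed.

Lemma smooth_plus {V : NormedModule R_AbsRing} (D : V -> Prop) f g :
  smooth_on D f -> smooth_on D g -> smooth_on D (fun x => f x + g x).
Proof. intros. apply smooth_alg_smooth. apply alg_plus; now apply alg_base. Qed.

Lemma smooth_mult {V : NormedModule R_AbsRing} (D : V -> Prop) f g :
  smooth_on D f -> smooth_on D g -> smooth_on D (fun x => f x * g x).
Proof. intros. apply smooth_alg_smooth. apply alg_mult; now apply alg_base. Qed.

Lemma smooth_on_ext {V : NormedModule R_AbsRing} (D : V -> Prop) f g :
  (forall x, D x -> f x = g x) -> smooth_on D f -> smooth_on D g.
Proof.
  intros E [F [H0 [H1 H2]]]. exists F; refine (conj _ (conj _ _)); auto. intros x Dx. now rewrite H0, E.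
Qed.

Lemma smooth_opp {V : NormedModule R_AbsRing} (D : V -> Prop) f :
  smooth_on D f -> smooth_on D (fun x => - f x).
Proof.
  intros H. apply smooth_on_ext with (fun x => (-1) * f x); [intros; ring|].
  apply smooth_mult; auto. apply smooth_const.
Qed.

Lemma smooth_minus {V : NormedModule R_AbsRing} (D : V -> Prop) f g :
  smooth_on D f -> smooth_on D g -> smooth_on D (fun x => f x - g x).
Proof. intros. apply smooth_plus; auto. now apply smooth_opp. Qed.

Lemma smooth_pow {V : NormedModule R_AbsRing} (D : V -> Prop) f n :
  smooth_on D f -> smooth_on D (fun x => f x ^ n).
Proof. intros H; induction n; simpl; [apply smooth_const|now apply smooth_mult]. Qed.

Lemma smooth_on_sub {V : NormedModule R_AbsRing} (D E : V -> Prop) f :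
  (forall x, E x -> D x) -> smooth_on D f -> smooth_on E f.
Proof.
  intros HS [F [H0 [H1 H2]]]. exists F; refine (conj _ (conj _ _)); auto.
  - intros s x Ex. eapply filterlim_filter_le_1; [|apply H1; auto].
    intros P HP. unfold within in *. revert HP. apply filter_imp. auto.
  - intros s v x Ex. specialize (H2 s v x (HS x Ex)). unfold is_deriv_within in *.
    eapply filterlim_filter_le_1; [|apply H2].
    intros P HP. unfold within at 1 in HP. unfold within at 1. revert HP. apply filter_imp. auto.
Qed.

(* [phi] solves the autonomous equation [phi' = p phi] with [p] polynomial. *)
Lemma smooth_comp {V : NormedModule R_AbsRing} (D : V -> Prop) (f : V -> R) (phi p : R -> R) :
  (forall x, D x -> is_derive phi (f x) (p (phi (f x)))) ->
  (forall B : (V -> R) -> Prop, forall g, alg B g -> alg B (fun x => p (g x))) ->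
  smooth_on D f -> smooth_on D (fun x => phi (f x)).
Proof.
  intros Hphi Hp Hf.
  apply (smooth_alg D (fun g => smooth_on D g \/ g = fun x => phi (f x))).
  - intros g [Hg| ->]; [now apply smooth_on_cont|].
    apply cont_on_comp; [now apply smooth_on_cont|].
    intros x Dx. apply (ex_derive_continuous (V := R_NormedModule) phi). eexists. apply Hphi; auto.
  - intros g v [Hg| ->].
    + destruct (smooth_on_deriv D g v Hg) as [g' [H1 H2]]. exists g'; split; auto. apply alg_base; auto.
    + destruct (smooth_on_deriv D f v Hf) as [g' [H1 H2]].
      exists (fun x => p (phi (f x)) * g' x). split.
      * apply alg_mult; [|apply alg_base; auto]. apply Hp. apply alg_base; auto.
      * intros x Dx. apply dw_comp; auto.
  - apply alg_base; auto.
Qed.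

Lemma smooth_exp {V : NormedModule R_AbsRing} (D : V -> Prop) f :
  smooth_on D f -> smooth_on D (fun x => exp (f x)).
Proof.
  apply smooth_comp with (p := fun y => y); auto.
  intros x _. apply is_derive_exp.
Qed.

Lemma smooth_inv {V : NormedModule R_AbsRing} (D : V -> Prop) f :
  (forall x, D x -> f x <> 0) ->
  smooth_on D f -> smooth_on D (fun x => / f x).
Proof.
  intros Hn. apply smooth_comp with (p := fun y => (-1) * (y * y)).
  - intros x Dx. assert (H := Hn x Dx). auto_derive; auto. field; auto.
  - intros B g Hg. apply alg_mult; [apply alg_const|]. now apply alg_mult.
Qed.

Lemma smooth_rsqrt {V : NormedModule R_AbsRing} (D : V -> Prop) f :
  (forall x, D x -> 0 < f x) ->
  smooth_on D f -> smooth_on D (fun x => / sqrt (f x)).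
Proof.
  intros Hn. apply smooth_comp with (phi := fun y => / sqrt y) (p := fun y => (-1/2) * (y * (y * y))).
  - intros x Dx. assert (H := Hn x Dx). assert (Hs : 0 < sqrt (f x)) by now apply sqrt_lt_R0.
    auto_derive; [split; auto; lra|]. field; lra.
  - intros B g Hg. apply alg_mult; [apply alg_const|]. apply alg_mult; auto. now apply alg_mult.
Qed.

(** [smooth_comp] does not apply, since the derivative of ln is not a polynomial in ln. It is the
    inverse, however, which is already smooth, so adjoining ln f to the smooth functions gives a
    closed class. *)
Lemma smooth_ln {V : NormedModule R_AbsRing} (D : V -> Prop) f :
  (forall x, D x -> 0 < f x) ->
  smooth_on D f -> smooth_on D (fun x => ln (f x)).
Proof.
  intros Hn Hf.
  apply (smooth_alg D (fun g => smooth_on D g \/ g = fun x => ln (f x))).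
  - intros g [Hg| ->]; [now apply smooth_on_cont|].
    apply cont_on_comp; [now apply smooth_on_cont|].
    intros x Dx. apply (ex_derive_continuous (V := R_NormedModule) ln). auto_derive. auto.
  - intros g v [Hg| ->].
    + destruct (smooth_on_deriv D g v Hg) as [g' [H1 H2]]. exists g'; split; auto. apply alg_base; auto.
    + destruct (smooth_on_deriv D f v Hf) as [g' [H1 H2]].
      exists (fun x => / f x * g' x). split.
      * apply alg_base. left. apply smooth_mult; auto. apply smooth_inv; auto.
        intros x Dx; specialize (Hn x Dx); lra.
      * intros x Dx. apply dw_comp with (phi := ln); auto. apply is_derive_ln; auto.
  - apply alg_base; auto.
Qed.

Lemma filterlim_scal_near {V : NormedModule R_AbsRing} (x v : V) (h0 : R) :
  filterlim (fun h : R => plus x (scal h v)) (locally h0) (locally (plus x (scal h0 v))).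
Proof.
  apply (filterlim_comp_2 (G := locally x) (H := locally (scal h0 v)) (fun _ => x) (fun h : R => scal h v) plus).
  - apply filterlim_const.
  - apply (filterlim_scal_l (K := R_AbsRing)).
  - apply filterlim_plus.
Qed.

Lemma filterlim_line {V : NormedModule R_AbsRing} (D : V -> Prop) (x v : V) (h0 : R) (P : V -> Prop) :
  within D (locally (plus x (scal h0 v))) P ->
  locally h0 (fun h : R => D (plus x (scal h v)) -> P (plus x (scal h v))).
Proof. intros H. apply (filterlim_scal_near x v h0 _ H). Qed.

Lemma plus_scal_0 {V : NormedModule R_AbsRing} (x v : V) : plus x (scal 0 v) = x.
Proof.
  transitivity (plus x zero); [f_equal; exact (scal_zero_l (K := R_AbsRing) v)|apply plus_zero_r].
Qed.

Lemma plus_scal_scal {V : NormedModule R_AbsRing} (x v : V) (a b : R) :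
  plus (plus x (scal a v)) (scal b v) = plus x (scal (a + b) v).
Proof. rewrite <- plus_assoc. f_equal. exact (eq_sym (scal_distr_r (K := R_AbsRing) a b v)). Qed.

Lemma linear_smooth {V : NormedModule R_AbsRing} (D : V -> Prop) (L : V -> R) :
  (forall x v (h : R), L (plus x (scal h v)) = L x + h * L v) ->
  (forall x, filterlim L (locally x) (locally (L x))) ->
  smooth_on D L.
Proof.
  intros HL HC. apply (smooth_alg D (fun g => g = L)); [..|apply alg_base; auto].
  - intros f -> x Dx. eapply filterlim_filter_le_1; [|apply HC]. apply filter_le_within.
  - intros f v ->. exists (fun _ => L v). split; [apply alg_const|]. intros x Dx.
    apply dw_lim. eapply filterlim_ext_loc; [|apply filterlim_const].
    generalize (line_ne D x v). apply filter_imp. intros h [Hn _]. rewrite HL. field; auto.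
Qed.

Lemma open_line {V : NormedModule R_AbsRing} (D : V -> Prop) (x v : V) :
  open D -> D x -> exists d, 0 < d /\ forall h : R, Rabs h < d -> D (plus x (scal h v)).
Proof.
  intros HO Dx. assert (H := filterlim_scal_near x v 0).
  rewrite plus_scal_0 in H. destruct (H D (HO x Dx)) as [d Hd].
  exists d; split; [apply cond_pos|]. intros h Hh. apply Hd.
  unfold ball; simpl; unfold AbsRing_ball, abs, minus, plus, opp; simpl.
  now rewrite Ropp_0, Rplus_0_r.
Qed.

(* Two-sided derivative along a line, at a parameter whose neighbours stay in [D]. *)
Lemma dw_is_derive {V : NormedModule R_AbsRing} (D : V -> Prop) f (x v : V) (s l : R) :
  (exists d, 0 < d /\ forall h : R, Rabs (h - s) < d -> D (plus x (scal h v))) ->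
  is_deriv_within D f (plus x (scal s v)) v l ->
  is_derive (fun h : R => f (plus x (scal h v))) s l.
Proof.
  intros [d0 [Hd0 HD]] H. apply is_derive_Reals. intros eps He.
  apply dw_lim in H. destruct (line_elim _ _ _ _ (flim_elim H eps He)) as [d [Hd H']].
  assert (Hm : 0 < Rmin d d0) by now apply Rmin_glb_lt.
  exists (mkposreal _ Hm). simpl. intros h Hn Hh.
  specialize (H' h Hn). rewrite plus_scal_scal in H'. apply H'.
  - eapply Rlt_le_trans; [exact Hh|apply Rmin_l].
  - apply HD. replace (s + h - s) with h by ring. eapply Rlt_le_trans; [exact Hh|apply Rmin_r].
Qed.

Lemma dw_open {V : NormedModule R_AbsRing} (D : V -> Prop) f (x v : V) (l : R) :
  open D -> D x ->
  is_deriv_within D f x v l <-> is_derive (fun h : R => f (plus x (scal h v))) 0 l.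
Proof.
  intros HO Dx. split.
  - intros H. apply dw_is_derive with D.
    + destruct (open_line D x v HO Dx) as [d [Hd H']]. exists d; split; auto.
      intros h Hh; apply H'; now rewrite Rminus_0_r in Hh.
    + now rewrite plus_scal_0.
  - intros H. apply dw_lim. apply filterlim_R; [apply line_filter|]. intros eps He.
    apply is_derive_Reals in H. destruct (H eps He) as [d Hd].
    apply line_intro. exists d; split; [apply cond_pos|]. intros h Hn Hh _.
    specialize (Hd h Hn Hh). rewrite plus_scal_0, Rplus_0_l in Hd. exact Hd.
Qed.

(** Continuity is only one-sided at the end points, as happens at t = 0 in the flow. *)
Lemma MVT_within (a b : R) (phi psi : R -> R) :
  a < b ->
  (forall s, a <= s <= b ->
     filterlim phi (within (fun s => a <= s <= b) (locally s)) (locally (phi s))) ->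
  (forall s, a < s < b -> is_derive phi s (psi s)) ->
  exists c, a <= c <= b /\ phi b - phi a = psi c * (b - a).
Proof.
  intros Hab HC HD.
  (* Composing with the clamp onto [a, b] turns one-sided continuity at the ends into continuity and
     keeps the derivatives inside. *)
  set (cl := fun s => Rmax a (Rmin b s)).
  assert (Hcl : forall s, a <= cl s <= b).
  { intros s; unfold cl. split; [apply Rmax_l|]. apply Rmax_lub; [lra|apply Rmin_l]. }
  assert (Hid : forall s, a <= s <= b -> cl s = s).
  { intros s Hs; unfold cl. rewrite Rmin_right by lra. now rewrite Rmax_right by lra. }
  assert (Hlip : forall s t, Rabs (cl t - cl s) <= Rabs (t - s)).
  { assert (H3 : forall s, (s <= a /\ cl s = a) \/ (a <= s <= b /\ cl s = s) \/ (b <= s /\ cl s = b)).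
    { intros s. unfold cl. destruct (Rle_dec s a); [left|right; destruct (Rle_dec s b); [left|right]].
      - split; auto. rewrite Rmin_right by lra. now rewrite Rmax_left by lra.
      - split; [lra|]. rewrite Rmin_right by lra. now rewrite Rmax_right by lra.
      - split; [lra|]. rewrite Rmin_left by lra. now rewrite Rmax_right by lra. }
    intros s t. destruct (H3 s) as [[? ->]|[[? ->]|[? ->]]]; destruct (H3 t) as [[? ->]|[[? ->]|[? ->]]];
    split_Rabs; lra. }
  destruct (MVT_gen (fun s => phi (cl s)) a b psi) as [c [Hc E]].
  - rewrite Rmin_left, Rmax_right by lra. intros c Hc.
    eapply is_derive_ext_loc; [|apply HD; auto].
    assert (Hm : 0 < Rmin (c - a) (b - c)) by (apply Rmin_glb_lt; lra).
    exists (mkposreal _ Hm). intros y Hy. rewrite Hid; auto.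
    unfold ball in Hy; simpl in Hy; unfold AbsRing_ball, abs, minus, plus, opp in Hy; simpl in Hy.
    assert (H1 := Rmin_l (c - a) (b - c)). assert (H2 := Rmin_r (c - a) (b - c)).
    apply Rabs_def2 in Hy. lra.
  - rewrite Rmin_left, Rmax_right by lra. intros c Hc.
    apply continuity_pt_filterlim. rewrite (Hid c) by lra.
    specialize (HC c Hc).
    apply filterlim_R; [apply locally_filter|]. intros eps He.
    destruct (flim_elim HC eps He) as [d Hd]. exists d. intros y Hy. apply Hd; auto.
    unfold ball in Hy; simpl in Hy; unfold AbsRing_ball, abs, minus, plus, opp in Hy; simpl in Hy.
    unfold ball; simpl; unfold AbsRing_ball, abs, minus, plus, opp; simpl.
    eapply Rle_lt_trans; [|exact Hy]. rewrite <- (Hid c) at 1 by lra. apply Hlip.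
  - rewrite Rmin_left, Rmax_right in Hc by lra. exists c; split; auto.
    rewrite !Hid in E by lra. exact E.
Qed.

(** * Coordinates of C^2 and functions constant along rays *)

Definition mkv (a b c d : R) : C2 := ((a, b), (c, d)).
Definition cc (i : nat) (x : C2) : R :=
  match i with
  | 0%nat => fst (fst x) | 1%nat => snd (fst x) | 2%nat => fst (snd x) | _ => snd (snd x)
  end.
Definition ev (i : nat) : C2 :=
  match i with
  | 0%nat => mkv 1 0 0 0 | 1%nat => mkv 0 1 0 0 | 2%nat => mkv 0 0 1 0 | _ => mkv 0 0 0 1
  end.
Definition sum4 (F : nat -> R) : R := F 0%nat + F 1%nat + F 2%nat + F 3%nat.

Lemma mkv_eta (x : C2) : x = mkv (cc 0 x) (cc 1 x) (cc 2 x) (cc 3 x).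
Proof. destruct x as [[a b] [c d]]. reflexivity. Qed.

Lemma cc_ext (x y : C2) : (forall i, (i < 4)%nat -> cc i x = cc i y) -> x = y.
Proof. intros H. rewrite (mkv_eta x), (mkv_eta y), !H; auto; lia. Qed.

Lemma cc_plus i (x y : C2) : cc i (plus x y) = cc i x + cc i y.
Proof. destruct x as [[a b] [c d]], y as [[a' b'] [c' d']]. destruct i as [|[|[|i]]]; reflexivity. Qed.

Lemma cc_scal i (r : R) (x : C2) : cc i (scal r x) = r * cc i x.
Proof. destruct x as [[a b] [c d]]. destruct i as [|[|[|i]]]; reflexivity. Qed.

Lemma cc_opp i (x : C2) : cc i (opp x) = - cc i x.
Proof. destruct x as [[a b] [c d]]. destruct i as [|[|[|i]]]; reflexivity. Qed.

Lemma cc_zero i : cc i zero = 0.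
Proof. destruct i as [|[|[|i]]]; reflexivity. Qed.

Lemma ball_C2 (x y : C2) (e : R) :
  ball x e y <-> (forall i, (i < 4)%nat -> Rabs (cc i y - cc i x) < e).
Proof.
  destruct x as [[a b] [c d]], y as [[a' b'] [c' d']]. split.
  - intros [[H0 H1] [H2 H3]] i Hi. destruct i as [|[|[|i]]]; assumption.
  - intros H. split; split.
    + apply (H 0%nat); lia.
    + apply (H 1%nat); lia.
    + apply (H 2%nat); lia.
    + apply (H 3%nat); lia.
Qed.

Lemma cc_lim i (x : C2) : filterlim (cc i) (locally x) (locally (cc i x)).
Proof.
  apply filterlim_R; [apply locally_filter|]. intros e He. exists (mkposreal e He).
  intros y Hy. destruct i as [|[|[|i]]];
  [apply (proj1 (ball_C2 _ _ _) Hy 0%nat)|apply (proj1 (ball_C2 _ _ _) Hy 1%nat)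
  |apply (proj1 (ball_C2 _ _ _) Hy 2%nat)|apply (proj1 (ball_C2 _ _ _) Hy 3%nat)]; lia.
Qed.

Lemma smooth_cc (D : C2 -> Prop) i : smooth_on D (cc i).
Proof.
  apply linear_smooth; [|apply cc_lim]. intros x v h. now rewrite cc_plus, cc_scal.
Qed.

Definition nsq (x : C2) : R := sum4 (fun i => cc i x * cc i x).

Lemma Cmod_sqr (z : C) : Cmod z ^ 2 = fst z * fst z + snd z * snd z.
Proof. unfold Cmod. rewrite pow2_sqrt; nra. Qed.

Lemma nsq_Cmod (x : C2) : Cmod (z0 x) ^ 2 + Cmod (z1 x) ^ 2 = nsq x.
Proof. rewrite !Cmod_sqr. unfold nsq, sum4, cc, z0, z1. ring. Qed.

Lemma S3_nsq (x : C2) : S3 x <-> nsq x = 1.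
Proof. unfold S3. now rewrite nsq_Cmod. Qed.

Lemma nsq_nonneg x : 0 <= nsq x.
Proof. unfold nsq, sum4. nra. Qed.

Lemma nsq_pos (x : C2) : x <> zero -> 0 < nsq x.
Proof.
  intros H. destruct (Rle_lt_or_eq_dec 0 (nsq x) (nsq_nonneg x)) as [|E]; auto.
  exfalso; apply H. unfold nsq, sum4 in E. apply cc_ext. intros i Hi. rewrite cc_zero.
  destruct i as [|[|[|[|i]]]]; try lia; nra.
Qed.

Lemma nsq_nonzero (x : C2) : 0 < nsq x -> x <> zero.
Proof. intros H ->. unfold nsq, sum4 in H. rewrite !cc_zero in H. lra. Qed.

Lemma nsq_scal (r : R) x : nsq (scal r x) = r * r * nsq x.
Proof. unfold nsq, sum4. rewrite !cc_scal. ring. Qed.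

Lemma S3_nonzero p : S3 p -> p <> zero.
Proof. intros H. apply nsq_nonzero. apply S3_nsq in H. lra. Qed.

Lemma proj_def (x : C2) : proj x = scal (/ sqrt (nsq x)) x.
Proof. unfold proj. now rewrite nsq_Cmod. Qed.

Lemma scal_one_C2 (x : C2) : scal (1 : R) x = x.
Proof. apply cc_ext; intros. rewrite cc_scal; ring. Qed.

Lemma proj_S3 (p : C2) : S3 p -> proj p = p.
Proof.
  intros H. apply S3_nsq in H. rewrite proj_def, H, sqrt_1, Rinv_1. apply scal_one_C2.
Qed.

Lemma S3_proj (x : C2) : x <> zero -> S3 (proj x).
Proof.
  intros H. apply nsq_pos in H. apply S3_nsq. rewrite proj_def, nsq_scal.
  rewrite <- (sqrt_sqrt (nsq x)) at 3 by lra. assert (0 < sqrt (nsq x)) by now apply sqrt_lt_R0.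
  field. lra.
Qed.

Lemma ext_S3 {A : Type} (f : C2 -> A) p : S3 p -> ext f p = f p.
Proof. intros H. unfold ext. now rewrite proj_S3. Qed.

Lemma proj_scal (r : R) (x : C2) : 0 < r -> proj (scal r x) = proj x.
Proof.
  intros Hr. rewrite !proj_def, nsq_scal.
  rewrite sqrt_mult by (try apply nsq_nonneg; nra). rewrite sqrt_square by lra.
  apply cc_ext; intros i _. rewrite !cc_scal.
  destruct (Req_dec (sqrt (nsq x)) 0) as [E|E].
  - apply sqrt_eq_0 in E; [|apply nsq_nonneg].
    assert (Hx : cc i x = 0).
    { destruct (classic (x = zero)) as [->|n]; [apply cc_zero|]. apply nsq_pos in n; lra. }
    rewrite Hx. ring.
  - field. split; lra.
Qed.

Lemma ext_scal {A : Type} (f : C2 -> A) (r : R) (x : C2) : 0 < r -> ext f (scal r x) = ext f x.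
Proof. intros. unfold ext. now rewrite proj_scal. Qed.

Definition cone0 : C2 -> Prop := cone (fun _ => True).

Lemma cone_S3 U p : S3 p -> U p -> cone U p.
Proof. intros H HU. split; [now apply S3_nonzero|]. now rewrite proj_S3. Qed.

Lemma cone0_nz x : cone0 x <-> x <> zero.
Proof. unfold cone0, cone. tauto. Qed.

Lemma cont_locally {V : NormedModule R_AbsRing} (f : V -> R) (x : V) :
  smooth_on (fun _ => True) f -> filterlim f (locally x) (locally (f x)).
Proof.
  intros H. apply smooth_on_cont in H. specialize (H x I).
  intros P HP. generalize (H P HP). unfold filtermap, within. apply filter_imp. auto.
Qed.

Lemma smooth_nsq D : smooth_on D nsq.
Proof.
  unfold nsq, sum4. repeat apply smooth_plus; apply smooth_mult; apply smooth_cc.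
Qed.

Lemma cone0_open : open_S3 (fun _ => True).
Proof.
  intros x Hx. apply cone0_nz in Hx. assert (Hp := nsq_pos x Hx).
  assert (HC := cont_locally nsq x (smooth_nsq _)).
  generalize (flim_elim HC (nsq x) Hp). apply filter_imp. intros y Hy.
  apply cone0_nz. apply nsq_nonzero. apply Rabs_def2 in Hy. lra.
Qed.

(** * Directional derivatives and the chain rule in C^2 *)

Lemma dirD_spec {V : NormedModule R_AbsRing} (D : V -> Prop) f (x v : V) g :
  open D -> D x -> is_deriv_within D f x v (g x) ->
  Derive (fun h : R => f (plus x (scal h v))) 0 = g x.
Proof. intros HO Dx H. apply is_derive_unique. apply (dw_open D f x v _ HO Dx). exact H. Qed.

Lemma smooth_dirD (D : C2 -> Prop) f v : open D -> smooth_on D f -> smooth_on D (dirD v f).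
Proof.
  intros HO H. destruct (smooth_on_deriv D f v H) as [g [Hg Hd]].
  apply smooth_on_ext with g; auto. intros x Dx. symmetry. apply (dirD_spec D); auto.
Qed.

Lemma dirD_dw (D : C2 -> Prop) f x v : open D -> smooth_on D f -> D x ->
  is_deriv_within D f x v (dirD v f x).
Proof.
  intros HO H Dx. destruct (smooth_on_deriv D f v H) as [g [Hg Hd]].
  unfold dirD. rewrite (dirD_spec D f x v g); auto.
Qed.

Lemma dirD_unique (D : C2 -> Prop) f x v l : open D -> D x ->
  is_deriv_within D f x v l -> dirD v f x = l.
Proof. intros HO Dx H. now apply (dirD_spec D f x v (fun _ => l)). Qed.

Lemma dirD_ext_open (D : C2 -> Prop) f g x v : open D -> D x ->
  (forall y, D y -> f y = g y) -> dirD v f x = dirD v g x.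
Proof.
  intros HO Dx E. apply Derive_ext_loc.
  destruct (open_line D x v HO Dx) as [d [Hd H]]. exists (mkposreal d Hd). intros h Hh. apply E, H.
  unfold ball in Hh; simpl in Hh; unfold AbsRing_ball, abs, minus, plus, opp in Hh; simpl in Hh.
  now rewrite Ropp_0, Rplus_0_r in Hh.
Qed.

Lemma locally_R (x : R) (P : R -> Prop) :
  locally x P <-> exists d, 0 < d /\ forall y, Rabs (y - x) < d -> P y.
Proof.
  split.
  - intros [d H]. exists d; split; [apply cond_pos|exact H].
  - intros [d [Hd H]]. exists (mkposreal d Hd). exact H.
Qed.

(** By the mean value theorem the increment along [v] is [d] times a value of [g] near [x]. The
    bound is uniform in the base point [y], which allows the chain rule to move one coordinate at a
    time from varying base points. *)
Lemma strict_diff {V : NormedModule R_AbsRing} (D : V -> Prop) f g (x v : V) :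
  open D -> D x -> (forall y, D y -> is_deriv_within D f y v (g y)) -> cont_on D g ->
  forall eps, 0 < eps -> exists eta : posreal, forall y (d : R), ball x eta y -> Rabs d < eta ->
    Rabs (f (plus y (scal d v)) - f y - d * g x) <= eps * Rabs d.
Proof.
  intros HO Dx Hd Hc eps He.
  assert (HG : locally x (fun z => D z /\ Rabs (g z - g x) < eps)).
  { generalize (flim_elim (Hc x Dx) eps He) (HO x Dx). unfold within.
    intros H1 H2. generalize (filter_and _ _ H1 H2). apply filter_imp. intuition. }
  assert (HL : filterlim (fun p : V * R => plus (fst p) (scal (snd p) v))
     (filter_prod (locally x) (locally 0)) (locally x)).
  { intros P HP. rewrite <- (plus_scal_0 x v) in HP. revert P HP.
    apply (filterlim_comp_2 (G := locally x) (H := locally (scal (0 : R) v))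
       (fun p : V * R => fst p) (fun p : V * R => scal (snd p) v) plus).
    - apply filterlim_fst.
    - apply (filterlim_comp _ _ _ (fun p : V * R => snd p) (fun h : R => scal h v) _ (locally 0)).
      + apply filterlim_snd.
      + apply (filterlim_scal_l (K := R_AbsRing)).
    - apply filterlim_plus. }
  destruct (HL _ HG) as [Q R' HQ HR HQR].
  destruct HQ as [d1 HQ]. apply locally_R in HR. destruct HR as [d2 [Hd2 HR]].
  assert (Hm : 0 < Rmin d1 d2) by (apply Rmin_glb_lt; auto; apply cond_pos).
  exists (mkposreal _ Hm). simpl. intros y d Hy Hdd.
  assert (HQy : Q y) by (apply HQ; eapply ball_le; [apply Rmin_l|exact Hy]).
  assert (HS : forall s, Rabs s < Rmin d1 d2 -> D (plus y (scal s v)) /\ Rabs (g (plus y (scal s v)) - g x) < eps).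
  { intros s Hs. apply (HQR y s); auto. apply HR. rewrite Rminus_0_r.
    eapply Rlt_le_trans; [exact Hs|apply Rmin_r]. }
  assert (Hin : forall c, Rmin 0 d <= c <= Rmax 0 d -> Rabs c <= Rabs d).
  { intros c. unfold Rmin, Rmax. destruct (Rle_dec 0 d); intros; split_Rabs; lra. }
  assert (HDer : forall c, Rmin 0 d <= c <= Rmax 0 d ->
     is_derive (fun h : R => f (plus y (scal h v))) c (g (plus y (scal c v)))).
  { intros c Hcc. assert (Hc' := Hin c Hcc). apply dw_is_derive with D.
    - exists (Rmin d1 d2 - Rabs d); split; [lra|]. intros h Hh. apply HS.
      replace h with (c + (h - c)) by ring. eapply Rle_lt_trans; [apply Rabs_triang|]. lra.
    - apply Hd. apply HS. lra. }
  destruct (MVT_gen (fun h : R => f (plus y (scal h v))) 0 d (fun s : R => g (plus y (scal s v)))) as [c [Hcc E]].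
  - intros c Hcc. apply HDer. lra.
  - intros c Hcc. apply continuity_pt_filterlim.
    apply (ex_derive_continuous (V := R_NormedModule) (fun h : R => f (plus y (scal h v)))). eexists. apply HDer. exact Hcc.
  - cbv beta in E. rewrite (plus_scal_0 y v) in E. rewrite E.
    replace (g (plus y (scal c v)) * (d - 0) - d * g x) with ((g (plus y (scal c v)) - g x) * d) by ring.
    rewrite Rabs_mult. apply Rmult_le_compat_r; [apply Rabs_pos|].
    left. apply HS. specialize (Hin c Hcc). lra.
Qed.

Lemma derive_bound (u : R -> R) (s l : R) : is_derive u s l ->
  exists d, 0 < d /\ forall h, Rabs h < d -> Rabs (u (s + h) - u s) <= (Rabs l + 1) * Rabs h.
Proof.
  intros H. apply is_derive_Reals in H. destruct (H 1 Rlt_0_1) as [d Hd].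
  exists d; split; [apply cond_pos|]. intros h Hh.
  destruct (Req_dec h 0) as [->|n].
  - rewrite Rplus_0_r, Rminus_diag_eq by auto. rewrite Rabs_R0. lra.
  - specialize (Hd h n Hh).
    replace (u (s + h) - u s) with ((((u (s + h) - u s) / h - l) + l) * h) by (field; auto).
    rewrite Rabs_mult. apply Rmult_le_compat_r; [apply Rabs_pos|].
    eapply Rle_trans; [apply Rabs_triang|]. lra.
Qed.

Lemma is_derive_sum4 (u : nat -> R -> R) (l : nat -> R) s :
  (forall i, (i < 4)%nat -> is_derive (u i) s (l i)) ->
  is_derive (fun t => sum4 (fun i => u i t)) s (sum4 l).
Proof.
  intros H. unfold sum4.
  repeat apply (is_derive_plus (K := R_AbsRing) (V := R_NormedModule)); apply H; lia.
Qed.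

(** Continuous partial derivatives imply differentiability: the increment of the curve is split into
    four coordinate steps, each controlled by [strict_diff]. *)
Lemma chain_C2 (D : C2 -> Prop) (f : C2 -> R) (gam : R -> C2) (s : R) (l : nat -> R) :
  open D -> smooth_on D f -> D (gam s) ->
  (forall i, (i < 4)%nat -> is_derive (fun t => cc i (gam t)) s (l i)) ->
  is_derive (fun t => f (gam t)) s (sum4 (fun i => l i * dirD (ev i) f (gam s))).
Proof.
  intros HO Hf Dx Hg. set (x := gam s) in *.
  set (G := fun i => dirD (ev i) f x).
  (* After subtraction of the linear part it remains to see that the remainder has derivative 0. *)
  set (Rm := fun t => f (gam t) - sum4 (fun i => cc i (gam t) * G i)).
  assert (HR : is_derive Rm s 0).
  { apply is_derive_Reals. intros eps He.
    (* By [derive_bound] the coordinate increments add up to at most C |h|, so an error e' per unit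
       of increment costs at most eps / 2 in the quotient. *)
    set (C := sum4 (fun i => Rabs (l i) + 1)).
    assert (HC : 0 < C).
    { unfold C, sum4. assert (H := fun i => Rabs_pos (l i)).
      generalize (H 0%nat) (H 1%nat) (H 2%nat) (H 3%nat). lra. }
    set (e' := eps / (2 * C)).
    assert (He' : 0 < e') by (apply Rdiv_lt_0_compat; lra).
    assert (HS : forall i, exists eta : posreal, forall y (d : R), ball x eta y -> Rabs d < eta ->
       Rabs (f (plus y (scal d (ev i))) - f y - d * G i) <= e' * Rabs d).
    { intros i. apply (strict_diff D f (dirD (ev i) f) x (ev i)); auto.
      - intros y Dy. now apply dirD_dw.
      - apply smooth_on_cont. now apply smooth_dirD. }
    destruct (HS 0%nat) as [t0 H0]. destruct (HS 1%nat) as [t1 H1].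
    destruct (HS 2%nat) as [t2 H2]. destruct (HS 3%nat) as [t3 H3]. clear HS.
    destruct (derive_bound _ _ _ (Hg 0%nat ltac:(lia))) as [r0 [R0 B0]].
    destruct (derive_bound _ _ _ (Hg 1%nat ltac:(lia))) as [r1 [R1 B1]].
    destruct (derive_bound _ _ _ (Hg 2%nat ltac:(lia))) as [r2 [R2 B2]].
    destruct (derive_bound _ _ _ (Hg 3%nat ltac:(lia))) as [r3 [R3 B3]].
    assert (Hex : exists d, 0 < d /\ (d <= r0 /\ d <= r1 /\ d <= r2 /\ d <= r3) /\
       (C * d <= t0 /\ C * d <= t1 /\ C * d <= t2 /\ C * d <= t3)).
    { set (m1 := Rmin (Rmin r0 r1) (Rmin r2 r3)). set (m2 := Rmin (Rmin t0 t1) (Rmin t2 t3)).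
      assert (0 < m1) by (unfold m1; repeat apply Rmin_glb_lt; auto).
      assert (0 < m2) by (unfold m2; repeat apply Rmin_glb_lt; apply cond_pos).
      assert (m1 <= r0 /\ m1 <= r1 /\ m1 <= r2 /\ m1 <= r3).
      { unfold m1. generalize (Rmin_l (Rmin r0 r1) (Rmin r2 r3)) (Rmin_r (Rmin r0 r1) (Rmin r2 r3))
          (Rmin_l r0 r1) (Rmin_r r0 r1) (Rmin_l r2 r3) (Rmin_r r2 r3). lra. }
      assert (m2 <= t0 /\ m2 <= t1 /\ m2 <= t2 /\ m2 <= t3).
      { unfold m2. generalize (Rmin_l (Rmin t0 t1) (Rmin t2 t3)) (Rmin_r (Rmin t0 t1) (Rmin t2 t3))
          (Rmin_l t0 t1) (Rmin_r t0 t1) (Rmin_l t2 t3) (Rmin_r t2 t3). lra. }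
      assert (0 < m2 / C) by now apply Rdiv_lt_0_compat.
      exists (Rmin m1 (m2 / C)). split; [now apply Rmin_glb_lt|].
      generalize (Rmin_l m1 (m2 / C)) (Rmin_r m1 (m2 / C)). intros E1 E2.
      assert (C * Rmin m1 (m2 / C) <= m2).
      { apply Rle_trans with (C * (m2 / C)); [apply Rmult_le_compat_l; lra|]. right; field; lra. }
      lra. }
    destruct Hex as [d [Hd [[Q0 [Q1 [Q2 Q3]]] [W0 [W1 [W2 W3]]]]]].
    exists (mkposreal d Hd). simpl. intros h Hn Hh.
    specialize (B0 h ltac:(lra)). specialize (B1 h ltac:(lra)).
    specialize (B2 h ltac:(lra)). specialize (B3 h ltac:(lra)).
    fold x in B0, B1, B2, B3.
    set (y := gam (s + h)) in *.
    set (b0 := cc 0 y - cc 0 x) in *. set (b1 := cc 1 y - cc 1 x) in *.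
    set (b2 := cc 2 y - cc 2 x) in *. set (b3 := cc 3 y - cc 3 x) in *.
    assert (Hhp := Rabs_pos_lt h Hn).
    assert (P0 := Rabs_pos (l 0%nat)). assert (P1 := Rabs_pos (l 1%nat)).
    assert (P2 := Rabs_pos (l 2%nat)). assert (P3 := Rabs_pos (l 3%nat)).
    assert (HCh : C * Rabs h < C * d) by (apply Rmult_lt_compat_l; auto).
    assert (HCe : C * Rabs h = (Rabs (l 0%nat) + 1) * Rabs h + (Rabs (l 1%nat) + 1) * Rabs h
        + (Rabs (l 2%nat) + 1) * Rabs h + (Rabs (l 3%nat) + 1) * Rabs h) by (unfold C, sum4; ring).
    assert (HX : forall i, 0 <= (Rabs (l i) + 1) * Rabs h).
    { intros i. apply Rmult_le_pos; [|apply Rabs_pos]. generalize (Rabs_pos (l i)); lra. }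
    assert (X0 := HX 0%nat). assert (X1 := HX 1%nat). assert (X2 := HX 2%nat). assert (X3 := HX 3%nat).
    (* Corners of the path from [x] to [y] that changes the coordinates one after the other. *)
    set (y1 := plus x (scal b0 (ev 0))). set (y2 := plus y1 (scal b1 (ev 1))).
    set (y3 := plus y2 (scal b2 (ev 2))).
    assert (Ey : plus y3 (scal b3 (ev 3)) = y).
    { apply cc_ext. intros i Hi. unfold y3, y2, y1. rewrite !cc_plus, !cc_scal.
      destruct i as [|[|[|[|i]]]]; try lia; simpl; unfold b0, b1, b2, b3; simpl; ring. }
    assert (Z : forall (t : posreal) (z : C2), C * d <= t ->
       (Rabs (cc 0 z - cc 0 x) <= Rabs b0 /\ Rabs (cc 1 z - cc 1 x) <= Rabs b1 /\
        Rabs (cc 2 z - cc 2 x) <= Rabs b2 /\ Rabs (cc 3 z - cc 3 x) <= Rabs b3) -> ball x t z).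
    { intros t z Ht [K0 [K1 [K2 K3]]]. apply ball_C2. intros i Hi.
      destruct i as [|[|[|[|i]]]]; try lia; lra. }
    assert (HAB : forall u b : R, u = b \/ u = 0 -> Rabs u <= Rabs b).
    { intros u b [->| ->]; [lra|]. rewrite Rabs_R0. apply Rabs_pos. }
    assert (A0 := Rabs_pos b0). assert (A1 := Rabs_pos b1). assert (A2 := Rabs_pos b2). assert (A3 := Rabs_pos b3).
    assert (F0 := H0 x b0 (ball_center x t0) ltac:(lra)).
    assert (F1 : Rabs (f y2 - f y1 - b1 * G 1%nat) <= e' * Rabs b1).
    { apply H1; [|lra]. apply Z; auto. unfold y1. rewrite !cc_plus, !cc_scal. unfold ev, mkv, cc; simpl.
      repeat split; apply HAB; (left; simpl; unfold b0, b1, b2, b3; simpl; ring) || (right; simpl; unfold b0, b1, b2, b3; simpl; ring). }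
    assert (F2 : Rabs (f y3 - f y2 - b2 * G 2%nat) <= e' * Rabs b2).
    { apply H2; [|lra]. apply Z; auto. unfold y2, y1. rewrite !cc_plus, !cc_scal. unfold ev, mkv, cc; simpl.
      repeat split; apply HAB; (left; simpl; unfold b0, b1, b2, b3; simpl; ring) || (right; simpl; unfold b0, b1, b2, b3; simpl; ring). }
    assert (F3 : Rabs (f y - f y3 - b3 * G 3%nat) <= e' * Rabs b3).
    { rewrite <- Ey at 1. apply H3; [|lra]. apply Z; auto. unfold y3, y2, y1. rewrite !cc_plus, !cc_scal. unfold ev, mkv, cc; simpl.
      repeat split; apply HAB; (left; simpl; unfold b0, b1, b2, b3; simpl; ring) || (right; simpl; unfold b0, b1, b2, b3; simpl; ring). }
    fold y1 in F0.
    assert (FT : Rabs (Rm (s + h) - Rm s) <= e' * (C * Rabs h)).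
    { apply Rle_trans with (e' * (Rabs b0 + Rabs b1 + Rabs b2 + Rabs b3)).
      2:{ apply Rmult_le_compat_l; lra. }
      replace (Rm (s + h) - Rm s) with ((f y1 - f x - b0 * G 0%nat) + (f y2 - f y1 - b1 * G 1%nat)
         + (f y3 - f y2 - b2 * G 2%nat) + (f y - f y3 - b3 * G 3%nat)).
      2:{ unfold Rm. fold x y. unfold sum4, b0, b1, b2, b3. ring. }
      eapply Rle_trans; [apply Rabs_triang|].
      apply Rle_trans with ((e' * Rabs b0 + e' * Rabs b1 + e' * Rabs b2) + e' * Rabs b3); [|right; ring].
      apply Rplus_le_compat; auto. eapply Rle_trans; [apply Rabs_triang|].
      apply Rplus_le_compat; auto. eapply Rle_trans; [apply Rabs_triang|]. now apply Rplus_le_compat. }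
    rewrite Rminus_0_r. unfold Rdiv. rewrite Rabs_mult, Rabs_inv.
    apply Rle_lt_trans with (e' * (C * Rabs h) * / Rabs h).
    - apply Rmult_le_compat_r; auto. left; now apply Rinv_0_lt_compat.
    - unfold e'. replace (eps / (2 * C) * (C * Rabs h) * / Rabs h) with (eps / 2) by (field; lra). lra. }
  apply is_derive_ext with (fun t => Rm t + sum4 (fun i => cc i (gam t) * G i)).
  { intros t. unfold Rm. set (w := sum4 _). change (f (gam t) - w + w = f (gam t)). ring. }
  replace (sum4 (fun i => l i * dirD (ev i) f x)) with (0 + sum4 (fun i => l i * G i)) by (unfold G; ring).
  apply (is_derive_plus (K := R_AbsRing) (V := R_NormedModule)); auto.
  apply is_derive_sum4 with (u := fun i t => cc i (gam t) * G i). intros i Hi.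
  apply is_derive_ext with (fun t => scal (cc i (gam t)) (G i)); [reflexivity|].
  apply (is_derive_scal_l (K := R_AbsRing) (V := R_NormedModule)). auto.
Qed.

(** * Invariant vector fields on the sphere *)

Lemma smooth_cc_proj U i : smooth_on (cone U) (fun x => cc i (proj x)).
Proof.
  apply smooth_on_ext with (fun x => / sqrt (nsq x) * cc i x).
  - intros x _. now rewrite proj_def, cc_scal.
  - apply smooth_mult; [|apply smooth_cc]. apply smooth_rsqrt; [|apply smooth_nsq].
    intros x [Hx _]. now apply nsq_pos.
Qed.

Lemma smooth_fun_cc U i : smooth_fun U (cc i).
Proof. apply smooth_cc_proj. Qed.

Lemma smooth_fun_const U c : smooth_fun U (fun _ => c).
Proof. apply smooth_const. Qed.

Lemma smooth_fun_plus U f g : smooth_fun U f -> smooth_fun U g -> smooth_fun U (fun p => f p + g p).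
Proof. apply smooth_plus. Qed.

Lemma smooth_fun_minus U f g : smooth_fun U f -> smooth_fun U g -> smooth_fun U (fun p => f p - g p).
Proof. apply smooth_minus. Qed.

Lemma smooth_fun_mult U f g : smooth_fun U f -> smooth_fun U g -> smooth_fun U (fun p => f p * g p).
Proof. apply smooth_mult. Qed.

Lemma smooth_fun_opp U f : smooth_fun U f -> smooth_fun U (fun p => - f p).
Proof. apply smooth_opp. Qed.

Lemma smooth_fun_exp U f : smooth_fun U f -> smooth_fun U (fun p => exp (f p)).
Proof. apply smooth_exp. Qed.

Lemma smooth_fun_sub (U U' : C2 -> Prop) f : (forall p, U' p -> U p) -> smooth_fun U f -> smooth_fun U' f.
Proof. intros H. apply smooth_on_sub. intros x [H1 H2]. split; auto. Qed.

Lemma smooth_S3_fun U f : smooth_S3 f -> smooth_fun U f.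
Proof. apply smooth_fun_sub. auto. Qed.

Lemma smooth_fun_ext U f g : (forall p, S3 p -> U p -> f p = g p) -> smooth_fun U f -> smooth_fun U g.
Proof.
  intros E. apply smooth_on_ext. intros x [Hx HU]. apply E; auto. now apply S3_proj.
Qed.

Definition lin (A : C2 -> C2) : Prop :=
  (forall x y, A (plus x y) = plus (A x) (A y)) /\
  (forall (r : R) x, A (scal r x) = scal r (A x)).

Lemma cc_basis (x : C2) :
  x = plus (plus (plus (scal (cc 0 x) (ev 0)) (scal (cc 1 x) (ev 1)))
      (scal (cc 2 x) (ev 2))) (scal (cc 3 x) (ev 3)).
Proof.
  apply cc_ext. intros i Hi. rewrite !cc_plus, !cc_scal.
  destruct i as [|[|[|[|i]]]]; try lia; unfold ev, mkv; simpl; ring.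
Qed.

Lemma cc_lin A i (x : C2) : lin A -> cc i (A x) = sum4 (fun j => cc j x * cc i (A (ev j))).
Proof.
  intros [H1 H2]. rewrite (cc_basis x) at 1. rewrite !H1, !H2, !cc_plus, !cc_scal. reflexivity.
Qed.

Lemma smooth_lin D A i : lin A -> smooth_on D (fun x => cc i (A x)).
Proof.
  intros HA. apply smooth_on_ext with (fun x => sum4 (fun j => cc j x * cc i (A (ev j)))).
  - intros x _. symmetry. now apply cc_lin.
  - unfold sum4. repeat apply smooth_plus; apply smooth_mult; try apply smooth_cc; apply smooth_const.
Qed.

Lemma dirD_lin (D : C2 -> Prop) f x v : open D -> smooth_on D f -> D x ->
  dirD v f x = sum4 (fun i => cc i v * dirD (ev i) f x).
Proof.
  intros HO Hf Dx. unfold dirD at 1. apply is_derive_unique.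
  replace (sum4 (fun i => cc i v * dirD (ev i) f x)) with
    (sum4 (fun i => cc i v * dirD (ev i) f (plus x (scal (0 : R) v)))) by now rewrite plus_scal_0.
  apply (chain_C2 D f (fun h : R => plus x (scal h v)) 0 (fun i => cc i v)); auto.
  - now rewrite plus_scal_0.
  - intros i _. apply is_derive_ext with (fun t => cc i x + t * cc i v).
    + intros t. now rewrite cc_plus, cc_scal.
    + auto_derive; auto. ring.
Qed.

Lemma dirD_scal_v (D : C2 -> Prop) f x (r : R) v : open D -> smooth_on D f -> D x ->
  dirD (scal r v) f x = r * dirD v f x.
Proof.
  intros HO Hf Dx. rewrite !(dirD_lin D f x) by auto. unfold sum4. rewrite !cc_scal. ring.
Qed.

Lemma chain_curve (D : C2 -> Prop) (f : C2 -> R) (gam : R -> C2) (s : R) (v : C2) :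
  open D -> smooth_on D f -> D (gam s) ->
  (forall i, (i < 4)%nat -> is_derive (fun t => cc i (gam t)) s (cc i v)) ->
  is_derive (fun t => f (gam t)) s (dirD v f (gam s)).
Proof.
  intros HO Hf Dx H. rewrite (dirD_lin D) by auto.
  apply (chain_C2 D f gam s (fun i => cc i v)); auto.
Qed.

Definition Dv (A : C2 -> C2) (f : C2 -> R) : C2 -> R := fun p => dirD (A p) (ext f) p.

(** As [A] is linear, the line through proj x with direction A (proj x) is a rescaling of the line
    through x with direction A x, and [ext f] is constant along rays. *)
Lemma ext_Dv A f x : lin A -> x <> zero -> ext (Dv A f) x = dirD (A x) (ext f) x.
Proof.
  intros [_ HA] Hx. unfold ext at 1. unfold Dv, dirD.
  apply Derive_ext. intros t.
  assert (Hp := nsq_pos x Hx). assert (Hs : 0 < sqrt (nsq x)) by now apply sqrt_lt_R0.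
  replace (plus (proj x) (scal t (A (proj x)))) with (scal (/ sqrt (nsq x)) (plus x (scal t (A x)))).
  - apply ext_scal. now apply Rinv_0_lt_compat.
  - rewrite proj_def, HA. apply cc_ext; intros. rewrite !cc_scal, !cc_plus, !cc_scal. ring.
Qed.

Lemma Dv_ext_S3 A f g p : lin A -> (forall q, S3 q -> f q = g q) -> S3 p -> Dv A f p = Dv A g p.
Proof.
  intros HA E Hp. unfold Dv. apply (dirD_ext_open cone0); [apply cone0_open|apply cone0_nz, S3_nonzero; auto|].
  intros y Hy. apply cone0_nz in Hy. apply E. now apply S3_proj.
Qed.

Lemma dirD_ext_U U f g p v : open_S3 U -> S3 p -> U p -> (forall q, S3 q -> U q -> f q = g q) ->
  dirD v (ext f) p = dirD v (ext g) p.
Proof.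
  intros HO Hp HU E. apply (dirD_ext_open (cone U)); auto; [now apply cone_S3|].
  intros y [Hy HUy]. apply E; auto. now apply S3_proj.
Qed.

(** Euler's relation in degree 0. *)
Lemma dirD_self f x : x <> zero -> dirD x (ext f) x = 0.
Proof.
  intros Hx. unfold dirD. rewrite (Derive_ext_loc _ (fun _ => ext f x)); [apply Derive_const|].
  apply locally_R. exists 1; split; [lra|]. intros h Hh.
  replace (plus x (scal h x)) with (scal (1 + h) x).
  - apply ext_scal. apply Rabs_def2 in Hh. lra.
  - apply cc_ext; intros. rewrite cc_plus, !cc_scal. ring.
Qed.

Lemma ext_Dv_sum U A f x : open_S3 U -> lin A -> smooth_fun U f -> cone U x ->
  ext (Dv A f) x = sum4 (fun i => cc i (A x) * dirD (ev i) (ext f) x).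
Proof.
  intros HO HA Hf Hx. rewrite ext_Dv; auto; [|apply Hx]. now apply (dirD_lin (cone U)).
Qed.

Lemma smooth_Dv U A f : open_S3 U -> lin A -> smooth_fun U f -> smooth_fun U (Dv A f).
Proof.
  intros HO HA Hf. unfold smooth_fun.
  apply smooth_on_ext with (fun x => sum4 (fun i => cc i (A x) * dirD (ev i) (ext f) x)).
  - intros x Hx. symmetry. now apply (ext_Dv_sum U).
  - unfold sum4. repeat apply smooth_plus; apply smooth_mult; try (now apply smooth_lin);
    now apply smooth_dirD.
Qed.

Lemma smooth_S3_Dv A f : lin A -> smooth_S3 f -> smooth_S3 (Dv A f).
Proof. intros. apply smooth_Dv; auto. apply cone0_open. Qed.

Lemma dirD_mult D f g x v : open D -> smooth_on D f -> smooth_on D g -> D x ->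
  dirD v (fun y => f y * g y) x = dirD v f x * g x + f x * dirD v g x.
Proof. intros. apply (dirD_unique D); auto. apply dw_mult; apply dirD_dw; auto. Qed.

Lemma dirD_plus D f g x v : open D -> smooth_on D f -> smooth_on D g -> D x ->
  dirD v (fun y => f y + g y) x = dirD v f x + dirD v g x.
Proof. intros. apply (dirD_unique D); auto. apply dw_plus; apply dirD_dw; auto. Qed.

Lemma dirD_const (c : R) x v : dirD v (fun _ => c) x = 0.
Proof. unfold dirD. apply Derive_const. Qed.

Lemma dirD_exp D f x v : open D -> smooth_on D f -> D x ->
  dirD v (fun y => exp (f y)) x = exp (f x) * dirD v f x.
Proof.
  intros. apply (dirD_unique D); auto. apply dw_comp; [apply dirD_dw; auto|apply is_derive_exp].
Qed.

Lemma dirD_lin_fun D A i x v : open D -> lin A -> D x -> dirD v (fun y => cc i (A y)) x = cc i (A v).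
Proof.
  intros HO HA Dx. apply is_derive_unique.
  apply is_derive_ext with (fun t => cc i (A x) + t * cc i (A v)).
  - intros t. destruct HA as [H1 H2]. now rewrite H1, H2, cc_plus, cc_scal.
  - auto_derive; auto. ring.
Qed.

Lemma dirD_sum4 D (F : nat -> C2 -> R) x v : open D -> (forall i, smooth_on D (F i)) -> D x ->
  dirD v (fun y => sum4 (fun i => F i y)) x = sum4 (fun i => dirD v (F i) x).
Proof.
  intros HO HF Dx. unfold sum4. rewrite !(dirD_plus D); auto; repeat apply smooth_plus; auto.
Qed.

Lemma Dv_Dv U A B f p : open_S3 U -> lin A -> lin B -> smooth_fun U f -> cone U p ->
  Dv A (Dv B f) p = sum4 (fun j => cc j (A p) * sum4 (fun i =>
     cc i (B (ev j)) * dirD (ev i) (ext f) p + cc i (B p) * dirD (ev j) (dirD (ev i) (ext f)) p)).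
Proof.
  intros HO HA HB Hf Hp.
  assert (HS := smooth_Dv U B f HO HB Hf).
  unfold Dv at 1. rewrite (dirD_lin (cone U)) by auto.
  assert (E : forall j, dirD (ev j) (ext (Dv B f)) p = sum4 (fun i =>
     cc i (B (ev j)) * dirD (ev i) (ext f) p + cc i (B p) * dirD (ev j) (dirD (ev i) (ext f)) p)).
  { intros j. rewrite (dirD_ext_open (cone U) _ (fun x => sum4 (fun i => cc i (B x) * dirD (ev i) (ext f) x))); auto.
    2:{ intros y Hy. now apply (ext_Dv_sum U). }
    rewrite (dirD_sum4 (cone U) (fun i x => cc i (B x) * dirD (ev i) (ext f) x)); auto.
    2:{ intros i. apply smooth_mult; [now apply smooth_lin|now apply smooth_dirD]. }
    assert (E2 : forall i, dirD (ev j) (fun x => cc i (B x) * dirD (ev i) (ext f) x) p =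
       cc i (B (ev j)) * dirD (ev i) (ext f) p + cc i (B p) * dirD (ev j) (dirD (ev i) (ext f)) p).
    { intros i. rewrite (dirD_mult (cone U)); auto; [|now apply smooth_lin|now apply smooth_dirD].
      now rewrite (dirD_lin_fun (cone U)). }
    unfold sum4. now rewrite !E2. }
  unfold sum4 at 1 3. now rewrite !E.
Qed.

(** Restriction to the plane x + s v + t w reduces this to two real variables; the mixed derivatives
    are continuous there because they are again smooth on the open set. *)
Lemma dirD_Schwarz (D : C2 -> Prop) f x v w : open D -> smooth_on D f -> D x ->
  dirD v (dirD w f) x = dirD w (dirD v f) x.
Proof.
  intros HO Hf Dx.
  set (pt := fun s t : R => plus (plus x (scal s v)) (scal t w)).
  assert (Hpt0 : pt 0 0 = x) by (unfold pt; rewrite (plus_scal_0 (plus x (scal (0:R) v)) w); apply plus_scal_0).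
  assert (Hsw : forall s t, pt s t = plus (plus x (scal t w)) (scal s v)).
  { intros. unfold pt. apply cc_ext; intros. rewrite !cc_plus, !cc_scal. ring. }
  assert (Hloc : forall P : C2 -> Prop, locally x P -> exists d, 0 < d /\ forall s t, Rabs s < d -> Rabs t < d -> P (pt s t)).
  { intros P [e He].
    set (M := 1 + sum4 (fun i => Rabs (cc i v) + Rabs (cc i w))).
    assert (HM : forall i, (i < 4)%nat -> Rabs (cc i v) + Rabs (cc i w) < M).
    { intros i Hi. unfold M, sum4.
      generalize (Rabs_pos (cc 0 v)) (Rabs_pos (cc 1 v)) (Rabs_pos (cc 2 v)) (Rabs_pos (cc 3 v))
        (Rabs_pos (cc 0 w)) (Rabs_pos (cc 1 w)) (Rabs_pos (cc 2 w)) (Rabs_pos (cc 3 w)).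
      destruct i as [|[|[|[|i]]]]; try lia; lra. }
    assert (HM0 : 0 < M). { specialize (HM 0%nat ltac:(lia)). generalize (Rabs_pos (cc 0 v)) (Rabs_pos (cc 0 w)); lra. }
    exists (e / M). split; [apply Rdiv_lt_0_compat; auto; apply cond_pos|].
    intros s t Hs Ht. apply He. apply ball_C2. intros i Hi. unfold pt. rewrite !cc_plus, !cc_scal.
    replace (cc i x + s * cc i v + t * cc i w - cc i x) with (s * cc i v + t * cc i w) by ring.
    eapply Rle_lt_trans; [apply Rabs_triang|]. rewrite !Rabs_mult.
    apply Rle_lt_trans with (e / M * (Rabs (cc i v) + Rabs (cc i w))).
    - rewrite Rmult_plus_distr_l. apply Rplus_le_compat; apply Rmult_le_compat_r; try apply Rabs_pos; lra.
    - replace (pos e) with (e / M * M) at 2 by (field; lra).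
      apply Rmult_lt_compat_l; auto. apply Rdiv_lt_0_compat; auto; apply cond_pos. }
  destruct (Hloc D (HO x Dx)) as [d0 [Hd0 HD0]].
  assert (Hv : forall g s t, smooth_on D g -> Rabs s < d0 -> Rabs t < d0 ->
     is_derive (fun z => g (pt z t)) s (dirD v g (pt s t))).
  { intros g s t Hg Hs Ht. apply (chain_curve D g (fun z => pt z t)); auto.
    intros i _. apply is_derive_ext with (fun z => cc i x + z * cc i v + t * cc i w).
    - intros z. unfold pt. now rewrite !cc_plus, !cc_scal.
    - auto_derive; auto. ring. }
  assert (Hw : forall g s t, smooth_on D g -> Rabs s < d0 -> Rabs t < d0 ->
     is_derive (fun z => g (pt s z)) t (dirD w g (pt s t))).
  { intros g s t Hg Hs Ht. apply (chain_curve D g (fun z => pt s z)); auto.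
    intros i _. apply is_derive_ext with (fun z => cc i x + s * cc i v + z * cc i w).
    - intros z. unfold pt. now rewrite !cc_plus, !cc_scal.
    - auto_derive; auto. ring. }
  assert (Hnear : forall s, Rabs s < d0 -> locally s (fun z => Rabs z < d0)).
  { intros s Hs. apply locally_R. exists (d0 - Rabs s). split; [lra|]. intros y Hy.
    replace y with (s + (y - s)) by ring. eapply Rle_lt_trans; [apply Rabs_triang|]. lra. }
  assert (Sv := smooth_dirD D f v HO Hf). assert (Sw := smooth_dirD D f w HO Hf).
  assert (Evw : forall s t, Rabs s < d0 -> Rabs t < d0 ->
    is_derive (fun z => Derive (fun t0 => f (pt z t0)) t) s (dirD v (dirD w f) (pt s t))).
  { intros s t Hs Ht. eapply is_derive_ext_loc; [|apply Hv; auto].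
    generalize (Hnear s Hs). apply filter_imp. intros z Hz. symmetry. apply is_derive_unique. apply Hw; auto. }
  assert (Ewv : forall s t, Rabs s < d0 -> Rabs t < d0 ->
    is_derive (fun z => Derive (fun t0 => f (pt t0 z)) s) t (dirD w (dirD v f) (pt s t))).
  { intros s t Hs Ht. eapply is_derive_ext_loc; [|apply Hw; auto].
    generalize (Hnear t Ht). apply filter_imp. intros z Hz. symmetry. apply is_derive_unique. apply Hv; auto. }
  assert (Hcont : forall (F : R -> R -> R) g, smooth_on D g -> (forall s t, Rabs s < d0 -> Rabs t < d0 -> F s t = g (pt s t)) ->
    continuity_2d_pt F 0 0).
  { intros F g Hg HF eps.
    assert (HL : locally x (fun y => D y /\ Rabs (g y - g x) < eps)).
    { generalize (flim_elim (smooth_on_cont D g Hg x Dx) eps (cond_pos eps)) (HO x Dx). unfold within.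
      intros H1 H2. generalize (filter_and _ _ H1 H2). apply filter_imp. intuition. }
    destruct (Hloc _ HL) as [d1 [Hd1 H1]].
    assert (Hm : 0 < Rmin d0 d1) by now apply Rmin_glb_lt.
    exists (mkposreal _ Hm). simpl. intros u t Hu Ht. rewrite Rminus_0_r in Hu, Ht.
    generalize (Rmin_l d0 d1) (Rmin_r d0 d1). intros.
    rewrite !HF by (try rewrite Rabs_R0; lra). rewrite Hpt0. apply H1; lra. }
  assert (Z0 : Rabs 0 < d0) by now rewrite Rabs_R0.
  assert (HSch := Schwarz (fun s t => f (pt s t)) 0 0). cbv beta in HSch.
  generalize (is_derive_unique _ _ _ (Evw 0 0 Z0 Z0)) (is_derive_unique _ _ _ (Ewv 0 0 Z0 Z0)).
  rewrite Hpt0. intros E1 E2.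
  refine (eq_trans (eq_sym E1) (eq_trans (HSch _ _ _) E2)).
  - exists (mkposreal d0 Hd0). simpl. intros s t Hs Ht. rewrite Rminus_0_r in Hs, Ht.
    repeat split; eexists; [apply Hv|apply Hw|apply Evw|apply Ewv]; auto.
  - apply Hcont with (dirD v (dirD w f)); [now apply smooth_dirD|].
    intros s t Hs Ht. apply is_derive_unique. now apply Evw.
  - apply Hcont with (dirD w (dirD v f)); [now apply smooth_dirD|].
    intros s t Hs Ht. apply is_derive_unique. now apply Ewv.
Qed.

(** The second-order terms cancel by symmetry of second derivatives; what remains is the bracket of
    two linear fields, that is, a commutator of matrices. *)
Lemma Dv_bracket U A B f p : open_S3 U -> lin A -> lin B -> smooth_fun U f -> cone U p ->
  Dv A (Dv B f) p - Dv B (Dv A f) p = dirD (plus (B (A p)) (opp (A (B p)))) (ext f) p.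
Proof.
  intros HO HA HB Hf Hp. rewrite !(Dv_Dv U) by auto. rewrite (dirD_lin (cone U)) by auto.
  assert (Sc : forall i j, dirD (ev i) (dirD (ev j) (ext f)) p = dirD (ev j) (dirD (ev i) (ext f)) p).
  { intros. now apply (dirD_Schwarz (cone U)). }
  unfold sum4. rewrite !cc_plus, !cc_opp. rewrite !(cc_lin B _ (A p)), !(cc_lin A _ (B p)) by auto.
  unfold sum4.
  rewrite (Sc 1%nat 0%nat), (Sc 2%nat 0%nat), (Sc 3%nat 0%nat), (Sc 2%nat 1%nat), (Sc 3%nat 1%nat), (Sc 3%nat 2%nat).
  ring.
Qed.

(* Multiplication by i, j, k on one side (fieldT, fieldX, fieldY) and infinitesimal
   rotations in su(2) on the other side (rot1, rot2, rot3). *)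
Definition fieldT (x : C2) : C2 := mkv (- cc 1 x) (cc 0 x) (- cc 3 x) (cc 2 x).
Definition fieldX (x : C2) : C2 := mkv (- cc 2 x) (cc 3 x) (cc 0 x) (- cc 1 x).
Definition fieldY (x : C2) : C2 := mkv (- cc 3 x) (- cc 2 x) (cc 1 x) (cc 0 x).
Definition rot1 (x : C2) : C2 := mkv (- cc 1 x) (cc 0 x) (cc 3 x) (- cc 2 x).
Definition rot2 (x : C2) : C2 := mkv (- cc 2 x) (- cc 3 x) (cc 0 x) (cc 1 x).
Definition rot3 (x : C2) : C2 := mkv (- cc 3 x) (cc 2 x) (- cc 1 x) (cc 0 x).

Ltac ccx := apply cc_ext; let i := fresh "i" in let Hi := fresh "Hi" in intros i Hi;
  destruct i as [|[|[|[|i]]]]; try lia.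

Ltac lin_tac A := split; [intros x y|intros r x]; ccx; unfold A; rewrite ?cc_plus, ?cc_scal;
  unfold mkv; simpl; rewrite ?cc_plus, ?cc_scal; simpl; ring.

Lemma lin_fieldT : lin fieldT. Proof. lin_tac fieldT. Qed.
Lemma lin_fieldX : lin fieldX. Proof. lin_tac fieldX. Qed.
Lemma lin_fieldY : lin fieldY. Proof. lin_tac fieldY. Qed.
Lemma lin_rot1 : lin rot1. Proof. lin_tac rot1. Qed.
Lemma lin_rot2 : lin rot2. Proof. lin_tac rot2. Qed.
Lemma lin_rot3 : lin rot3. Proof. lin_tac rot3. Qed.

Definition dot (v w : C2) : R := sum4 (fun i => cc i v * cc i w).

(** The vectors x, rot1 x, rot2 x, rot3 x are orthogonal of squared length [nsq x], and the radial
    derivative vanishes by [dirD_self]. Every derivative is thus expressed by the rotations, which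
    commute with the projections. *)
Lemma dirD_rot U f x v : open_S3 U -> smooth_fun U f -> cone U x ->
  dirD v (ext f) x = / nsq x * (dot v (rot1 x) * ext (Dv rot1 f) x + dot v (rot2 x) * ext (Dv rot2 f) x
     + dot v (rot3 x) * ext (Dv rot3 f) x).
Proof.
  intros HO Hf Hx. assert (Hn := nsq_pos x (proj1 Hx)).
  rewrite !(ext_Dv_sum U) by auto using lin_rot1, lin_rot2, lin_rot3.
  assert (Hs := dirD_self f x (proj1 Hx)).
  rewrite (dirD_lin (cone U)) in Hs |- * by auto.
  apply (Rmult_eq_reg_l (nsq x)); [|lra]. rewrite <- Rmult_assoc, Rinv_r, Rmult_1_l by lra.
  apply Rminus_diag_uniq.
  transitivity (dot v x * sum4 (fun i => cc i x * dirD (ev i) (ext f) x)); [|rewrite Hs; ring].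
  unfold dot, nsq, sum4, rot1, rot2, rot3, mkv; simpl. ring.
Qed.

Lemma dirD_fields U f x v : open_S3 U -> smooth_fun U f -> cone U x ->
  dirD v (ext f) x = / nsq x * (dot v (fieldT x) * ext (Dv fieldT f) x + dot v (fieldX x) * ext (Dv fieldX f) x
     + dot v (fieldY x) * ext (Dv fieldY f) x).
Proof.
  intros HO Hf Hx. assert (Hn := nsq_pos x (proj1 Hx)).
  rewrite !(ext_Dv_sum U) by auto using lin_fieldT, lin_fieldX, lin_fieldY.
  assert (Hs := dirD_self f x (proj1 Hx)).
  rewrite (dirD_lin (cone U)) in Hs |- * by auto.
  apply (Rmult_eq_reg_l (nsq x)); [|lra]. rewrite <- Rmult_assoc, Rinv_r, Rmult_1_l by lra.
  apply Rminus_diag_uniq.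
  transitivity (dot v x * sum4 (fun i => cc i x * dirD (ev i) (ext f) x)); [|rewrite Hs; ring].
  unfold dot, nsq, sum4, fieldT, fieldX, fieldY, mkv; simpl. ring.
Qed.

(** Both sides are the Casimir operator of su(2), acting from one side and from the other: the
    Laplacian of the sphere. *)
Lemma sum_squares U f p : open_S3 U -> smooth_fun U f -> cone U p ->
  Dv fieldT (Dv fieldT f) p + Dv fieldX (Dv fieldX f) p + Dv fieldY (Dv fieldY f) p =
  Dv rot1 (Dv rot1 f) p + Dv rot2 (Dv rot2 f) p + Dv rot3 (Dv rot3 f) p.
Proof.
  intros HO Hf Hp. rewrite !(Dv_Dv U) by auto using lin_fieldT, lin_fieldX, lin_fieldY, lin_rot1, lin_rot2, lin_rot3.
  unfold sum4, fieldT, fieldX, fieldY, rot1, rot2, rot3, ev, mkv; simpl. ring.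
Qed.

Lemma bracket_TX U f p : open_S3 U -> smooth_fun U f -> cone U p ->
  Dv fieldT (Dv fieldX f) p - Dv fieldX (Dv fieldT f) p = -2 * Dv fieldY f p.
Proof.
  intros HO Hf Hp. rewrite (Dv_bracket U) by auto using lin_fieldT, lin_fieldX.
  unfold Dv. rewrite <- (dirD_scal_v (cone U)) by auto. f_equal.
  ccx; rewrite ?cc_plus, ?cc_opp, ?cc_scal; unfold fieldT, fieldX, fieldY, mkv; simpl; ring.
Qed.

Lemma bracket_XY U f p : open_S3 U -> smooth_fun U f -> cone U p ->
  Dv fieldX (Dv fieldY f) p - Dv fieldY (Dv fieldX f) p = -2 * Dv fieldT f p.
Proof.
  intros HO Hf Hp. rewrite (Dv_bracket U) by auto using lin_fieldY, lin_fieldX.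
  unfold Dv. rewrite <- (dirD_scal_v (cone U)) by auto. f_equal.
  ccx; rewrite ?cc_plus, ?cc_opp, ?cc_scal; unfold fieldT, fieldX, fieldY, mkv; simpl; ring.
Qed.

Lemma bracket_TY U f p : open_S3 U -> smooth_fun U f -> cone U p ->
  Dv fieldT (Dv fieldY f) p - Dv fieldY (Dv fieldT f) p = 2 * Dv fieldX f p.
Proof.
  intros HO Hf Hp. rewrite (Dv_bracket U) by auto using lin_fieldY, lin_fieldT.
  unfold Dv. rewrite <- (dirD_scal_v (cone U)) by auto. f_equal.
  ccx; rewrite ?cc_plus, ?cc_opp, ?cc_scal; unfold fieldT, fieldX, fieldY, mkv; simpl; ring.
Qed.

(** * Integration over the sphere *)

Lemma filter_list {T A : Type} (F : (T -> Prop) -> Prop) {FF : Filter F} (l : list A) (P : A -> T -> Prop) :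
  (forall a, In a l -> F (P a)) -> F (fun t => forall a, In a l -> P a t).
Proof.
  induction l as [|a l IH]; intros H.
  - apply filter_forall. intros t a [].
  - generalize (filter_and _ _ (H a (or_introl eq_refl)) (IH (fun b Hb => H b (or_intror Hb)))).
    apply filter_imp. intros t [H1 H2] b [<-|Hb]; auto.
Qed.

Definition coord_close (e : R) (x y : C2) : Prop := forall i, (i < 4)%nat -> Rabs (cc i y - cc i x) < e.

Lemma S3_cc_bound p i : S3 p -> -1 <= cc i p <= 1.
Proof.
  intros H. apply S3_nsq in H. unfold nsq, sum4 in H.
  assert (E : cc i p * cc i p <= 1) by (destruct i as [|[|[|i]]]; cbn -[Rmult] in *; nra).
  nra.
Qed.

Lemma nsq_close t : exists d, 0 < d /\ forall y, coord_close d t y -> Rabs (nsq y - nsq t) < Rabs (nsq t - 1) \/ nsq t = 1.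
Proof.
  destruct (Req_dec (nsq t) 1) as [E|N]; [exists 1; split; [lra|]; auto|].
  assert (Hp : 0 < Rabs (nsq t - 1)) by (apply Rabs_pos_lt; lra).
  destruct (flim_elim (cont_locally nsq t (smooth_nsq _)) _ Hp) as [d Hd].
  exists d; split; [apply cond_pos|]. intros y Hy. left. apply Hd. now apply ball_C2.
Qed.

(** Compactness of the sphere, stated for an arbitrary filter so that one lemma serves several
    purposes: [at_right 0] gives uniform continuity, neighbourhoods of infinity give bounds, and
    neighbourhoods of a parameter give uniform convergence. *)
Lemma tube {T : Type} (F : (T -> Prop) -> Prop) {FF : Filter F} (Q : T -> C2 -> Prop) :
  (forall y, S3 y -> exists e, 0 < e /\ F (fun th => forall y', S3 y' -> coord_close e y y' -> Q th y')) ->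
  F (fun th => forall y, S3 y -> Q th y).
Proof.
  intros H.
  assert (H' : forall t : C2, exists d : posreal, F (fun th => forall y', S3 y' -> coord_close d t y' -> Q th y')).
  { intros t. destruct (classic (S3 t)) as [Ht|Ht].
    - destruct (H t Ht) as [e [He HF]]. exists (mkposreal e He). exact HF.
    (* The covering theorem concerns the whole cube. Around a point off the sphere the gauge is so
       small that its box misses the sphere, and nothing is to be shown there. *)
    - destruct (nsq_close t) as [d [Hd HN]]. exists (mkposreal d Hd). apply filter_forall.
      intros th y' Hy' Hc. exfalso. rewrite S3_nsq in Ht, Hy'. destruct (HN y' Hc) as [E|E]; auto.
      rewrite Hy' in E. rewrite <- (Rabs_Ropp (1 - nsq t)) in E. replace (- (1 - nsq t)) with (nsq t - 1) in E by ring. lra. }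
  set (del := fun t => proj1_sig (constructive_indefinite_description _ (H' t))).
  assert (Hdel : forall t, F (fun th => forall y', S3 y' -> coord_close (del t) t y' -> Q th y')).
  { intros t. unfold del. apply (proj2_sig (constructive_indefinite_description _ (H' t))). }
  set (pt := fun t : Compactness.Tn 4 R => mkv (fst t) (fst (snd t)) (fst (snd (snd t))) (fst (snd (snd (snd t))))).
  assert (HC := compactness_list 4 (-1, (-1, (-1, (-1, tt)))) (1, (1, (1, (1, tt)))) (fun t => del (pt t))).
  (* The finite covering is provided under a double negation. *)
  apply NNPP in HC. destruct HC as [l Hl].
  assert (HF := filter_list F l (fun t th => forall y', S3 y' -> coord_close (del (pt t)) (pt t) y' -> Q th y')
     (fun t _ => Hdel (pt t))).
  revert HF. apply filter_imp. intros th Hth y Hy.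
  destruct (Hl (cc 0 y, (cc 1 y, (cc 2 y, (cc 3 y, tt))))) as [t [Hin [_ Hcl]]].
  - simpl. repeat split; apply (S3_cc_bound y 0%nat Hy) || apply (S3_cc_bound y 1%nat Hy) ||
    apply (S3_cc_bound y 2%nat Hy) || apply (S3_cc_bound y 3%nat Hy).
  - apply (Hth t Hin); auto. destruct t as [t0 [t1 [t2 [t3 []]]]].
    simpl in Hcl. destruct Hcl as [K0 [K1 [K2 [K3 _]]]].
    intros i Hi. destruct i as [|[|[|[|i]]]]; try lia; assumption.
Qed.

Definition contS (f : C2 -> R) : Prop := forall p, S3 p -> forall eps, 0 < eps ->
  exists d, 0 < d /\ forall q, S3 q -> coord_close d p q -> Rabs (f q - f p) < eps.

Lemma cont_contS f : cont_on cone0 (ext f) -> contS f.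
Proof.
  intros H p Hp eps He. assert (Hc : cone0 p) by (apply cone0_nz; now apply S3_nonzero).
  destruct (flim_elim (H p Hc) eps He) as [d Hd]. exists d; split; [apply cond_pos|].
  intros q Hq Hcl. rewrite <- (ext_S3 f p Hp), <- (ext_S3 f q Hq). apply Hd; [now apply ball_C2|].
  apply cone0_nz; now apply S3_nonzero.
Qed.

Lemma smooth_contS f : smooth_S3 f -> contS f.
Proof. intros H. apply cont_contS. now apply smooth_on_cont. Qed.

Lemma contS_unif f : contS f -> forall eps, 0 < eps -> exists d, 0 < d /\
  forall p q, S3 p -> S3 q -> coord_close d p q -> Rabs (f q - f p) < eps.
Proof.
  intros H eps He.
  assert (HT := tube (at_right 0) (fun d p => forall q, S3 q -> coord_close d p q -> Rabs (f q - f p) < eps)).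
  assert (HX : at_right 0 (fun d => forall p, S3 p -> forall q, S3 q -> coord_close d p q -> Rabs (f q - f p) < eps)).
  { apply HT. intros y Hy. destruct (H y Hy (eps / 2) ltac:(lra)) as [d [Hd HQ]].
    exists (d / 2); split; [lra|].
    assert (Hd2 : 0 < d / 2) by lra. exists (mkposreal _ Hd2). intros e Hb Hpos p Hp Hcp q Hq Hcq.
    assert (He2 : e < d / 2).
    { unfold ball in Hb; simpl in Hb; unfold AbsRing_ball, abs, minus, plus, opp in Hb; simpl in Hb.
      apply Rabs_def2 in Hb. lra. }
    assert (Rabs (f p - f y) < eps / 2).
    { apply HQ; auto. intros i Hi. specialize (Hcp i Hi). lra. }
    assert (Rabs (f q - f y) < eps / 2).
    { apply HQ; auto. intros i Hi. specialize (Hcp i Hi). specialize (Hcq i Hi).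
      replace (cc i q - cc i y) with ((cc i q - cc i p) + (cc i p - cc i y)) by ring.
      eapply Rle_lt_trans; [apply Rabs_triang|]. lra. }
    replace (f q - f p) with ((f q - f y) - (f p - f y)) by ring.
    eapply Rle_lt_trans; [apply Rabs_triang|]. rewrite Rabs_Ropp. lra. }
  destruct HX as [d Hd]. exists (d / 2). assert (Hp := cond_pos d). split; [lra|].
  intros p q Hp' Hq Hc. apply (Hd (d / 2)); auto; [|lra].
  unfold ball; simpl; unfold AbsRing_ball, abs, minus, plus, opp; simpl.
  rewrite Ropp_0, Rplus_0_r, Rabs_pos_eq; lra.
Qed.

Lemma contS_bounded f : contS f -> exists M, 0 < M /\ forall p, S3 p -> Rabs (f p) <= M.
Proof.
  intros H.
  assert (HX : Rbar_locally p_infty (fun M => forall p, S3 p -> Rabs (f p) <= M)).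
  { apply (tube (Rbar_locally p_infty) (fun M p => Rabs (f p) <= M)).
    intros y Hy. destruct (H y Hy 1 Rlt_0_1) as [d [Hd HQ]]. exists d; split; auto.
    exists (Rabs (f y) + 1). intros M HM p Hp Hc. specialize (HQ p Hp Hc).
    replace (f p) with ((f p - f y) + f y) by ring. eapply Rle_trans; [apply Rabs_triang|]. lra. }
  destruct HX as [M HM]. exists (Rmax M 0 + 1). generalize (Rmax_l M 0) (Rmax_r M 0). intros.
  split; [lra|]. apply HM. lra.
Qed.

Lemma contS_const c : contS (fun _ => c).
Proof. apply smooth_contS. apply smooth_const. Qed.

Lemma contS_comp2 (op : R -> R -> R) f g :
  (forall a b eps, 0 < eps -> exists d, 0 < d /\ forall a' b', Rabs (a' - a) < d -> Rabs (b' - b) < d -> Rabs (op a' b' - op a b) < eps) ->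
  contS f -> contS g -> contS (fun p => op (f p) (g p)).
Proof.
  intros Hop Hf Hg p Hp eps He. destruct (Hop (f p) (g p) eps He) as [d [Hd H]].
  destruct (Hf p Hp d Hd) as [d1 [Hd1 H1]]. destruct (Hg p Hp d Hd) as [d2 [Hd2 H2]].
  exists (Rmin d1 d2); split; [now apply Rmin_glb_lt|]. intros q Hq Hc.
  apply H; [apply H1|apply H2]; auto; intros i Hi; specialize (Hc i Hi);
  eapply Rlt_le_trans; try exact Hc; [apply Rmin_l|apply Rmin_r].
Qed.

Lemma contS_plus f g : contS f -> contS g -> contS (fun p => f p + g p).
Proof.
  apply (contS_comp2 Rplus). intros a b eps He. exists (eps / 2); split; [lra|]. intros a' b' H1 H2.
  replace (a' + b' - (a + b)) with ((a' - a) + (b' - b)) by ring.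
  eapply Rle_lt_trans; [apply Rabs_triang|]. lra.
Qed.

Lemma Rmult_cont_eps a b eps : 0 < eps -> exists d, 0 < d /\ forall a' b',
  Rabs (a' - a) < d -> Rabs (b' - b) < d -> Rabs (a' * b' - a * b) < eps.
Proof.
  intros He. set (M := Rabs a + Rabs b + 1). assert (HM : 0 < M) by (unfold M; generalize (Rabs_pos a) (Rabs_pos b); lra).
  exists (Rmin 1 (eps / (2 * M))). assert (H2 : 0 < eps / (2 * M)) by (apply Rdiv_lt_0_compat; lra).
  split; [apply Rmin_glb_lt; lra|]. intros a' b' Ha Hb.
  generalize (Rmin_l 1 (eps / (2 * M))) (Rmin_r 1 (eps / (2 * M))). intros K1 K2.
  set (e := Rmin 1 (eps / (2 * M))) in *.
  replace (a' * b' - a * b) with ((a' - a) * (b' - b) + a * (b' - b) + (a' - a) * b) by ring.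
  assert (HeM : e * M <= eps / 2).
  { apply Rle_trans with (eps / (2 * M) * M); [apply Rmult_le_compat_r; lra|]. right; field; lra. }
  eapply Rle_lt_trans; [apply Rabs_triang|].
  eapply Rle_lt_trans; [apply Rplus_le_compat_r; apply Rabs_triang|]. rewrite !Rabs_mult.
  assert (Rabs (a' - a) * Rabs (b' - b) <= e * 1).
  { apply Rmult_le_compat; try apply Rabs_pos; lra. }
  assert (Rabs a * Rabs (b' - b) <= Rabs a * e) by (apply Rmult_le_compat_l; [apply Rabs_pos|lra]).
  assert (Rabs (a' - a) * Rabs b <= e * Rabs b) by (apply Rmult_le_compat_r; [apply Rabs_pos|lra]).
  unfold M in HeM. nra.
Qed.

Lemma contS_mult f g : contS f -> contS g -> contS (fun p => f p * g p).
Proof. apply (contS_comp2 Rmult). intros. now apply Rmult_cont_eps. Qed.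

Lemma contS_scal c f : contS f -> contS (fun p => c * f p).
Proof. apply contS_mult. apply contS_const. Qed.

Lemma contS_minus f g : contS f -> contS g -> contS (fun p => f p - g p).
Proof.
  intros Hf Hg p Hp eps He. destruct (contS_plus f (fun p => -1 * g p) Hf (contS_scal _ _ Hg) p Hp eps He) as [d [Hd H]].
  exists d; split; auto. intros q Hq Hc. specialize (H q Hq Hc).
  now replace (f q - g q - (f p - g p)) with (f q + -1 * g q - (f p + -1 * g p)) by ring.
Qed.

Lemma contS_ext f g : (forall p, S3 p -> f p = g p) -> contS f -> contS g.
Proof.
  intros E H p Hp eps He. destruct (H p Hp eps He) as [d [Hd K]]. exists d; split; auto.
  intros q Hq Hc. rewrite <- !E; auto.
Qed.

(** * Functions of the Hopf coordinates *)

(** Uniform continuity and boundedness on all of R^3, and not only on the coordinate box: the class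
    is stable under partial integration, and integrability never needs a range condition. Functions
    of the Hopf coordinates qualify because the parametrization is made of sines and cosines. *)
Definition UCB (f : R -> R -> R -> R) : Prop :=
  (forall eps, 0 < eps -> exists d, 0 < d /\ forall x y z x' y' z',
     Rabs (x' - x) < d -> Rabs (y' - y) < d -> Rabs (z' - z) < d ->
     Rabs (f x' y' z' - f x y z) < eps) /\
  (exists M, 0 <= M /\ forall x y z, Rabs (f x y z) <= M).

Lemma UCB_const c : UCB (fun _ _ _ => c).
Proof.
  split.
  - intros eps He. exists 1; split; [lra|]. intros. rewrite Rminus_diag_eq by auto. now rewrite Rabs_R0.
  - exists (Rabs c); split; [apply Rabs_pos|]. intros; lra.
Qed.

Lemma UCB_plus f g : UCB f -> UCB g -> UCB (fun x y z => f x y z + g x y z).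
Proof.
  intros [Hf [M [HM Mf]]] [Hg [N [HN Ng]]]. split.
  - intros eps He. destruct (Hf (eps / 2) ltac:(lra)) as [d1 [Hd1 H1]].
    destruct (Hg (eps / 2) ltac:(lra)) as [d2 [Hd2 H2]].
    exists (Rmin d1 d2); split; [now apply Rmin_glb_lt|]. intros x y z x' y' z' Hx Hy Hz.
    generalize (Rmin_l d1 d2) (Rmin_r d1 d2). intros.
    specialize (H1 x y z x' y' z' ltac:(lra) ltac:(lra) ltac:(lra)).
    specialize (H2 x y z x' y' z' ltac:(lra) ltac:(lra) ltac:(lra)).
    replace (f x' y' z' + g x' y' z' - (f x y z + g x y z)) with
      ((f x' y' z' - f x y z) + (g x' y' z' - g x y z)) by ring.
    eapply Rle_lt_trans; [apply Rabs_triang|]. lra.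
  - exists (M + N); split; [lra|]. intros. eapply Rle_trans; [apply Rabs_triang|].
    apply Rplus_le_compat; auto.
Qed.

Lemma UCB_mult f g : UCB f -> UCB g -> UCB (fun x y z => f x y z * g x y z).
Proof.
  intros [Hf [M [HM Mf]]] [Hg [N [HN Ng]]]. split.
  - intros eps He.
    assert (HM1 : 0 < eps / (2 * (M + 1))) by (apply Rdiv_lt_0_compat; lra).
    assert (HN1 : 0 < eps / (2 * (N + 1))) by (apply Rdiv_lt_0_compat; lra).
    destruct (Hf _ HN1) as [d1 [Hd1 H1]]. destruct (Hg _ HM1) as [d2 [Hd2 H2]].
    exists (Rmin d1 d2); split; [now apply Rmin_glb_lt|]. intros x y z x' y' z' Hx Hy Hz.
    generalize (Rmin_l d1 d2) (Rmin_r d1 d2). intros.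
    specialize (H1 x y z x' y' z' ltac:(lra) ltac:(lra) ltac:(lra)).
    specialize (H2 x y z x' y' z' ltac:(lra) ltac:(lra) ltac:(lra)).
    replace (f x' y' z' * g x' y' z' - f x y z * g x y z) with
      ((f x' y' z' - f x y z) * g x' y' z' + f x y z * (g x' y' z' - g x y z)) by ring.
    eapply Rle_lt_trans; [apply Rabs_triang|]. rewrite !Rabs_mult.
    assert (K1 : Rabs (f x' y' z' - f x y z) * Rabs (g x' y' z') <= eps / (2 * (N + 1)) * N).
    { apply Rmult_le_compat; try apply Rabs_pos; auto. lra. }
    assert (K2 : Rabs (f x y z) * Rabs (g x' y' z' - g x y z) <= M * (eps / (2 * (M + 1)))).
    { apply Rmult_le_compat; try apply Rabs_pos; auto. lra. }
    assert (K3 : eps / (2 * (N + 1)) * N < eps / 2).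
    { replace (eps / 2) with (eps / (2 * (N + 1)) * (N + 1)) by (field; lra). apply Rmult_lt_compat_l; lra. }
    assert (K4 : M * (eps / (2 * (M + 1))) < eps / 2).
    { replace (eps / 2) with ((M + 1) * (eps / (2 * (M + 1)))) by (field; lra). apply Rmult_lt_compat_r; lra. }
    lra.
  - exists (M * N); split; [now apply Rmult_le_pos|]. intros. rewrite Rabs_mult.
    apply Rmult_le_compat; try apply Rabs_pos; auto.
Qed.

Lemma UCB_ext f g : (forall x y z, f x y z = g x y z) -> UCB f -> UCB g.
Proof.
  intros E [H [M [HM K]]]. split.
  - intros eps He. destruct (H eps He) as [d [Hd L]]. exists d; split; auto. intros. rewrite <- !E. auto.
  - exists M; split; auto. intros. rewrite <- E. auto.
Qed.

Lemma UCB_lip (u du : R -> R) (al be ga : R) :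
  (forall t, is_derive u t (du t)) -> (forall t, Rabs (du t) <= 1) -> (forall t, Rabs (u t) <= 1) ->
  UCB (fun x y z => u (al * x + be * y + ga * z)).
Proof.
  intros Hd Hdu Hu. split.
  - intros eps He. set (M := Rabs al + Rabs be + Rabs ga + 1).
    assert (HM : 0 < M) by (unfold M; generalize (Rabs_pos al) (Rabs_pos be) (Rabs_pos ga); lra).
    exists (eps / M). split; [now apply Rdiv_lt_0_compat|]. intros x y z x' y' z' Hx Hy Hz.
    set (s := al * x + be * y + ga * z). set (s' := al * x' + be * y' + ga * z').
    assert (Hss : Rabs (u s' - u s) <= Rabs (s' - s)).
    { destruct (MVT_abs u du s s') as [c [E _]]; [intros; apply is_derive_Reals; auto|].
      rewrite E. rewrite <- (Rmult_1_l (Rabs (s' - s))) at 2. apply Rmult_le_compat_r; auto. apply Rabs_pos. }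
    eapply Rle_lt_trans; [exact Hss|].
    replace (s' - s) with (al * (x' - x) + be * (y' - y) + ga * (z' - z)) by (unfold s, s'; ring).
    apply Rle_lt_trans with (Rabs al * (eps / M) + Rabs be * (eps / M) + Rabs ga * (eps / M)).
    + eapply Rle_trans; [apply Rabs_triang|]. apply Rplus_le_compat.
      * eapply Rle_trans; [apply Rabs_triang|]. rewrite !Rabs_mult.
        apply Rplus_le_compat; apply Rmult_le_compat_l; try apply Rabs_pos; lra.
      * rewrite Rabs_mult. apply Rmult_le_compat_l; try apply Rabs_pos; lra.
    + replace eps with (M * (eps / M)) at 4 by (field; lra).
      rewrite <- !Rmult_plus_distr_r. apply Rmult_lt_compat_r; [now apply Rdiv_lt_0_compat|]. unfold M; lra.
  - exists 1; split; [lra|]. auto.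
Qed.

Lemma abs_sin t : Rabs (sin t) <= 1.
Proof. apply Rabs_le. apply SIN_bound. Qed.
Lemma abs_cos t : Rabs (cos t) <= 1.
Proof. apply Rabs_le. apply COS_bound. Qed.

Lemma UCB_sin al be ga : UCB (fun x y z => sin (al * x + be * y + ga * z)).
Proof. apply UCB_lip with cos; auto using abs_sin, abs_cos. intros. apply is_derive_sin. Qed.

Lemma UCB_cos al be ga : UCB (fun x y z => cos (al * x + be * y + ga * z)).
Proof.
  apply UCB_lip with (fun t => - sin t); auto using abs_cos.
  - intros. apply is_derive_cos.
  - intros. rewrite Rabs_Ropp. apply abs_sin.
Qed.

Lemma UCB_sinx : UCB (fun x _ _ => sin x).
Proof. apply UCB_ext with (2 := UCB_sin 1 0 0). intros; f_equal; ring. Qed.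
Lemma UCB_cosx : UCB (fun x _ _ => cos x).
Proof. apply UCB_ext with (2 := UCB_cos 1 0 0). intros; f_equal; ring. Qed.
Lemma UCB_siny : UCB (fun _ y _ => sin y).
Proof. apply UCB_ext with (2 := UCB_sin 0 1 0). intros; f_equal; ring. Qed.
Lemma UCB_cosy : UCB (fun _ y _ => cos y).
Proof. apply UCB_ext with (2 := UCB_cos 0 1 0). intros; f_equal; ring. Qed.
Lemma UCB_sinz : UCB (fun _ _ z => sin z).
Proof. apply UCB_ext with (2 := UCB_sin 0 0 1). intros; f_equal; ring. Qed.
Lemma UCB_cosz : UCB (fun _ _ z => cos z).
Proof. apply UCB_ext with (2 := UCB_cos 0 0 1). intros; f_equal; ring. Qed.

Lemma continuous_R_intro (f : R -> R) t :
  (forall eps, 0 < eps -> exists d, 0 < d /\ forall s, Rabs (s - t) < d -> Rabs (f s - f t) < eps) ->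
  continuous f t.
Proof.
  intros H. apply filterlim_R; [apply locally_filter|]. intros eps He. apply locally_R. auto.
Qed.

Lemma UCB_cont_x f y z t : UCB f -> continuous (fun x => f x y z) t.
Proof.
  intros [H _]. apply continuous_R_intro. intros eps He. destruct (H eps He) as [d [Hd K]].
  exists d; split; auto. intros s Hs. apply K; auto; rewrite Rminus_diag_eq, Rabs_R0; auto.
Qed.
Lemma UCB_cont_y f x z t : UCB f -> continuous (fun y => f x y z) t.
Proof.
  intros [H _]. apply continuous_R_intro. intros eps He. destruct (H eps He) as [d [Hd K]].
  exists d; split; auto. intros s Hs. apply K; auto; rewrite Rminus_diag_eq, Rabs_R0; auto.
Qed.
Lemma UCB_cont_z f x y t : UCB f -> continuous (fun z => f x y z) t.
Proof.
  intros [H _]. apply continuous_R_intro. intros eps He. destruct (H eps He) as [d [Hd K]].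
  exists d; split; auto. intros s Hs. apply K; auto; rewrite Rminus_diag_eq, Rabs_R0; auto.
Qed.

Lemma ex_RInt_cont (f : R -> R) a b : (forall t, continuous f t) -> ex_RInt f a b.
Proof. intros H. apply (ex_RInt_continuous (V := R_CompleteNormedModule)). intros; apply H. Qed.

Lemma RInt_close (f g : R -> R) (c e : R) : 0 <= c -> (forall t, continuous f t) -> (forall t, continuous g t) ->
  (forall t, Rabs (f t - g t) <= e) -> Rabs (RInt f 0 c - RInt g 0 c) <= c * e.
Proof.
  intros Hc Hf Hg H.
  assert (E : RInt (fun t => f t - g t) 0 c = RInt f 0 c - RInt g 0 c).
  { apply (RInt_minus (V := R_CompleteNormedModule)); now apply ex_RInt_cont. }
  rewrite <- E. replace (c * e) with ((c - 0) * e) by ring.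
  apply abs_RInt_le_const; auto. apply ex_RInt_cont.
  intros t. apply (continuous_minus (V := R_NormedModule)); auto.
Qed.

Lemma RInt_add (f g : R -> R) (a b : R) : (forall t, continuous f t) -> (forall t, continuous g t) ->
  RInt (fun t => f t + g t) a b = RInt f a b + RInt g a b.
Proof. intros. apply (RInt_plus (V := R_CompleteNormedModule)); now apply ex_RInt_cont. Qed.

Lemma RInt_mul (f : R -> R) (a b c : R) : (forall t, continuous f t) ->
  RInt (fun t => c * f t) a b = c * RInt f a b.
Proof. intros. apply (RInt_scal (V := R_CompleteNormedModule)); now apply ex_RInt_cont. Qed.

(** The variable integrated out survives as a dummy argument, so that [UCB] applies to the result
    again. *)
Definition Ib (f : R -> R -> R -> R) : R -> R -> R -> R := fun x y _ => RInt (fun z => f x y z) 0 (2 * PI).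
Definition Ia (f : R -> R -> R -> R) : R -> R -> R -> R := fun x _ z => RInt (fun y => f x y z) 0 (2 * PI).
Definition Ie (f : R -> R -> R -> R) : R := RInt (fun x => f x 0 0) 0 (PI / 2).

Lemma two_PI_pos : 0 < 2 * PI.
Proof. generalize PI_RGT_0. lra. Qed.

Lemma UCB_Ib f : UCB f -> UCB (Ib f).
Proof.
  intros Hf. assert (Hf' := Hf). destruct Hf' as [H [M [HM K]]]. assert (Hpi := two_PI_pos). split.
  - intros eps He. assert (He' : 0 < eps / (2 * (2 * PI))) by (apply Rdiv_lt_0_compat; lra).
    destruct (H _ He') as [d [Hd L]]. exists d; split; auto. intros x y z x' y' z' Hx Hy Hz.
    unfold Ib. apply Rle_lt_trans with (2 * PI * (eps / (2 * (2 * PI)))).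
    + apply RInt_close; [lra| | |].
      * intros; now apply UCB_cont_z.
      * intros; now apply UCB_cont_z.
      * intros t. left. apply L; auto. rewrite Rminus_diag_eq, Rabs_R0; auto.
    + replace (2 * PI * (eps / (2 * (2 * PI)))) with (eps / 2) by (field; lra). lra.
  - exists (2 * PI * M). split; [apply Rmult_le_pos; lra|]. intros. unfold Ib.
    replace (2 * PI * M) with ((2 * PI - 0) * M) by ring. apply abs_RInt_le_const; auto; [lra|].
    apply ex_RInt_cont. intros; now apply UCB_cont_z.
Qed.

Lemma UCB_Ia f : UCB f -> UCB (Ia f).
Proof.
  intros Hf. assert (Hf' := Hf). destruct Hf' as [H [M [HM K]]]. assert (Hpi := two_PI_pos). split.
  - intros eps He. assert (He' : 0 < eps / (2 * (2 * PI))) by (apply Rdiv_lt_0_compat; lra).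
    destruct (H _ He') as [d [Hd L]]. exists d; split; auto. intros x y z x' y' z' Hx Hy Hz.
    unfold Ia. apply Rle_lt_trans with (2 * PI * (eps / (2 * (2 * PI)))).
    + apply RInt_close; [lra| | |].
      * intros; now apply UCB_cont_y.
      * intros; now apply UCB_cont_y.
      * intros t. left. apply L; auto. rewrite Rminus_diag_eq, Rabs_R0; auto.
    + replace (2 * PI * (eps / (2 * (2 * PI)))) with (eps / 2) by (field; lra). lra.
  - exists (2 * PI * M). split; [apply Rmult_le_pos; lra|]. intros. unfold Ia.
    replace (2 * PI * M) with ((2 * PI - 0) * M) by ring. apply abs_RInt_le_const; auto; [lra|].
    apply ex_RInt_cont. intros; now apply UCB_cont_y.
Qed.

(** The difference quotient equals f' at an intermediate parameter, and f' is uniformly continuous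
    in the parameter, uniformly in t. *)
Lemma leib (f f' : R -> R -> R) (c s : R) : 0 <= c ->
  (forall s t, is_derive (fun s => f s t) s (f' s t)) ->
  (forall s t, continuous (f s) t) -> (forall s t, continuous (f' s) t) ->
  (forall eps, 0 < eps -> exists d, 0 < d /\ forall s s' t, Rabs (s' - s) < d -> Rabs (f' s' t - f' s t) < eps) ->
  is_derive (fun s => RInt (f s) 0 c) s (RInt (f' s) 0 c).
Proof.
  intros Hc Hd Cf Cf' Hu. apply is_derive_Reals. intros eps He.
  assert (He' : 0 < eps / (2 * (c + 1))) by (apply Rdiv_lt_0_compat; lra).
  destruct (Hu _ He') as [d [Hdp H]]. exists (mkposreal d Hdp). simpl. intros h Hn Hh.
  replace ((RInt (f (s + h)) 0 c - RInt (f s) 0 c) / h - RInt (f' s) 0 c)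
    with ((RInt (f (s + h)) 0 c - RInt (fun t => f s t + h * f' s t) 0 c) / h).
  2:{ rewrite (RInt_add (f s) (fun t => h * f' s t)); auto.
      - rewrite RInt_mul; auto. field; auto.
      - intros t. apply (continuous_scal_r (V := R_NormedModule)). auto. }
  unfold Rdiv. rewrite Rabs_mult, Rabs_inv.
  assert (Hhp := Rabs_pos_lt h Hn).
  apply Rle_lt_trans with (c * (eps / (2 * (c + 1)) * Rabs h) * / Rabs h).
  - apply Rmult_le_compat_r; [left; now apply Rinv_0_lt_compat|]. apply RInt_close; auto.
    + intros t. apply (continuous_plus (V := R_NormedModule)); auto.
      apply (continuous_scal_r (V := R_NormedModule)). auto.
    + intros t.
      destruct (MVT_gen (fun u => f u t) s (s + h) (fun u => f' u t)) as [x [Hx E]].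
      * intros; apply Hd.
      * intros. apply continuity_pt_filterlim.
        apply (ex_derive_continuous (V := R_NormedModule) (fun u => f u t)). eexists. apply Hd.
      * cbv beta in E. replace (f (s + h) t - (f s t + h * f' s t)) with ((f' x t - f' s t) * h).
        -- rewrite Rabs_mult. apply Rmult_le_compat_r; [lra|]. left. apply H.
           assert (Rabs (x - s) <= Rabs h); [|lra].
           revert Hx. unfold Rmin, Rmax. destruct (Rle_dec s (s + h)); intros; split_Rabs; lra.
        -- replace (f (s + h) t) with (f s t + f' x t * (s + h - s)) by lra. ring.
  - replace (c * (eps / (2 * (c + 1)) * Rabs h) * / Rabs h) with (eps / 2 * (c / (c + 1))) by (field; lra).
    assert (c / (c + 1) < 1).
    { apply (Rmult_lt_reg_r (c + 1)); [lra|]. unfold Rdiv. rewrite Rmult_assoc, Rinv_l; lra. }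
    assert (0 <= c / (c + 1)) by (apply Rdiv_le_0_compat; lra). nra.
Qed.

Lemma Ib_derive_x f f' y z : UCB f -> UCB f' ->
  (forall x y z, is_derive (fun x => f x y z) x (f' x y z)) ->
  forall x, is_derive (fun x => Ib f x y z) x (Ib f' x y z).
Proof.
  intros Hf Hf' Hd x. unfold Ib. apply (leib (fun x t => f x y t) (fun x t => f' x y t)); auto.
  - generalize two_PI_pos; lra.
  - intros; now apply UCB_cont_z.
  - intros; now apply UCB_cont_z.
  - intros eps He. destruct Hf' as [H _]. destruct (H eps He) as [d [Hdp L]]. exists d; split; auto.
    intros. apply L; auto; rewrite Rminus_diag_eq, Rabs_R0; auto.
Qed.

Lemma Ib_derive_y f f' x z : UCB f -> UCB f' ->
  (forall x y z, is_derive (fun y => f x y z) y (f' x y z)) ->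
  forall y, is_derive (fun y => Ib f x y z) y (Ib f' x y z).
Proof.
  intros Hf Hf' Hd y. unfold Ib. apply (leib (fun y t => f x y t) (fun y t => f' x y t)); auto.
  - generalize two_PI_pos; lra.
  - intros; now apply UCB_cont_z.
  - intros; now apply UCB_cont_z.
  - intros eps He. destruct Hf' as [H _]. destruct (H eps He) as [d [Hdp L]]. exists d; split; auto.
    intros. apply L; auto; rewrite Rminus_diag_eq, Rabs_R0; auto.
Qed.

Lemma Ia_derive_x f f' y z : UCB f -> UCB f' ->
  (forall x y z, is_derive (fun x => f x y z) x (f' x y z)) ->
  forall x, is_derive (fun x => Ia f x y z) x (Ia f' x y z).
Proof.
  intros Hf Hf' Hd x. unfold Ia. apply (leib (fun x t => f x t z) (fun x t => f' x t z)); auto.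
  - generalize two_PI_pos; lra.
  - intros; now apply UCB_cont_y.
  - intros; now apply UCB_cont_y.
  - intros eps He. destruct Hf' as [H _]. destruct (H eps He) as [d [Hdp L]]. exists d; split; auto.
    intros. apply L; auto; rewrite Rminus_diag_eq, Rabs_R0; auto.
Qed.

Definition I3 (f : R -> R -> R -> R) : R := Ie (Ia (Ib f)).

Lemma I3_ext f g : (forall x y z, f x y z = g x y z) -> I3 f = I3 g.
Proof.
  intros E. assert (f = g) by (extensionality x; extensionality y; extensionality z; apply E). now subst.
Qed.

Lemma I3_plus f g : UCB f -> UCB g -> I3 (fun x y z => f x y z + g x y z) = I3 f + I3 g.
Proof.
  intros Hf Hg. unfold I3, Ie.
  rewrite <- RInt_add.
  2:{ intros; apply (UCB_cont_x (Ia (Ib f))). now apply UCB_Ia, UCB_Ib. }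
  2:{ intros; apply (UCB_cont_x (Ia (Ib g))). now apply UCB_Ia, UCB_Ib. }
  apply RInt_ext. intros x _. unfold Ia.
  rewrite <- RInt_add.
  2:{ intros; apply (UCB_cont_y (Ib f)). now apply UCB_Ib. }
  2:{ intros; apply (UCB_cont_y (Ib g)). now apply UCB_Ib. }
  apply RInt_ext. intros y _. unfold Ib. apply RInt_add; intros; now apply UCB_cont_z.
Qed.

Lemma I3_scal c f : UCB f -> I3 (fun x y z => c * f x y z) = c * I3 f.
Proof.
  intros Hf. unfold I3, Ie.
  rewrite <- RInt_mul.
  2:{ intros; apply (UCB_cont_x (Ia (Ib f))). now apply UCB_Ia, UCB_Ib. }
  apply RInt_ext. intros x _. unfold Ia.
  rewrite <- RInt_mul.
  2:{ intros; apply (UCB_cont_y (Ib f)). now apply UCB_Ib. }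
  apply RInt_ext. intros y _. unfold Ib. apply RInt_mul; intros; now apply UCB_cont_z.
Qed.

Lemma I3_le f g : UCB f -> UCB g -> (forall x y z, 0 <= x <= PI / 2 -> f x y z <= g x y z) -> I3 f <= I3 g.
Proof.
  intros Hf Hg H. unfold I3, Ie. assert (Hp := PI_RGT_0).
  apply RInt_le; [lra| | |].
  - apply ex_RInt_cont. intros; apply (UCB_cont_x (Ia (Ib f))). now apply UCB_Ia, UCB_Ib.
  - apply ex_RInt_cont. intros; apply (UCB_cont_x (Ia (Ib g))). now apply UCB_Ia, UCB_Ib.
  - intros x Hx. unfold Ia. apply RInt_le; [lra| | |].
    + apply ex_RInt_cont. intros; apply (UCB_cont_y (Ib f)). now apply UCB_Ib.
    + apply ex_RInt_cont. intros; apply (UCB_cont_y (Ib g)). now apply UCB_Ib.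
    + intros y Hy. unfold Ib. apply RInt_le; [lra| | |].
      * apply ex_RInt_cont. intros; now apply UCB_cont_z.
      * apply ex_RInt_cont. intros; now apply UCB_cont_z.
      * intros z Hz. apply H. lra.
Qed.

Lemma hopf_mkv x y z : hopf x y z = mkv (cos x * cos y) (cos x * sin y) (sin x * cos z) (sin x * sin z).
Proof. reflexivity. Qed.

Lemma hopf_S3 x y z : S3 (hopf x y z).
Proof.
  apply S3_nsq. rewrite hopf_mkv. unfold nsq, sum4, mkv; simpl.
  assert (E1 := sin2_cos2 x). assert (E2 := sin2_cos2 y). assert (E3 := sin2_cos2 z). unfold Rsqr in *.
  transitivity (cos x * cos x * (sin y * sin y + cos y * cos y) + sin x * sin x * (sin z * sin z + cos z * cos z)); [ring|].
  rewrite E2, E3. lra.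
Qed.

Lemma UCB_cc_hopf i : UCB (fun x y z => cc i (hopf x y z)).
Proof.
  destruct i as [|[|[|i]]]; rewrite ?hopf_mkv; unfold mkv; simpl; apply UCB_mult;
  auto using UCB_sinx, UCB_cosx, UCB_siny, UCB_cosy, UCB_sinz, UCB_cosz.
Qed.

Lemma UCB_hopf f : contS f -> UCB (fun x y z => f (hopf x y z)).
Proof.
  intros H. split.
  - intros eps He. destruct (contS_unif f H eps He) as [d [Hd K]].
    destruct (proj1 (UCB_cc_hopf 0) d Hd) as [d0 [P0 L0]].
    destruct (proj1 (UCB_cc_hopf 1) d Hd) as [d1 [P1 L1]].
    destruct (proj1 (UCB_cc_hopf 2) d Hd) as [d2 [P2 L2]].
    destruct (proj1 (UCB_cc_hopf 3) d Hd) as [d3 [P3 L3]].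
    set (m := Rmin (Rmin d0 d1) (Rmin d2 d3)).
    assert (Hm : m <= d0 /\ m <= d1 /\ m <= d2 /\ m <= d3).
    { unfold m. generalize (Rmin_l (Rmin d0 d1) (Rmin d2 d3)) (Rmin_r (Rmin d0 d1) (Rmin d2 d3))
        (Rmin_l d0 d1) (Rmin_r d0 d1) (Rmin_l d2 d3) (Rmin_r d2 d3). lra. }
    exists m. split; [unfold m; repeat apply Rmin_glb_lt; auto|].
    intros x y z x' y' z' Hx Hy Hz. apply K; try apply hopf_S3.
    intros i Hi. destruct i as [|[|[|[|i]]]]; try lia; [apply L0|apply L1|apply L2|apply L3]; lra.
  - destruct (contS_bounded f H) as [M [HM K]]. exists M; split; [lra|]. intros. apply K. apply hopf_S3.
Qed.

(** The density of theta0 /\ d theta0 in Hopf coordinates, see [volume_hopf]. *)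
Definition wgt (x : R) : R := 2 * (sin x * cos x).

Lemma UCB_wgt : UCB (fun x _ _ => wgt x).
Proof.
  apply (UCB_mult (fun _ _ _ => 2)); [apply UCB_const|].
  apply (UCB_mult (fun x _ _ => sin x)); [apply UCB_sinx|apply UCB_cosx].
Qed.

Lemma wgt_nonneg x : 0 <= x <= PI / 2 -> 0 <= wgt x.
Proof.
  intros H. unfold wgt. assert (0 <= sin x) by (apply sin_ge_0; generalize PI_RGT_0; lra).
  assert (0 <= cos x) by (apply cos_ge_0; generalize PI_RGT_0; lra). nra.
Qed.

(* Sealed, so that conversion never unfolds iterated integrals. *)
Lemma IS_sig : { F : (C2 -> R) -> R | forall f, F f = I3 (fun x y z => f (hopf x y z) * wgt x) }.
Proof. eexists. intros f. reflexivity. Qed.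

Definition IS : (C2 -> R) -> R := proj1_sig IS_sig.

Lemma IS_eq f : IS f = I3 (fun x y z => f (hopf x y z) * wgt x).
Proof. apply (proj2_sig IS_sig). Qed.

Lemma UCB_IS f : contS f -> UCB (fun x y z => f (hopf x y z) * wgt x).
Proof. intros. apply (UCB_mult (fun x y z => f (hopf x y z))); [now apply UCB_hopf|apply UCB_wgt]. Qed.

Lemma IS_ext f g : (forall p, S3 p -> f p = g p) -> IS f = IS g.
Proof. intros E. rewrite !IS_eq. apply I3_ext. intros. rewrite E; auto. apply hopf_S3. Qed.

Lemma IS_plus f g : contS f -> contS g -> IS (fun p => f p + g p) = IS f + IS g.
Proof.
  intros. rewrite !IS_eq. rewrite <- I3_plus by now apply UCB_IS. apply I3_ext. intros; ring.
Qed.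

Lemma IS_scal c f : contS f -> IS (fun p => c * f p) = c * IS f.
Proof.
  intros. rewrite !IS_eq. rewrite <- I3_scal by now apply UCB_IS. apply I3_ext. intros; ring.
Qed.

Lemma IS_minus f g : contS f -> contS g -> IS (fun p => f p - g p) = IS f - IS g.
Proof.
  intros Hf Hg. rewrite (IS_ext _ (fun p => f p + -1 * g p)) by (intros; ring).
  rewrite IS_plus; auto using contS_scal. rewrite IS_scal; auto. ring.
Qed.

Lemma IS_le f g : contS f -> contS g -> (forall p, S3 p -> f p <= g p) -> IS f <= IS g.
Proof.
  intros Hf Hg H. rewrite !IS_eq. apply I3_le; try now apply UCB_IS. intros x y z Hx.
  apply Rmult_le_compat_r; [now apply wgt_nonneg|]. apply H, hopf_S3.
Qed.

Definition Vol : R := IS (fun _ => 1).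

Lemma IS_const c : IS (fun _ => c) = c * Vol.
Proof.
  rewrite (IS_ext _ (fun p => c * 1)) by (intros; ring). apply (IS_scal c (fun _ => 1)). apply contS_const.
Qed.

Lemma Vol_pos : 0 < Vol.
Proof.
  unfold Vol. rewrite IS_eq. unfold I3, Ie. assert (Hp := PI_RGT_0).
  rewrite (RInt_ext _ (fun x => (2 * PI) * (2 * PI) * wgt x)).
  - apply RInt_gt_0; [lra| |].
    + intros x Hx. unfold wgt. assert (0 < sin x) by (apply sin_gt_0; lra).
      assert (0 < cos x) by (apply cos_gt_0; lra).
      assert (0 < sin x * cos x) by now apply Rmult_lt_0_compat. assert (0 < PI * PI) by nra. nra.
    + intros x _. apply (continuous_scal_r (V := R_NormedModule)).
      apply (UCB_cont_x (fun x _ _ => wgt x) 0 0 x UCB_wgt).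
  - intros x _. unfold Ia, Ib.
    rewrite (RInt_ext _ (fun _ => (2 * PI) * (1 * wgt x))).
    + rewrite (RInt_const (V := R_CompleteNormedModule)). unfold scal; simpl; unfold mult; simpl. ring.
    + intros y _. rewrite (RInt_const (V := R_CompleteNormedModule)). unfold scal; simpl; unfold mult; simpl. ring.
Qed.

Lemma IS_abs f M : contS f -> (forall p, S3 p -> Rabs (f p) <= M) -> Rabs (IS f) <= M * Vol.
Proof.
  intros Hf H. apply Rabs_le. split.
  - replace (- (M * Vol)) with ((- M) * Vol) by ring. rewrite <- IS_const.
    apply IS_le; auto using contS_const. intros p Hp. specialize (H p Hp).
    apply Rabs_le_between in H. lra.
  - rewrite <- IS_const. apply IS_le; auto using contS_const. intros p Hp. specialize (H p Hp).
    apply Rabs_le_between in H. lra.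
Qed.

Lemma IS_pos f m : contS f -> 0 < m -> (forall p, S3 p -> m <= f p) -> 0 < IS f.
Proof.
  intros Hf Hm H. apply Rlt_le_trans with (IS (fun _ => m)).
  - rewrite IS_const. apply Rmult_lt_0_compat; auto. apply Vol_pos.
  - apply IS_le; auto using contS_const.
Qed.

(** * Integrals depending on a parameter *)

Lemma scal_scal {V : NormedModule R_AbsRing} (x v : V) (a b : R) :
  plus x (scal a (scal b v)) = plus x (scal (a * b) v).
Proof. f_equal. exact (scal_assoc (K := R_AbsRing) a b v). Qed.

Lemma dw_scal {V : NormedModule R_AbsRing} (D : V -> Prop) f (x v : V) (k l : R) :
  is_deriv_within D f x v l -> is_deriv_within D f x (scal k v) (k * l).
Proof.
  intros H. destruct (Req_dec k 0) as [->|Hk].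
  - rewrite Rmult_0_l. apply dw_lim. apply filterlim_ext with (fun _ : R => 0); [|apply filterlim_const].
    intros h. change R in h.
    assert (E : plus x (scal h (scal (0 : R) v)) = x).
    { rewrite scal_scal, Rmult_0_r. apply plus_scal_0. }
    transitivity ((f x - f x) / h); [unfold Rdiv; ring|]. rewrite <- E at 1. reflexivity.
  - apply dw_lim. apply filterlim_R; [apply line_filter|]. intros eps He.
    assert (Hka := Rabs_pos_lt k Hk).
    assert (He' : 0 < eps / Rabs k) by now apply Rdiv_lt_0_compat.
    apply dw_lim in H.
    destruct (line_elim _ _ _ _ (flim_elim H _ He')) as [d [Hd K]].
    apply line_intro. exists (d / Rabs k). split; [now apply Rdiv_lt_0_compat|].
    intros h Hn Hh HD. rewrite scal_scal in HD |- *.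
    assert (Hhk : h * k <> 0) by (apply Rmult_integral_contrapositive_currified; auto).
    assert (Hb : Rabs (h * k) < d).
    { rewrite Rabs_mult. replace d with (d / Rabs k * Rabs k) by (field; lra). now apply Rmult_lt_compat_r. }
    specialize (K (h * k) Hhk Hb HD). cbv beta in K. set (y := f (plus x (scal (h * k) v))) in *.
    replace ((y - f x) / h - k * l) with (k * ((y - f x) / (h * k) - l)) by (field; auto).
    rewrite Rabs_mult. replace eps with (Rabs k * (eps / Rabs k)) by (field; lra).
    now apply Rmult_lt_compat_l.
Qed.

Lemma seg_MVT {V : NormedModule R_AbsRing} (E : V -> Prop) (f l : V -> R) (x v : V) :
  (forall s, 0 <= s <= 1 -> E (plus x (scal s v))) -> cont_on E f ->
  (forall y, E y -> is_deriv_within E f y v (l y)) ->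
  exists s : R, 0 <= s <= 1 /\ f (plus x v) - f x = l (plus x (scal s v)).
Proof.
  intros HE Hc Hd.
  destruct (MVT_within 0 1 (fun s : R => f (plus x (scal s v))) (fun s : R => l (plus x (scal s v)))) as [c [Hcc Eq]].
  - lra.
  - intros s Hs. intros P HP. specialize (Hc _ (HE s Hs) P HP).
    generalize (filterlim_line E x v s _ Hc). unfold filtermap, within.
    apply filter_imp. intros h H1 H2. apply H1. now apply HE.
  - intros s Hs. apply dw_is_derive with E.
    + exists (Rmin s (1 - s)). split; [apply Rmin_glb_lt; lra|]. intros h Hh. apply HE.
      generalize (Rmin_l s (1 - s)) (Rmin_r s (1 - s)). intros. apply Rabs_def2 in Hh. lra.
    + apply Hd. apply HE. lra.
  - exists c; split; auto. cbv beta in Eq. rewrite (plus_scal_0 x v) in Eq.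
    assert (E1 : plus x (scal (1 : R) v) = plus x v) by (f_equal; exact (scal_one (K := R_AbsRing) v)).
    rewrite E1 in Eq. rewrite Eq. ring.
Qed.

(** Local convexity along lines. It replaces openness in mean value arguments and also holds for [0,
    oo) and for its product with the punctured C^2. *)
Definition segm {V : NormedModule R_AbsRing} (D : V -> Prop) : Prop :=
  forall x v, D x -> exists d, 0 < d /\ forall h : R, Rabs h < d -> D (plus x (scal h v)) ->
    forall s : R, 0 <= s <= 1 -> D (plus x (scal (s * h) v)).

Lemma segm_open {V : NormedModule R_AbsRing} (D : V -> Prop) : open D -> segm D.
Proof.
  intros HO x v Dx. destruct (open_line D x v HO Dx) as [d [Hd H]]. exists d; split; auto.
  intros h Hh _ s Hs. apply H. rewrite Rabs_mult, (Rabs_pos_eq s) by lra.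
  generalize (Rabs_pos h). nra.
Qed.

Lemma locally_pair {U V : UniformSpace} (x : U * V) (P : U * V -> Prop) :
  locally x P <-> exists e, 0 < e /\ forall a b, ball (fst x) e a -> ball (snd x) e b -> P (a, b).
Proof.
  split.
  - intros [e H]. exists e; split; [apply cond_pos|]. intros a b Ha Hb. apply H. split; auto.
  - intros [e [He H]]. exists (mkposreal e He). intros [a b] [Ha Hb]. apply H; auto.
Qed.

Definition prodW (W : NormedModule R_AbsRing) : NormedModule R_AbsRing := prod_NormedModule R_AbsRing W C2.
Definition Dprod {W : NormedModule R_AbsRing} (D : W -> Prop) (z : prodW W) : Prop :=
  D (fst z) /\ snd z <> zero.

Definition mkw {W : NormedModule R_AbsRing} (w : W) (y : C2) : prodW W := (w, y).

Lemma unif_in_S3 {W : NormedModule R_AbsRing} (D : W -> Prop) (G : prodW W -> R) w :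
  cont_on (Dprod D) G -> D w -> forall eps, 0 < eps ->
  within D (locally w) (fun w' => forall y, S3 y -> Rabs (G (mkw w' y) - G (mkw w y)) < eps).
Proof.
  intros HG Dw eps He.
  apply (tube (within D (locally w)) (fun w' y => Rabs (G (mkw w' y) - G (mkw w y)) < eps)).
  intros y Hy.
  assert (Hd : Dprod D (mkw w y)) by (split; [exact Dw|now apply S3_nonzero]).
  assert (H := flim_elim (HG (mkw w y) Hd) (eps / 2) ltac:(lra)). unfold within in H.
  apply locally_pair in H. destruct H as [e [Hep H]]. simpl in H. exists e; split; auto.
  exists (mkposreal e Hep). intros w' Hw' Dw' y' Hy' Hcl.
  assert (K1 : Rabs (G (mkw w' y') - G (mkw w y)) < eps / 2).
  { apply H; auto; [now apply ball_C2|]. split; [exact Dw'|now apply S3_nonzero]. }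
  assert (K2 : Rabs (G (mkw w y') - G (mkw w y)) < eps / 2).
  { apply H; auto; [apply (ball_center _ (mkposreal e Hep))|now apply ball_C2|]. split; [exact Dw|now apply S3_nonzero]. }
  cbv beta. apply Rabs_def2 in K1. apply Rabs_def2 in K2. apply Rabs_def1; lra.
Qed.

Lemma slice_contS {W : NormedModule R_AbsRing} (D : W -> Prop) (G : prodW W -> R) w :
  cont_on (Dprod D) G -> D w -> contS (fun y => G (mkw w y)).
Proof.
  intros HG Dw p Hp eps He.
  assert (Hd : Dprod D (mkw w p)) by (split; [exact Dw|now apply S3_nonzero]).
  assert (H := flim_elim (HG (mkw w p) Hd) eps He). unfold within in H.
  apply locally_pair in H. destruct H as [e [Hep H]]. simpl in H. exists e; split; auto.
  intros q Hq Hcl. apply H; [apply (ball_center _ (mkposreal e Hep))|now apply ball_C2|].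
  split; [exact Dw|now apply S3_nonzero].
Qed.

Lemma IS_cont {W : NormedModule R_AbsRing} (D : W -> Prop) (G : prodW W -> R) :
  cont_on (Dprod D) G -> cont_on D (fun w => IS (fun y => G (mkw w y))).
Proof.
  intros HG w Dw. apply filterlim_R; [apply within_locally_filter|]. intros eps He.
  assert (HV := Vol_pos). assert (He' : 0 < eps / (2 * Vol)) by (apply Rdiv_lt_0_compat; lra).
  assert (H := unif_in_S3 D G w HG Dw _ He'). revert H. unfold within. apply filter_imp.
  intros w' H Dw'. specialize (H Dw'). rewrite <- IS_minus by now apply (slice_contS D).
  apply Rle_lt_trans with (eps / (2 * Vol) * Vol).
  - apply IS_abs; [apply contS_minus; now apply (slice_contS D)|]. intros p Hp. left. now apply H.
  - replace (eps / (2 * Vol) * Vol) with (eps / 2) by (field; lra). lra.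
Qed.

(** By [seg_MVT] the difference quotient of the integrand is [g] at an intermediate parameter, and
    [unif_in_S3] makes this close to [g] at [w] uniformly over the sphere. *)
Lemma IS_deriv {W : NormedModule R_AbsRing} (D : W -> Prop) (G g : prodW W -> R) (w v : W) :
  segm D -> D w -> cont_on (Dprod D) G -> cont_on (Dprod D) g ->
  (forall z, Dprod D z -> is_deriv_within (Dprod D) G z ((v, zero) : prodW W) (g z)) ->
  is_deriv_within D (fun w => IS (fun y => G (mkw w y))) w v (IS (fun y => g (mkw w y))).
Proof.
  intros HS Dw HG Hg Hd. apply dw_lim. apply filterlim_R; [apply line_filter|]. intros eps He.
  assert (HV := Vol_pos). assert (He' : 0 < eps / (2 * Vol)) by (apply Rdiv_lt_0_compat; lra).
  assert (H := unif_in_S3 D g w Hg Dw _ He').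
  rewrite <- (plus_scal_0 w v) in H at 1. assert (H1 := filterlim_line D w v 0 _ H).
  apply locally_R in H1. destruct H1 as [d [Hdp H1]].
  destruct (HS w v Dw) as [d' [Hd' HS']].
  apply line_intro. exists (Rmin d d'). split; [now apply Rmin_glb_lt|].
  intros h Hn Hh HD. generalize (Rmin_l d d') (Rmin_r d d'). intros Hm1 Hm2.
  set (w' := plus w (scal h v)) in *.
  assert (C1 := slice_contS D G w HG Dw). assert (C2' := slice_contS D G w' HG HD).
  assert (C3 := slice_contS D g w Hg Dw).
  assert (E : (IS (fun y => G (mkw w' y)) - IS (fun y => G (mkw w y))) / h - IS (fun y => g (mkw w y)) =
     IS (fun y => / h * (G (mkw w' y) - G (mkw w y)) - g (mkw w y))).
  { rewrite IS_minus by auto using contS_scal, contS_minus. rewrite IS_scal by auto using contS_minus.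
    rewrite IS_minus by auto. field; auto. }
  rewrite E. apply Rle_lt_trans with (eps / (2 * Vol) * Vol).
  2:{ replace (eps / (2 * Vol) * Vol) with (eps / 2) by (field; lra). lra. }
  apply IS_abs; [auto using contS_scal, contS_minus|]. intros y Hy.
  destruct (seg_MVT (Dprod D) G (fun z => h * g z) (mkw w y) (scal h ((v, zero) : prodW W))) as [s [Hs Eq]]; auto.
  - intros s Hs. split.
    + assert (Hw : D (plus w (scal (s * h) v))) by (apply HS'; auto; lra).
      rewrite <- scal_scal in Hw. exact Hw.
    + assert (Ey : snd (plus (mkw w y) (scal s (scal h ((v, zero) : prodW W)))) = y).
      { change (plus y (scal s (scal h (zero : C2))) = y).
        apply cc_ext; intros; rewrite cc_plus, !cc_scal, cc_zero; ring. }
      rewrite Ey. now apply S3_nonzero.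
  - intros z Hz. apply dw_scal. apply Hd; auto.
  - assert (Ey : plus (mkw w y) (scal h ((v, zero) : prodW W)) = (mkw w' y)).
    { change (mkw (plus w (scal h v)) (plus y (scal h (zero : C2))) = mkw w' y). f_equal.
      apply cc_ext; intros; rewrite cc_plus, cc_scal, cc_zero; ring. }
    assert (Ez : plus (mkw w y) (scal s (scal h ((v, zero) : prodW W))) = (mkw (plus w (scal (s * h) v)) y)).
    { rewrite <- scal_scal. change (mkw (plus w (scal s (scal h v))) (plus y (scal s (scal h (zero : C2)))) = mkw (plus w (scal s (scal h v))) y). f_equal.
      apply cc_ext; intros; rewrite cc_plus, !cc_scal, cc_zero; ring. }
    rewrite Ey, Ez in Eq. rewrite Eq.
    rewrite <- Rmult_assoc, Rinv_l, Rmult_1_l by auto. left. apply H1; auto.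
    + rewrite Rminus_0_r, Rabs_mult, (Rabs_pos_eq s) by lra. generalize (Rabs_pos h). nra.
    + apply HS'; auto. lra.
Qed.

(** Integrals of smooth families form a class closed under derivation, so the coinduction principle
    applies to them directly. *)
Lemma smooth_IS {W : NormedModule R_AbsRing} (D : W -> Prop) (G : prodW W -> R) :
  segm D -> smooth_on (Dprod D) G -> smooth_on D (fun w => IS (fun y => G (mkw w y))).
Proof.
  intros HS HG.
  apply (smooth_on_coind D (fun F => exists G, smooth_on (Dprod D) G /\ F = fun w => IS (fun y => G (mkw w y)))).
  - intros f [G' [H1 ->]]. apply IS_cont. now apply smooth_on_cont.
  - intros f v [G' [H1 ->]]. destruct (smooth_on_deriv _ G' ((v, zero) : prodW W) H1) as [g [Hg Hd]].
    exists (fun w => IS (fun y => g (mkw w y))). split; [now exists g|].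
    intros w Dw. apply IS_deriv; auto using smooth_on_cont.
  - now exists G.
Qed.

(** * Invariance of the integral *)

Lemma hopf_curve_x f x y z : smooth_S3 f ->
  is_derive (fun x => f (hopf x y z)) x (dirD (hopf_eta x y z) (ext f) (hopf x y z)).
Proof.
  intros Hf. apply is_derive_ext with (fun x => ext f (hopf x y z)).
  - intros t. apply ext_S3, hopf_S3.
  - apply (chain_curve cone0 (ext f) (fun x => hopf x y z)); auto; [apply cone0_open|apply cone0_nz, S3_nonzero, hopf_S3|].
    intros i Hi. destruct i as [|[|[|[|i]]]]; try lia; simpl; auto_derive; auto; ring.
Qed.

Lemma hopf_curve_y f x y z : smooth_S3 f ->
  is_derive (fun y => f (hopf x y z)) y (dirD (hopf_a x y z) (ext f) (hopf x y z)).
Proof.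
  intros Hf. apply is_derive_ext with (fun y => ext f (hopf x y z)).
  - intros t. apply ext_S3, hopf_S3.
  - apply (chain_curve cone0 (ext f) (fun y => hopf x y z)); auto; [apply cone0_open|apply cone0_nz, S3_nonzero, hopf_S3|].
    intros i Hi. destruct i as [|[|[|[|i]]]]; try lia; simpl; auto_derive; auto; ring.
Qed.

Lemma hopf_curve_z f x y z : smooth_S3 f ->
  is_derive (fun z => f (hopf x y z)) z (dirD (hopf_b x y z) (ext f) (hopf x y z)).
Proof.
  intros Hf. apply is_derive_ext with (fun z => ext f (hopf x y z)).
  - intros t. apply ext_S3, hopf_S3.
  - apply (chain_curve cone0 (ext f) (fun z => hopf x y z)); auto; [apply cone0_open|apply cone0_nz, S3_nonzero, hopf_S3|].
    intros i Hi. destruct i as [|[|[|[|i]]]]; try lia; simpl; auto_derive; auto; ring.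
Qed.

Lemma contS_dirD f i : smooth_S3 f -> contS (dirD (ev i) (ext f)).
Proof.
  intros Hf p Hp eps He.
  assert (H := smooth_on_cont _ _ (smooth_dirD cone0 (ext f) (ev i) cone0_open Hf)).
  assert (Hc : cone0 p) by (apply cone0_nz; now apply S3_nonzero).
  destruct (flim_elim (H p Hc) eps He) as [d Hd]. exists d; split; [apply cond_pos|].
  intros q Hq Hcl. apply Hd; [now apply ball_C2|]. apply cone0_nz; now apply S3_nonzero.
Qed.

Lemma UCB_dirD f (v : R -> R -> R -> C2) : smooth_S3 f -> (forall i, UCB (fun x y z => cc i (v x y z))) ->
  UCB (fun x y z => dirD (v x y z) (ext f) (hopf x y z)).
Proof.
  intros Hf Hv.
  apply UCB_ext with (fun x y z => sum4 (fun i => cc i (v x y z) * dirD (ev i) (ext f) (hopf x y z))).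
  - intros. symmetry. apply (dirD_lin cone0); auto; [apply cone0_open|apply cone0_nz, S3_nonzero, hopf_S3].
  - assert (K : forall i, UCB (fun x y z => cc i (v x y z) * dirD (ev i) (ext f) (hopf x y z))).
    { intros i. apply (UCB_mult (fun x y z => cc i (v x y z))); auto.
      apply UCB_hopf. now apply contS_dirD. }
    unfold sum4. repeat apply UCB_plus; apply K.
Qed.

Lemma UCB_opp f : UCB f -> UCB (fun x y z => - f x y z).
Proof.
  intros H. apply UCB_ext with (fun x y z => -1 * f x y z); [intros; ring|].
  apply UCB_mult; auto. apply UCB_const.
Qed.

Lemma UCB_hopf_eta i : UCB (fun x y z => cc i (hopf_eta x y z)).
Proof.
  destruct i as [|[|[|i]]]; simpl; repeat apply UCB_mult; try apply UCB_opp;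
  auto using UCB_sinx, UCB_cosx, UCB_siny, UCB_cosy, UCB_sinz, UCB_cosz.
Qed.

Lemma UCB_hopf_a i : UCB (fun x y z => cc i (hopf_a x y z)).
Proof.
  destruct i as [|[|[|i]]]; simpl; try apply UCB_const; try apply UCB_opp; repeat apply UCB_mult;
  auto using UCB_sinx, UCB_cosx, UCB_siny, UCB_cosy, UCB_sinz, UCB_cosz.
Qed.

Lemma UCB_hopf_b i : UCB (fun x y z => cc i (hopf_b x y z)).
Proof.
  destruct i as [|[|[|i]]]; simpl; try apply UCB_const; try apply UCB_opp; repeat apply UCB_mult;
  auto using UCB_sinx, UCB_cosx, UCB_siny, UCB_cosy, UCB_sinz, UCB_cosz.
Qed.

Lemma RInt_deriv (F dF : R -> R) (a b : R) : (forall x, is_derive F x (dF x)) -> (forall x, continuous dF x) ->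
  RInt dF a b = F b - F a.
Proof.
  intros H1 H2. apply is_RInt_unique. apply (is_RInt_derive (V := R_CompleteNormedModule)); auto.
Qed.

Lemma RInt_zero (f : R -> R) a b : (forall x, f x = 0) -> RInt f a b = 0.
Proof.
  intros H. rewrite (RInt_ext _ (fun _ => 0)) by (intros; apply H).
  rewrite (RInt_const (V := R_CompleteNormedModule)). apply (scal_zero_r (K := R_AbsRing) (V := R_NormedModule)).
Qed.

Lemma I3_dz F dF : UCB F -> UCB dF -> (forall x y z, is_derive (fun z => F x y z) z (dF x y z)) ->
  (forall x y, F x y (2 * PI) = F x y 0) -> I3 dF = 0.
Proof.
  intros HF HdF Hd Hp. unfold I3, Ie. apply RInt_zero; intros x. unfold Ia. apply RInt_zero. intros y.
  unfold Ib. rewrite (RInt_deriv (fun z => F x y z)); auto.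
  - rewrite Hp. ring.
  - intros; now apply UCB_cont_z.
Qed.

Lemma I3_dy F dF : UCB F -> UCB dF -> (forall x y z, is_derive (fun y => F x y z) y (dF x y z)) ->
  (forall x z, F x (2 * PI) z = F x 0 z) -> I3 dF = 0.
Proof.
  intros HF HdF Hd Hp. unfold I3, Ie. apply RInt_zero; intros x. unfold Ia.
  rewrite (RInt_deriv (fun y => Ib F x y 0)).
  - unfold Ib. rewrite (RInt_ext (fun z => F x (2 * PI) z) (fun z => F x 0 z)) by auto. ring.
  - intros y. now apply (Ib_derive_y F dF).
  - intros; apply (UCB_cont_y (Ib dF)). now apply UCB_Ib.
Qed.

Lemma I3_dx F dF : UCB F -> UCB dF -> (forall x y z, is_derive (fun x => F x y z) x (dF x y z)) ->
  (forall y z, F (PI / 2) y z = 0) -> (forall y z, F 0 y z = 0) -> I3 dF = 0.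
Proof.
  intros HF HdF Hd H1 H2. unfold I3, Ie.
  rewrite (RInt_deriv (fun x => Ia (Ib F) x 0 0)).
  - unfold Ia, Ib. rewrite !(RInt_zero (fun y => RInt _ _ _)); [ring| |];
    intros y; apply RInt_zero; auto.
  - intros x. apply (Ia_derive_x (Ib F) (Ib dF)); try now apply UCB_Ib.
    intros; now apply (Ib_derive_x F dF).
  - intros; apply (UCB_cont_x (Ia (Ib dF))). now apply UCB_Ia, UCB_Ib.
Qed.

Lemma hopf_per_y x z : hopf x (2 * PI) z = hopf x 0 z.
Proof. rewrite !hopf_mkv, cos_2PI, sin_2PI, cos_0, sin_0. reflexivity. Qed.
Lemma hopf_per_z x y : hopf x y (2 * PI) = hopf x y 0.
Proof. rewrite !hopf_mkv, cos_2PI, sin_2PI, cos_0, sin_0. reflexivity. Qed.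

(* The field [B] multiplied by the density [wgt] is written in Hopf coordinates
   with coefficients (a, b, c) of vanishing divergence. *)
Lemma IS_div (B : C2 -> C2) (a b c da db dc : R -> R -> R -> R) f :
  smooth_S3 f -> UCB a -> UCB b -> UCB c -> UCB da -> UCB db -> UCB dc ->
  (forall x y z, is_derive (fun x => a x y z) x (da x y z)) ->
  (forall x y z, is_derive (fun y => b x y z) y (db x y z)) ->
  (forall x y z, is_derive (fun z => c x y z) z (dc x y z)) ->
  (forall x y z, da x y z + db x y z + dc x y z = 0) ->
  (forall y z, a (PI / 2) y z = 0) -> (forall y z, a 0 y z = 0) ->
  (forall x z, b x (2 * PI) z = b x 0 z) -> (forall x y, c x y (2 * PI) = c x y 0) ->
  (forall x y z i, (i < 4)%nat -> wgt x * cc i (B (hopf x y z)) =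
     a x y z * cc i (hopf_eta x y z) + b x y z * cc i (hopf_a x y z) + c x y z * cc i (hopf_b x y z)) ->
  IS (Dv B f) = 0.
Proof.
  intros Hf Ha Hb Hc Hda Hdb Hdc Da Db Dc Hdiv a1 a0 bp cp HB.
  set (F := fun x y z => f (hopf x y z)).
  set (Fx := fun x y z => dirD (hopf_eta x y z) (ext f) (hopf x y z)).
  set (Fy := fun x y z => dirD (hopf_a x y z) (ext f) (hopf x y z)).
  set (Fz := fun x y z => dirD (hopf_b x y z) (ext f) (hopf x y z)).
  assert (UF : UCB F) by (apply UCB_hopf, smooth_contS, Hf).
  assert (UFx : UCB Fx) by (apply UCB_dirD; auto using UCB_hopf_eta).
  assert (UFy : UCB Fy) by (apply UCB_dirD; auto using UCB_hopf_a).
  assert (UFz : UCB Fz) by (apply UCB_dirD; auto using UCB_hopf_b).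
  rewrite IS_eq.
  rewrite (I3_ext _ (fun x y z => (da x y z * F x y z + a x y z * Fx x y z)
     + ((db x y z * F x y z + b x y z * Fy x y z) + (dc x y z * F x y z + c x y z * Fz x y z)))).
  - set (T1 := fun x y z => da x y z * F x y z + a x y z * Fx x y z).
    set (T2 := fun x y z => db x y z * F x y z + b x y z * Fy x y z).
    set (T3 := fun x y z => dc x y z * F x y z + c x y z * Fz x y z).
    assert (U1 : UCB T1) by (apply UCB_plus; now apply UCB_mult).
    assert (U2 : UCB T2) by (apply UCB_plus; now apply UCB_mult).
    assert (U3 : UCB T3) by (apply UCB_plus; now apply UCB_mult).
    transitivity (I3 T1 + (I3 T2 + I3 T3)).
    { rewrite <- (I3_plus T2 T3), <- I3_plus; auto. now apply UCB_plus. }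
    rewrite (I3_dx (fun x y z => a x y z * F x y z) T1); auto using UCB_mult.
    2:{ intros x y z. apply (is_derive_mult (fun x => a x y z) (fun x => F x y z)); auto; [now apply hopf_curve_x|]. intros; apply Rmult_comm. }
    2:{ intros. rewrite a1. ring. }
    2:{ intros. rewrite a0. ring. }
    rewrite (I3_dy (fun x y z => b x y z * F x y z) T2); auto using UCB_mult.
    2:{ intros x y z. apply (is_derive_mult (fun y => b x y z) (fun y => F x y z)); auto; [now apply hopf_curve_y|]. intros; apply Rmult_comm. }
    2:{ intros. unfold F. now rewrite bp, hopf_per_y. }
    rewrite (I3_dz (fun x y z => c x y z * F x y z) T3); auto using UCB_mult.
    2:{ intros x y z. apply (is_derive_mult (fun z => c x y z) (fun z => F x y z)); auto; [now apply hopf_curve_z|]. intros; apply Rmult_comm. }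
    2:{ intros. unfold F. now rewrite cp, hopf_per_z. }
    ring.
  - intros x y z. unfold Dv.
    assert (Hc0 : cone0 (hopf x y z)) by (apply cone0_nz, S3_nonzero, hopf_S3).
    transitivity (a x y z * Fx x y z + b x y z * Fy x y z + c x y z * Fz x y z).
    + unfold Fx, Fy, Fz. rewrite !(dirD_lin cone0 (ext f) (hopf x y z)) by (auto; apply cone0_open).
      rewrite Rmult_comm.
      transitivity (sum4 (fun i => (wgt x * cc i (B (hopf x y z))) * dirD (ev i) (ext f) (hopf x y z))); [unfold sum4; ring|].
      unfold sum4. rewrite !HB by lia. ring.
    + replace (da x y z) with (- db x y z - dc x y z) by (specialize (Hdiv x y z); lra). ring.
Qed.

Ltac ucb_auto := repeat first [apply UCB_opp | apply UCB_plus | apply UCB_mult | apply UCB_const];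
  auto using UCB_sinx, UCB_cosx, UCB_siny, UCB_cosy, UCB_sinz, UCB_cosz, UCB_const.

Lemma IS_fieldT f : smooth_S3 f -> IS (Dv fieldT f) = 0.
Proof.
  intros Hf. apply (IS_div fieldT (fun _ _ _ => 0) (fun x _ _ => 2 * (sin x * cos x)) (fun x _ _ => 2 * (sin x * cos x))
    (fun _ _ _ => 0) (fun _ _ _ => 0) (fun _ _ _ => 0)); auto; try (ucb_auto; fail).
  - intros; auto_derive; auto.
  - intros; auto_derive; auto.
  - intros; auto_derive; auto.
  - intros; ring.
  - intros x y z i Hi. unfold wgt. rewrite hopf_mkv. destruct i as [|[|[|[|i]]]]; try lia; simpl; ring.
Qed.

Lemma IS_rot1 f : smooth_S3 f -> IS (Dv rot1 f) = 0.
Proof.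
  intros Hf. apply (IS_div rot1 (fun _ _ _ => 0) (fun x _ _ => 2 * (sin x * cos x)) (fun x _ _ => - (2 * (sin x * cos x)))
    (fun _ _ _ => 0) (fun _ _ _ => 0) (fun _ _ _ => 0)); auto; try (ucb_auto; fail).
  - intros; auto_derive; auto.
  - intros; auto_derive; auto.
  - intros; auto_derive; auto.
  - intros; ring.
  - intros x y z i Hi. unfold wgt. rewrite hopf_mkv. destruct i as [|[|[|[|i]]]]; try lia; simpl; ring.
Qed.

(** With d = y - z this rotation has the components cos d, tan x sin d and cot x sin d along
    [hopf_eta], [hopf_a] and [hopf_b]; the density 2 sin x cos x clears the poles. [rot3] is the
    same with the phase of d shifted. *)
Lemma IS_rot2 f : smooth_S3 f -> IS (Dv rot2 f) = 0.
Proof.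
  intros Hf. apply (IS_div rot2
    (fun x y z => 2 * (sin x * cos x) * (cos z * cos y + sin z * sin y))
    (fun x y z => 2 * (sin x * sin x) * (cos z * sin y + - (sin z * cos y)))
    (fun x y z => 2 * (cos x * cos x) * (cos z * sin y + - (sin z * cos y)))
    (fun x y z => 2 * (cos x * cos x + - (sin x * sin x)) * (cos z * cos y + sin z * sin y))
    (fun x y z => 2 * (sin x * sin x) * (cos z * cos y + sin z * sin y))
    (fun x y z => - (2 * (cos x * cos x) * (cos z * cos y + sin z * sin y)))); auto; try (ucb_auto; fail).
  - intros; auto_derive; auto; ring.
  - intros; auto_derive; auto; ring.
  - intros; auto_derive; auto; ring.
  - intros; ring.
  - intros; rewrite cos_PI2; ring.
  - intros; rewrite sin_0; ring.
  - intros; rewrite cos_2PI, sin_2PI, cos_0, sin_0; ring.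
  - intros; rewrite cos_2PI, sin_2PI, cos_0, sin_0; ring.
  - intros x y z i Hi. unfold wgt. rewrite hopf_mkv.
    assert (E2 := sin2_cos2 y). assert (E3 := sin2_cos2 z). unfold Rsqr in *.
    assert (E2' : sin y * sin y = 1 - cos y * cos y) by lra.
    assert (E3' : sin z * sin z = 1 - cos z * cos z) by lra.
    destruct i as [|[|[|[|i]]]]; try lia; simpl; ring [E2' E3'].
Qed.

Lemma IS_rot3 f : smooth_S3 f -> IS (Dv rot3 f) = 0.
Proof.
  intros Hf. apply (IS_div rot3
    (fun x y z => 2 * (sin x * cos x) * (sin z * cos y + - (cos z * sin y)))
    (fun x y z => 2 * (sin x * sin x) * (cos z * cos y + sin z * sin y))
    (fun x y z => 2 * (cos x * cos x) * (cos z * cos y + sin z * sin y))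
    (fun x y z => 2 * (cos x * cos x + - (sin x * sin x)) * (sin z * cos y + - (cos z * sin y)))
    (fun x y z => 2 * (sin x * sin x) * (sin z * cos y + - (cos z * sin y)))
    (fun x y z => - (2 * (cos x * cos x) * (sin z * cos y + - (cos z * sin y))))); auto; try (ucb_auto; fail).
  - intros; auto_derive; auto; ring.
  - intros; auto_derive; auto; ring.
  - intros; auto_derive; auto; ring.
  - intros; ring.
  - intros; rewrite cos_PI2; ring.
  - intros; rewrite sin_0; ring.
  - intros; rewrite cos_2PI, sin_2PI, cos_0, sin_0; ring.
  - intros; rewrite cos_2PI, sin_2PI, cos_0, sin_0; ring.
  - intros x y z i Hi. unfold wgt. rewrite hopf_mkv.
    assert (E2 := sin2_cos2 y). assert (E3 := sin2_cos2 z). unfold Rsqr in *.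
    assert (E2' : sin y * sin y = 1 - cos y * cos y) by lra.
    assert (E3' : sin z * sin z = 1 - cos z * cos z) by lra.
    destruct i as [|[|[|[|i]]]]; try lia; simpl; ring [E2' E3'].
Qed.

Lemma Dv_mult A f g p : lin A -> smooth_S3 f -> smooth_S3 g -> S3 p ->
  Dv A (fun q => f q * g q) p = Dv A f p * g p + f p * Dv A g p.
Proof.
  intros HA Hf Hg Hp. unfold Dv.
  assert (E := dirD_mult cone0 (ext f) (ext g) p (A p) cone0_open Hf Hg (proj2 (cone0_nz p) (S3_nonzero p Hp))).
  rewrite !ext_S3 in E by auto. exact E.
Qed.

Lemma Dv_plus A f g p : lin A -> smooth_S3 f -> smooth_S3 g -> S3 p ->
  Dv A (fun q => f q + g q) p = Dv A f p + Dv A g p.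
Proof.
  intros HA Hf Hg Hp. unfold Dv.
  apply (dirD_plus cone0 (ext f) (ext g) p (A p) cone0_open Hf Hg (proj2 (cone0_nz p) (S3_nonzero p Hp))).
Qed.

Lemma Dv_const A (c : R) p : Dv A (fun _ => c) p = 0.
Proof. exact (dirD_const c p (A p)). Qed.

Lemma Dv_scal A (c : R) f p : lin A -> smooth_S3 f -> S3 p ->
  Dv A (fun q => c * f q) p = c * Dv A f p.
Proof.
  intros HA Hf Hp. rewrite Dv_mult; auto; [|apply smooth_const]. rewrite Dv_const. ring.
Qed.

Lemma IS_parts A f g : lin A -> (forall h, smooth_S3 h -> IS (Dv A h) = 0) -> smooth_S3 f -> smooth_S3 g ->
  IS (fun p => f p * Dv A g p) = - IS (fun p => Dv A f p * g p).
Proof.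
  intros HA H Hf Hg.
  assert (Hfg : smooth_S3 (fun q => f q * g q)) by now apply smooth_mult.
  assert (S1 := smooth_S3_Dv A f HA Hf). assert (S2 := smooth_S3_Dv A g HA Hg).
  assert (E := H _ Hfg).
  rewrite (IS_ext _ (fun p => Dv A f p * g p + f p * Dv A g p)) in E by (intros; now apply Dv_mult).
  rewrite IS_plus in E by (apply contS_mult; now apply smooth_contS). lra.
Qed.

(** * Zonal kernels *)

(* Arrays indexed by (p, q) stand for formal power series in a, b; [sa], [sb]
   are the multiplications by a and b and [Dop u v] is the multiplication by
   1 - u a - v b + a b. *)
Definition arr := nat -> nat -> C.
Definition sa (x : arr) : arr := fun p q => match p with O => RtoC 0 | S p' => x p' q end.
Definition sb (x : arr) : arr := fun p q => match q with O => RtoC 0 | S q' => x p q' end.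
Definition Dop (u v : C) (x : arr) : arr := fun p q =>
  (x p q - u * sa x p q - v * sb x p q + sa (sb x) p q)%C.

(** The power series f / (1 - u a - v b + a b), computed coefficient by coefficient from the
    equation [Dop u v y = f]. *)
Fixpoint sol (u v : C) (f : arr) (p : nat) : nat -> C :=
  match p with
  | O => fix r (q : nat) : C :=
      match q with O => f O O | S q' => (f O (S q') + v * r q')%C end
  | S p' => fix r (q : nat) : C :=
      match q with
      | O => (f (S p') O + u * sol u v f p' O)%C
      | S q' => (f (S p') (S q') + u * sol u v f p' (S q') + v * r q' - sol u v f p' q')%C
      end
  end.

Lemma sol_00 u v f : sol u v f 0 0 = f 0%nat 0%nat.
Proof. reflexivity. Qed.
Lemma sol_0S u v f q : sol u v f 0 (S q) = (f 0%nat (S q) + v * sol u v f 0 q)%C.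
Proof. reflexivity. Qed.
Lemma sol_S0 u v f p : sol u v f (S p) 0 = (f (S p) 0%nat + u * sol u v f p 0)%C.
Proof. reflexivity. Qed.
Lemma sol_SS u v f p q : sol u v f (S p) (S q) =
  (f (S p) (S q) + u * sol u v f p (S q) + v * sol u v f (S p) q - sol u v f p q)%C.
Proof. reflexivity. Qed.

Lemma Dop_sol u v f p q : Dop u v (sol u v f) p q = f p q.
Proof.
  unfold Dop, sa, sb. destruct p as [|p]; destruct q as [|q].
  - rewrite sol_00. ring.
  - rewrite sol_0S. ring.
  - rewrite sol_S0. ring.
  - rewrite sol_SS. ring.
Qed.

Lemma Dop_inj u v x y : (forall p q, Dop u v x p q = Dop u v y p q) -> forall p q, x p q = y p q.
Proof.
  intros H. induction p as [|p IHp].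
  - induction q as [|q IHq].
    + specialize (H 0%nat 0%nat). unfold Dop, sa, sb in H.
      replace (x 0%nat 0%nat) with (x 0%nat 0%nat - u * RtoC 0 - v * RtoC 0 + RtoC 0)%C by ring. rewrite H. ring.
    + specialize (H 0%nat (S q)). unfold Dop, sa, sb in H. rewrite IHq in H.
      replace (x 0%nat (S q)) with ((x 0%nat (S q) - u * RtoC 0 - v * y 0%nat q + RtoC 0) + v * y 0%nat q)%C by ring. rewrite H. ring.
  - induction q as [|q IHq].
    + specialize (H (S p) 0%nat). unfold Dop, sa, sb in H. rewrite IHp in H.
      replace (x (S p) 0%nat) with ((x (S p) 0%nat - u * y p 0%nat - v * RtoC 0 + RtoC 0) + u * y p 0%nat)%C by ring. rewrite H. ring.
    + specialize (H (S p) (S q)). unfold Dop, sa, sb in H. rewrite IHq, !IHp in H.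
      replace (x (S p) (S q)) with ((x (S p) (S q) - u * y p (S q) - v * y (S p) q + y p q) + u * y p (S q) + v * y (S p) q - y p q)%C by ring.
      rewrite H. ring.
Qed.

Ltac arrs := intros p q; unfold Dop, sa, sb; destruct p as [|[|p]]; destruct q as [|[|q]]; try ring.

Lemma Dop_sa u v x : forall p q, Dop u v (sa x) p q = sa (Dop u v x) p q.
Proof. arrs. Qed.
Lemma Dop_sb u v x : forall p q, Dop u v (sb x) p q = sb (Dop u v x) p q.
Proof. arrs. Qed.

Definition numC (n : nat) : C := RtoC (INR n).
Lemma numC_S n : numC (S n) = (numC n + 1)%C.
Proof. unfold numC. rewrite S_INR, RtoC_plus. reflexivity. Qed.
Lemma numC_0 : numC 0 = RtoC 0.
Proof. reflexivity. Qed.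

(** Multiplying the (p, q) entry by p is the Euler operator a d/da. The correction is its action on
    the denominator: a d/da (1 - u a - v b + a b) = - u a + a b. *)
Lemma Dop_Na u v x : forall p q, Dop u v (fun p q => (numC p * x p q)%C) p q =
  (numC p * Dop u v x p q + u * sa x p q - sa (sb x) p q)%C.
Proof. arrs; rewrite ?numC_S, ?numC_0; ring. Qed.
Lemma Dop_Nb u v x : forall p q, Dop u v (fun p q => (numC q * x p q)%C) p q =
  (numC q * Dop u v x p q + v * sb x p q - sa (sb x) p q)%C.
Proof. arrs; rewrite ?numC_S, ?numC_0; ring. Qed.

Definition delta : arr := fun p q => match p, q with O, O => RtoC 1 | _, _ => RtoC 0 end.
(** With D = 1 - u a - v b + a b, the arrays [K1], [K2], [K3] are the coefficients of 1/D, 1/D^2,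
    1/D^3. *)
Definition K1 (u v : C) : arr := sol u v delta.
Definition K2 (u v : C) : arr := sol u v (K1 u v).
Definition K3 (u v : C) : arr := sol u v (K2 u v).

Lemma Dop_K1 u v p q : Dop u v (K1 u v) p q = delta p q. Proof. apply Dop_sol. Qed.
Lemma Dop_K2 u v p q : Dop u v (K2 u v) p q = K1 u v p q. Proof. apply Dop_sol. Qed.
Lemma Dop_K3 u v p q : Dop u v (K3 u v) p q = K2 u v p q. Proof. apply Dop_sol. Qed.

Lemma arr_ext (x y : arr) : (forall p q, x p q = y p q) -> x = y.
Proof. intros H. extensionality p; extensionality q; apply H. Qed.

Lemma Dop_minus u v x y p q : Dop u v (fun p q => (x p q - y p q)%C) p q = (Dop u v x p q - Dop u v y p q)%C.
Proof. revert p q. arrs. Qed.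
Lemma Dop_plus u v x y p q : Dop u v (fun p q => (x p q + y p q)%C) p q = (Dop u v x p q + Dop u v y p q)%C.
Proof. revert p q. arrs. Qed.
Lemma Dop_scal u v c x p q : Dop u v (fun p q => (c * x p q)%C) p q = (c * Dop u v x p q)%C.
Proof. revert p q. arrs. Qed.

Lemma DopK2_eq u v : Dop u v (K2 u v) = K1 u v. Proof. apply arr_ext, Dop_K2. Qed.
Lemma DopK3_eq u v : Dop u v (K3 u v) = K2 u v. Proof. apply arr_ext, Dop_K3. Qed.
Lemma Dop_sasb u v x : Dop u v (sa (sb x)) = sa (sb (Dop u v x)).
Proof.
  apply arr_ext. intros p q. rewrite Dop_sa. f_equal. apply arr_ext. intros. now rewrite Dop_sb.
Qed.

(** This is a d/da (1/D) = (u a - a b) / D^2, read on coefficients. *)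
Lemma Na_K1 u v p q : (numC p * K1 u v p q)%C = (u * sa (K2 u v) p q - sa (sb (K2 u v)) p q)%C.
Proof.
  revert p q. apply (Dop_inj u v). intros p q. rewrite Dop_Na, Dop_K1.
  rewrite Dop_minus, Dop_scal, Dop_sa, Dop_sasb, DopK2_eq.
  destruct p as [|p]; destruct q as [|q]; simpl delta; rewrite ?numC_0; ring.
Qed.

Lemma Nb_K1 u v p q : (numC q * K1 u v p q)%C = (v * sb (K2 u v) p q - sa (sb (K2 u v)) p q)%C.
Proof.
  revert p q. apply (Dop_inj u v). intros p q. rewrite Dop_Nb, Dop_K1.
  rewrite Dop_minus, Dop_scal, Dop_sb, Dop_sasb, DopK2_eq.
  destruct p as [|p]; destruct q as [|q]; simpl delta; rewrite ?numC_0; ring.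
Qed.

Lemma Nb_K2 u v p q : (numC q * K2 u v p q)%C = (2 * (v * sb (K3 u v) p q - sa (sb (K3 u v)) p q))%C.
Proof.
  revert p q. apply (Dop_inj u v). intros p q. rewrite Dop_Nb, Dop_K2, Nb_K1.
  rewrite Dop_scal, Dop_minus, Dop_scal, Dop_sb, Dop_sasb, DopK3_eq. ring.
Qed.

(* At u = <x,y>, v = conj u this gives the eigenvalue of X^2 + Y^2 on the kernel [K1]. *)
Lemma K1_laplace u v p q :
  (u * sa (K2 u v) p q + v * sb (K2 u v) p q - 4 * (1 - u * v) * sa (sb (K3 u v)) p q)%C =
  ((2 * numC p * numC q + numC p + numC q) * K1 u v p q)%C.
Proof.
  replace ((2 * numC p * numC q + numC p + numC q) * K1 u v p q)%C
    with (2 * (numC q * (numC p * K1 u v p q)) + numC p * K1 u v p q + numC q * K1 u v p q)%C by ring.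
  rewrite Na_K1, Nb_K1.
  (* The operator b d/db applied to (u a - a b) / D^2, simplified by (u - b) (v - a) = D - (1 - u
     v). *)
  assert (E : (numC q * (u * sa (K2 u v) p q - sa (sb (K2 u v)) p q))%C =
     (sa (sb (K2 u v)) p q - 2 * (1 - u * v) * sa (sb (K3 u v)) p q)%C).
  { assert (E3 := fun p q => Dop_K3 u v p q). unfold Dop in E3.
    assert (N := fun p q => Nb_K2 u v p q).
    destruct p as [|p]; destruct q as [|q]; simpl sa; simpl sb; rewrite ?numC_0; try ring.
    rewrite numC_S. specialize (E3 p q).
    replace ((numC q + 1) * (u * K2 u v p (S q) - K2 u v p q))%C with
      (u * (numC (S q) * K2 u v p (S q)) - numC q * K2 u v p q - K2 u v p q)%C by (rewrite numC_S; ring).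
    rewrite !N, <- !E3. simpl sb.
    destruct p as [|p]; destruct q as [|q]; simpl sa; simpl sb; ring. }
  rewrite E. ring.
Qed.

Definition Cder (f : R -> C) (s : R) (l : C) : Prop :=
  is_derive (fun t => Re (f t)) s (Re l) /\ is_derive (fun t => Im (f t)) s (Im l).

Lemma Cder_const c s : Cder (fun _ => c) s (RtoC 0).
Proof. split; apply (is_derive_const (K := R_AbsRing) (V := R_NormedModule)). Qed.

Lemma Cder_plus f g s a b : Cder f s a -> Cder g s b -> Cder (fun t => (f t + g t)%C) s (a + b)%C.
Proof.
  intros [H1 H2] [H3 H4]. split.
  - apply (is_derive_plus (K := R_AbsRing) (V := R_NormedModule) _ _ _ _ _ H1 H3).
  - apply (is_derive_plus (K := R_AbsRing) (V := R_NormedModule) _ _ _ _ _ H2 H4).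
Qed.

Lemma Cder_mult f g s a b : Cder f s a -> Cder g s b -> Cder (fun t => (f t * g t)%C) s (a * g s + f s * b)%C.
Proof.
  assert (P : forall f1 f2 a1 a2, is_derive f1 s a1 -> is_derive f2 s a2 -> is_derive (fun t => f1 t * f2 t) s (a1 * f2 s + f1 s * a2)).
  { intros. apply (is_derive_mult f1 f2); auto. intros; apply Rmult_comm. }
  intros [H1 H2] [H3 H4]. split.
  - apply is_derive_ext with (fun t => Re (f t) * Re (g t) - Im (f t) * Im (g t)); [reflexivity|].
    replace (Re (a * g s + f s * b)) with ((Re a * Re (g s) + Re (f s) * Re b) - (Im a * Im (g s) + Im (f s) * Im b)) by (simpl; unfold Re, Im; ring).
    apply (is_derive_minus (K := R_AbsRing) (V := R_NormedModule)); apply P; auto.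
  - apply is_derive_ext with (fun t => Re (f t) * Im (g t) + Im (f t) * Re (g t)); [reflexivity|].
    replace (Im (a * g s + f s * b)) with ((Re a * Im (g s) + Re (f s) * Im b) + (Im a * Re (g s) + Im (f s) * Re b)) by (simpl; unfold Re, Im; ring).
    apply (is_derive_plus (K := R_AbsRing) (V := R_NormedModule)); apply P; auto.
Qed.

Lemma Cder_val f s a b : Cder f s a -> a = b -> Cder f s b.
Proof. now intros H <-. Qed.

Lemma Cder_scal c f s a : Cder f s a -> Cder (fun t => (c * f t)%C) s (c * a)%C.
Proof.
  intros H. eapply Cder_val; [apply (Cder_mult (fun _ => c)); [apply Cder_const|exact H]|]. ring.
Qed.

Lemma Cder_opp f s a : Cder f s a -> Cder (fun t => (- f t)%C) s (- a)%C.
Proof.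
  intros [H1 H2]. split; [apply (is_derive_opp (K := R_AbsRing) (V := R_NormedModule) _ _ _ H1)
  |apply (is_derive_opp (K := R_AbsRing) (V := R_NormedModule) _ _ _ H2)].
Qed.

Lemma Cder_minus f g s a b : Cder f s a -> Cder g s b -> Cder (fun t => (f t - g t)%C) s (a - b)%C.
Proof. intros. apply Cder_plus; auto. now apply Cder_opp. Qed.

Lemma Cder_conj f s a : Cder f s a -> Cder (fun t => Cconj (f t)) s (Cconj a).
Proof.
  intros [H1 H2]. split; [exact H1|]. apply (is_derive_opp (K := R_AbsRing) (V := R_NormedModule) _ _ _ H2).
Qed.

(** Differentiating D y = f gives D y' = f' + (du a + dv b) y. The entries of y are built by a
    polynomial recursion, so the array g that solves this equation is the derivative, entry by
    entry. *)
Lemma Cder_sol (u v : R -> C) (f : R -> arr) (f' g : arr) s du dv :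
  Cder u s du -> Cder v s dv -> (forall p q, Cder (fun t => f t p q) s (f' p q)) ->
  (forall p q, Dop (u s) (v s) g p q =
     (f' p q + du * sa (sol (u s) (v s) (f s)) p q + dv * sb (sol (u s) (v s) (f s)) p q)%C) ->
  forall p q, Cder (fun t => sol (u t) (v t) (f t) p q) s (g p q).
Proof.
  intros Hu Hv Hf Hg. unfold Dop in Hg. set (y := sol (u s) (v s) (f s)) in *.
  induction p as [|p IHp].
  - induction q as [|q IHq].
    + eapply Cder_val; [apply Hf|]. specialize (Hg 0%nat 0%nat). simpl in Hg.
      replace (g 0%nat 0%nat) with (g 0%nat 0%nat - u s * RtoC 0 - v s * RtoC 0 + RtoC 0)%C by ring. rewrite Hg. ring.
    + eapply Cder_val; [exact (Cder_plus _ _ _ _ _ (Hf 0%nat (S q)) (Cder_mult _ _ _ _ _ Hv IHq))|].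
      specialize (Hg 0%nat (S q)). simpl sa in Hg. simpl sb in Hg.
      replace (g 0%nat (S q)) with ((g 0%nat (S q) - u s * RtoC 0 - v s * g 0%nat q + RtoC 0) + v s * g 0%nat q)%C by ring. rewrite Hg.
      change (sol (u s) (v s) (f s) 0 q) with (y 0%nat q). ring.
  - induction q as [|q IHq].
    + eapply Cder_val; [exact (Cder_plus _ _ _ _ _ (Hf (S p) 0%nat) (Cder_mult _ _ _ _ _ Hu (IHp 0%nat)))|].
      specialize (Hg (S p) 0%nat). simpl sa in Hg. simpl sb in Hg.
      replace (g (S p) 0%nat) with ((g (S p) 0%nat - u s * g p 0%nat - v s * RtoC 0 + RtoC 0) + u s * g p 0%nat)%C by ring. rewrite Hg.
      change (sol (u s) (v s) (f s) p 0) with (y p 0%nat). ring.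
    + eapply Cder_val; [exact (Cder_minus _ _ _ _ _ (Cder_plus _ _ _ _ _ (Cder_plus _ _ _ _ _ (Hf (S p) (S q))
        (Cder_mult _ _ _ _ _ Hu (IHp (S q)))) (Cder_mult _ _ _ _ _ Hv IHq)) (IHp q))|].
      specialize (Hg (S p) (S q)). simpl sa in Hg. simpl sb in Hg.
      replace (g (S p) (S q)) with ((g (S p) (S q) - u s * g p (S q) - v s * g (S p) q + g p q) + u s * g p (S q) + v s * g (S p) q - g p q)%C by ring.
      rewrite Hg. change (sol (u s) (v s) (f s) p (S q)) with (y p (S q)). change (sol (u s) (v s) (f s) (S p) q) with (y (S p) q). ring.
Qed.

Lemma Cder_K1 (u v : R -> C) s du dv p q : Cder u s du -> Cder v s dv ->
  Cder (fun t => K1 (u t) (v t) p q) s (du * sa (K2 (u s) (v s)) p q + dv * sb (K2 (u s) (v s)) p q)%C.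
Proof.
  intros Hu Hv. revert p q.
  apply (Cder_sol u v (fun _ => delta) (fun _ _ => RtoC 0)
     (fun p q => (du * sa (K2 (u s) (v s)) p q + dv * sb (K2 (u s) (v s)) p q)%C) s du dv); auto.
  - intros; apply Cder_const.
  - intros. rewrite Dop_plus, !Dop_scal, Dop_sa, Dop_sb, DopK2_eq. change (sol (u s) (v s) delta) with (K1 (u s) (v s)). ring.
Qed.

Lemma Cder_K2 (u v : R -> C) s du dv p q : Cder u s du -> Cder v s dv ->
  Cder (fun t => K2 (u t) (v t) p q) s (2 * (du * sa (K3 (u s) (v s)) p q + dv * sb (K3 (u s) (v s)) p q))%C.
Proof.
  intros Hu Hv. revert p q.
  apply (Cder_sol u v (fun t => K1 (u t) (v t)) (fun p q => (du * sa (K2 (u s) (v s)) p q + dv * sb (K2 (u s) (v s)) p q)%C)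
     (fun p q => (2 * (du * sa (K3 (u s) (v s)) p q + dv * sb (K3 (u s) (v s)) p q))%C) s du dv); auto.
  - intros; now apply Cder_K1.
  - intros. rewrite Dop_scal, Dop_plus, !Dop_scal, Dop_sa, Dop_sb, DopK3_eq. change (sol (u s) (v s) (K1 (u s) (v s))) with (K2 (u s) (v s)). ring.
Qed.

Lemma Cder_sa (x : R -> arr) g s : (forall p q, Cder (fun t => x t p q) s (g p q)) ->
  forall p q, Cder (fun t => sa (x t) p q) s (sa g p q).
Proof. intros H [|p] q; simpl; auto. apply Cder_const. Qed.
Lemma Cder_sb (x : R -> arr) g s : (forall p q, Cder (fun t => x t p q) s (g p q)) ->
  forall p q, Cder (fun t => sb (x t) p q) s (sb g p q).
Proof. intros H p [|q]; simpl; auto. apply Cder_const. Qed.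

(** * Bounds on the zonal kernels *)

Fixpoint csum (f : nat -> C) (n : nat) : C := match n with O => RtoC 0 | S n' => (csum f n' + f n')%C end.

Lemma csum_ext f g n : (forall i, (i < n)%nat -> f i = g i) -> csum f n = csum g n.
Proof. induction n; simpl; intros H; auto. rewrite IHn, H; auto. Qed.
Lemma csum_plus f g n : csum (fun i => (f i + g i)%C) n = (csum f n + csum g n)%C.
Proof. induction n; simpl; [|rewrite IHn]; ring. Qed.
Lemma csum_scal c f n : csum (fun i => (c * f i)%C) n = (c * csum f n)%C.
Proof. induction n; simpl; [|rewrite IHn]; ring. Qed.
Lemma csum_swap f n m : csum (fun i => csum (fun j => f i j) m) n = csum (fun j => csum (fun i => f i j) n) m.
Proof.
  induction n; simpl.
  - induction m; simpl; auto. rewrite <- IHm. ring.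
  - rewrite IHn. now rewrite <- csum_plus.
Qed.
Lemma csum_zero f n : (forall i, (i < n)%nat -> f i = RtoC 0) -> csum f n = RtoC 0.
Proof. induction n; simpl; intros H; auto. rewrite IHn, H; auto. ring. Qed.
Lemma csum_single f n k : (k < n)%nat -> (forall i, (i < n)%nat -> i <> k -> f i = RtoC 0) -> csum f n = f k.
Proof.
  induction n; simpl; intros Hk H; [lia|]. destruct (Nat.eq_dec k n) as [->|N].
  - rewrite csum_zero; [ring|]. intros; apply H; lia.
  - rewrite IHn, (H n); try lia; [ring|]. intros; apply H; lia.
Qed.
Lemma csum_shift f n : csum f (S n) = (f 0%nat + csum (fun i => f (S i)) n)%C.
Proof. induction n; simpl in *; [|rewrite IHn]; ring. Qed.
Lemma csum_bound f n M : (forall i, (i < n)%nat -> Cmod (f i) <= M) -> Cmod (csum f n) <= INR n * M.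
Proof.
  induction n; intros H.
  - simpl. rewrite Cmod_0. lra.
  - rewrite S_INR. simpl csum. eapply Rle_trans; [apply Cmod_triangle|].
    assert (Cmod (f n) <= M) by (apply H; lia). assert (Cmod (csum f n) <= INR n * M) by (apply IHn; intros; apply H; lia). lra.
Qed.

(** The coefficient of s^k after the substitution a = b = s, which turns the denominator into 1 - (u
    + v) s + s^2. *)
Definition dg (x : arr) (k : nat) : C := csum (fun q => x (k - q)%nat q) (S k).

Lemma dg_sa x k : dg (sa x) (S k) = dg x k.
Proof.
  unfold dg.
  change (csum (fun q => sa x (S k - q)%nat q) (S (S k))) with
    (csum (fun q => sa x (S k - q)%nat q) (S k) + sa x (S k - S k)%nat (S k))%C.
  rewrite Nat.sub_diag. change (sa x 0%nat (S k)) with (RtoC 0).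
  rewrite (csum_ext _ (fun q => x (k - q)%nat q)); [ring|].
  intros i Hi. now rewrite Nat.sub_succ_l by lia.
Qed.

Lemma dg_sb x k : dg (sb x) (S k) = dg x k.
Proof.
  unfold dg. rewrite csum_shift. simpl sb at 1. rewrite (csum_ext _ (fun q => x (k - q)%nat q)); [ring|].
  intros i Hi. reflexivity.
Qed.

Lemma dg_Dop u v x k : dg (Dop u v x) (S (S k)) = (dg x (S (S k)) - (u + v) * dg x (S k) + dg x k)%C.
Proof.
  rewrite <- (dg_sb x k), <- (dg_sa (sb x) (S k)).
  replace ((u + v) * dg x (S k))%C with (u * dg (sa x) (S (S k)) + v * dg (sb x) (S (S k)))%C by (rewrite dg_sa, dg_sb; ring).
  unfold dg. rewrite <- !csum_scal.
  set (N := S (S (S k))). unfold Dop.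
  rewrite (csum_ext _ (fun q => ((x (S (S k) - q)%nat q + - RtoC 1 * (u * sa x (S (S k) - q)%nat q)) + (- RtoC 1 * (v * sb x (S (S k) - q)%nat q) + sa (sb x) (S (S k) - q)%nat q))%C)) by (intros; ring).
  rewrite !csum_plus, !csum_scal. ring.
Qed.

(** Chebyshev polynomials of the second kind, with generating function 1 / (1 - 2 c s + s^2). *)
Fixpoint cheb (c : R) (k : nat) : R :=
  match k with
  | O => 1
  | S k' => match k' with O => 2 * c | S k'' => 2 * c * cheb c k' - cheb c k'' end
  end.

Lemma cheb_SS c k : cheb c (S (S k)) = 2 * c * cheb c (S k) - cheb c k.
Proof. reflexivity. Qed.

Lemma dg_K1 (z : C) k : dg (K1 z (Cconj z)) k = RtoC (cheb (Re z) k).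
Proof.
  assert (H : dg (K1 z (Cconj z)) k = RtoC (cheb (Re z) k) /\ dg (K1 z (Cconj z)) (S k) = RtoC (cheb (Re z) (S k))).
  { induction k as [|k [IH1 IH2]].
    - split; unfold dg, csum, K1; simpl.
      + ring.
      + destruct z as [a b]. unfold RtoC, Cplus, Cmult, Cconj; simpl. f_equal; ring.
    - split; auto. assert (E := dg_Dop z (Cconj z) (K1 z (Cconj z)) k).
      rewrite IH1, IH2 in E. rewrite cheb_SS.
      assert (E0 : dg (Dop z (Cconj z) (K1 z (Cconj z))) (S (S k)) = RtoC 0).
      { unfold dg. apply csum_zero. intros i Hi. rewrite Dop_K1. destruct (S (S k) - i)%nat eqn:F; destruct i; simpl; auto; lia. }
      rewrite E0 in E.
      replace (dg (K1 z (Cconj z)) (S (S k))) with (RtoC 0 + ((z + Cconj z) * cheb (Re z) (S k) - cheb (Re z) k))%C by (rewrite E; ring).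
      destruct z as [a b]. unfold RtoC, Cplus, Cmult, Cconj, Cminus, Copp; simpl. f_equal; ring. }
  apply H.
Qed.

(** Write U_k for [cheb] of degree k. The quotient sin ((k+1) th) / sin th is awkward where sin th =
    0; instead U_(k+1) = cos th U_k + cos ((k+1) th), so that each step adds at most 1. *)
Lemma cheb_bound c k : -1 <= c <= 1 -> Rabs (cheb c k) <= INR k + 1.
Proof.
  intros Hc. set (th := acos c). assert (Ec : c = cos th) by (symmetry; apply cos_acos; lra).
  rewrite Ec.
  assert (P : forall k, sin th * cheb (cos th) k = sin (INR (S k) * th) /\
     sin th * cheb (cos th) (S k) = sin (INR (S (S k)) * th)).
  { induction k0 as [|k0 [P1 P2]].
    - split; simpl; [rewrite Rmult_1_l; ring|]. replace ((1 + 1) * th) with (2 * th) by ring. rewrite sin_2a. ring.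
    - split; auto. rewrite cheb_SS.
      replace (sin th * (2 * cos th * cheb (cos th) (S k0) - cheb (cos th) k0))
        with (2 * cos th * (sin th * cheb (cos th) (S k0)) - sin th * cheb (cos th) k0) by ring.
      rewrite P1, P2. rewrite !S_INR.
      replace ((INR k0 + 1 + 1 + 1) * th) with ((INR k0 + 1 + 1) * th + th) by ring.
      replace ((INR k0 + 1) * th) with ((INR k0 + 1 + 1) * th - th) by ring.
      rewrite sin_plus, sin_minus. ring. }
  assert (Q : forall k, cheb (cos th) (S k) = cos th * cheb (cos th) k + cos (INR (S k) * th)).
  { induction k0 as [|k0 IH].
    - replace (INR 1 * th) with th by (simpl; ring). simpl. ring.
    - rewrite cheb_SS. destruct (P k0) as [P1 _].
      replace (INR (S (S k0)) * th) with (INR (S k0) * th + th) by (rewrite (S_INR (S k0)); ring).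
      rewrite cos_plus, <- P1. assert (E := sin2_cos2 th). unfold Rsqr in E.
      assert (E' : sin th * sin th = 1 - cos th * cos th) by lra.
      replace (sin th * cheb (cos th) k0 * sin th) with ((sin th * sin th) * cheb (cos th) k0) by ring. rewrite E'.
      replace (2 * cos th * cheb (cos th) (S k0)) with (cos th * cheb (cos th) (S k0) + cos th * cheb (cos th) (S k0)) by ring.
      rewrite IH at 2. ring. }
  induction k as [|k IH].
  - simpl. rewrite Rabs_R1. lra.
  - rewrite Q. generalize (abs_cos (INR (S k) * th)). generalize (cos (INR (S k) * th)). intros w Hw.
    rewrite S_INR. eapply Rle_trans; [apply Rabs_triang|]. rewrite Rabs_mult.
    assert (H1 := abs_cos th).
    assert (Rabs (cos th) * Rabs (cheb (cos th) k) <= 1 * (INR k + 1)).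
    { apply Rmult_le_compat; auto; apply Rabs_pos. }
    lra.
Qed.

(** Scaling a by e and b by e' leaves the term a b of the denominator unchanged, because e e' =
    1. *)
Lemma K1_rot (e e' u v : C) : (e * e' = 1)%C -> forall p q,
  K1 (e * u)%C (e' * v)%C p q = (Cpow e p * Cpow e' q * K1 u v p q)%C.
Proof.
  intros He. apply (Dop_inj (e * u)%C (e' * v)%C). intros p q. rewrite Dop_K1.
  assert (E := Dop_K1 u v p q). unfold Dop in *.
  destruct p as [|p]; destruct q as [|q]; simpl sa in *; simpl sb in *; simpl delta in *; simpl Cpow.
  - replace (1 * 1 * K1 u v 0%nat 0%nat - e * u * 0 - e' * v * 0 + 0)%C with (K1 u v 0%nat 0%nat - u * 0 - v * 0 + 0)%C by ring. now rewrite E.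
  - replace (1 * (e' * e' ^ q) * K1 u v 0%nat (S q) - e * u * 0 - e' * v * (1 * e' ^ q * K1 u v 0%nat q) + 0)%C
      with (e' * e' ^ q * (K1 u v 0%nat (S q) - u * 0 - v * K1 u v 0%nat q + 0))%C by ring. rewrite E. ring.
  - replace (e * e ^ p * 1 * K1 u v (S p) 0%nat - e * u * (e ^ p * 1 * K1 u v p 0%nat) - e' * v * 0 + 0)%C
      with (e * e ^ p * (K1 u v (S p) 0%nat - u * K1 u v p 0%nat - v * 0 + 0))%C by ring. rewrite E. ring.
  - replace (e * e ^ p * (e' * e' ^ q) * K1 u v (S p) (S q) - e * u * (e ^ p * (e' * e' ^ q) * K1 u v p (S q))
       - e' * v * (e * e ^ p * e' ^ q * K1 u v (S p) q) + e ^ p * e' ^ q * K1 u v p q)%C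
      with ((e * e') * e ^ p * e' ^ q * (K1 u v (S p) (S q) - u * K1 u v p (S q) - v * K1 u v (S p) q + K1 u v p q)
        + (1 - e * e') * e ^ p * e' ^ q * K1 u v p q)%C by ring.
    rewrite E, He. ring.
Qed.

Definition cis (t : R) : C := (cos t, sin t).
Lemma cis_plus a b : cis (a + b) = (cis a * cis b)%C.
Proof. unfold cis, Cmult; simpl. rewrite cos_plus, sin_plus. f_equal; ring. Qed.
Lemma cis_0 : cis 0 = RtoC 1.
Proof. unfold cis. now rewrite cos_0, sin_0. Qed.
Lemma cis_pow t n : Cpow (cis t) n = cis (INR n * t).
Proof.
  induction n.
  - simpl. now rewrite Rmult_0_l, cis_0.
  - simpl Cpow. rewrite IHn, <- cis_plus, S_INR. f_equal; ring.
Qed.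
Lemma Cmod_cis t : Cmod (cis t) = 1.
Proof.
  unfold Cmod, cis; simpl. assert (E := sin2_cos2 t). unfold Rsqr in E.
  replace (cos t * (cos t * 1) + sin t * (sin t * 1)) with 1 by lra. apply sqrt_1.
Qed.

Lemma cis_2PI_mult (m : nat) : cis (2 * INR m * PI) = RtoC 1.
Proof.
  unfold cis. replace (2 * INR m * PI) with (0 + 2 * INR m * PI) by ring.
  now rewrite cos_period, sin_period, cos_0, sin_0.
Qed.

Lemma geom_sum (w : C) n : ((w - 1) * csum (fun l => Cpow w l) n)%C = (Cpow w n - 1)%C.
Proof. induction n; simpl; [ring|]. rewrite Cmult_plus_distr_l, IHn. ring. Qed.

Lemma root_sum (N m : nat) (sg : R) : (0 < m < N)%nat -> sg = 1 \/ sg = -1 ->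
  csum (fun l => cis (sg * (2 * INR m * PI / INR N) * INR l)) N = RtoC 0.
Proof.
  intros Hm Hsg. assert (HN : 0 < INR N) by (apply lt_0_INR; lia).
  set (a := sg * (2 * INR m * PI / INR N)).
  assert (G := geom_sum (cis a) N).
  rewrite cis_pow in G.
  assert (E1 : cis (INR N * a) = RtoC 1).
  { destruct Hsg as [-> | ->].
    - replace (INR N * a) with (2 * INR m * PI) by (unfold a; field; lra). apply cis_2PI_mult.
    - assert (H := cis_2PI_mult m). replace (INR N * a) with (- (2 * INR m * PI)) by (unfold a; field; lra).
      unfold cis in *. rewrite cos_neg, sin_neg. injection H; intros -> ->. unfold RtoC. f_equal; ring. }
  rewrite E1 in G.
  rewrite (csum_ext _ (fun l => Cpow (cis a) l)).
  2:{ intros. rewrite cis_pow. f_equal; ring. }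
  assert (Hne : (cis a - 1)%C <> RtoC 0).
  { intros H. assert (Hc : cos a = 1).
    { apply (f_equal Re) in H. unfold cis, Cminus, Cplus, Copp, RtoC in H; simpl in H. lra. }
    assert (Hca : cos (2 * (INR m * PI / INR N)) = 1).
    { rewrite <- Hc. unfold a. destruct Hsg as [-> | ->]; [f_equal; field; lra|].
      rewrite <- cos_neg. f_equal; field; lra. }
    rewrite cos_2a_sin in Hca.
    assert (0 < sin (INR m * PI / INR N)).
    { assert (Hp := PI_RGT_0). assert (0 < INR m) by (apply lt_0_INR; lia). apply sin_gt_0.
      - apply Rdiv_lt_0_compat; auto. apply Rmult_lt_0_compat; auto.
      - apply (Rmult_lt_reg_r (INR N)); auto. unfold Rdiv. rewrite Rmult_assoc, Rinv_l, Rmult_1_r by lra.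
        rewrite Rmult_comm. apply Rmult_lt_compat_l; auto. apply lt_INR; lia. }
    nra. }
  assert (G' : ((cis a - 1) * csum (fun l => Cpow (cis a) l) N)%C = RtoC 0) by (rewrite G; ring).
  destruct (Ceq_dec (csum (fun l => Cpow (cis a) l) N) (RtoC 0)) as [|n]; auto.
  exfalso. apply (Cmult_neq_0 _ _ Hne n). exact G'.
Qed.

Lemma Re_le_Cmod (z : C) : Rabs (Re z) <= Cmod z.
Proof. apply re_le_Cmod. Qed.

(* The Fourier coefficients of the Chebyshev polynomial on a circle. *)
Lemma K1_bound (z : C) p q : Cmod z <= 1 -> Cmod (K1 z (Cconj z) p q) <= INR (p + q) + 1.
Proof.
  intros Hz. set (k := (p + q)%nat). set (N := S k).
  assert (HN : 0 < INR N) by (apply lt_0_INR; unfold N; lia).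
  (* Rotating z by e^(it) multiplies the entry (k - j, j) by e^(i (k - 2 j) t). These frequencies
     differ by even numbers, so nodes at half the usual spacing, pi l / N, already separate the N =
     p + q + 1 entries of degree k. The entry (p, q) is then an average of N numbers of modulus at
     most k + 1. *)
  set (t := fun l : nat => PI / INR N * INR l).
  assert (Hcc : forall a, (cis a * cis (- a))%C = RtoC 1).
  { intros. rewrite <- cis_plus. replace (a + - a) with 0 by ring. apply cis_0. }
  assert (Hconj : forall a, Cconj (cis a) = cis (- a)).
  { intros. unfold Cconj, cis; simpl. now rewrite cos_neg, sin_neg. }
  assert (E : csum (fun l => (Cpow (cis (- t l)) p * Cpow (cis (t l)) q * RtoC (cheb (Re (cis (t l) * z)) k))%C) N
     = (RtoC (INR N) * K1 z (Cconj z) p q)%C).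
  { rewrite (csum_ext _ (fun l => csum (fun j => (cis (2 * (INR q - INR j) * t l) * K1 z (Cconj z) (k - j)%nat j)%C) N)).
    - rewrite csum_swap.
      rewrite (csum_single _ N q).
      + rewrite (csum_ext _ (fun l => (K1 z (Cconj z) p q * RtoC 1)%C)).
        * rewrite csum_scal. assert (Es : csum (fun _ => RtoC 1) N = RtoC (INR N)).
          { generalize N. intros n. induction n as [|n IHn]; [reflexivity|]. rewrite S_INR, RtoC_plus, <- IHn. reflexivity. }
          rewrite Es. ring.
        * intros l _. replace (2 * (INR q - INR q) * t l) with 0 by ring. rewrite cis_0.
          replace (k - q)%nat with p by (unfold k; lia). ring.
      + unfold N, k; lia.
      + intros j Hj Hjq.
        rewrite (csum_ext _ (fun l => (K1 z (Cconj z) (k - j)%nat j * cis (2 * (INR q - INR j) * t l))%C)) by (intros; ring).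
        rewrite csum_scal.
        assert (E0 : csum (fun l => cis (2 * (INR q - INR j) * t l)) N = RtoC 0).
        { destruct (Nat.lt_ge_cases j q) as [L|L].
          - rewrite (csum_ext _ (fun l => cis (1 * (2 * INR (q - j) * PI / INR N) * INR l))).
            + apply root_sum; auto. unfold N, k; lia.
            + intros l _. rewrite minus_INR by lia. unfold t. f_equal; field; lra.
          - rewrite (csum_ext _ (fun l => cis (-1 * (2 * INR (j - q) * PI / INR N) * INR l))).
            + apply root_sum; auto. unfold N in *; lia.
            + intros l _. rewrite minus_INR by lia. unfold t. f_equal; field; lra. }
        rewrite E0. ring.
    - intros l _. rewrite <- dg_K1, Cmult_conj, Hconj.
      unfold dg. rewrite <- csum_scal. apply csum_ext. intros j Hj.
      rewrite K1_rot by apply Hcc. rewrite !cis_pow.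
      replace (cis (2 * (INR q - INR j) * t l)) with
        (cis (INR p * - t l) * cis (INR q * t l) * (cis (INR (k - j) * t l) * cis (INR j * - t l)))%C.
      + ring.
      + rewrite <- !cis_plus. f_equal. rewrite minus_INR by lia. unfold k. rewrite plus_INR. ring. }
  assert (B : Cmod (RtoC (INR N) * K1 z (Cconj z) p q)%C <= INR N * (INR k + 1)).
  { rewrite <- E. apply csum_bound. intros l _. rewrite !Cmod_mult, !cis_pow, !Cmod_cis, Cmod_R, !Rmult_1_l.
    apply cheb_bound. apply Rabs_le_between. eapply Rle_trans; [apply Re_le_Cmod|].
    rewrite Cmod_mult, Cmod_cis. lra. }
  rewrite Cmod_mult, Cmod_R, (Rabs_pos_eq (INR N)) in B by lra.
  apply (Rmult_le_reg_l (INR N)); auto.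
Qed.

Lemma sol_conj u v (f g : arr) : (forall p q, Cconj (f p q) = g p q) ->
  forall p q, Cconj (sol u v f p q) = sol (Cconj u) (Cconj v) g p q.
Proof.
  intros Hf. apply (Dop_inj (Cconj u) (Cconj v)). intros p q. rewrite Dop_sol, <- Hf, <- (Dop_sol u v f p q).
  assert (E0 : Cconj 0 = RtoC 0) by (unfold Cconj, RtoC; simpl; f_equal; ring).
  unfold Dop. destruct p as [|p]; destruct q as [|q]; unfold sa, sb;
  rewrite ?Cplus_conj, ?Cminus_conj, ?Cplus_conj, ?Cminus_conj, ?Cmult_conj, ?E0; reflexivity.
Qed.

Lemma K1_conj u v p q : Cconj (K1 u v p q) = K1 (Cconj u) (Cconj v) p q.
Proof.
  apply sol_conj. intros [|a] [|b]; unfold delta, Cconj, RtoC; simpl; f_equal; ring.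
Qed.

Lemma K2_conj u v p q : Cconj (K2 u v p q) = K2 (Cconj u) (Cconj v) p q.
Proof. apply sol_conj. intros; apply K1_conj. Qed.

(** * Projections onto spherical harmonics of bidegree (p, q) *)

(** The pulled-back function along directions s has the iterated derivatives of [f] along the images
    of s under the linear part [L], hence the list [map L s]. *)
Lemma smooth_pull {V W : NormedModule R_AbsRing} (E : V -> Prop) (D : W -> Prop) (pi L : V -> W) f :
  (forall z v (h : R), pi (plus z (scal h v)) = plus (pi z) (scal h (L v))) ->
  (forall z, filterlim pi (locally z) (locally (pi z))) ->
  (forall z, E z -> D (pi z)) -> smooth_on D f -> smooth_on E (fun z => f (pi z)).
Proof.
  intros HL Hc HE [F [H0 [H1 H2]]].
  exists (fun s z => F (map L s) (pi z)). refine (conj _ (conj _ _)).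
  - intros x Ex. apply H0. auto.
  - intros s x Ex P HP. specialize (H1 (map L s) (pi x) (HE x Ex) P HP).
    unfold within in *. generalize (Hc x _ H1). unfold filtermap. apply filter_imp.
    intros y Hy Ey. apply Hy. auto.
  - intros s v x Ex. specialize (H2 (map L s) (L v) (pi x) (HE x Ex)).
    apply dw_lim. apply dw_lim in H2. apply filterlim_R; [apply line_filter|]. intros eps He.
    destruct (line_elim _ _ _ _ (flim_elim H2 eps He)) as [d [Hd K]].
    apply line_intro. exists d; split; auto. intros h Hn Hh HD.
    rewrite HL. apply K; auto. rewrite <- HL. auto.
Qed.

(** The Hermitian product of C^2, complex linear in [x] and antilinear in [y]. *)
Definition ipc (x y : C2) : C := (dot x y, - dot (fieldT x) y).

Lemma dot_plus x x' y : dot (plus x x') y = dot x y + dot x' y.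
Proof. unfold dot, sum4. rewrite !cc_plus. ring. Qed.
Lemma dot_scal (r : R) x y : dot (scal r x) y = r * dot x y.
Proof. unfold dot, sum4. rewrite !cc_scal. ring. Qed.

Lemma ipc_plus x x' y : ipc (plus x x') y = (ipc x y + ipc x' y)%C.
Proof.
  unfold ipc, Cplus; cbn [fst snd]. rewrite (proj1 lin_fieldT), !dot_plus. f_equal; ring.
Qed.
Lemma ipc_scal (r : R) x y : ipc (scal r x) y = (RtoC r * ipc x y)%C.
Proof.
  unfold ipc, Cmult, RtoC; cbn [fst snd]. rewrite (proj2 lin_fieldT), !dot_scal. f_equal; ring.
Qed.
Lemma ipc_sym x y : ipc y x = Cconj (ipc x y).
Proof. unfold ipc, Cconj; simpl. f_equal; unfold dot, sum4, fieldT, mkv; simpl; ring. Qed.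
Lemma ipc_T x y : ipc (fieldT x) y = (Ci * ipc x y)%C.
Proof. unfold ipc, Cmult, Ci; simpl. f_equal; unfold dot, sum4, fieldT, mkv; simpl; ring. Qed.
Lemma ipc_Y x y : ipc (fieldY x) y = (Ci * ipc (fieldX x) y)%C.
Proof. rewrite <- ipc_T. f_equal. ccx; unfold fieldT, fieldX, fieldY, mkv; simpl; ring. Qed.
Lemma ipc_XX x y : ipc (fieldX (fieldX x)) y = (- ipc x y)%C.
Proof. unfold ipc, Copp; simpl. f_equal; unfold dot, sum4, fieldT, fieldX, mkv; simpl; ring. Qed.
Lemma ipc_YY x y : ipc (fieldY (fieldY x)) y = (- ipc x y)%C.
Proof. unfold ipc, Copp; simpl. f_equal; unfold dot, sum4, fieldT, fieldY, mkv; simpl; ring. Qed.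

(** For x on the sphere, x and [fieldX x] form a unitary basis of C^2; this is Parseval's identity
    for the unit vector y. *)
Lemma ipc_parseval x y : S3 x -> S3 y ->
  (ipc (fieldX x) y * Cconj (ipc (fieldX x) y))%C = (1 - ipc x y * Cconj (ipc x y))%C.
Proof.
  intros Hx Hy. apply S3_nsq in Hx. apply S3_nsq in Hy.
  assert (E : nsq x * nsq y = 1) by (rewrite Hx, Hy; ring).
  unfold Cmult, Cminus, Cplus, Copp, Cconj, ipc, RtoC; simpl. f_equal; [|ring].
  rewrite <- E. unfold nsq, dot, sum4, fieldT, fieldX, mkv; simpl. ring.
Qed.

Lemma ipc_le1 x y : S3 x -> S3 y -> Cmod (ipc x y) <= 1.
Proof.
  intros Hx Hy. assert (E := ipc_parseval x y Hx Hy). rewrite <- !Cmod2_conj in E.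
  apply (f_equal Re) in E. simpl in E.
  assert (H1 := Cmod_ge_0 (ipc x y)). assert (H2 := Cmod_ge_0 (ipc (fieldX x) y)). nra.
Qed.

Definition ker (p q : nat) (x y : C2) : R := Re (K1 (ipc x y) (Cconj (ipc x y)) p q).

Lemma ker_sym p q x y : ker p q x y = ker p q y x.
Proof.
  unfold ker. rewrite (ipc_sym x y), Cconj_conj.
  transitivity (Re (Cconj (K1 (ipc x y) (Cconj (ipc x y)) p q))); [reflexivity|].
  rewrite K1_conj, Cconj_conj. reflexivity.
Qed.

Lemma ker_bound p q x y : S3 x -> S3 y -> Rabs (ker p q x y) <= INR (p + q) + 1.
Proof.
  intros Hx Hy. eapply Rle_trans; [apply re_le_Cmod|]. apply K1_bound. now apply ipc_le1.
Qed.

Definition smoothC {V : NormedModule R_AbsRing} (D : V -> Prop) (F : V -> C) : Prop :=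
  smooth_on D (fun x => Re (F x)) /\ smooth_on D (fun x => Im (F x)).

Lemma smoothC_const {V : NormedModule R_AbsRing} (D : V -> Prop) c : smoothC D (fun _ => c).
Proof. split; apply smooth_const. Qed.
Lemma smoothC_plus {V : NormedModule R_AbsRing} (D : V -> Prop) F G :
  smoothC D F -> smoothC D G -> smoothC D (fun x => (F x + G x)%C).
Proof. intros [] []; split; now apply smooth_plus. Qed.
Lemma smoothC_minus {V : NormedModule R_AbsRing} (D : V -> Prop) F G :
  smoothC D F -> smoothC D G -> smoothC D (fun x => (F x - G x)%C).
Proof. intros [] []; split; now apply smooth_minus. Qed.
Lemma smoothC_mult {V : NormedModule R_AbsRing} (D : V -> Prop) F G :
  smoothC D F -> smoothC D G -> smoothC D (fun x => (F x * G x)%C).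
Proof.
  intros [A B] [A' B']; split.
  - apply (smooth_minus D (fun x => Re (F x) * Re (G x)) (fun x => Im (F x) * Im (G x))); now apply smooth_mult.
  - apply (smooth_plus D (fun x => Re (F x) * Im (G x)) (fun x => Im (F x) * Re (G x))); now apply smooth_mult.
Qed.
Lemma smoothC_conj {V : NormedModule R_AbsRing} (D : V -> Prop) F :
  smoothC D F -> smoothC D (fun x => Cconj (F x)).
Proof. intros [A B]; split; auto. now apply (smooth_opp D (fun x => Im (F x))). Qed.

Lemma smoothC_sol {V : NormedModule R_AbsRing} (D : V -> Prop) (u v : V -> C) (f : V -> arr) :
  smoothC D u -> smoothC D v -> (forall p q, smoothC D (fun x => f x p q)) ->
  forall p q, smoothC D (fun x => sol (u x) (v x) (f x) p q).
Proof.
  intros Hu Hv Hf. induction p as [|p IHp]; induction q as [|q IHq].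
  - apply Hf.
  - apply (smoothC_plus D (fun x => f x 0%nat (S q)) (fun x => (v x * sol (u x) (v x) (f x) 0 q)%C)); auto using smoothC_mult.
  - apply (smoothC_plus D (fun x => f x (S p) 0%nat) (fun x => (u x * sol (u x) (v x) (f x) p 0%nat)%C)); auto using smoothC_mult.
  - apply (smoothC_minus D (fun x => (f x (S p) (S q) + u x * sol (u x) (v x) (f x) p (S q) + v x * sol (u x) (v x) (f x) (S p) q)%C)
      (fun x => sol (u x) (v x) (f x) p q)); auto.
    apply (smoothC_plus D (fun x => (f x (S p) (S q) + u x * sol (u x) (v x) (f x) p (S q))%C)); [|now apply smoothC_mult].
    apply (smoothC_plus D (fun x => f x (S p) (S q))); auto. now apply smoothC_mult.
Qed.

Lemma smooth_ker {V : NormedModule R_AbsRing} (D : V -> Prop) (X Y : V -> C2) p q :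
  (forall i, smooth_on D (fun z => cc i (X z))) -> (forall i, smooth_on D (fun z => cc i (Y z))) ->
  smooth_on D (fun z => ker p q (X z) (Y z)).
Proof.
  intros HX HY. unfold ker.
  assert (Hd : smooth_on D (fun z => dot (X z) (Y z))).
  { unfold dot, sum4. repeat apply smooth_plus; now apply smooth_mult. }
  assert (Ht : smooth_on D (fun z => - dot (fieldT (X z)) (Y z))).
  { apply smooth_opp. apply smooth_on_ext with (fun z => - cc 1 (X z) * cc 0 (Y z) + cc 0 (X z) * cc 1 (Y z)
      + - cc 3 (X z) * cc 2 (Y z) + cc 2 (X z) * cc 3 (Y z)); [reflexivity|].
    repeat apply smooth_plus; apply smooth_mult; auto using smooth_opp. }
  assert (Hz : smoothC D (fun z => ipc (X z) (Y z))) by (split; auto).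
  apply (smoothC_sol D (fun z => ipc (X z) (Y z)) (fun z => Cconj (ipc (X z) (Y z))) (fun _ => delta)); auto.
  - now apply smoothC_conj.
  - intros; apply smoothC_const.
Qed.

Lemma smooth_S3_ker1 p q y : smooth_S3 (fun x => ker p q x y).
Proof.
  apply (smooth_ker cone0 (fun x => proj x) (fun _ => y)); intros i; [apply smooth_cc_proj|apply smooth_const].
Qed.
Lemma smooth_S3_ker2 p q x : smooth_S3 (fun y => ker p q x y).
Proof.
  apply (smooth_ker cone0 (fun _ => x) (fun y => proj y)); intros i; [apply smooth_const|apply smooth_cc_proj].
Qed.

(** * Derivatives of the kernels along great circles *)

Definition flow (A : C2 -> C2) (p : C2) (s : R) : C2 := plus (scal (cos s) p) (scal (sin s) (A p)).
(** These conditions keep the curve [flow A p] on the sphere, so that f itself can be differentiated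
    along it instead of its extension. *)
Definition rot_field (A : C2 -> C2) : Prop :=
  lin A /\ (forall p, dot p (A p) = 0) /\ (forall p, nsq (A p) = nsq p).

Ltac rot_tac A H := split; [apply H|split; intros p; unfold dot, nsq, sum4, A, mkv; simpl; ring].
Lemma rot_fieldT : rot_field fieldT. Proof. rot_tac fieldT lin_fieldT. Qed.
Lemma rot_fieldX : rot_field fieldX. Proof. rot_tac fieldX lin_fieldX. Qed.
Lemma rot_fieldY : rot_field fieldY. Proof. rot_tac fieldY lin_fieldY. Qed.
Lemma rot_rot1 : rot_field rot1. Proof. rot_tac rot1 lin_rot1. Qed.
Lemma rot_rot2 : rot_field rot2. Proof. rot_tac rot2 lin_rot2. Qed.
Lemma rot_rot3 : rot_field rot3. Proof. rot_tac rot3 lin_rot3. Qed.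

Lemma flow_0 A p : flow A p 0 = p.
Proof. unfold flow. rewrite cos_0, sin_0. apply cc_ext; intros; rewrite cc_plus, !cc_scal; ring. Qed.

Lemma flow_S3 A p s : rot_field A -> S3 p -> S3 (flow A p s).
Proof.
  intros [_ [H1 H2]] Hp. apply S3_nsq in Hp. apply S3_nsq.
  transitivity (cos s * cos s * nsq p + 2 * (cos s * sin s) * dot p (A p) + sin s * sin s * nsq (A p)).
  - unfold flow, nsq, dot, sum4. rewrite !cc_plus, !cc_scal. ring.
  - rewrite H1, H2, Hp. assert (E := sin2_cos2 s). unfold Rsqr in E. lra.
Qed.

Lemma Dv_flow A f p : rot_field A -> smooth_S3 f -> S3 p ->
  is_derive (fun s => f (flow A p s)) 0 (Dv A f p).
Proof.
  intros HA Hf Hp. apply is_derive_ext with (fun s => ext f (flow A p s)).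
  - intros s. apply ext_S3. now apply flow_S3.
  - assert (H := chain_curve cone0 (ext f) (flow A p) 0 (A p)). rewrite (flow_0 A p) in H.
    apply H; auto; [apply cone0_open| |].
    + now apply cone0_nz, S3_nonzero.
    + intros i _. apply is_derive_ext with (fun t => cos t * cc i p + sin t * cc i (A p)).
      * intros t. unfold flow. now rewrite cc_plus, !cc_scal.
      * auto_derive; auto. rewrite cos_0, sin_0. ring.
Qed.

Lemma Dv_Re A (F : C2 -> C) p l : rot_field A -> smooth_S3 (fun x => Re (F x)) -> S3 p ->
  Cder (fun s => F (flow A p s)) 0 l -> Dv A (fun x => Re (F x)) p = Re l.
Proof.
  intros HA Hf Hp [H _]. rewrite <- (is_derive_unique _ _ _ H). symmetry.
  apply is_derive_unique. now apply (Dv_flow A (fun x => Re (F x))).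
Qed.

Lemma Cder_cis_comb a b : Cder (fun s => (RtoC (cos s) * a + RtoC (sin s) * b)%C) 0 b.
Proof.
  destruct a as [a1 a2], b as [b1 b2]. split; simpl; unfold Re, Im; simpl; auto_derive; auto; rewrite cos_0, sin_0; ring.
Qed.

Lemma Cder_ipc_lin A B p y : lin A -> lin B -> Cder (fun s => ipc (B (flow A p s)) y) 0 (ipc (B (A p)) y).
Proof.
  intros HA [H1 H2].
  destruct (Cder_cis_comb (ipc (B p) y) (ipc (B (A p)) y)) as [K1' K2'].
  assert (E : forall s, ipc (B (flow A p s)) y = (RtoC (cos s) * ipc (B p) y + RtoC (sin s) * ipc (B (A p)) y)%C).
  { intros s. unfold flow. now rewrite H1, !H2, ipc_plus, !ipc_scal. }
  split; [apply is_derive_ext with (2 := K1')|apply is_derive_ext with (2 := K2')]; intros s; now rewrite E.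
Qed.

Lemma Cder_ipc A p y : lin A -> Cder (fun s => ipc (flow A p s) y) 0 (ipc (A p) y).
Proof.
  intros HA. apply (Cder_ipc_lin A (fun x => x)); auto. split; auto.
Qed.

(** The derivative of [K1 z (Cconj z)] when z moves with velocity dz. *)
Definition dK (z dz : C) p q : C :=
  (dz * sa (K2 z (Cconj z)) p q + Cconj dz * sb (K2 z (Cconj z)) p q)%C.

Lemma Cder_kerC A p q x y : lin A ->
  Cder (fun s => K1 (ipc (flow A x s) y) (Cconj (ipc (flow A x s) y)) p q) 0 (dK (ipc x y) (ipc (A x) y) p q).
Proof.
  intros HA. assert (H := Cder_ipc A x y HA).
  assert (H3 := Cder_K1 _ _ _ _ _ p q H (Cder_conj _ _ _ H)). cbv beta in H3. rewrite flow_0 in H3. exact H3.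
Qed.

Lemma Dv_ker A p q x y : rot_field A -> S3 x ->
  Dv A (fun x => ker p q x y) x = Re (dK (ipc x y) (ipc (A x) y) p q).
Proof.
  intros HA Hx. apply (Dv_Re A (fun x => K1 (ipc x y) (Cconj (ipc x y)) p q)); auto.
  - apply smooth_S3_ker1.
  - apply Cder_kerC. apply HA.
Qed.

Lemma dK_opp z dz p q : dK z (- dz) p q = (- dK z dz p q)%C.
Proof. unfold dK. rewrite Copp_conj. ring. Qed.

Lemma sa_lin2 (c d : C) (x y : arr) p q : sa (fun p q => (2 * (c * x p q + d * y p q))%C) p q = (2 * (c * sa x p q + d * sa y p q))%C.
Proof. destruct p; simpl; ring. Qed.
Lemma sb_lin2 (c d : C) (x y : arr) p q : sb (fun p q => (2 * (c * x p q + d * y p q))%C) p q = (2 * (c * sb x p q + d * sb y p q))%C.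
Proof. destruct q; simpl; ring. Qed.
Lemma sb_sa (x : arr) p q : sb (sa x) p q = sa (sb x) p q.
Proof. destruct p; destruct q; reflexivity. Qed.

Lemma Dv_Dv_ker A p q x y : rot_field A -> S3 x ->
  Dv A (Dv A (fun x => ker p q x y)) x =
  Re (dK (ipc x y) (ipc (A (A x)) y) p q
     + 2 * (ipc (A x) y * ipc (A x) y * sa (sa (K3 (ipc x y) (Cconj (ipc x y)))) p q
     + 2 * (ipc (A x) y * Cconj (ipc (A x) y)) * sa (sb (K3 (ipc x y) (Cconj (ipc x y)))) p q
     + Cconj (ipc (A x) y) * Cconj (ipc (A x) y) * sb (sb (K3 (ipc x y) (Cconj (ipc x y)))) p q))%C.
Proof.
  intros HA Hx. assert (HA' := proj1 HA).
  rewrite (Dv_ext_S3 A _ (fun x => Re (dK (ipc x y) (ipc (A x) y) p q))); auto.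
  2:{ intros; now apply Dv_ker. }
  apply (Dv_Re A (fun x => dK (ipc x y) (ipc (A x) y) p q)); auto.
  - apply (smooth_fun_ext _ (Dv A (fun x => ker p q x y))).
    + intros; now apply Dv_ker.
    + apply smooth_S3_Dv; auto. apply smooth_S3_ker1.
  - assert (H := Cder_ipc A x y HA'). assert (Hc := Cder_conj _ _ _ H).
    assert (G := Cder_ipc_lin A A x y HA' HA'). assert (Gc := Cder_conj _ _ _ G).
    assert (H2 := fun p q => Cder_K2 _ _ _ _ _ p q H Hc). cbv beta in H2.
    assert (Hs := Cder_sa _ _ _ H2 p q). assert (Ht := Cder_sb _ _ _ H2 p q). cbv beta in Hs, Ht.
    eapply Cder_val; [exact (Cder_plus _ _ _ _ _ (Cder_mult _ _ _ _ _ G Hs) (Cder_mult _ _ _ _ _ Gc Ht))|].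
    cbv beta. rewrite !flow_0, sa_lin2, sb_lin2, sb_sa. unfold dK.
    change (sa (fun p q => K2 (ipc x y) (Cconj (ipc x y)) p q)) with (sa (K2 (ipc x y) (Cconj (ipc x y)))).
    change (sb (fun p q => K2 (ipc x y) (Cconj (ipc x y)) p q)) with (sb (K2 (ipc x y) (Cconj (ipc x y)))).
    ring.
Qed.

Definition mu (p q : nat) : R := 2 * INR p * INR q + INR p + INR q.

(** Under [ipc] the direction Y is i times X. Adding the two second derivatives therefore cancels
    the terms in g^2 and its conjugate (1 + i^2 = 0) and doubles the term in |g|^2 = 1 - |z|^2. What
    is left is the combination evaluated by [K1_laplace]. *)
Lemma XXYY_ker p q x y : S3 x -> S3 y ->
  Dv fieldX (Dv fieldX (fun x => ker p q x y)) x + Dv fieldY (Dv fieldY (fun x => ker p q x y)) x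
  = - (2 * mu p q) * ker p q x y.
Proof.
  intros Hx Hy. rewrite !Dv_Dv_ker by auto using rot_fieldX, rot_fieldY.
  rewrite ipc_XX, ipc_YY, ipc_Y, !dK_opp.
  set (z := ipc x y). set (g := ipc (fieldX x) y).
  assert (Ep : (g * Cconj g)%C = (1 - z * Cconj z)%C) by now apply ipc_parseval.
  assert (Ec : Cconj (Ci * g) = (- Ci * Cconj g)%C).
  { rewrite Cmult_conj. f_equal. unfold Cconj, Ci, Copp; simpl. f_equal; ring. }
  assert (Ei : (Ci * Ci)%C = (- (1))%C) by (unfold Ci, Cmult, Copp, RtoC; simpl; f_equal; ring).
  rewrite Ec.
  set (k3 := K3 z (Cconj z)). set (a := sa (sa k3) p q). set (b := sa (sb k3) p q). set (c := sb (sb k3) p q).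
  match goal with |- Re ?u + Re ?v = _ => transitivity (Re (u + v)%C); [reflexivity|] end.
  replace (- dK z z p q + 2 * (g * g * a + 2 * (g * Cconj g) * b + Cconj g * Cconj g * c) +
    (- dK z z p q + 2 * (Ci * g * (Ci * g) * a + 2 * (Ci * g * (- Ci * Cconj g)) * b + - Ci * Cconj g * (- Ci * Cconj g) * c)))%C
  with (- (2) * (dK z z p q) + 2 * (1 + Ci * Ci) * (g * g * a) + 2 * (1 + Ci * Ci) * (Cconj g * Cconj g * c)
     + 4 * (1 - Ci * Ci) * (g * Cconj g) * b)%C by ring.
  rewrite Ei, Ep.
  assert (EL := K1_laplace z (Cconj z) p q). fold k3 in EL. fold b in EL.
  replace (- (2) * dK z z p q + 2 * (1 + - (1)) * (g * g * a) + 2 * (1 + - (1)) * (Cconj g * Cconj g * c)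
     + 4 * (1 - - (1)) * (1 - z * Cconj z) * b)%C
  with (- (2) * (z * sa (K2 z (Cconj z)) p q + Cconj z * sb (K2 z (Cconj z)) p q - 4 * (1 - z * Cconj z) * b))%C
    by (unfold dK; ring).
  rewrite EL. unfold ker, mu, numC. fold z.
  destruct (K1 z (Cconj z) p q) as [k1 k2]. unfold Cmult, Cplus, Copp, RtoC, Re; simpl. ring.
Qed.

(** Along T the product z moves by i z, and the Euler operators of [Na_K1] and [Nb_K1] turn this
    into multiplication of [K1] by i (p - q). *)
Lemma TT_ker p q x y : S3 x ->
  Dv fieldT (Dv fieldT (fun x => ker p q x y)) x = - (INR p - INR q) ^ 2 * ker p q x y.
Proof.
  intros Hx.
  assert (Ed : forall z, dK z (Ci * z)%C p q = (Ci * (numC p - numC q) * K1 z (Cconj z) p q)%C).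
  { intros z. unfold dK. assert (E1 := Na_K1 z (Cconj z) p q). assert (E2 := Nb_K1 z (Cconj z) p q).
    assert (Ec : Cconj (Ci * z) = (- Ci * Cconj z)%C).
    { rewrite Cmult_conj. f_equal. unfold Cconj, Ci, Copp; simpl. f_equal; ring. }
    rewrite Ec.
    replace (Ci * (numC p - numC q) * K1 z (Cconj z) p q)%C with (Ci * (numC p * K1 z (Cconj z) p q - numC q * K1 z (Cconj z) p q))%C by ring.
    rewrite E1, E2. ring. }
  assert (E1 : forall x', S3 x' -> Dv fieldT (fun x => ker p q x y) x' = Re (Ci * (numC p - numC q) * K1 (ipc x' y) (Cconj (ipc x' y)) p q)%C).
  { intros x' Hx'. rewrite Dv_ker by auto using rot_fieldT. now rewrite ipc_T, Ed. }
  rewrite (Dv_ext_S3 fieldT _ _ x lin_fieldT E1 Hx).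
  rewrite (Dv_Re fieldT (fun x' => (Ci * (numC p - numC q) * K1 (ipc x' y) (Cconj (ipc x' y)) p q)%C) x
     (Ci * (numC p - numC q) * dK (ipc x y) (ipc (fieldT x) y) p q)%C); auto using rot_fieldT.
  - rewrite ipc_T, Ed. unfold ker, numC. destruct (K1 (ipc x y) (Cconj (ipc x y)) p q) as [k1 k2].
    unfold Cmult, Cplus, Cminus, Copp, RtoC, Ci, Re; simpl. ring.
  - apply (smooth_fun_ext _ (Dv fieldT (fun x => ker p q x y))).
    + intros; now apply E1.
    + apply smooth_S3_Dv; [apply lin_fieldT|]. apply smooth_S3_ker1.
  - apply Cder_scal. apply Cder_kerC. apply lin_fieldT.
Qed.

(** * The sub-Laplacian and the Paneitz operator *)

(** By [sum_squares] this is X^2 + Y^2, that is twice the sub-Laplacian. It is written through the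
    rotations and T because these commute with the projections. *)
Definition Lop (f : C2 -> R) : C2 -> R := fun p =>
  Dv rot1 (Dv rot1 f) p + Dv rot2 (Dv rot2 f) p + Dv rot3 (Dv rot3 f) p - Dv fieldT (Dv fieldT f) p.
Definition Pst (f : C2 -> R) : C2 -> R := fun p => / 4 * Lop (Lop f) p + Dv fieldT (Dv fieldT f) p.

Create HintDb sm.
#[global] Hint Resolve lin_fieldT lin_fieldX lin_fieldY lin_rot1 lin_rot2 lin_rot3
  rot_fieldT rot_fieldX rot_fieldY rot_rot1 rot_rot2 rot_rot3 : sm.
#[global] Hint Resolve smooth_S3_Dv smooth_S3_ker1 smooth_S3_ker2 smooth_contS contS_plus contS_mult contS_minus contS_scal contS_const : sm.

Lemma smooth_S3_plus f g : smooth_S3 f -> smooth_S3 g -> smooth_S3 (fun p => f p + g p).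
Proof. apply smooth_plus. Qed.
Lemma smooth_S3_minus f g : smooth_S3 f -> smooth_S3 g -> smooth_S3 (fun p => f p - g p).
Proof. apply smooth_minus. Qed.
Lemma smooth_S3_mult f g : smooth_S3 f -> smooth_S3 g -> smooth_S3 (fun p => f p * g p).
Proof. apply smooth_mult. Qed.
Lemma smooth_S3_const c : smooth_S3 (fun _ => c).
Proof. apply smooth_const. Qed.
Lemma smooth_S3_scal c f : smooth_S3 f -> smooth_S3 (fun p => c * f p).
Proof. apply smooth_mult. apply smooth_const. Qed.
#[global] Hint Resolve smooth_S3_plus smooth_S3_minus smooth_S3_mult smooth_S3_const smooth_S3_scal : sm.

Lemma smooth_Lop f : smooth_S3 f -> smooth_S3 (Lop f).
Proof. intros. unfold Lop. auto 10 with sm. Qed.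
#[global] Hint Resolve smooth_Lop : sm.
Lemma smooth_Pst f : smooth_S3 f -> smooth_S3 (Pst f).
Proof. intros. unfold Pst. auto 10 with sm. Qed.
#[global] Hint Resolve smooth_Pst : sm.

Lemma Lop_XY U f p : open_S3 U -> smooth_fun U f -> cone U p ->
  Lop f p = Dv fieldX (Dv fieldX f) p + Dv fieldY (Dv fieldY f) p.
Proof. intros HO Hf Hp. unfold Lop. assert (E := sum_squares U f p HO Hf Hp). lra. Qed.

Lemma Lop_ext f g p : (forall q, S3 q -> f q = g q) -> S3 p -> Lop f p = Lop g p.
Proof.
  intros E Hp. unfold Lop.
  assert (K : forall A, lin A -> Dv A (Dv A f) p = Dv A (Dv A g) p).
  { intros A HA. apply Dv_ext_S3; auto. intros q Hq. now apply Dv_ext_S3. }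
  now rewrite !K by auto with sm.
Qed.

Lemma Pst_ext f g p : (forall q, S3 q -> f q = g q) -> S3 p -> Pst f p = Pst g p.
Proof.
  intros E Hp. unfold Pst. f_equal.
  - f_equal. apply Lop_ext; auto. intros; now apply Lop_ext.
  - apply Dv_ext_S3; auto with sm. intros; apply Dv_ext_S3; auto with sm.
Qed.

Lemma Lop_ker p q x y : S3 x -> S3 y -> Lop (fun y => ker p q x y) y = - (2 * mu p q) * ker p q x y.
Proof.
  intros Hx Hy. rewrite (Lop_ext _ (fun y => ker p q y x)) by (auto; intros; apply ker_sym).
  rewrite ker_sym. rewrite (Lop_XY (fun _ => True)); [now apply XXYY_ker|apply cone0_open|apply smooth_S3_ker1|now apply cone_S3].
Qed.

Lemma TT_ker2 p q x y : S3 x -> S3 y ->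
  Dv fieldT (Dv fieldT (fun y => ker p q x y)) y = - (INR p - INR q) ^ 2 * ker p q x y.
Proof.
  intros Hx Hy. rewrite (Dv_ext_S3 fieldT _ (Dv fieldT (fun y => ker p q y x))); auto with sm.
  - rewrite ker_sym. now apply TT_ker.
  - intros. apply Dv_ext_S3; auto with sm. intros; apply ker_sym.
Qed.

(** Generators of U(2). They are skew for the Hermitian product ([unitary_ipc]), which fieldX and
    fieldY are not. *)
Definition unitary (A : C2 -> C2) : Prop := A = rot1 \/ A = rot2 \/ A = rot3 \/ A = fieldT.

Lemma unitary_rot A : unitary A -> rot_field A.
Proof. intros [->|[->|[->| ->]]]; auto with sm. Qed.
Lemma unitary_lin A : unitary A -> lin A.
Proof. intros H. apply unitary_rot in H. apply H. Qed.
Lemma unitary_IS A f : unitary A -> smooth_S3 f -> IS (Dv A f) = 0.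
Proof. intros [->|[->|[->| ->]]]; auto using IS_rot1, IS_rot2, IS_rot3, IS_fieldT. Qed.
Lemma unitary_ipc A x y : unitary A -> ipc (A x) y = (- ipc x (A y))%C.
Proof.
  intros [->|[->|[->| ->]]]; unfold ipc, Copp; simpl; f_equal;
  unfold dot, sum4, rot1, rot2, rot3, fieldT, mkv; simpl; ring.
Qed.
Lemma uni1 : unitary rot1. Proof. now left. Qed.
Lemma uni2 : unitary rot2. Proof. now right; left. Qed.
Lemma uni3 : unitary rot3. Proof. now right; right; left. Qed.
Lemma uniT : unitary fieldT. Proof. now right; right; right. Qed.
#[global] Hint Resolve uni1 uni2 uni3 uniT unitary_rot unitary_lin : sm.

Lemma unitary_parts A f g : unitary A -> smooth_S3 f -> smooth_S3 g ->
  IS (fun p => f p * Dv A g p) = - IS (fun p => Dv A f p * g p).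
Proof.
  intros HA Hf Hg. apply IS_parts; auto with sm. intros; now apply unitary_IS.
Qed.

Lemma unitary_parts2 A f g : unitary A -> smooth_S3 f -> smooth_S3 g ->
  IS (fun p => Dv A (Dv A f) p * g p) = IS (fun p => f p * Dv A (Dv A g) p).
Proof.
  intros HA Hf Hg. assert (E1 := unitary_parts A (Dv A f) g HA ltac:(auto with sm) Hg).
  assert (E2 := unitary_parts A f (Dv A g) HA Hf ltac:(auto with sm)). lra.
Qed.

Lemma Lop_selfadj f g : smooth_S3 f -> smooth_S3 g -> IS (fun p => Lop f p * g p) = IS (fun p => f p * Lop g p).
Proof.
  intros Hf Hg.
  assert (S : forall A h, unitary A -> smooth_S3 h -> smooth_S3 (Dv A (Dv A h))) by auto with sm.
  rewrite (IS_ext _ (fun p => (Dv rot1 (Dv rot1 f) p * g p + Dv rot2 (Dv rot2 f) p * g p) + (Dv rot3 (Dv rot3 f) p * g p - Dv fieldT (Dv fieldT f) p * g p))).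
  2:{ intros; unfold Lop; ring. }
  rewrite (IS_ext (fun p => f p * Lop g p) (fun p => (f p * Dv rot1 (Dv rot1 g) p + f p * Dv rot2 (Dv rot2 g) p) + (f p * Dv rot3 (Dv rot3 g) p - f p * Dv fieldT (Dv fieldT g) p))).
  2:{ intros; unfold Lop; ring. }
  rewrite !IS_plus, !IS_minus by auto 10 with sm. rewrite !unitary_parts2 by auto with sm. reflexivity.
Qed.

Lemma IS_Lop f : smooth_S3 f -> IS (Lop f) = 0.
Proof.
  intros Hf. rewrite (IS_ext _ (fun p => Lop f p * 1)) by (intros; ring).
  rewrite (Lop_selfadj f (fun _ => 1)) by auto with sm.
  rewrite (IS_ext _ (fun p => 0)); [rewrite IS_const; ring|].
  intros p Hp. unfold Lop.
  assert (K : forall A, Dv A (Dv A (fun _ => 1)) p = 0).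
  { intros A. replace (Dv A (fun _ => 1)) with (fun _ : C2 => 0); [apply Dv_const|].
    extensionality q. now rewrite Dv_const. }
  rewrite !K. ring.
Qed.

(** The kernel has value 1 on the diagonal and the harmonics of bidegree (p, q) have dimension p + q
    + 1, whence the normalization. *)
Definition pr (p q : nat) (f : C2 -> R) (x : C2) : R :=
  (INR (p + q) + 1) / Vol * IS (fun y => f y * ker p q x y).

Lemma pr_ext p q f g x : (forall y, S3 y -> f y = g y) -> pr p q f x = pr p q g x.
Proof. intros E. unfold pr. f_equal. apply IS_ext. intros y Hy. now rewrite E. Qed.

Lemma pr_plus p q f g x : contS f -> contS g -> pr p q (fun y => f y + g y) x = pr p q f x + pr p q g x.
Proof.
  intros. unfold pr. rewrite (IS_ext _ (fun y => f y * ker p q x y + g y * ker p q x y)) by (intros; ring).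
  rewrite IS_plus by auto with sm. ring.
Qed.

Lemma pr_scal p q c f x : contS f -> pr p q (fun y => c * f y) x = c * pr p q f x.
Proof.
  intros. unfold pr. rewrite (IS_ext _ (fun y => c * (f y * ker p q x y))) by (intros; ring).
  rewrite IS_scal by auto with sm. ring.
Qed.

Lemma pr_L p q f x : smooth_S3 f -> S3 x -> pr p q (Lop f) x = - (2 * mu p q) * pr p q f x.
Proof.
  intros Hf Hx. unfold pr. rewrite Lop_selfadj by auto with sm.
  rewrite (IS_ext _ (fun y => - (2 * mu p q) * (f y * ker p q x y))).
  - rewrite IS_scal by auto with sm. ring.
  - intros y Hy. rewrite Lop_ker by auto. ring.
Qed.

Lemma pr_TT p q f x : smooth_S3 f -> S3 x -> pr p q (Dv fieldT (Dv fieldT f)) x = - (INR p - INR q) ^ 2 * pr p q f x.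
Proof.
  intros Hf Hx. unfold pr. rewrite unitary_parts2 by auto with sm.
  rewrite (IS_ext _ (fun y => - (INR p - INR q) ^ 2 * (f y * ker p q x y))).
  - rewrite IS_scal by auto with sm. ring.
  - intros y Hy. rewrite TT_ker2 by auto. ring.
Qed.

Definition lam (p q : nat) : R := 4 * INR p * INR q * (INR p + 1) * (INR q + 1).

(** [Lop] and T^2 act by -2 mu and -(p - q)^2, and mu^2 - (p - q)^2 = (2 p q + 2 p) (2 p q + 2
    q). *)
Lemma pr_P p q f x : smooth_S3 f -> S3 x -> pr p q (Pst f) x = lam p q * pr p q f x.
Proof.
  intros Hf Hx. unfold Pst. rewrite pr_plus by auto 8 with sm. rewrite pr_scal by auto with sm.
  rewrite !pr_L, pr_TT by auto with sm. unfold mu, lam. field.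
Qed.

(** The integrand of [pr] on pairs of nonzero vectors, constant along rays in each of them: the form
    that [smooth_IS] and [IS_deriv] accept. *)
Definition Gk (p q : nat) (f : C2 -> R) : prodW C2 -> R :=
  fun z => ext f (snd z) * ker p q (proj (fst z)) (proj (snd z)).

Lemma smooth_fst {W : NormedModule R_AbsRing} (D : W -> Prop) f : smooth_on D f ->
  smooth_on (Dprod D) (fun z => f (fst z)).
Proof.
  apply (smooth_pull (V := prodW W) (Dprod D) D (fun z => fst z) (fun z => fst z)).
  - reflexivity.
  - intros [a b] P [e He]. exists e. intros [c d] [H1 H2]. now apply He.
  - intros z [H _]. exact H.
Qed.

Lemma smooth_snd {W : NormedModule R_AbsRing} (D : W -> Prop) f : smooth_on cone0 f ->
  smooth_on (Dprod D) (fun z => f (snd z)).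
Proof.
  apply (smooth_pull (V := prodW W) (Dprod D) cone0 (fun z => snd z) (fun z => snd z)).
  - reflexivity.
  - intros [a b] P [e He]. exists e. intros [c d] [H1 H2]. now apply He.
  - intros z [_ H]. now apply cone0_nz.
Qed.

Lemma smooth_Gk p q f : smooth_S3 f -> smooth_on (Dprod cone0) (Gk p q f).
Proof.
  intros Hf. apply smooth_mult; [now apply smooth_snd|].
  apply (smooth_ker (Dprod cone0) (fun z => proj (fst z)) (fun z => proj (snd z))); intros i.
  - apply (smooth_fst cone0 (fun x => cc i (proj x))). apply smooth_cc_proj.
  - apply (smooth_snd cone0 (fun x => cc i (proj x))). apply smooth_cc_proj.
Qed.

Lemma pr_Gk p q f x : ext (pr p q f) x = (INR (p + q) + 1) / Vol * IS (fun y => Gk p q f (mkw (W := C2) x y)).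
Proof.
  unfold ext at 1, pr. f_equal. apply IS_ext. intros y Hy. unfold Gk, mkw; simpl.
  now rewrite ext_S3, (proj_S3 y) by auto.
Qed.

Lemma smooth_pr p q f : smooth_S3 f -> smooth_S3 (pr p q f).
Proof.
  intros Hf. unfold smooth_S3, smooth_fun.
  apply smooth_on_ext with (fun x => (INR (p + q) + 1) / Vol * IS (fun y => Gk p q f (mkw (W := C2) x y))).
  - intros; symmetry; apply pr_Gk.
  - apply smooth_mult; [apply smooth_const|]. apply (smooth_IS cone0).
    + apply segm_open, cone0_open.
    + now apply smooth_Gk.
Qed.
#[global] Hint Resolve smooth_pr : sm.

(** Differentiate under the integral. By [unitary_ipc] a derivative of the kernel in x is minus its
    derivative in y, and integration by parts moves the latter onto f. *)
Lemma Dv_pr p q A f x : unitary A -> smooth_S3 f -> S3 x -> Dv A (pr p q f) x = pr p q (Dv A f) x.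
Proof.
  intros HA Hf Hx. assert (Hc : cone0 x) by now apply cone0_nz, S3_nonzero.
  assert (HG := smooth_Gk p q f Hf).
  destruct (smooth_on_deriv _ _ ((A x, zero) : prodW C2) HG) as [g [Hg Hd]].
  assert (E := IS_deriv cone0 (Gk p q f) g x (A x) (segm_open _ cone0_open) Hc
     (smooth_on_cont _ _ HG) (smooth_on_cont _ _ Hg) Hd).
  unfold Dv at 1.
  rewrite (dirD_ext_open cone0 _ (fun x => (INR (p + q) + 1) / Vol * IS (fun y => Gk p q f (mkw (W := C2) x y))) x (A x) cone0_open Hc)
    by (intros; apply pr_Gk).
  rewrite (dirD_unique cone0 _ x (A x) _ cone0_open Hc (dw_mult _ _ _ _ _ _ _ (dw_const _ _ _ _) E)).
  rewrite Rmult_0_l, Rplus_0_l. unfold pr. f_equal.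
  transitivity (-1 * IS (fun y => f y * Dv A (fun y => ker p q x y) y)).
  2:{ rewrite (unitary_parts A f (fun y => ker p q x y)) by auto with sm. ring. }
  rewrite <- IS_scal by auto with sm.
  apply IS_ext. intros y Hy.
  assert (Hxy : Dprod cone0 (mkw (W := C2) x y)) by (split; [exact Hc|now apply S3_nonzero]).
  specialize (Hd _ Hxy).
  (* The abstract derivative [g] of the integrand is identified by freezing y and comparing with the
     explicit derivative in the first variable. *)
  assert (Hd2 : is_deriv_within cone0 (fun x' => f y * ext (fun x => ker p q x y) x') x (A x) (g (mkw (W := C2) x y))).
  { apply dw_lim. apply filterlim_R; [apply line_filter|]. intros eps He.
    apply dw_lim in Hd.
    destruct (line_elim _ _ _ _ (flim_elim Hd eps He)) as [d [Hdp K]].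
    apply line_intro. exists d; split; auto. intros h Hn Hh HD.
    assert (Ey : plus (mkw (W := C2) x y) (scal h ((A x, zero) : prodW C2)) = mkw (W := C2) (plus x (scal h (A x))) y).
    { change (mkw (W := C2) (plus x (scal h (A x))) (plus y (scal h (zero : C2))) = mkw (W := C2) (plus x (scal h (A x))) y). f_equal.
      apply cc_ext; intros; rewrite cc_plus, cc_scal, cc_zero; ring. }
    specialize (K h Hn Hh). rewrite Ey in K.
    assert (EG : forall x', Gk p q f (mkw (W := C2) x' y) = f y * ext (fun x => ker p q x y) x').
    { intros x'. unfold Gk, mkw; simpl. now rewrite ext_S3, (proj_S3 y) by auto. }
    cbv beta. rewrite !EG in K. apply K. split; [exact HD|now apply S3_nonzero]. }
  assert (Hk := smooth_S3_ker1 p q y).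
  rewrite <- (dirD_unique cone0 _ x (A x) _ cone0_open Hc Hd2).
  rewrite (dirD_mult cone0 (fun _ => f y) _ x (A x) cone0_open (smooth_const _ _) Hk Hc).
  rewrite dirD_const. change (dirD (A x) (ext (fun x0 => ker p q x0 y)) x) with (Dv A (fun x0 => ker p q x0 y) x).
  rewrite Dv_ker by auto with sm.
  rewrite (Dv_ext_S3 A _ (fun y => ker p q y x)) by (auto with sm; intros; apply ker_sym).
  rewrite Dv_ker by auto with sm. rewrite (unitary_ipc A x y HA), dK_opp.
  rewrite (ipc_sym x y), (ipc_sym x (A y)).
  set (z := ipc x y). set (w := ipc x (A y)).
  assert (Ec : Re (dK (Cconj z) (Cconj w) p q) = Re (dK z w p q)).
  { transitivity (Re (Cconj (dK (Cconj z) (Cconj w) p q))); [reflexivity|]. f_equal.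
    unfold dK. rewrite Cplus_conj, !Cmult_conj, !Cconj_conj.
    assert (E0 : Cconj 0 = RtoC 0) by (unfold Cconj, RtoC; simpl; f_equal; ring).
    f_equal; f_equal; destruct p as [|p]; destruct q as [|q]; simpl; rewrite ?K2_conj, ?Cconj_conj; auto. }
  rewrite Ec. change (Re (- dK z w p q)) with (- Re (dK z w p q)). ring.
Qed.

(** * Series of smooth functions and multipliers *)

Lemma ex_series_dom (a b : nat -> R) : (forall n, Rabs (a n) <= b n) -> ex_series b -> ex_series a.
Proof. intros H Hb. apply (ex_series_le (K := R_AbsRing) (V := R_CompleteNormedModule) a b); auto. Qed.

Lemma Series_abs_le (a b : nat -> R) : (forall n, Rabs (a n) <= b n) -> ex_series b -> Rabs (Series a) <= Series b.
Proof.
  intros H Hb. assert (Ha : ex_series (fun n => Rabs (a n))).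
  { apply ex_series_dom with b; auto. intros n. rewrite Rabs_Rabsolu. auto. }
  eapply Rle_trans; [apply Series_Rabs; auto|]. apply Series_le; auto.
  intros n; split; auto. apply Rabs_pos.
Qed.

(** The cut-off [N] depends on the majorant only, and this is the uniformity that [tannery]
    needs. *)
Lemma series_tail (b : nat -> R) : ex_series b -> forall eps, 0 < eps -> exists N, forall a,
  (forall n, Rabs (a n) <= b n) -> Rabs (Series a - sum_n a N) <= eps.
Proof.
  intros Hb eps He.
  assert (HS := Series_correct b Hb).
  assert (HL : is_lim_seq (sum_n b) (Series b)) by exact HS.
  apply is_lim_seq_spec in HL. destruct (HL (mkposreal eps He)) as [N HN]. simpl in HN.
  exists N. intros a Ha.
  assert (Hea : ex_series a) by (apply ex_series_dom with b; auto).
  assert (Ea : Series a - sum_n a N = Series (fun k => a (S N + k)%nat)).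
  { rewrite (Series_incr_n a (S N)) by (auto; lia). simpl pred. rewrite sum_n_Reals. ring. }
  assert (Eb : Series b - sum_n b N = Series (fun k => b (S N + k)%nat)).
  { rewrite (Series_incr_n b (S N)) by (auto; lia). simpl pred. rewrite sum_n_Reals. ring. }
  rewrite Ea. eapply Rle_trans; [apply (Series_abs_le _ (fun k => b (S N + k)%nat)); auto|].
  - apply (ex_series_incr_n b (S N)). exact Hb.
  - rewrite <- Eb. specialize (HN N (Nat.le_refl N)). rewrite Rabs_minus_sym in HN.
    apply Rabs_def2 in HN. lra.
Qed.

Lemma filterlim_sum_n {T : Type} (F : (T -> Prop) -> Prop) {FF : Filter F} (a : nat -> T -> R) (l : nat -> R) N :
  (forall n, filterlim (a n) F (locally (l n))) ->
  filterlim (fun t => sum_n (fun n => a n t) N) F (locally (sum_n l N)).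
Proof.
  intros H. induction N as [|N IH].
  - rewrite sum_O. apply filterlim_ext with (a 0%nat); [intros; now rewrite sum_O|]. apply H.
  - rewrite sum_Sn. apply filterlim_ext with (fun t => sum_n (fun n => a n t) N + a (S N) t).
    + intros; now rewrite sum_Sn.
    + apply filterlim_Rplus; auto.
Qed.

(** Dominated convergence for series along any filter: a finite part converges termwise and the
    tails are uniformly small. It yields continuity, termwise differentiation and the Abel limit
    alike. *)
Lemma tannery {T : Type} (F : (T -> Prop) -> Prop) {FF : Filter F} (a : nat -> T -> R) (l b : nat -> R) :
  ex_series b -> (forall n, Rabs (l n) <= b n) ->
  F (fun t => forall n, Rabs (a n t) <= b n) ->
  (forall n, filterlim (a n) F (locally (l n))) ->
  filterlim (fun t => Series (fun n => a n t)) F (locally (Series l)).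
Proof.
  intros Hb Hl Ha Hlim. apply filterlim_R; auto. intros eps He.
  destruct (series_tail b Hb (eps / 4) ltac:(lra)) as [N HN].
  assert (HS := flim_elim (filterlim_sum_n F a l N Hlim) (eps / 4) ltac:(lra)).
  generalize (filter_and _ _ Ha HS). apply filter_imp. intros t [H1 H2].
  assert (K1 := HN (fun n => a n t) H1). assert (K2 := HN l Hl).
  set (A := sum_n (fun n => a n t) N) in *. set (B := sum_n l N) in *.
  apply Rabs_def2 in H2. apply Rabs_le_between in K1. apply Rabs_le_between in K2. apply Rabs_def1; lra.
Qed.

Lemma series_cont {V : NormedModule R_AbsRing} (D : V -> Prop) (a : nat -> V -> R) (b : nat -> R) :
  ex_series b -> (forall n, cont_on D (a n)) -> (forall n x, D x -> Rabs (a n x) <= b n) ->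
  cont_on D (fun x => Series (fun n => a n x)).
Proof.
  intros Hb Hc Ha x Dx. apply (tannery _ a (fun n => a n x) b); auto.
  - unfold within. apply filter_forall. auto.
  - intros n. now apply Hc.
Qed.

(** The mean value theorem replaces the difference quotient of the n-th term by a value of [g n] on
    the segment, so a bound on [g n] near [x] is a majorant for the quotients. *)
Lemma series_deriv {V : NormedModule R_AbsRing} (D : V -> Prop) (a g : nat -> V -> R) (b0 b : nat -> R) (x v : V) :
  segm D -> D x -> (forall n, cont_on D (a n)) ->
  (forall n y, D y -> is_deriv_within D (a n) y v (g n y)) ->
  ex_series b0 -> (forall n y, D y -> Rabs (a n y) <= b0 n) ->
  ex_series b -> (exists d, 0 < d /\ forall n (h : R), Rabs h < d -> D (plus x (scal h v)) -> Rabs (g n (plus x (scal h v))) <= b n) ->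
  is_deriv_within D (fun y => Series (fun n => a n y)) x v (Series (fun n => g n x)).
Proof.
  intros HS Dx Hc Hd Hb0 Ha Hb [d [Hdp Hg]]. apply dw_lim.
  destruct (HS x v Dx) as [d' [Hd' Hseg]].
  apply filterlim_ext_loc with (fun h : R => Series (fun n => (a n (plus x (scal h v)) - a n x) / h)).
  - generalize (line_ne D x v). apply filter_imp. intros h [Hn HD].
    assert (E1 : ex_series (fun n => a n (plus x (scal h v)))) by (apply ex_series_dom with b0; auto).
    assert (E2 : ex_series (fun n => a n x)) by (apply ex_series_dom with b0; auto).
    rewrite <- Series_minus by auto. unfold Rdiv. now rewrite <- Series_scal_r.
  - apply (tannery _ (fun n (h : R) => (a n (plus x (scal h v)) - a n x) / h) (fun n => g n x) b); auto.
    + intros n. specialize (Hg n 0). rewrite plus_scal_0 in Hg. apply Hg; auto. now rewrite Rabs_R0.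
    + apply line_intro. exists (Rmin d d'). split; [now apply Rmin_glb_lt|]. intros h Hn Hh HD n.
      generalize (Rmin_l d d') (Rmin_r d d'). intros M1 M2.
      destruct (seg_MVT D (a n) (fun y => h * g n y) x (scal h v)) as [s [Hs E]]; auto.
      * intros s Hs. rewrite scal_scal. apply Hseg; auto. lra.
      * intros y Dy. apply dw_scal. auto.
      * rewrite E, scal_scal. unfold Rdiv. rewrite (Rmult_comm h), Rmult_assoc, Rinv_r, Rmult_1_r by auto.
        apply Hg.
        -- rewrite Rabs_mult, (Rabs_pos_eq s) by lra. generalize (Rabs_pos h). nra.
        -- apply Hseg; auto. lra.
    + intros n. exact (Hd n x Dx).
Qed.

Lemma ex_series_inv_sq : ex_series (fun k => / (INR k + 1) ^ 2).
Proof.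
  assert (HP : forall k, 0 < INR k + 1) by (intros; generalize (pos_INR k); lra).
  apply ex_series_dom with (fun k => 2 * (/ (INR k + 1) - / (INR k + 1 + 1))).
  - intros k. specialize (HP k). rewrite Rabs_pos_eq.
    + replace (2 * (/ (INR k + 1) - / (INR k + 1 + 1))) with (2 / ((INR k + 1) * (INR k + 1 + 1))) by (field; lra).
      apply (Rmult_le_reg_r ((INR k + 1) ^ 2 * (INR k + 1 + 1))); [apply Rmult_lt_0_compat; [apply pow_lt; lra|lra]|].
      replace (/ (INR k + 1) ^ 2 * ((INR k + 1) ^ 2 * (INR k + 1 + 1))) with (INR k + 1 + 1) by (field; lra).
      replace (2 / ((INR k + 1) * (INR k + 1 + 1)) * ((INR k + 1) ^ 2 * (INR k + 1 + 1))) with (2 * (INR k + 1)) by (field; lra).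
      generalize (pos_INR k); lra.
    + left. apply Rinv_0_lt_compat. apply pow_lt; lra.
  - apply (ex_series_scal_l (K := R_AbsRing) (V := R_NormedModule) 2).
    exists 1. change (is_lim_seq (sum_n (fun k => / (INR k + 1) - / (INR k + 1 + 1))) 1).
    apply is_lim_seq_ext with (fun n => 1 - / (INR n + 1 + 1)).
    + intros n. induction n as [|n IH].
      * rewrite sum_O. simpl. field.
      * rewrite sum_Sn, <- IH. rewrite S_INR. unfold plus; simpl. field.
        generalize (pos_INR n). lra.
    + replace 1 with (1 - 0) at 1 by ring.
      apply (is_lim_seq_minus' (fun _ => 1) (fun n => / (INR n + 1 + 1))); [apply is_lim_seq_const|].
      replace (Finite 0) with (Rbar_inv p_infty) by reflexivity.
      apply is_lim_seq_inv; [|discriminate].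
      apply is_lim_seq_ext with (fun n => INR (n + 2)).
      * intros n. rewrite plus_INR. simpl. ring.
      * apply (is_lim_seq_incr_n INR 2). apply is_lim_seq_INR.
Qed.

(** * Decay of the projections *)

(** It acts on bidegree (p, q) by 1 + mu, which is at least p + q + 1: each application gains one
    power of the degree. *)
Definition Hop (f : C2 -> R) : C2 -> R := fun p => f p + - / 2 * Lop f p.
Lemma smooth_Hop f : smooth_S3 f -> smooth_S3 (Hop f).
Proof. intros. unfold Hop. auto with sm. Qed.
#[global] Hint Resolve smooth_Hop : sm.

Lemma pr_Hop p q f x : smooth_S3 f -> S3 x -> pr p q (Hop f) x = (1 + mu p q) * pr p q f x.
Proof.
  intros Hf Hx. unfold Hop. rewrite pr_plus, pr_scal, pr_L by auto with sm. field.
Qed.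

Lemma pr_bound p q f M x : contS f -> (forall y, S3 y -> Rabs (f y) <= M) -> S3 x ->
  Rabs (pr p q f x) <= (INR (p + q) + 1) ^ 2 * M.
Proof.
  intros Hf HM Hx. assert (HV := Vol_pos). assert (Hk : 0 < INR (p + q) + 1) by (generalize (pos_INR (p + q)); lra).
  unfold pr. rewrite Rabs_mult, Rabs_pos_eq by (apply Rdiv_le_0_compat; lra).
  assert (H : Rabs (IS (fun y => f y * ker p q x y)) <= (M * (INR (p + q) + 1)) * Vol).
  { apply IS_abs; auto with sm. intros y Hy. rewrite Rabs_mult.
    apply Rmult_le_compat; try apply Rabs_pos; auto. now apply ker_bound. }
  apply Rle_trans with ((INR (p + q) + 1) / Vol * ((M * (INR (p + q) + 1)) * Vol)).
  - apply Rmult_le_compat_l; auto. apply Rdiv_le_0_compat; lra.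
  - right. field. lra.
Qed.

Lemma mu_ge p q : INR (p + q) + 1 <= 1 + mu p q.
Proof. unfold mu. rewrite plus_INR. generalize (pos_INR p) (pos_INR q). nra. Qed.

(** Five applications of [Hop] gain five powers of p + q + 1 and [pr_bound] costs two. The remaining
    three leave a summable square once the k + 1 projections of degree k are added. *)
Lemma pr_decay f : smooth_S3 f -> exists M, 0 < M /\ forall p q x, S3 x ->
  Rabs (pr p q f x) <= M / (INR (p + q) + 1) ^ 3.
Proof.
  intros Hf. set (h := Hop (Hop (Hop (Hop (Hop f))))).
  assert (Hh : smooth_S3 h) by (unfold h; repeat apply smooth_Hop; exact Hf).
  destruct (contS_bounded h (smooth_contS h Hh)) as [M [HM0 HM]].
  exists M; split; auto. intros p q x Hx.
  assert (E : pr p q h x = (1 + mu p q) ^ 5 * pr p q f x).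
  { unfold h. rewrite !pr_Hop by (try (repeat apply smooth_Hop; exact Hf); exact Hx). ring. }
  assert (B := pr_bound p q h M x (smooth_contS h Hh) HM Hx). rewrite E in B.
  set (k := INR (p + q) + 1) in *. assert (Hk : 0 < k) by (unfold k; generalize (pos_INR (p + q)); lra).
  assert (Hm : k <= 1 + mu p q) by apply mu_ge.
  rewrite Rabs_mult, (Rabs_pos_eq ((1 + mu p q) ^ 5)) in B by (apply pow_le; lra).
  assert (B2 : k ^ 5 * Rabs (pr p q f x) <= k ^ 2 * M).
  { eapply Rle_trans; [|exact B]. apply Rmult_le_compat_r; [apply Rabs_pos|]. apply pow_incr. lra. }
  apply (Rmult_le_reg_l (k ^ 5)); [now apply pow_lt|].
  replace (k ^ 5 * (M / k ^ 3)) with (k ^ 2 * M) by (field; lra). exact B2.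
Qed.

Fixpoint rsum (f : nat -> R) (n : nat) : R := match n with O => 0 | S n' => rsum f n' + f n' end.
Lemma rsum_ext f g n : (forall i, (i < n)%nat -> f i = g i) -> rsum f n = rsum g n.
Proof. induction n; simpl; intros H; auto. rewrite IHn, H; auto. Qed.
Lemma rsum_plus f g n : rsum (fun i => f i + g i) n = rsum f n + rsum g n.
Proof. induction n; simpl; [ring|rewrite IHn; ring]. Qed.
Lemma rsum_scal c f n : rsum (fun i => c * f i) n = c * rsum f n.
Proof. induction n; simpl; [ring|rewrite IHn; ring]. Qed.
Lemma rsum_bound f n M : (forall i, (i < n)%nat -> Rabs (f i) <= M) -> Rabs (rsum f n) <= INR n * M.
Proof.
  induction n; intros H.
  - simpl. rewrite Rabs_R0. lra.
  - rewrite S_INR. simpl rsum. eapply Rle_trans; [apply Rabs_triang|].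
    assert (Rabs (f n) <= M) by (apply H; lia). assert (Rabs (rsum f n) <= INR n * M) by (apply IHn; intros; apply H; lia). lra.
Qed.

(** The double series over (p, q) is grouped by total degree, which gives simple series and, for the
    multiplier 1, the Chebyshev kernels. *)
Definition blk (m : nat -> nat -> R) (f : C2 -> R) (k : nat) (x : C2) : R :=
  rsum (fun q => m (k - q)%nat q * pr (k - q) q f x) (S k).

Definition bounded_by (B : R) (m : nat -> nat -> R) : Prop := forall p q, Rabs (m p q) <= B.

Definition dec (M : R) (k : nat) : R := M * / (INR k + 1) ^ 2.
Lemma ex_series_decay M : ex_series (dec M).
Proof. apply (ex_series_scal_l (K := R_AbsRing) (V := R_NormedModule) M). apply ex_series_inv_sq. Qed.

Lemma blk_decay f : smooth_S3 f -> exists M, 0 < M /\ forall B m k x, 0 <= B -> bounded_by B m -> S3 x ->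
  Rabs (blk m f k x) <= dec (B * M) k.
Proof.
  intros Hf. destruct (pr_decay f Hf) as [M [HM0 HM]]. exists M; split; auto.
  intros B m k x HB Hm Hx. unfold blk, dec. assert (Hk : 0 < INR k + 1) by (generalize (pos_INR k); lra).
  replace (B * M * / (INR k + 1) ^ 2) with (INR (S k) * (B * (M / (INR k + 1) ^ 3))) by (rewrite S_INR; field; lra).
  apply rsum_bound. intros q Hq. rewrite Rabs_mult. apply Rmult_le_compat; try apply Rabs_pos; [apply Hm|].
  specialize (HM (k - q)%nat q x Hx). now replace (k - q + q)%nat with k in HM by lia.
Qed.

Lemma smooth_rsum (F : nat -> C2 -> R) n : (forall i, smooth_S3 (F i)) -> smooth_S3 (fun x => rsum (fun i => F i x) n).
Proof. intros H. induction n; simpl; auto with sm. Qed.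

Lemma smooth_blk m f k : smooth_S3 f -> smooth_S3 (blk m f k).
Proof. intros Hf. apply (smooth_rsum (fun q x => m (k - q)%nat q * pr (k - q) q f x)). auto with sm. Qed.
#[global] Hint Resolve smooth_blk : sm.

Lemma blk_ext m f g k x : (forall y, S3 y -> f y = g y) -> blk m f k x = blk m g k x.
Proof. intros E. apply rsum_ext. intros. f_equal. now apply pr_ext. Qed.

Lemma blk_plus m f g k x : smooth_S3 f -> smooth_S3 g -> blk m (fun y => f y + g y) k x = blk m f k x + blk m g k x.
Proof.
  intros. unfold blk. rewrite <- rsum_plus. apply rsum_ext. intros. rewrite pr_plus by auto with sm. ring.
Qed.
Lemma blk_scal m c f k x : smooth_S3 f -> blk m (fun y => c * f y) k x = c * blk m f k x.
Proof.
  intros. unfold blk. rewrite <- rsum_scal. apply rsum_ext. intros. rewrite pr_scal by auto with sm. ring.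
Qed.

Lemma Dv_rsum A (F : nat -> C2 -> R) n x : lin A -> (forall i, smooth_S3 (F i)) -> S3 x ->
  Dv A (fun x => rsum (fun i => F i x) n) x = rsum (fun i => Dv A (F i) x) n.
Proof.
  intros HA HF Hx. induction n; simpl; [apply Dv_const|].
  rewrite Dv_plus; auto; [now rewrite IHn|]. now apply smooth_rsum.
Qed.

Lemma Dv_blk m A f k x : unitary A -> smooth_S3 f -> S3 x -> Dv A (blk m f k) x = blk m (Dv A f) k x.
Proof.
  intros HA Hf Hx.
  transitivity (rsum (fun q => Dv A (fun x => m (k - q)%nat q * pr (k - q) q f x) x) (S k)).
  { apply (Dv_rsum A (fun q x => m (k - q)%nat q * pr (k - q) q f x) (S k) x); auto with sm. }
  apply rsum_ext. intros i _. rewrite Dv_scal by auto with sm. now rewrite Dv_pr.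
Qed.

(** * Multipliers *)

Definition mult_op (m : nat -> nat -> R) (f : C2 -> R) (x : C2) : R := Series (fun k => blk m f k x).

Lemma ex_blk B m f x : 0 <= B -> bounded_by B m -> smooth_S3 f -> S3 x -> ex_series (fun k => blk m f k x).
Proof.
  intros HB Hm Hf Hx. destruct (blk_decay f Hf) as [M [_ HM]].
  apply ex_series_dom with (dec (B * M)); [|apply ex_series_decay]. intros; now apply HM.
Qed.

Lemma mult_op_bound f : smooth_S3 f -> exists M, 0 < M /\ forall B m x, 0 <= B -> bounded_by B m -> S3 x ->
  Rabs (mult_op m f x) <= B * M.
Proof.
  intros Hf. destruct (blk_decay f Hf) as [M [HM0 HM]].
  exists (Series (dec M)).
  assert (Hpos : forall k, 0 < dec M k).
  { intros k. unfold dec. apply Rmult_lt_0_compat; auto. apply Rinv_0_lt_compat, pow_lt. generalize (pos_INR k); lra. }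
  split.
  - rewrite Series_incr_1 by apply ex_series_decay.
    assert (0 <= Series (fun k => dec M (S k))).
    { eapply Rle_trans; [apply Rabs_pos|apply (Series_abs_le (fun _ => 0))].
      - intros n. rewrite Rabs_R0. left; apply Hpos.
      - apply (ex_series_incr_1 (dec M)). apply ex_series_decay. }
    specialize (Hpos 0%nat). lra.
  - intros B m x HB Hm Hx. replace (B * Series (dec M)) with (Series (dec (B * M))).
    + apply Series_abs_le; [|apply ex_series_decay]. intros; now apply HM.
    + rewrite <- Series_scal_l. apply Series_ext. intros; unfold dec; ring.
Qed.

Lemma open_cone0 : open cone0.
Proof. exact cone0_open. Qed.

Lemma loc_bound {V : NormedModule R_AbsRing} (D : V -> Prop) (c : V -> R) (x v : V) :
  cont_on D c -> D x -> exists d C, 0 < d /\ 0 <= C /\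
    forall h : R, Rabs h < d -> D (plus x (scal h v)) -> Rabs (c (plus x (scal h v))) <= C.
Proof.
  intros Hc Dx. assert (H := flim_elim (Hc x Dx) 1 Rlt_0_1).
  rewrite <- (plus_scal_0 x v) in H at 1. assert (H1 := filterlim_line D x v 0 _ H).
  apply locally_R in H1. destruct H1 as [d [Hd H1]].
  exists d, (Rabs (c x) + 1). split; [auto|split; [generalize (Rabs_pos (c x)); lra|]].
  intros h Hh HD. rewrite <- (Rminus_0_r h) in Hh. specialize (H1 h Hh HD).
  set (y := c (plus x (scal h v))) in *. replace y with ((y - c x) + c x) by ring.
  eapply Rle_trans; [apply Rabs_triang|]. lra.
Qed.

Definition lsum {V I : Type} (l : list ((V -> R) * I)) (y : V) (phi : I -> R) : R :=
  fold_right (fun cj s => fst cj y * phi (snd cj) + s) 0 l.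

(** A system of series closed under derivation, with smooth coefficients, consists of smooth
    functions: its members and the smooth functions generate a class to which [smooth_alg] applies.
    Only a majorant for each member is needed, since the derivatives are combinations of other
    members. *)
Lemma series_smooth {V : NormedModule R_AbsRing} (D : V -> Prop) (I : Type) (A : I -> nat -> V -> R) :
  segm D -> (forall i n, cont_on D (A i n)) ->
  (forall i, exists b, ex_series b /\ forall n y, D y -> Rabs (A i n y) <= b n) ->
  (forall i v, exists l : list ((V -> R) * I), (forall cj, In cj l -> smooth_on D (fst cj)) /\
     forall n y, D y -> is_deriv_within D (A i n) y v (lsum l y (fun j => A j n y))) ->
  (forall i, smooth_on D (fun y => Series (fun n => A i n y))) /\
  (forall i v l, (forall cj, In cj l -> smooth_on D (fst cj)) ->
     (forall n y, D y -> is_deriv_within D (A i n) y v (lsum l y (fun j => A j n y))) ->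
     forall y, D y -> is_deriv_within D (fun y => Series (fun n => A i n y)) y v
       (lsum l y (fun j => Series (fun n => A j n y)))).
Proof.
  intros HS Hc Hb Hd.
  assert (Hder : forall i v l, (forall cj, In cj l -> smooth_on D (fst cj)) ->
     (forall n y, D y -> is_deriv_within D (A i n) y v (lsum l y (fun j => A j n y))) ->
     forall y, D y -> is_deriv_within D (fun y => Series (fun n => A i n y)) y v
       (lsum l y (fun j => Series (fun n => A j n y)))).
  { intros i v l Hl Hdl y Dy.
    assert (E : lsum l y (fun j => Series (fun n => A j n y)) = Series (fun n => lsum l y (fun j => A j n y))
       /\ ex_series (fun n => lsum l y (fun j => A j n y))).
    { clear Hl Hdl. induction l as [|[c j] l [IH1 IH2]]; simpl.
      - split.
        + rewrite (Series_ext _ (fun _ => 0 * 0)) by (intros; ring). rewrite Series_scal_l. ring.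
        + apply ex_series_dom with (dec 0); [|apply ex_series_decay]. intros n. rewrite Rabs_R0. unfold dec. lra.
      - assert (Ej : ex_series (fun n => c y * A j n y)).
        { destruct (Hb j) as [b [Hb1 Hb2]].
          apply (ex_series_scal_l (K := R_AbsRing) (V := R_NormedModule) (c y)).
          apply ex_series_dom with b; auto. }
        split.
        + rewrite IH1, Series_plus, Series_scal_l; auto.
        + apply (ex_series_plus (K := R_AbsRing) (V := R_NormedModule) (fun n => c y * A j n y)); auto. }
    rewrite (proj1 E). destruct (Hb i) as [b0 [Hb0 Hb0']].
    assert (HL : exists b d, ex_series b /\ 0 < d /\ forall n (h : R), Rabs h < d -> D (plus y (scal h v)) ->
       Rabs (lsum l (plus y (scal h v)) (fun j => A j n (plus y (scal h v)))) <= b n).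
    { clear E Hdl. induction l as [|[c j] l IH].
      - exists (dec 0), 1. split; [apply ex_series_decay|split; [lra|]]. intros. simpl. rewrite Rabs_R0. unfold dec; lra.
      - destruct IH as [b [d [H1 [H2 H3]]]]; [intros; apply Hl; now right|].
        destruct (Hb j) as [bj [Hbj Hbj']].
        destruct (loc_bound D c y v) as [dc [C [Hdc [HC HB]]]]; auto.
        { apply smooth_on_cont. apply (Hl (c, j)). now left. }
        exists (fun n => C * bj n + b n), (Rmin d dc). split; [|split].
        + apply (ex_series_plus (K := R_AbsRing) (V := R_NormedModule) (fun n => C * bj n)); auto.
          now apply (ex_series_scal_l (K := R_AbsRing) (V := R_NormedModule) C).
        + now apply Rmin_glb_lt.
        + intros n h Hh HD. generalize (Rmin_l d dc) (Rmin_r d dc). intros M1 M2. simpl.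
          eapply Rle_trans; [apply Rabs_triang|]. apply Rplus_le_compat.
          * rewrite Rabs_mult. apply Rmult_le_compat; try apply Rabs_pos; auto. apply HB; auto. lra.
          * apply H3; auto. lra. }
    destruct HL as [b [d [H1 [H2 H3]]]].
    apply (series_deriv D (A i) (fun n y => lsum l y (fun j => A j n y)) b0 b); auto. exists d; auto. }
  split; auto.
  intros i.
  apply (smooth_alg D (fun F => smooth_on D F \/ exists i, F = fun y => Series (fun n => A i n y))).
  - intros f [Hf|[j ->]]; [now apply smooth_on_cont|].
    destruct (Hb j) as [b [Hb1 Hb2]]. now apply (series_cont D (A j) b).
  - intros f v [Hf|[j ->]].
    + destruct (smooth_on_deriv D f v Hf) as [g [Hg1 Hg2]]. exists g; split; auto. apply alg_base; auto.
    + destruct (Hd j v) as [l [Hl1 Hl2]].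
      exists (fun y => lsum l y (fun j => Series (fun n => A j n y))). split; [|now apply Hder].
      clear Hl2. induction l as [|[c k] l IH]; simpl; [apply alg_const|].
      apply (alg_plus _ (fun y => c y * Series (fun n => A k n y))).
      * apply alg_mult; apply alg_base; [left; apply (Hl1 (c, k)); now left|right; now exists k].
      * apply IH. intros; apply Hl1; now right.
  - apply alg_base. right. now exists i.
Qed.

(** The index set of the systems of series: each smooth function g labels the series made from its
    projections. *)
Definition SF : Type := { g : C2 -> R | smooth_S3 g }.
Definition sfD (A : C2 -> C2) (HA : lin A) (g : SF) : SF := exist _ (Dv A (proj1_sig g)) (smooth_S3_Dv A _ HA (proj2_sig g)).
(** Coefficient of a rotation in the expansion of the direction v given by [dirD_rot]. *)
Definition rcoef (A : C2 -> C2) (v x : C2) : R := / nsq x * dot v (A x).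

Lemma smooth_rcoef A v : lin A -> smooth_on cone0 (rcoef A v).
Proof.
  intros HA. apply smooth_mult.
  - apply smooth_inv; [|apply smooth_nsq]. intros x Hx. apply cone0_nz in Hx. apply nsq_pos in Hx. lra.
  - unfold dot, sum4. repeat apply smooth_plus; apply smooth_mult; auto using smooth_const, smooth_lin.
Qed.

Lemma dirD_rcoef f x v : smooth_S3 f -> cone0 x ->
  dirD v (ext f) x = rcoef rot1 v x * ext (Dv rot1 f) x + (rcoef rot2 v x * ext (Dv rot2 f) x
     + (rcoef rot3 v x * ext (Dv rot3 f) x + 0)).
Proof.
  intros Hf Hx. rewrite (dirD_rot (fun _ => True)); auto using cone0_open, open_cone0. unfold rcoef. ring.
Qed.

Definition Dlist (v : C2) (g : SF) : list ((C2 -> R) * SF) :=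
  (rcoef rot1 v, sfD rot1 lin_rot1 g) :: (rcoef rot2 v, sfD rot2 lin_rot2 g) ::
  (rcoef rot3 v, sfD rot3 lin_rot3 g) :: nil.

Lemma Dlist_smooth v g cj : In cj (Dlist v g) -> smooth_on cone0 (fst cj).
Proof. intros [<-|[<-|[<-|[]]]]; simpl; auto using smooth_rcoef, lin_rot1, lin_rot2, lin_rot3. Qed.

Lemma ext_blk m f k x : x <> zero -> forall A, unitary A -> smooth_S3 f ->
  ext (Dv A (blk m f k)) x = ext (blk m (Dv A f) k) x.
Proof. intros Hx A HA Hf. unfold ext. apply Dv_blk; auto. now apply S3_proj. Qed.

(** A derivative of the series labelled by g is a combination of the series labelled by the rotated
    functions [Dv A g], because the rotations commute with the blocks; so the system is closed in
    the sense of [series_smooth]. *)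
Lemma static B m : 0 <= B -> bounded_by B m ->
  (forall g, smooth_S3 g -> smooth_S3 (mult_op m g)) /\
  (forall g : SF, forall v y, cone0 y -> is_deriv_within cone0 (ext (mult_op m (proj1_sig g))) y v
     (lsum (Dlist v g) y (fun j => ext (mult_op m (proj1_sig j)) y))).
Proof.
  intros HB Hm.
  destruct (series_smooth cone0 SF (fun g n => ext (blk m (proj1_sig g) n))) as [H1 H2].
  - apply segm_open, cone0_open.
  - intros [g Hg] n. simpl. apply smooth_on_cont. now apply (smooth_blk m g n).
  - intros [g Hg]. destruct (blk_decay g Hg) as [M [_ HM]]. exists (dec (B * M)). split; [apply ex_series_decay|].
    intros n y Dy. simpl. apply HM; auto. apply S3_proj. exact (proj1 (cone0_nz y) Dy).
  - intros g v. exists (Dlist v g). split; [apply Dlist_smooth|].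
    intros n y Dy. assert (Hg := proj2_sig g).
    assert (E : lsum (Dlist v g) y (fun j => ext (blk m (proj1_sig j) n) y) = dirD v (ext (blk m (proj1_sig g) n)) y).
    { rewrite dirD_rcoef by auto with sm. apply cone0_nz in Dy. rewrite !ext_blk by auto with sm. reflexivity. }
    rewrite E. apply dirD_dw; auto using open_cone0. exact (smooth_blk m (proj1_sig g) n Hg).
  - split.
    + intros g Hg. apply (H1 (exist _ g Hg)).
    + intros g v y Dy. apply (H2 g v (Dlist v g)); [exact (Dlist_smooth v g)| |exact Dy].
      intros n z Dz. assert (Hg := proj2_sig g).
      assert (E : lsum (Dlist v g) z (fun j => ext (blk m (proj1_sig j) n) z) = dirD v (ext (blk m (proj1_sig g) n)) z).
      { rewrite dirD_rcoef by auto with sm. apply cone0_nz in Dz. rewrite !ext_blk by auto with sm. reflexivity. }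
      rewrite E. apply dirD_dw; auto using open_cone0. exact (smooth_blk m (proj1_sig g) n Hg).
Qed.

Lemma smooth_mult_op B m g : 0 <= B -> bounded_by B m -> smooth_S3 g -> smooth_S3 (mult_op m g).
Proof. intros HB Hm. now apply (static B m HB Hm). Qed.

Lemma mult_op_plus B m f g x : 0 <= B -> bounded_by B m -> smooth_S3 f -> smooth_S3 g -> S3 x ->
  mult_op m (fun y => f y + g y) x = mult_op m f x + mult_op m g x.
Proof.
  intros HB Hm Hf Hg Hx. unfold mult_op. rewrite <- Series_plus by now apply (ex_blk B).
  apply Series_ext. intros. now apply blk_plus.
Qed.

Lemma mult_op_scal m c f x : smooth_S3 f -> mult_op m (fun y => c * f y) x = c * mult_op m f x.
Proof.
  intros Hf. unfold mult_op. rewrite <- Series_scal_l. apply Series_ext. intros. now apply blk_scal.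
Qed.

Lemma mult_op_ext m f g x : (forall y, S3 y -> f y = g y) -> mult_op m f x = mult_op m g x.
Proof. intros E. apply Series_ext. intros. now apply blk_ext. Qed.

Lemma smooth_Dv_unit A f : unitary A -> smooth_S3 f -> smooth_S3 (Dv A f).
Proof. auto with sm. Qed.

Lemma Dv_mult_op B m A g x : 0 <= B -> bounded_by B m -> unitary A -> smooth_S3 g -> S3 x ->
  Dv A (mult_op m g) x = mult_op m (Dv A g) x.
Proof.
  intros HB Hm HA Hg Hx. assert (Hc : cone0 x) by now apply cone0_nz, S3_nonzero.
  destruct (static B m HB Hm) as [_ H2]. specialize (H2 (exist _ g Hg) (A x) x Hc).
  cbn [proj1_sig] in H2.
  unfold Dv at 1. rewrite (dirD_unique cone0 _ x (A x) _ cone0_open Hc H2). simpl.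
  rewrite !ext_S3 by auto. unfold mult_op.
  rewrite <- !Series_scal_l.
  assert (S : forall R, unitary R -> ex_series (fun n => rcoef R (A x) x * blk m (Dv R g) n x)).
  { intros R HR. apply (ex_series_scal_l (K := R_AbsRing) (V := R_NormedModule) (rcoef R (A x) x)).
    apply (ex_blk B); auto using smooth_Dv_unit. }
  rewrite Rplus_0_r, <- !Series_plus; auto with sm.
  2:{ apply (ex_series_plus (K := R_AbsRing) (V := R_NormedModule) (fun n => rcoef rot2 (A x) x * blk m (Dv rot2 g) n x)); auto with sm. }
  apply Series_ext. intros n. rewrite <- (Dv_blk m A) by auto.
  unfold Dv at 4. rewrite dirD_rcoef by auto with sm. rewrite !ext_S3, !Dv_blk by auto with sm. ring.
Qed.

Lemma Dv2_mult_op B m A g x : 0 <= B -> bounded_by B m -> unitary A -> smooth_S3 g -> S3 x ->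
  Dv A (Dv A (mult_op m g)) x = mult_op m (Dv A (Dv A g)) x.
Proof.
  intros HB Hm HA Hg Hx.
  rewrite (Dv_ext_S3 A _ (mult_op m (Dv A g))) by (auto with sm; intros; now apply (Dv_mult_op B)).
  apply (Dv_mult_op B); auto using smooth_Dv_unit.
Qed.

Lemma Lop_mult_op B m g x : 0 <= B -> bounded_by B m -> smooth_S3 g -> S3 x ->
  Lop (mult_op m g) x = mult_op m (Lop g) x.
Proof.
  intros HB Hm Hg Hx. unfold Lop at 1. rewrite !(Dv2_mult_op B) by auto with sm.
  assert (S : forall A, unitary A -> smooth_S3 (Dv A (Dv A g))) by auto using smooth_Dv_unit.
  rewrite (mult_op_ext m (Lop g) (fun y => (Dv rot1 (Dv rot1 g) y + Dv rot2 (Dv rot2 g) y) + (Dv rot3 (Dv rot3 g) y + -1 * Dv fieldT (Dv fieldT g) y))).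
  2:{ intros; unfold Lop; ring. }
  rewrite !(mult_op_plus B), mult_op_scal by auto with sm. ring.
Qed.

Lemma Pst_mult_op B m g x : 0 <= B -> bounded_by B m -> smooth_S3 g -> S3 x ->
  Pst (mult_op m g) x = mult_op m (Pst g) x.
Proof.
  intros HB Hm Hg Hx. unfold Pst at 1.
  rewrite (Lop_ext _ (mult_op m (Lop g))) by (auto; intros; now apply (Lop_mult_op B)).
  rewrite (Lop_mult_op B), (Dv2_mult_op B) by auto with sm.
  unfold Pst. rewrite (mult_op_plus B), mult_op_scal by auto with sm. reflexivity.
Qed.

Lemma mult_op_Pst m g x : smooth_S3 g -> S3 x ->
  mult_op m (Pst g) x = Series (fun k => blk (fun p q => m p q * lam p q) g k x).
Proof.
  intros Hg Hx. apply Series_ext. intros k. apply rsum_ext. intros q _. rewrite pr_P by auto. ring.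
Qed.

(** Finite sums of smooth coefficients times [mult_op m g], viewed as functions of the multiplier m.
    Since the coefficients do not involve m, convergence of multipliers passes to every iterated
    derivative. *)
Inductive Good : ((nat -> nat -> R) -> C2 -> R) -> Prop :=
| Good_base g : smooth_S3 g -> Good (fun m => ext (mult_op m g))
| Good_zero : Good (fun _ _ => 0)
| Good_coef c O : smooth_on cone0 c -> Good O -> Good (fun m x => c x * O m x)
| Good_plus O O' : Good O -> Good O' -> Good (fun m x => O m x + O' m x).

Lemma Good_smooth O m : Good O -> bounded_by 1 m -> smooth_on cone0 (O m).
Proof.
  intros HO Hm. induction HO; auto using smooth_plus, smooth_mult, smooth_const.
  now apply (smooth_mult_op 1 m g); [lra| |].
Qed.

Lemma Good_dirD O v : Good O -> exists O', Good O' /\ forall m x, bounded_by 1 m -> cone0 x -> dirD v (O m) x = O' m x.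
Proof.
  intros HO. induction HO as [g Hg| |c O Hc HO [O' [H1 H2]]|O P HO [O' [H1 H2]] HP [P' [H3 H4]]].
  - assert (K : forall A, lin A -> Good (fun m x => rcoef A v x * ext (mult_op m (Dv A g)) x)).
    { intros A HA. apply (Good_coef (rcoef A v) (fun m => ext (mult_op m (Dv A g)))); [now apply smooth_rcoef|]. apply Good_base. auto with sm. }
    eexists. split; [apply Good_plus; [apply (K rot1); auto with sm|apply Good_plus; [apply (K rot2); auto with sm|
      apply Good_plus; [apply (K rot3); auto with sm|apply Good_zero]]]|].
    intros m x Hm Hx. destruct (static 1 m ltac:(lra) Hm) as [_ H2].
    exact (dirD_unique cone0 _ x v _ cone0_open Hx (H2 (exist _ g Hg) v x Hx)).
  - exists (fun _ _ => 0). split; [apply Good_zero|]. intros. apply dirD_const.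
  - exists (fun m x => dirD v c x * O m x + c x * O' m x). split.
    + apply (Good_plus (fun m x => dirD v c x * O m x) (fun m x => c x * O' m x)); apply Good_coef; auto.
      apply smooth_dirD; auto using cone0_open, open_cone0.
    + intros m x Hm Hx. rewrite (dirD_mult cone0) by auto using cone0_open, open_cone0, Good_smooth. now rewrite H2.
  - exists (fun m x => O' m x + P' m x). split; [now apply Good_plus|].
    intros m x Hm Hx. rewrite (dirD_plus cone0) by auto using cone0_open, open_cone0, Good_smooth. now rewrite H2, H4.
Qed.

Lemma Good_iterD s g : smooth_S3 g -> exists O, Good O /\ forall m x, bounded_by 1 m -> cone0 x ->
  iterD s (ext (mult_op m g)) x = O m x.
Proof.
  intros Hg. induction s as [|v s [O [HO E]]].
  - exists (fun m => ext (mult_op m g)). split; [now apply Good_base|]. reflexivity.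
  - destruct (Good_dirD O v HO) as [O' [HO' E']]. exists O'. split; auto.
    intros m x Hm Hx. simpl. rewrite <- E' by auto. apply (dirD_ext_open cone0); auto using cone0_open, open_cone0.
Qed.

(** The operator is linear in the multiplier and bounded by its supremum ([mult_op_bound]); the
    coefficients are bounded on the sphere. *)
Lemma Good_lip O : Good O -> exists C, 0 <= C /\ forall e m m' x, 0 <= e -> bounded_by 1 m -> bounded_by 1 m' ->
  (forall p q, Rabs (m p q - m' p q) <= e) -> S3 x -> Rabs (O m x - O m' x) <= C * e.
Proof.
  intros HO. induction HO as [g Hg| |c O Hc HO [C [HC H]]|O P HO [C [HC H]] HP [C' [HC' H']]].
  - destruct (mult_op_bound g Hg) as [M [HM0 HM]]. exists M. split; [lra|].
    intros e m m' x He Hm Hm' Hd Hx. rewrite !ext_S3 by auto. unfold mult_op.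
    rewrite <- Series_minus by (apply (ex_blk 1); auto; lra).
    rewrite (Series_ext _ (fun k => blk (fun p q => m p q - m' p q) g k x)).
    + rewrite Rmult_comm. apply HM; auto.
    + intros k. unfold blk.
      replace (rsum (fun q => m' (k - q)%nat q * pr (k - q) q g x) (S k)) with (- (rsum (fun q => (-1) * (m' (k - q)%nat q * pr (k - q) q g x)) (S k))) by (rewrite rsum_scal; ring).
      unfold Rminus at 1. rewrite Ropp_involutive, <- rsum_plus. apply rsum_ext. intros; ring.
  - exists 0; split; [lra|]. intros. rewrite Rminus_diag_eq, Rabs_R0 by auto. lra.
  - assert (Hcc : contS c).
    { intros p Hp eps He. assert (Hcp : cone0 p) by now apply cone0_nz, S3_nonzero.
      destruct (flim_elim (smooth_on_cont _ _ Hc p Hcp) eps He) as [d Hd]. exists d; split; [apply cond_pos|].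
      intros q Hq Hcl. apply Hd; [now apply ball_C2|]. apply cone0_nz; now apply S3_nonzero. }
    destruct (contS_bounded c Hcc) as [M [HM0 HM]]. exists (M * C). split; [apply Rmult_le_pos; lra|].
    intros e m m' x He Hm Hm' Hd Hx. rewrite <- Rmult_minus_distr_l, Rabs_mult, Rmult_assoc.
    apply Rmult_le_compat; try apply Rabs_pos; auto.
  - exists (C + C'). split; [lra|]. intros e m m' x He Hm Hm' Hd Hx.
    replace (O m x + P m x - (O m' x + P m' x)) with ((O m x - O m' x) + (P m x - P m' x)) by ring.
    eapply Rle_trans; [apply Rabs_triang|]. rewrite Rmult_plus_distr_r. apply Rplus_le_compat; auto.
Qed.

(** * Completeness of the spherical harmonics *)

Lemma Re_csum f n : Re (csum f n) = rsum (fun i => Re (f i)) n.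
Proof. induction n; simpl; auto. now rewrite <- IHn. Qed.

Lemma contS_rsum (F : nat -> C2 -> R) n : (forall i, contS (F i)) -> contS (fun y => rsum (fun i => F i y) n).
Proof. intros H. induction n; simpl; auto with sm. Qed.

Lemma IS_rsum (F : nat -> C2 -> R) n : (forall i, contS (F i)) ->
  IS (fun y => rsum (fun i => F i y) n) = rsum (fun i => IS (F i)) n.
Proof.
  intros H. induction n; simpl.
  - rewrite IS_const. ring.
  - rewrite (IS_plus (fun y => rsum (fun i => F i y) n)); auto using contS_rsum. now rewrite IHn.
Qed.

(** The substitution a = b in the generating function: the harmonics of total degree k have a kernel
    that depends on the real product only. *)
Lemma rsum_ker k x y : rsum (fun q => ker (k - q) q x y) (S k) = cheb (dot x y) k.
Proof.
  assert (E := dg_K1 (ipc x y) k). apply (f_equal Re) in E. unfold dg in E. rewrite Re_csum in E. exact E.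
Qed.

Lemma contS_cheb x k : contS (fun y => cheb (dot x y) k).
Proof.
  apply contS_ext with (fun y => rsum (fun q => ker (k - q) q x y) (S k)).
  - intros; apply rsum_ker.
  - apply (contS_rsum (fun q y => ker (k - q) q x y)). auto with sm.
Qed.
#[global] Hint Resolve contS_cheb : sm.

Definition one_mult : nat -> nat -> R := fun _ _ => 1.

Lemma one_bounded : bounded_by 1 one_mult.
Proof. intros p q. unfold one_mult. rewrite Rabs_R1. lra. Qed.

Lemma blk_one f k x : contS f -> blk one_mult f k x = (INR k + 1) / Vol * IS (fun y => f y * cheb (dot x y) k).
Proof.
  intros Hf. rewrite (IS_ext _ (fun y => rsum (fun q => f y * ker (k - q) q x y) (S k))).
  2:{ intros. rewrite rsum_scal, rsum_ker. reflexivity. }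
  rewrite (IS_rsum (fun q y => f y * ker (k - q) q x y)) by (intros; auto with sm).
  rewrite <- rsum_scal. unfold blk. apply rsum_ext. intros q Hq. unfold one_mult, pr.
  replace (k - q + q)%nat with k by lia. ring.
Qed.

(** The Poisson kernel of the unit ball of R^4, up to the factor 1 / Vol. *)
Definition poisson (r c : R) : R := (1 - r ^ 2) / (1 - 2 * r * c + r ^ 2) ^ 2.
Definition pb (r : R) (k : nat) : R := r ^ k * (INR k + 1) ^ 2.

Lemma ex_pb r : 0 < r < 1 -> ex_series (pb r).
Proof.
  intros Hr. assert (HP : forall k, 0 < INR k + 1) by (intros; generalize (pos_INR k); lra).
  assert (Hpos : forall k, 0 < pb r k).
  { intros k. unfold pb. apply Rmult_lt_0_compat; apply pow_lt; auto; lra. }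
  apply ex_series_Rabs. apply ex_series_DAlembert with r; [lra| |].
  - intros n. specialize (Hpos n). lra.
  - apply is_lim_seq_ext with (fun n => r * (1 + / (INR n + 1)) * (1 + / (INR n + 1))).
    + intros n. specialize (HP n). rewrite Rabs_pos_eq by (apply Rdiv_le_0_compat; auto; left; auto).
      unfold pb. rewrite S_INR. simpl pow. field. split; [lra|]. apply pow_nonzero; lra.
    + assert (H0 : is_lim_seq (fun n => 1 + / (INR n + 1)) 1).
      { replace (Finite 1) with (Finite (1 + 0)) by (f_equal; ring).
        apply (is_lim_seq_plus' (fun _ => 1)); [apply is_lim_seq_const|].
        replace (Finite 0) with (Rbar_inv p_infty) by reflexivity.
        apply is_lim_seq_inv; [|discriminate].
        apply is_lim_seq_ext with (fun n => INR (n + 1)).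
        - intros n. rewrite plus_INR. simpl. ring.
        - apply (is_lim_seq_incr_n INR 1). apply is_lim_seq_INR. }
      replace (Finite r) with (Finite (r * 1 * 1)) by (f_equal; ring).
      apply (is_lim_seq_mult' (fun n => r * (1 + / (INR n + 1)))); auto.
      apply (is_lim_seq_mult' (fun _ => r)); auto. apply is_lim_seq_const.
Qed.

Lemma den_pos r c : 0 < r < 1 -> -1 <= c <= 1 -> 0 < 1 - 2 * r * c + r ^ 2.
Proof.
  intros Hr Hc. assert (0 < (1 - r) * (1 - r)) by (apply Rmult_lt_0_compat; lra).
  assert (0 <= r * (1 - c)) by (apply Rmult_le_pos; lra). nra.
Qed.

Lemma poisson_dom r c k : 0 < r < 1 -> -1 <= c <= 1 -> Rabs (r ^ k * ((INR k + 1) * cheb c k)) <= pb r k.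
Proof.
  intros Hr Hc. unfold pb. assert (0 < INR k + 1) by (generalize (pos_INR k); lra).
  assert (0 < r ^ k) by (apply pow_lt; lra).
  rewrite !Rabs_mult, (Rabs_pos_eq (r ^ k)), (Rabs_pos_eq (INR k + 1)) by lra.
  apply Rmult_le_compat_l; [lra|]. simpl. rewrite Rmult_1_r. apply Rmult_le_compat_l; [lra|]. now apply cheb_bound.
Qed.

(** Sum r^k U_k and r^k (k + 1) U_k, where U_k is [cheb]; the three-term recursion gives a linear
    equation for each sum. *)
Lemma poisson_series r c : 0 < r < 1 -> -1 <= c <= 1 ->
  Series (fun k => r ^ k * ((INR k + 1) * cheb c k)) = poisson r c.
Proof.
  intros Hr Hc.
  set (a := fun k => r ^ k * cheb c k). set (b := fun k => r ^ k * ((INR k + 1) * cheb c k)).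
  assert (Eb : ex_series b) by (apply ex_series_dom with (pb r); [intros; now apply poisson_dom|now apply ex_pb]).
  assert (Ea : ex_series a).
  { apply ex_series_dom with (pb r); [|now apply ex_pb]. intros k. eapply Rle_trans; [|apply (poisson_dom r c); auto].
    unfold a. rewrite !Rabs_mult. apply Rmult_le_compat_l; [apply Rabs_pos|].
    rewrite (Rabs_pos_eq (INR k + 1)) by (generalize (pos_INR k); lra).
    generalize (Rabs_pos (cheb c k)) (pos_INR k). nra. }
  assert (Ea1 : ex_series (fun k => a (S k))) by now apply (ex_series_incr_1 a).
  assert (Eb1 : ex_series (fun k => b (S k))) by now apply (ex_series_incr_1 b).
  assert (Sa1 := Series_incr_1 a Ea). assert (Sa2 := Series_incr_1 _ Ea1).
  assert (Sb1 := Series_incr_1 b Eb). assert (Sb2 := Series_incr_1 _ Eb1).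
  assert (Ra : Series (fun k => a (S (S k))) = 2 * r * c * Series (fun k => a (S k)) - r ^ 2 * Series a).
  { rewrite <- !Series_scal_l, <- Series_minus.
    - apply Series_ext. intros k. unfold a. rewrite cheb_SS. simpl. ring.
    - now apply (ex_series_scal_l (K := R_AbsRing) (V := R_NormedModule) (2 * r * c)).
    - now apply (ex_series_scal_l (K := R_AbsRing) (V := R_NormedModule) (r ^ 2)). }
  assert (Rb : Series (fun k => b (S (S k))) = (2 * r * c * Series (fun k => b (S k)) - r ^ 2 * Series b)
     + (2 * r * c * Series (fun k => a (S k)) - 2 * r ^ 2 * Series a)).
  { rewrite <- !Series_scal_l, <- !Series_minus.
    2-5: try (now apply (ex_series_scal_l (K := R_AbsRing) (V := R_NormedModule) (2 * r * c)));
      try (now apply (ex_series_scal_l (K := R_AbsRing) (V := R_NormedModule) (r ^ 2)));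
      now apply (ex_series_scal_l (K := R_AbsRing) (V := R_NormedModule) (2 * r ^ 2)).
    rewrite <- Series_plus.
    - apply Series_ext. intros k. unfold a, b. rewrite cheb_SS, !S_INR. simpl. ring.
    - apply (ex_series_minus (K := R_AbsRing) (V := R_NormedModule) (fun n => 2 * r * c * b (S n)) (fun n => r ^ 2 * b n)).
      + now apply (ex_series_scal_l (K := R_AbsRing) (V := R_NormedModule) (2 * r * c)).
      + now apply (ex_series_scal_l (K := R_AbsRing) (V := R_NormedModule) (r ^ 2)).
    - apply (ex_series_minus (K := R_AbsRing) (V := R_NormedModule) (fun n => 2 * r * c * a (S n)) (fun n => 2 * r ^ 2 * a n)).
      + now apply (ex_series_scal_l (K := R_AbsRing) (V := R_NormedModule) (2 * r * c)).
      + now apply (ex_series_scal_l (K := R_AbsRing) (V := R_NormedModule) (2 * r ^ 2)). }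
  cbv beta in Sa2, Sb2. rewrite Ra in Sa2. rewrite Rb in Sb2.
  assert (Va0 : a 0%nat = 1) by (unfold a; simpl; ring).
  assert (Va1 : a 1%nat = 2 * r * c) by (unfold a; simpl; ring).
  assert (Vb0 : b 0%nat = 1) by (unfold b; simpl; ring).
  assert (Vb1 : b 1%nat = 4 * r * c) by (unfold b; simpl; ring).
  rewrite Va0 in Sa1. rewrite Va1 in Sa2. rewrite Vb0 in Sb1. rewrite Vb1 in Sb2.
  set (A := Series a) in *. set (A1 := Series (fun k => a (S k))) in *.
  set (B := Series b) in *. set (B1 := Series (fun k => b (S k))) in *.
  set (Dn := 1 - 2 * r * c + r ^ 2).
  assert (HD : 0 < Dn) by now apply den_pos.
  (* The two linear equations, solved with the common denominator Dn = 1 - 2 r c + r^2. *)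
  assert (EA : A * Dn = 1) by (unfold Dn; replace A1 with (A - 1) in Sa2 by lra; lra).
  assert (EB : B * Dn = 1 + 2 * (r * c - r ^ 2) * A).
  { unfold Dn. replace A1 with (A - 1) in Sb2 by lra. replace B1 with (B - 1) in Sb2 by lra. lra. }
  unfold poisson. fold Dn. apply (Rmult_eq_reg_r (Dn ^ 2)); [|apply pow_nonzero; lra].
  unfold Rdiv. rewrite Rmult_assoc, Rinv_l, Rmult_1_r by (apply pow_nonzero; lra).
  replace (B * Dn ^ 2) with (B * Dn * Dn) by ring. rewrite EB.
  replace ((1 + 2 * (r * c - r ^ 2) * A) * Dn) with (Dn + 2 * (r * c - r ^ 2) * (A * Dn)) by ring. rewrite EA.
  unfold Dn. ring.
Qed.

Lemma dot_bound x y : S3 x -> S3 y -> -1 <= dot x y <= 1.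
Proof.
  intros Hx Hy. apply Rabs_le_between. change (dot x y) with (Re (ipc x y)).
  eapply Rle_trans; [apply re_le_Cmod|]. now apply ipc_le1.
Qed.

Lemma smooth_poisson r x : 0 < r < 1 -> S3 x -> smooth_S3 (fun y => poisson r (dot x y)).
Proof.
  intros Hr Hx. unfold poisson, Rdiv. apply smooth_S3_mult; [apply smooth_S3_const|].
  apply (smooth_inv cone0 (fun y => (1 - 2 * r * dot x (proj y) + r ^ 2) ^ 2)).
  - intros y Hy. apply pow_nonzero. apply cone0_nz, S3_proj in Hy. generalize (den_pos r (dot x (proj y)) Hr (dot_bound _ _ Hx Hy)). lra.
  - apply smooth_pow. apply smooth_plus; [|apply smooth_const]. apply smooth_minus; [apply smooth_const|].
    apply smooth_mult; [apply smooth_const|].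
    unfold dot, sum4. repeat apply smooth_plus; apply smooth_mult; auto using smooth_const; apply smooth_cc_proj.
Qed.
#[global] Hint Resolve smooth_poisson : sm.

Lemma contS_sum_n (F : nat -> C2 -> R) n : (forall i, contS (F i)) -> contS (fun y => sum_n (fun i => F i y) n).
Proof.
  intros H. induction n.
  - apply contS_ext with (F 0%nat); auto. intros; now rewrite sum_O.
  - apply contS_ext with (fun y => sum_n (fun i => F i y) n + F (S n) y); [intros; now rewrite sum_Sn|]. auto with sm.
Qed.

Lemma IS_sum_n (F : nat -> C2 -> R) n : (forall i, contS (F i)) ->
  IS (fun y => sum_n (fun i => F i y) n) = sum_n (fun i => IS (F i)) n.
Proof.
  intros H. induction n.
  - rewrite sum_O. apply IS_ext. intros; now rewrite sum_O.
  - rewrite sum_Sn, <- IHn. rewrite (IS_ext _ (fun y => sum_n (fun i => F i y) n + F (S n) y)) by (intros; now rewrite sum_Sn).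
    apply (IS_plus (fun y => sum_n (fun i => F i y) n)); auto using contS_sum_n.
Qed.

(** Sum and integral are exchanged on a finite part only; the tails are uniformly small in y. *)
Lemma abel_poisson f r x : smooth_S3 f -> 0 < r < 1 -> S3 x ->
  Series (fun k => r ^ k * blk one_mult f k x) = / Vol * IS (fun y => f y * poisson r (dot x y)).
Proof.
  intros Hf Hr Hx. assert (HV := Vol_pos).
  destruct (blk_decay f Hf) as [M [HM0 HM]].
  destruct (contS_bounded f (smooth_contS f Hf)) as [Mf [HMf0 HMf]].
  (* A common majorant of the series of kernels and of the series of blocks, so that one cut-off
     serves both. *)
  set (b := fun k => pb r k + dec (1 * M) k).
  assert (Hb : ex_series b).
  { apply (ex_series_plus (K := R_AbsRing) (V := R_NormedModule) (pb r)); [now apply ex_pb|apply ex_series_decay]. }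
  assert (Hpb : forall k, 0 <= pb r k).
  { intros k. unfold pb. apply Rmult_le_pos; [left; apply pow_lt; lra|apply pow2_ge_0]. }
  assert (Hdec : forall k, 0 <= dec (1 * M) k).
  { intros k. unfold dec. apply Rmult_le_pos; [lra|]. left; apply Rinv_0_lt_compat, pow_lt. generalize (pos_INR k); lra. }
  apply cond_eq. intros eps He.
  assert (He' : 0 < eps / (2 * (1 + Mf))) by (apply Rdiv_lt_0_compat; lra). set (e := eps / (2 * (1 + Mf))) in *.
  destruct (series_tail b Hb e He') as [N HN].
  assert (K1 := HN (fun k => r ^ k * blk one_mult f k x)).
  assert (K2 := fun y (Hy : S3 y) => HN (fun k => r ^ k * ((INR k + 1) * cheb (dot x y) k))).
  assert (Ct : forall i, contS (fun y => f y * (r ^ i * ((INR i + 1) * cheb (dot x y) i)))).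
  { intros i. apply contS_mult; auto with sm. }
  assert (E : sum_n (fun k => r ^ k * blk one_mult f k x) N =
     / Vol * IS (fun y => f y * sum_n (fun k => r ^ k * ((INR k + 1) * cheb (dot x y) k)) N)).
  { rewrite (IS_ext _ (fun y => sum_n (fun k => f y * (r ^ k * ((INR k + 1) * cheb (dot x y) k))) N)).
    2:{ intros y Hy. symmetry. apply (sum_n_mult_l (K := R_Ring)). }
    rewrite (IS_sum_n (fun k y => f y * (r ^ k * ((INR k + 1) * cheb (dot x y) k)))); auto.
    transitivity (sum_n (fun k => / Vol * IS (fun y => f y * (r ^ k * ((INR k + 1) * cheb (dot x y) k)))) N);
      [|apply (sum_n_mult_l (K := R_Ring))].
    apply sum_n_ext. intros k. rewrite blk_one by auto with sm.
    rewrite (IS_ext (fun y => f y * (r ^ k * _)) (fun y => (r ^ k * (INR k + 1)) * (f y * cheb (dot x y) k))) by (intros; ring).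
    rewrite IS_scal by auto with sm. match goal with |- ?a = ?b => change (@eq R a b) end. field. lra. }
  assert (Cs : contS (fun y => sum_n (fun k => r ^ k * ((INR k + 1) * cheb (dot x y) k)) N)).
  { apply (contS_sum_n (fun k y => r ^ k * ((INR k + 1) * cheb (dot x y) k))). auto with sm. }
  assert (B1 : Rabs (/ Vol * IS (fun y => f y * sum_n (fun k => r ^ k * ((INR k + 1) * cheb (dot x y) k)) N)
     - / Vol * IS (fun y => f y * poisson r (dot x y))) <= Mf * e).
  { rewrite <- Rmult_minus_distr_l, <- IS_minus by auto with sm.
    rewrite Rabs_mult, Rabs_pos_eq by (left; now apply Rinv_0_lt_compat).
    apply (Rmult_le_reg_l Vol); auto. rewrite <- Rmult_assoc, Rinv_r, Rmult_1_l by lra.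
    rewrite (Rmult_comm Vol). apply IS_abs; [auto with sm|]. intros y Hy.
    rewrite <- Rmult_minus_distr_l, Rabs_mult. apply Rmult_le_compat; try apply Rabs_pos; auto.
    rewrite Rabs_minus_sym, <- (poisson_series r (dot x y)) by (auto; now apply dot_bound).
    apply K2; auto. intros k. unfold b. eapply Rle_trans; [apply poisson_dom; auto; now apply dot_bound|].
    specialize (Hdec k). lra. }
  assert (B2 : Rabs (Series (fun k => r ^ k * blk one_mult f k x) - sum_n (fun k => r ^ k * blk one_mult f k x) N) <= e).
  { apply K1. intros k. unfold b. rewrite Rabs_mult.
    assert (Hrk : Rabs (r ^ k) <= 1).
    { rewrite <- RPow_abs, Rabs_pos_eq by lra. rewrite <- (pow1 k). apply pow_incr. lra. }
    specialize (HM 1 one_mult k x ltac:(lra) one_bounded Hx). specialize (Hpb k).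
    generalize (Rabs_pos (blk one_mult f k x)). nra. }
  rewrite E in B2.
  match goal with |- Rabs (?a - ?c) < _ => replace (a - c) with ((a - / Vol * IS (fun y => f y * sum_n (fun k => r ^ k * ((INR k + 1) * cheb (dot x y) k)) N)) +
     (/ Vol * IS (fun y => f y * sum_n (fun k => r ^ k * ((INR k + 1) * cheb (dot x y) k)) N) - c)) by ring end.
  eapply Rle_lt_trans; [apply Rabs_triang|].
  apply Rle_lt_trans with (e + Mf * e); [now apply Rplus_le_compat|].
  replace (e + Mf * e) with (eps / 2) by (unfold e; field; lra). lra.
Qed.

Lemma ker_00 x y : ker 0 0 x y = 1.
Proof. reflexivity. Qed.

(** [Lop] integrates to zero, yet multiplies this kernel by a nonzero number. *)
Lemma IS_ker p q x : S3 x -> (0 < p + q)%nat -> IS (fun y => ker p q x y) = 0.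
Proof.
  intros Hx Hpq. assert (E := IS_Lop (fun y => ker p q x y) (smooth_S3_ker2 p q x)).
  rewrite (IS_ext _ (fun y => - (2 * mu p q) * ker p q x y)) in E by (intros; now apply Lop_ker).
  rewrite IS_scal in E by auto with sm.
  assert (Hm : 0 < mu p q).
  { assert (H := mu_ge p q). assert (0 < INR (p + q)) by now apply lt_0_INR. lra. }
  apply Rmult_integral in E. destruct E as [E|E]; auto. lra.
Qed.

Lemma pr_const p q c x : S3 x -> pr p q (fun _ => c) x = match p, q with O, O => c | _, _ => 0 end.
Proof.
  intros Hx. assert (HV := Vol_pos). unfold pr. rewrite IS_scal by auto with sm.
  destruct p as [|p]; destruct q as [|q]; try (rewrite IS_ker by (auto; lia); ring).
  rewrite (IS_ext _ (fun _ => 1)) by (intros; apply ker_00). rewrite IS_const. simpl. field. lra.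
Qed.

Lemma blk_const m c k x : S3 x -> blk m (fun _ => c) k x = match k with O => m 0%nat 0%nat * c | _ => 0 end.
Proof.
  intros Hx. unfold blk. destruct k as [|k].
  - simpl. rewrite pr_const by auto. ring.
  - rewrite (rsum_ext _ (fun i => 0 * 0)); [rewrite rsum_scal; ring|].
    intros q Hq. rewrite pr_const by auto. destruct (S k - q)%nat eqn:F; destruct q; try ring. lia.
Qed.

Lemma Series_first (a : nat -> R) : (forall k, a (S k) = 0) -> Series a = a 0%nat.
Proof.
  intros H. assert (E : ex_series a).
  { apply (ex_series_incr_1 a). apply ex_series_dom with (dec 0); [|apply ex_series_decay].
    intros n. rewrite H, Rabs_R0. unfold dec. lra. }
  rewrite Series_incr_1 by auto. rewrite (Series_ext _ (fun _ => 0 * 0)) by (intros; rewrite H; ring).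
  rewrite Series_scal_l. ring.
Qed.

Lemma poisson_mean r x : 0 < r < 1 -> S3 x -> IS (fun y => poisson r (dot x y)) = Vol.
Proof.
  intros Hr Hx. assert (HV := Vol_pos).
  assert (E := abel_poisson (fun _ => 1) r x (smooth_S3_const 1) Hr Hx).
  rewrite (Series_ext _ (fun k => match k with O => 1 | _ => 0 end)) in E.
  2:{ intros k. rewrite blk_const by auto. destruct k; unfold one_mult; simpl; ring. }
  rewrite Series_first in E by auto.
  rewrite (IS_ext _ (fun y => poisson r (dot x y))) in E by (intros; ring).
  apply (Rmult_eq_reg_l (/ Vol)); [rewrite <- E; field; lra|]. apply Rinv_neq_0_compat; lra.
Qed.

(** Here |x - y|^2 = 2 (1 - <x, y>) is at least d^2, and the denominator 1 - 2 r c + r^2 = (1 - r)^2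
    + 2 r (1 - c) is at least d^2 / 2 since r >= 1/2. *)
Lemma poisson_far r d x y : 1 / 2 <= r < 1 -> 0 < d -> S3 x -> S3 y -> ~ coord_close d x y ->
  0 <= poisson r (dot x y) <= 4 * (1 - r ^ 2) / d ^ 4.
Proof.
  intros Hr Hd Hx Hy Hc.
  assert (Hsq : d ^ 2 <= 2 * (1 - dot x y)).
  { apply not_all_ex_not in Hc. destruct Hc as [i Hi]. apply imply_to_and in Hi. destruct Hi as [Hi1 Hi2].
    apply Rnot_lt_le in Hi2.
    assert (E : 2 * (1 - dot x y) = sum4 (fun i => (cc i y - cc i x) ^ 2)).
    { apply S3_nsq in Hx. apply S3_nsq in Hy. transitivity (nsq x + nsq y - 2 * dot x y); [rewrite Hx, Hy; ring|].
      unfold nsq, dot, sum4. ring. }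
    rewrite E. apply Rle_trans with ((cc i y - cc i x) ^ 2).
    - rewrite <- (pow2_abs (cc i y - cc i x)). apply pow_incr. lra.
    - unfold sum4. assert (H0 := fun j => pow2_ge_0 (cc j y - cc j x)).
      generalize (H0 0%nat) (H0 1%nat) (H0 2%nat) (H0 3%nat). destruct i as [|[|[|[|i]]]]; try lia; lra. }
  assert (Hdb := dot_bound x y Hx Hy).
  set (Dn := 1 - 2 * r * dot x y + r ^ 2).
  assert (HD : d ^ 2 / 2 <= Dn).
  { unfold Dn. assert (0 <= (1 - r) ^ 2) by apply pow2_ge_0. nra. }
  assert (Hd2 : 0 < d ^ 2) by now apply pow_lt.
  assert (HD2 : (d ^ 2 / 2) ^ 2 <= Dn ^ 2) by (apply pow_incr; lra).
  assert (Hr2 : 0 <= 1 - r ^ 2) by nra.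
  unfold poisson. fold Dn. split.
  - apply Rdiv_le_0_compat; auto. apply pow_lt. lra.
  - replace (4 * (1 - r ^ 2) / d ^ 4) with ((1 - r ^ 2) * / (d ^ 2 / 2) ^ 2) by (field; lra).
    apply Rmult_le_compat_l; auto. apply Rinv_le_contravar; auto. apply pow_lt. lra.
Qed.

Lemma poisson_nonneg r c : 0 < r < 1 -> -1 <= c <= 1 -> 0 <= poisson r c.
Proof.
  intros Hr Hc. unfold poisson. apply Rdiv_le_0_compat; [nra|]. apply pow_lt. now apply den_pos.
Qed.

Lemma abel_close f x : smooth_S3 f -> S3 x -> forall eps, 0 < eps -> exists C, 0 <= C /\ forall r, 1 / 2 <= r < 1 ->
  Rabs (/ Vol * IS (fun y => f y * poisson r (dot x y)) - f x) <= eps + C * (1 - r ^ 2).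
Proof.
  intros Hf Hx eps He. assert (HV := Vol_pos).
  destruct (contS_bounded f (smooth_contS f Hf)) as [M [HM0 HM]].
  destruct (smooth_contS f Hf x Hx eps He) as [d [Hd Hc]].
  assert (Hd4 : 0 < d ^ 4) by now apply pow_lt.
  (* Within [d] of x the function varies by less than eps and the kernel has mean 1; elsewhere |f y
     - f x| <= 2 M meets the bound of [poisson_far]. *)
  exists (2 * M * (4 / d ^ 4)). split.
  { apply Rmult_le_pos; [lra|]. left. apply Rdiv_lt_0_compat; lra. }
  intros r Hr. assert (Hr' : 0 < r < 1) by lra.
  assert (E : / Vol * IS (fun y => f y * poisson r (dot x y)) - f x = / Vol * IS (fun y => (f y - f x) * poisson r (dot x y))).
  { rewrite (IS_ext (fun y => (f y - f x) * _) (fun y => f y * poisson r (dot x y) - f x * poisson r (dot x y))) by (intros; ring).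
    rewrite IS_minus, IS_scal, poisson_mean by auto with sm. field. lra. }
  set (K := 2 * M * (4 / d ^ 4) * (1 - r ^ 2)).
  assert (B : forall y, S3 y -> Rabs ((f y - f x) * poisson r (dot x y)) <= eps * poisson r (dot x y) + K).
  { intros y Hy. rewrite Rabs_mult.
    assert (Hp := poisson_nonneg r (dot x y) Hr' (dot_bound x y Hx Hy)). rewrite (Rabs_pos_eq (poisson _ _)) by auto.
    assert (HK : 0 <= K).
    { unfold K. repeat apply Rmult_le_pos; try lra; [left; now apply Rinv_0_lt_compat|nra]. }
    destruct (classic (coord_close d x y)) as [H|H].
    - specialize (Hc y Hy H). assert (Rabs (f y - f x) * poisson r (dot x y) <= eps * poisson r (dot x y)) by (apply Rmult_le_compat_r; lra). lra.
    - destruct (poisson_far r d x y Hr Hd Hx Hy H) as [_ HF].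
      assert (Rabs (f y - f x) <= 2 * M).
      { eapply Rle_trans; [apply Rabs_triang|]. rewrite Rabs_Ropp. generalize (HM y Hy) (HM x Hx). lra. }
      assert (Rabs (f y - f x) * poisson r (dot x y) <= 2 * M * (4 * (1 - r ^ 2) / d ^ 4)).
      { apply Rmult_le_compat; auto. apply Rabs_pos. }
      assert (EK : K = 2 * M * (4 * (1 - r ^ 2) / d ^ 4)) by (unfold K; field; lra).
      assert (0 <= eps * poisson r (dot x y)) by (apply Rmult_le_pos; lra). lra. }
  rewrite E, Rabs_mult, Rabs_pos_eq by (left; now apply Rinv_0_lt_compat).
  apply (Rmult_le_reg_l Vol); auto. rewrite <- Rmult_assoc, Rinv_r, Rmult_1_l by lra.
  fold K. replace (Vol * (eps + K)) with (IS (fun y => eps * poisson r (dot x y) + K)).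
  2:{ rewrite IS_plus, IS_scal, poisson_mean, IS_const by auto with sm. ring. }
  apply Rabs_le. split.
  - rewrite <- (Rmult_1_l (IS (fun y => eps * poisson r (dot x y) + K))), Ropp_mult_distr_l.
    rewrite <- IS_scal by auto 6 with sm. apply IS_le; auto 6 with sm. intros y Hy. specialize (B y Hy). apply Rabs_le_between in B. lra.
  - apply IS_le; auto 6 with sm. intros y Hy. specialize (B y Hy). apply Rabs_le_between in B. lra.
Qed.

(* Abel summation of the expansion in spherical harmonics. *)
Theorem mult_op_one f x : smooth_S3 f -> S3 x -> mult_op one_mult f x = f x.
Proof.
  intros Hf Hx. destruct (blk_decay f Hf) as [M [HM0 HM]].
  assert (L : filterlim (fun r => Series (fun k => r ^ k * blk one_mult f k x)) (at_left 1)
     (locally (Series (fun k => 1 ^ k * blk one_mult f k x)))).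
  { apply (tannery (at_left 1) (fun k r => r ^ k * blk one_mult f k x) (fun k => 1 ^ k * blk one_mult f k x) (dec (1 * M))).
    - apply ex_series_decay.
    - intros k. rewrite pow1, Rmult_1_l. apply HM; auto using one_bounded. lra.
    - exists (mkposreal 1 Rlt_0_1). intros r Hr Hr1 k.
      assert (0 < r).
      { unfold ball in Hr; simpl in Hr; unfold AbsRing_ball, abs, minus, plus, opp in Hr; simpl in Hr. apply Rabs_def2 in Hr. lra. }
      rewrite Rabs_mult. assert (Hrk : Rabs (r ^ k) <= 1).
      { rewrite <- RPow_abs, Rabs_pos_eq by lra. rewrite <- (pow1 k). apply pow_incr. lra. }
      specialize (HM 1 one_mult k x ltac:(lra) one_bounded Hx). generalize (Rabs_pos (blk one_mult f k x)). nra.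
    - intros k.
      assert (H : filterlim (fun r => r ^ k * blk one_mult f k x) (locally 1) (locally (1 ^ k * blk one_mult f k x))).
      { apply (filterlim_Rmult (locally 1) (fun r => r ^ k)); [|apply filterlim_const].
        apply (ex_derive_continuous (V := R_NormedModule) (fun r => r ^ k)). auto_derive. auto. }
      intros P HP. specialize (H P HP). unfold at_left, within, filtermap in *. revert H. apply filter_imp. auto. }
  assert (E1 : Series (fun k => 1 ^ k * blk one_mult f k x) = mult_op one_mult f x).
  { apply Series_ext. intros; rewrite pow1; ring. }
  rewrite E1 in L. apply cond_eq. intros eps He.
  destruct (abel_close f x Hf Hx (eps / 4) ltac:(lra)) as [C [HC HB]].
  assert (F1 := flim_elim L (eps / 4) ltac:(lra)).
  assert (F2 : at_left 1 (fun r => 1 / 2 <= r < 1 /\ C * (1 - r ^ 2) <= eps / 4)).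
  { set (d := Rmin (1 / 2) (eps / (8 * (C + 1)))).
    assert (Hd : 0 < d) by (apply Rmin_glb_lt; [lra|apply Rdiv_lt_0_compat; lra]).
    exists (mkposreal d Hd). intros r Hr Hr1.
    unfold ball in Hr; simpl in Hr; unfold AbsRing_ball, abs, minus, plus, opp in Hr; simpl in Hr. apply Rabs_def2 in Hr.
    assert (d <= 1 / 2) by apply Rmin_l. assert (Hd2 : d <= eps / (8 * (C + 1))) by apply Rmin_r.
    split; [lra|]. assert (1 - r ^ 2 <= 2 * d) by nra.
    apply Rle_trans with (C * (2 * (eps / (8 * (C + 1))))); [apply Rmult_le_compat_l; lra|].
    replace (C * (2 * (eps / (8 * (C + 1))))) with (eps / 4 * (C / (C + 1))) by (field; lra).
    assert (C / (C + 1) <= 1).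
    { apply (Rmult_le_reg_r (C + 1)); [lra|]. unfold Rdiv. rewrite Rmult_assoc, Rinv_l; lra. }
    nra. }
  (* One r close enough to 1 compares the sum of the series with f x through the Abel mean. *)
  destruct (filter_ex _ (filter_and _ _ F1 F2)) as [r [H1 [H2 H3]]].
  specialize (HB r H2). rewrite abel_poisson in H1 by (auto; lra).
  set (A := / Vol * IS (fun y => f y * poisson r (dot x y))) in *.
  apply Rabs_le_between in HB. apply Rabs_def2 in H1. apply Rabs_def1; lra.
Qed.

(** * The flow, its uniqueness and its limit *)

Definition half (t : R_NormedModule) : Prop := 0 <= t.
Definition Dt : spacetime -> Prop := Dprod (W := R_NormedModule) half.
Definition st (t : R) (x : C2) : spacetime := (t, x).

Lemma half_line (t : R) (h : R) (v : R) : plus (t : R_NormedModule) (scal h (v : R_NormedModule)) = t + h * v.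
Proof. reflexivity. Qed.

Lemma segm_half : segm half.
Proof.
  intros x v Hx. exists 1. split; [lra|]. intros h _ HD s Hs. unfold half in *.
  rewrite half_line in *. change (0 <= x + h * v) in HD. change (0 <= x + s * h * v).
  replace (x + s * h * v) with ((1 - s) * x + s * (x + h * v)) by ring.
  apply Rplus_le_le_0_compat; apply Rmult_le_pos; lra.
Qed.

Lemma segm_Dt : segm Dt.
Proof.
  intros [t x] [tau w] [Ht Hx]. simpl in *.
  destruct (segm_half t tau Ht) as [d1 [Hd1 H1]].
  destruct (open_line cone0 x w open_cone0 (proj2 (cone0_nz x) Hx)) as [d2 [Hd2 H2]].
  exists (Rmin d1 d2). split; [now apply Rmin_glb_lt|]. intros h Hh [HD1 HD2] s Hs.
  generalize (Rmin_l d1 d2) (Rmin_r d1 d2). intros M1 M2. split.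
  - apply (H1 h); auto. lra.
  - apply cone0_nz. apply (H2 (s * h)). rewrite Rabs_mult, (Rabs_pos_eq s) by lra. generalize (Rabs_pos h). nra.
Qed.

Lemma dw_linear {V : NormedModule R_AbsRing} (D : V -> Prop) (L : V -> R) x v :
  (forall x v (h : R), L (plus x (scal h v)) = L x + h * L v) -> is_deriv_within D L x v (L v).
Proof.
  intros HL. apply dw_lim. eapply filterlim_ext_loc; [|apply filterlim_const].
  generalize (line_ne D x v). apply filter_imp. intros h [Hn _]. rewrite HL. field; auto.
Qed.

Lemma dw_pull {V W : NormedModule R_AbsRing} (E : V -> Prop) (D : W -> Prop) (pi L : V -> W) f z v l :
  (forall z v (h : R), pi (plus z (scal h v)) = plus (pi z) (scal h (L v))) ->
  (forall z, E z -> D (pi z)) -> is_deriv_within D f (pi z) (L v) l ->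
  is_deriv_within E (fun z => f (pi z)) z v l.
Proof.
  intros HL HE H. apply dw_lim. apply dw_lim in H. apply filterlim_R; [apply line_filter|]. intros eps He.
  destruct (line_elim _ _ _ _ (flim_elim H eps He)) as [d [Hd K]].
  apply line_intro. exists d; split; auto. intros h Hn Hh HD. rewrite HL. apply K; auto. rewrite <- HL. auto.
Qed.

Lemma smooth_time (D : spacetime -> Prop) : smooth_on D (fun y => fst y).
Proof.
  apply linear_smooth; [reflexivity|].
  intros [t x] P [e He]. exists e. intros [t' x'] [H1 H2]. now apply He.
Qed.

Definition et (t : R) (p q : nat) : R := exp (- (2 * t * lam p q)).

Lemma lam_nonneg p q : 0 <= lam p q.
Proof. unfold lam. generalize (pos_INR p) (pos_INR q). intros. repeat apply Rmult_le_pos; lra. Qed.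

Lemma et_bounded t : 0 <= t -> bounded_by 1 (et t).
Proof.
  intros Ht p q. unfold et. assert (H := lam_nonneg p q).
  rewrite Rabs_pos_eq by (left; apply exp_pos). rewrite <- exp_0.
  assert (0 <= 2 * t * lam p q) by (apply Rmult_le_pos; lra).
  destruct (Req_dec (- (2 * t * lam p q)) 0) as [->|N]; [lra|]. left. apply exp_increasing. lra.
Qed.

Definition st_blk (g : SF) (n : nat) : spacetime -> R := fun y => ext (blk (et (fst y)) (proj1_sig g) n) (snd y).

Lemma smooth_et p q : smooth_on Dt (fun y => et (fst y) p q).
Proof.
  unfold et. apply smooth_exp. apply smooth_opp. apply smooth_mult; [|apply smooth_const].
  apply smooth_mult; [apply smooth_const|apply smooth_time].
Qed.

Lemma smooth_snd_st f : smooth_on cone0 f -> smooth_on Dt (fun y => f (snd y)).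
Proof. apply (smooth_snd half). Qed.

Lemma smooth_rsum_gen {V : NormedModule R_AbsRing} (D : V -> Prop) (F : nat -> V -> R) n :
  (forall i, smooth_on D (F i)) -> smooth_on D (fun y => rsum (fun i => F i y) n).
Proof. intros H. induction n; simpl; [apply smooth_const|now apply smooth_plus]. Qed.

Lemma smooth_st_blk g n : smooth_on Dt (st_blk g n).
Proof.
  apply (smooth_rsum_gen Dt (fun q y => et (fst y) (n - q) q * ext (pr (n - q) q (proj1_sig g)) (snd y))).
  intros q. apply smooth_mult; [apply smooth_et|]. apply smooth_snd_st. apply (smooth_pr (n - q) q _ (proj2_sig g)).
Qed.

Lemma dw_rsum {V : NormedModule R_AbsRing} (D : V -> Prop) (F G : nat -> V -> R) n x v :
  (forall i, is_deriv_within D (F i) x v (G i x)) ->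
  is_deriv_within D (fun y => rsum (fun i => F i y) n) x v (rsum (fun i => G i x) n).
Proof. intros H. induction n; simpl; [apply dw_const|now apply dw_plus]. Qed.

(** The time derivative of exp (-2 t lam) pi_pq g is exp (-2 t lam) pi_pq (-2 P g) by [pr_P].
    Absorbing the factor lam into g keeps the system closed with a majorant valid for all t >= 0, t
    = 0 included. *)
Definition sfP (g : SF) : SF :=
  exist _ (fun p => -2 * Pst (proj1_sig g) p) (smooth_S3_scal (-2) _ (smooth_Pst _ (proj2_sig g))).

Definition st_list (v : spacetime) (g : SF) : list ((spacetime -> R) * SF) :=
  ((fun _ => fst v), sfP g) ::
  map (fun cj : (C2 -> R) * SF => ((fun y : spacetime => fst cj (snd y)), snd cj)) (Dlist (snd v) g).

Lemma st_list_smooth v g cj : In cj (st_list v g) -> smooth_on Dt (fst cj).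
Proof.
  intros [<-|H]; [apply (smooth_const (V := spacetime))|].
  apply in_map_iff in H. destruct H as [ck [<- Hk]]. apply (smooth_snd_st (fst ck)). now apply Dlist_smooth in Hk.
Qed.

Lemma st_deriv g n v y : Dt y -> is_deriv_within Dt (st_blk g n) y v (lsum (st_list v g) y (fun j => st_blk j n y)).
Proof.
  intros Hy. assert (Hg := proj2_sig g). cbv beta in Hg. set (f := proj1_sig g) in *.
  assert (Hs : snd y <> zero) by apply Hy. assert (Hc : cone0 (snd y)) by now apply cone0_nz.
  assert (HS : S3 (proj (snd y))) by now apply S3_proj.
  set (V := fun q => pr (n - q) q f).
  assert (Hv : forall q, smooth_S3 (V q)) by (intros; unfold V; auto with sm).
  assert (E : lsum (st_list v g) y (fun j => st_blk j n y) =
    rsum (fun q => (exp (- (2 * fst y * lam (n - q) q)) * (- (2 * lam (n - q) q) * fst v)) * ext (V q) (snd y)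
       + et (fst y) (n - q) q * dirD (snd v) (ext (V q)) (snd y)) (S n)).
  { symmetry.
    rewrite (rsum_ext _ (fun q => (fst v * (et (fst y) (n - q) q * pr (n - q) q (fun p => -2 * Pst f p) (proj (snd y)))
      + rcoef rot1 (snd v) (snd y) * (et (fst y) (n - q) q * pr (n - q) q (Dv rot1 f) (proj (snd y))))
      + (rcoef rot2 (snd v) (snd y) * (et (fst y) (n - q) q * pr (n - q) q (Dv rot2 f) (proj (snd y)))
      + rcoef rot3 (snd v) (snd y) * (et (fst y) (n - q) q * pr (n - q) q (Dv rot3 f) (proj (snd y)))))).
    - rewrite !rsum_plus, !rsum_scal.
      match goal with |- ?a + ?b + (?c + ?d) = _ => change (a + b + (c + d) = a + (b + (c + (d + 0)))) end. ring.
    - intros q _. rewrite pr_scal, pr_P by auto with sm. rewrite dirD_rcoef by auto.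
      unfold ext, V, et. rewrite !Dv_pr by auto with sm. ring. }
  rewrite E.
  apply (dw_rsum Dt (fun q y => et (fst y) (n - q) q * ext (V q) (snd y))
    (fun q y => (exp (- (2 * fst y * lam (n - q) q)) * (- (2 * lam (n - q) q) * fst v)) * ext (V q) (snd y)
       + et (fst y) (n - q) q * dirD (snd v) (ext (V q)) (snd y)) (S n)).
  intros q. apply (dw_mult Dt (fun y => et (fst y) (n - q) q) (fun y => ext (V q) (snd y))).
  - unfold et. apply (dw_comp Dt (fun y => - (2 * fst y * lam (n - q) q)) exp); [|apply is_derive_exp].
    replace (- (2 * lam (n - q) q) * fst v) with (- (2 * fst v * lam (n - q) q)) by ring.
    apply (dw_linear Dt (fun y : spacetime => - (2 * fst y * lam (n - q) q))).
    intros x w h. change (fst (plus x (scal h w))) with (fst x + h * fst w). ring.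
  - apply (dw_pull Dt cone0 (fun z => snd z) (fun z => snd z)).
    + reflexivity.
    + intros z [_ Hz]. now apply cone0_nz.
    + apply dirD_dw; auto using open_cone0. apply Hv.
Qed.

Lemma spacetime_series :
  (forall g : SF, smooth_on Dt (fun y => ext (mult_op (et (fst y)) (proj1_sig g)) (snd y))) /\
  (forall (g : SF) v y, Dt y -> is_deriv_within Dt (fun y => ext (mult_op (et (fst y)) (proj1_sig g)) (snd y)) y v
     (lsum (st_list v g) y (fun j => ext (mult_op (et (fst y)) (proj1_sig j)) (snd y)))).
Proof.
  destruct (series_smooth Dt SF st_blk) as [H1 H2].
  - apply segm_Dt.
  - intros g n. apply smooth_on_cont, smooth_st_blk.
  - intros [g Hg]. destruct (blk_decay g Hg) as [M [_ HM]]. exists (dec (1 * M)). split; [apply ex_series_decay|].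
    intros n y [Hy1 Hy2]. unfold st_blk, ext; simpl. apply HM; [lra|apply et_bounded; exact Hy1|now apply S3_proj].
  - intros g v. exists (st_list v g). split; [apply st_list_smooth|]. intros. now apply st_deriv.
  - split; [exact H1|]. intros g v y Hy. apply (H2 g v (st_list v g)); auto; [apply st_list_smooth|].
    intros. now apply st_deriv.
Qed.

Lemma rcoef_zero A x : rcoef A zero x = 0.
Proof. unfold rcoef, dot, sum4. rewrite !cc_zero. ring. Qed.

Lemma st_line t x (h : R) : plus (st t x) (scal h (st 1 zero)) = st (t + h) x.
Proof.
  unfold st. change ((t + h * 1, plus x (scal h (zero : C2))) = (t + h, x)). f_equal; [ring|].
  apply cc_ext; intros; rewrite cc_plus, cc_scal, cc_zero; ring.
Qed.

Lemma dw_time (F : spacetime -> R) t x l : x <> zero ->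
  is_deriv_within Dt F (st t x) (st 1 zero) l -> is_deriv_within half (fun s : R => F (st s x)) (t : R_NormedModule) (1 : R_NormedModule) l.
Proof.
  intros Hx H. apply dw_lim. apply dw_lim in H. apply filterlim_R; [apply line_filter|]. intros eps He.
  destruct (line_elim _ _ _ _ (flim_elim H eps He)) as [d [Hd K]].
  apply line_intro. exists d; split; auto. intros h Hn Hh HD.
  specialize (K h Hn Hh). rewrite st_line in K. rewrite half_line in HD |- *. rewrite Rmult_1_r in *.
  apply K. split; auto.
Qed.

Lemma usol_time g t x : smooth_S3 g -> 0 <= t -> S3 x ->
  is_deriv_within half (fun s : R => mult_op (et s) g x) (t : R_NormedModule) (1 : R_NormedModule) (-2 * Pst (mult_op (et t) g) x).
Proof.
  intros Hg Ht Hx. assert (Hxz := S3_nonzero x Hx).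
  assert (H := proj2 spacetime_series (exist _ g Hg) (st 1 zero) (st t x) (conj Ht Hxz)).
  apply dw_time in H; auto. unfold lsum, st_list, Dlist in H. cbn [map fold_right fst snd st proj1_sig sfP] in H.
  rewrite !rcoef_zero, !ext_S3 in H by auto.
  rewrite (Pst_mult_op 1) by (auto using et_bounded; lra).
  rewrite <- mult_op_scal by auto with sm.
  replace (mult_op (et t) (fun p => -2 * Pst g p) x) with (1 * mult_op (et t) (fun p => -2 * Pst g p) x + (0 * mult_op (et t) (proj1_sig (sfD rot1 lin_rot1 (exist _ g Hg))) x + (0 * mult_op (et t) (proj1_sig (sfD rot2 lin_rot2 (exist _ g Hg))) x + (0 * mult_op (et t) (proj1_sig (sfD rot3 lin_rot3 (exist _ g Hg))) x + 0)))) by ring.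
  apply (dw_ext half (fun s => ext (mult_op (et s) g) x)); auto. intros; now apply ext_S3.
Qed.

(** * One-sided calculus on [0, oo) *)

Lemma dw_half_unique (f : R -> R) (t l l' : R) : 0 <= t ->
  is_deriv_within half f (t : R_NormedModule) (1 : R_NormedModule) l -> is_deriv_within half f (t : R_NormedModule) (1 : R_NormedModule) l' -> l = l'.
Proof.
  intros Ht H1 H2. apply cond_eq. intros eps He. apply dw_lim in H1. apply dw_lim in H2.
  destruct (line_elim _ _ _ _ (flim_elim H1 (eps / 2) ltac:(lra))) as [d1 [Hd1 K1]].
  destruct (line_elim _ _ _ _ (flim_elim H2 (eps / 2) ltac:(lra))) as [d2 [Hd2 K2]].
  set (h := Rmin d1 d2 / 2). assert (Hm : 0 < Rmin d1 d2) by now apply Rmin_glb_lt.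
  assert (Hh : 0 < h) by (unfold h; lra).
  generalize (Rmin_l d1 d2) (Rmin_r d1 d2). intros M1 M2.
  assert (Ha : Rabs h = h) by (apply Rabs_pos_eq; lra).
  assert (HD : half (plus (t : R_NormedModule) (scal h (1 : R_NormedModule)))) by (unfold half; rewrite half_line; lra).
  specialize (K1 h ltac:(lra) ltac:(rewrite Ha; unfold h; lra) HD).
  specialize (K2 h ltac:(lra) ltac:(rewrite Ha; unfold h; lra) HD).
  cbv beta in K1, K2. apply Rabs_def2 in K1. apply Rabs_def2 in K2. apply Rabs_def1; lra.
Qed.

Lemma half_const (y : R -> R) : cont_on half y ->
  (forall t, 0 <= t -> is_deriv_within half y (t : R_NormedModule) (1 : R_NormedModule) 0) -> forall t, 0 <= t -> y t = y 0.
Proof.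
  intros Hc Hd t Ht.
  destruct (seg_MVT half y (fun _ => t * 0) (0 : R_NormedModule) (scal t (1 : R_NormedModule))) as [s [Hs E]]; auto.
  - intros s Hs. unfold half. rewrite scal_scal, half_line. assert (0 <= s * t) by (apply Rmult_le_pos; lra). lra.
  - intros z Hz. apply dw_scal. apply Hd. exact Hz.
  - rewrite half_line in E. replace (0 + t * 1) with t in E by ring. lra.
Qed.

(** The integrating factor exp (a t) reduces this to [half_const]. *)
Lemma half_ode (y : R -> R) a : smooth_on half y ->
  (forall t, 0 <= t -> is_deriv_within half y (t : R_NormedModule) (1 : R_NormedModule) (- a * y t)) -> y 0 = 0 -> forall t, 0 <= t -> y t = 0.
Proof.
  intros Hs Hd H0 t Ht.
  assert (Hlin : smooth_on half (fun s : R_NormedModule => a * s)).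
  { apply smooth_mult; [apply smooth_const|]. apply linear_smooth; [reflexivity|]. intros x P HP. exact HP. }
  assert (E : exp (a * t) * y t = exp (a * 0) * y 0).
  { apply (half_const (fun s => exp (a * s) * y s)); auto.
    - apply smooth_on_cont. apply smooth_mult; auto. now apply smooth_exp.
    - intros s Hs'. replace 0 with ((exp (a * s) * (a * 1)) * y s + exp (a * s) * (- a * y s)) by ring.
      apply (dw_mult half (fun s : R => exp (a * s)) y); [|apply Hd; auto].
      apply (dw_comp half (fun s : R => a * s) exp); [|apply is_derive_exp].
      apply (dw_linear half (fun s : R => a * s)). intros x v h. rewrite half_line. ring. }
  rewrite H0 in E. assert (H := exp_pos (a * t)). nra.
Qed.

(** * The rate r and the normalizing function of time *)

Definition IE (l : C2 -> R) : R := IS (fun p => exp (4 * l p)).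
Definition rr (l : C2 -> R) : R := IS (fun p => 2 * Pst l p * exp (4 * l p)) / IE l.

Lemma smooth_exp4 l : smooth_S3 l -> smooth_S3 (fun p => exp (4 * l p)).
Proof. intros. apply smooth_fun_exp. now apply smooth_S3_scal. Qed.
#[global] Hint Resolve smooth_exp4 : sm.

Lemma IE_pos l : smooth_S3 l -> 0 < IE l.
Proof.
  intros Hl. destruct (contS_bounded l (smooth_contS l Hl)) as [M [HM0 HM]].
  apply (IS_pos _ (exp (- (4 * M)))); auto with sm; [apply exp_pos|].
  intros p Hp. specialize (HM p Hp). apply Rabs_le_between in HM.
  destruct (Req_dec (- (4 * M)) (4 * l p)) as [->|N]; [lra|]. left. apply exp_increasing. lra.
Qed.

Lemma Dv_shift A f (c : R) p : Dv A (fun q => f q + c) p = Dv A f p.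
Proof.
  unfold Dv, dirD, Derive. f_equal. apply Lim_ext. intros y. unfold ext. f_equal. ring.
Qed.

Lemma Pst_shift f c : Pst (fun q => f q + c) = Pst f.
Proof.
  assert (E : forall A, Dv A (fun q => f q + c) = Dv A f) by (intros A; extensionality p; apply Dv_shift).
  assert (EL : Lop (fun q => f q + c) = Lop f) by (unfold Lop; now rewrite !E).
  unfold Pst. now rewrite EL, !E.
Qed.

Lemma rr_ext l l' : smooth_S3 l -> smooth_S3 l' -> (forall p, S3 p -> l p = l' p) -> rr l = rr l'.
Proof.
  intros Hl Hl' E. unfold rr, IE. f_equal; apply IS_ext; intros p Hp.
  - now rewrite (Pst_ext l l'), E.
  - now rewrite E.
Qed.

Lemma rr_shift l c : smooth_S3 l -> rr (fun q => l q + c) = rr l.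
Proof.
  intros Hl. unfold rr, IE. rewrite Pst_shift.
  rewrite (IS_ext _ (fun p => exp (4 * c) * (2 * Pst l p * exp (4 * l p)))).
  2:{ intros. rewrite Rmult_plus_distr_l, exp_plus. ring. }
  rewrite (IS_ext (fun p => exp (4 * (l p + c))) (fun p => exp (4 * c) * exp (4 * l p))).
  2:{ intros. rewrite Rmult_plus_distr_l, exp_plus. ring. }
  rewrite !IS_scal by auto 6 with sm. assert (H := exp_pos (4 * c)). assert (H2 := IE_pos l Hl). unfold IE in H2.
  field. lra.
Qed.

Definition usol (g : C2 -> R) (t : R) : C2 -> R := mult_op (et t) g.
Definition cc_t (g : C2 -> R) (t : R) : R := - / 4 * (ln (IE (usol g t)) - ln (IE (usol g 0))).
Definition lamsol (g : C2 -> R) (t : R) (p : C2) : R := usol g t p + cc_t g t.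

Lemma smooth_usol g t : smooth_S3 g -> 0 <= t -> smooth_S3 (usol g t).
Proof. intros. apply (smooth_mult_op 1); auto using et_bounded. lra. Qed.

Lemma smooth_usol_st g : smooth_S3 g -> smooth_on Dt (fun y => ext (usol g (fst y)) (snd y)).
Proof. intros Hg. exact (proj1 spacetime_series (exist _ g Hg)). Qed.

Definition expG (g : C2 -> R) : spacetime -> R := fun y => exp (4 * ext (usol g (fst y)) (snd y)).

Lemma smooth_expG g : smooth_S3 g -> smooth_on Dt (expG g).
Proof. intros Hg. apply smooth_exp. apply smooth_mult; [apply smooth_const|now apply smooth_usol_st]. Qed.

Lemma IE_expG g t : IE (usol g t) = IS (fun y => expG g (mkw (W := R_NormedModule) t y)).
Proof. apply IS_ext. intros y Hy. unfold expG, mkw; simpl. now rewrite ext_S3. Qed.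

Lemma smooth_IE g : smooth_S3 g -> smooth_on half (fun t : R => IE (usol g t)).
Proof.
  intros Hg. apply smooth_on_ext with (fun t : R_NormedModule => IS (fun y => expG g (mkw (W := R_NormedModule) t y))).
  - intros; symmetry; apply IE_expG.
  - apply (smooth_IS half); [apply segm_half|now apply smooth_expG].
Qed.

Lemma smooth_cc_t g : smooth_S3 g -> smooth_on half (fun t : R => cc_t g t).
Proof.
  intros Hg. unfold cc_t. apply smooth_mult; [apply smooth_const|].
  apply smooth_minus; [|apply smooth_const]. apply smooth_ln; [|now apply smooth_IE].
  intros t Ht. apply IE_pos. now apply smooth_usol.
Qed.

Lemma dw_IE g t : smooth_S3 g -> 0 <= t ->
  is_deriv_within half (fun s : R => IE (usol g s)) (t : R_NormedModule) (1 : R_NormedModule)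
    (-4 * IS (fun p => 2 * Pst (usol g t) p * exp (4 * usol g t p))).
Proof.
  intros Hg Ht. assert (HG := smooth_expG g Hg). assert (Hu := smooth_usol g t Hg Ht).
  destruct (smooth_on_deriv _ _ (st 1 zero) HG) as [F [HF Hd]].
  assert (E := IS_deriv half (expG g) F (t : R_NormedModule) (1 : R_NormedModule) segm_half Ht
    (smooth_on_cont _ _ HG) (smooth_on_cont _ _ HF) Hd).
  rewrite <- IS_scal by auto 8 with sm.
  rewrite (IS_ext _ (fun y => F (mkw (W := R_NormedModule) t y))).
  - apply (dw_ext half (fun w : R_NormedModule => IS (fun y => expG g (mkw (W := R_NormedModule) w y)))); auto.
    intros; symmetry; apply IE_expG.
  - intros p Hp. assert (Hpz := S3_nonzero p Hp).
    specialize (Hd (st t p) (conj Ht Hpz)). apply dw_time in Hd; auto.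
    (* The derivative [F] of the integrand is known only to exist; uniqueness of one-sided
       derivatives identifies it with the explicit one coming from [usol_time]. *)
    apply (dw_half_unique (fun s => expG g (st s p)) t); auto.
    apply (dw_ext half (fun s : R_NormedModule => exp (4 * usol g s p))); auto.
    { intros s _. unfold expG, st; simpl. now rewrite ext_S3. }
    replace (-4 * (2 * Pst (usol g t) p * exp (4 * usol g t p))) with (exp (4 * usol g t p) * (0 * usol g t p + 4 * (-2 * Pst (usol g t) p))) by ring.
    apply (dw_comp half (fun s : R_NormedModule => 4 * usol g s p) exp); [|apply is_derive_exp].
    apply (dw_mult half (fun _ => 4) (fun s : R_NormedModule => usol g s p)); [apply dw_const|].
    now apply usol_time.
Qed.

(** The logarithmic derivative of the integral of e^(4 u) is -4 r(u), so the shift that keeps this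
    integral fixed has derivative r(u). By [rr_shift] this is also the rate of the shifted function,
    as the flow demands. *)
Lemma dw_cc_t g t : smooth_S3 g -> 0 <= t ->
  is_deriv_within half (fun s : R => cc_t g s) (t : R_NormedModule) (1 : R_NormedModule) (rr (usol g t)).
Proof.
  intros Hg Ht. assert (Hu := smooth_usol g t Hg Ht). assert (HP := IE_pos _ Hu). unfold cc_t.
  replace (rr (usol g t)) with (0 * (ln (IE (usol g t)) - ln (IE (usol g 0))) + - / 4 *
    (/ IE (usol g t) * (-4 * IS (fun p => 2 * Pst (usol g t) p * exp (4 * usol g t p))) + 0)).
  - apply (dw_mult half (fun _ => - / 4) (fun s : R_NormedModule => ln (IE (usol g s)) - ln (IE (usol g 0)))); [apply dw_const|].
    apply (dw_plus half (fun s : R_NormedModule => ln (IE (usol g s))) (fun _ => - ln (IE (usol g 0)))); [|apply dw_const].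
    apply (dw_comp half (fun s : R_NormedModule => IE (usol g s)) ln); [now apply dw_IE|now apply is_derive_ln].
  - unfold rr. field. lra.
Qed.

Lemma usol_0 g p : smooth_S3 g -> S3 p -> usol g 0 p = g p.
Proof.
  intros Hg Hp. rewrite <- (mult_op_one g p Hg Hp). unfold usol. f_equal.
  unfold one_mult, et. extensionality a; extensionality b. rewrite <- exp_0. f_equal. ring.
Qed.

Lemma lamsol_0 g p : smooth_S3 g -> S3 p -> lamsol g 0 p = g p.
Proof. intros Hg Hp. unfold lamsol, cc_t. rewrite usol_0 by auto. ring. Qed.

Lemma smooth_lamsol g : smooth_S3 g -> smooth_spacetime (lamsol g).
Proof.
  intros Hg. apply (smooth_plus Dt (fun y => ext (usol g (fst y)) (snd y)) (fun y => cc_t g (fst y))); [now apply smooth_usol_st|].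
  apply (smooth_fst half). now apply smooth_cc_t.
Qed.

Lemma lamsol_time g t p : smooth_S3 g -> 0 <= t -> S3 p ->
  is_deriv_within half (fun s : R => lamsol g s p) (t : R_NormedModule) (1 : R_NormedModule) (-2 * Pst (lamsol g t) p + rr (lamsol g t)).
Proof.
  intros Hg Ht Hp. assert (Hu := smooth_usol g t Hg Ht).
  unfold lamsol at 2 3. rewrite Pst_shift, rr_shift by auto.
  apply (dw_plus half (fun s : R_NormedModule => usol g s p) (fun s : R_NormedModule => cc_t g s)); [now apply usol_time|now apply dw_cc_t].
Qed.

(** * Uniqueness of the flow *)

Lemma slice_smooth (mu : R -> C2 -> R) t : smooth_spacetime mu -> 0 <= t -> smooth_S3 (mu t).
Proof.
  intros H Ht. unfold smooth_S3, smooth_fun.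
  apply (smooth_pull (W := spacetime) (cone (fun _ => True)) Dt (fun x : C2 => st t x) (fun v : C2 => st 0 v) (fun y => ext (mu (fst y)) (snd y))); auto.
  - intros z v h. change (st t (plus z (scal h v)) = st (t + h * 0) (plus z (scal h v))). f_equal. ring.
  - intros z P [e He]. exists e. intros z' Hz'. apply He. split; [apply (ball_center (t : R_UniformSpace) e)|exact Hz'].
  - intros z [Hz _]. split; auto.
Qed.

(** The difference of two solutions satisfies a linear equation up to an unknown function of time,
    the difference of the rates. Projections show that it is constant in space; but then the two
    rates agree and it is constant in time as well. *)
Lemma unique_flow (l m : R -> C2 -> R) : smooth_spacetime l -> smooth_spacetime m ->
  (forall p, S3 p -> l 0 p = m 0 p) ->
  (forall t p, 0 <= t -> S3 p -> is_deriv_within half (fun s : R => l s p) (t : R_NormedModule) (1 : R_NormedModule) (-2 * Pst (l t) p + rr (l t))) ->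
  (forall t p, 0 <= t -> S3 p -> is_deriv_within half (fun s : R => m s p) (t : R_NormedModule) (1 : R_NormedModule) (-2 * Pst (m t) p + rr (m t))) ->
  forall t p, 0 <= t -> S3 p -> m t p = l t p.
Proof.
  intros Sl Sm H0 Dl Dm.
  set (de := fun t p => m t p - l t p).
  assert (Sd : smooth_spacetime de) by (apply (smooth_minus Dt); auto).
  assert (Ss : forall t, 0 <= t -> smooth_S3 (de t)) by (intros; now apply slice_smooth).
  assert (Ssl : forall t, 0 <= t -> smooth_S3 (l t)) by (intros; now apply slice_smooth).
  assert (Ssm : forall t, 0 <= t -> smooth_S3 (m t)) by (intros; now apply slice_smooth).
  assert (PD : forall f A p, unitary A -> smooth_S3 f -> S3 p -> Dv A (fun q => -1 * f q) p = -1 * Dv A f p) by (intros; apply Dv_scal; auto with sm).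
  assert (Pm : forall t p, 0 <= t -> S3 p -> Pst (de t) p = Pst (m t) p - Pst (l t) p).
  { intros t p Ht Hp.
    assert (EA : forall A, unitary A -> forall f g q, smooth_S3 f -> smooth_S3 g -> S3 q -> Dv A (fun x => f x - g x) q = Dv A f q - Dv A g q).
    { intros A HA f g q Hf Hg Hq. rewrite (Dv_ext_S3 A _ (fun x => f x + -1 * g x)) by (auto with sm; intros; ring).
      rewrite Dv_plus, PD by auto with sm. ring. }
    assert (EAA : forall A, unitary A -> forall f g q, smooth_S3 f -> smooth_S3 g -> S3 q -> Dv A (Dv A (fun x => f x - g x)) q = Dv A (Dv A f) q - Dv A (Dv A g) q).
    { intros A HA f g q Hf Hg Hq. rewrite (Dv_ext_S3 A _ (fun x => Dv A f x - Dv A g x)) by (auto with sm).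
      apply EA; auto using smooth_Dv_unit. }
    assert (EL : forall f g q, smooth_S3 f -> smooth_S3 g -> S3 q -> Lop (fun x => f x - g x) q = Lop f q - Lop g q).
    { intros f g q Hf Hg Hq. unfold Lop. rewrite !EAA by auto with sm. ring. }
    assert (H1 := Ssl t Ht). assert (H2 := Ssm t Ht).
    unfold Pst, de. rewrite (Lop_ext _ (fun x => Lop (m t) x - Lop (l t) x)) by auto.
    rewrite EL, EAA by auto with sm. ring. }
  set (gg := fun t => rr (m t) - rr (l t)).
  assert (Dd : forall t p, 0 <= t -> S3 p -> is_deriv_within half (fun s : R => de s p) (t : R_NormedModule) (1 : R_NormedModule) (-2 * Pst (de t) p + gg t)).
  { intros t p Ht Hp. rewrite Pm by auto. unfold gg, de.
    replace (-2 * (Pst (m t) p - Pst (l t) p) + (rr (m t) - rr (l t))) with ((-2 * Pst (m t) p + rr (m t)) + (0 * l t p + (-1) * (-2 * Pst (l t) p + rr (l t)))) by ring.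
    apply (dw_ext half (fun s : R_NormedModule => m s p + -1 * l s p)); [intros; ring|exact Ht|].
    apply (dw_plus half (fun s : R_NormedModule => m s p)); [now apply Dm|].
    apply (dw_mult half (fun _ => -1) (fun s : R_NormedModule => l s p)); [apply dw_const|now apply Dl]. }
  (* A projection with a + b > 0 kills constants, hence the unknown [gg], and leaves a linear
     equation with initial value 0. *)
  assert (Z : forall a b, (0 < a + b)%nat -> forall x t, S3 x -> 0 <= t -> pr a b (de t) x = 0).
  { intros a b Hab x t Hx Ht.
    set (G := fun y : spacetime => ext (de (fst y)) (snd y) * ext (fun y => ker a b x y) (snd y)).
    assert (SG : smooth_on Dt G).
    { apply smooth_mult; [exact Sd|]. apply smooth_snd_st. apply (smooth_S3_ker2 a b x). }
    assert (EG : forall s, pr a b (de s) x = (INR (a + b) + 1) / Vol * IS (fun y => G (mkw (W := R_NormedModule) s y))).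
    { intros s. unfold pr. f_equal. apply IS_ext. intros y Hy. unfold G, mkw; simpl. now rewrite !ext_S3. }
    apply (half_ode (fun s => pr a b (de s) x) (2 * lam a b)); auto.
    - apply smooth_on_ext with (fun s : R_NormedModule => (INR (a + b) + 1) / Vol * IS (fun y => G (mkw (W := R_NormedModule) s y))); [intros; now rewrite EG|].
      apply smooth_mult; [apply smooth_const|]. apply (smooth_IS half); auto using segm_half.
    - intros s Hs. destruct (smooth_on_deriv _ _ (st 1 zero) SG) as [F [HF Hd]].
      assert (E := IS_deriv half G F (s : R_NormedModule) (1 : R_NormedModule) segm_half Hs (smooth_on_cont _ _ SG) (smooth_on_cont _ _ HF) Hd).
      apply (dw_ext half (fun s : R_NormedModule => (INR (a + b) + 1) / Vol * IS (fun y => G (mkw (W := R_NormedModule) s y)))); [intros; now rewrite EG|exact Hs|].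
      replace (- (2 * lam a b) * pr a b (de s) x) with (0 * IS (fun y => G (mkw (W := R_NormedModule) s y)) + (INR (a + b) + 1) / Vol * IS (fun y => F (mkw (W := R_NormedModule) s y))).
      + apply (dw_mult half (fun _ => (INR (a + b) + 1) / Vol) (fun s : R_NormedModule => IS (fun y => G (mkw (W := R_NormedModule) s y)))); [apply dw_const|exact E].
      + rewrite (IS_ext (fun y => F (mkw (W := R_NormedModule) s y)) (fun y => (-2 * Pst (de s) y + gg s) * ker a b x y)).
        * transitivity (pr a b (fun y => -2 * Pst (de s) y + gg s) x); [unfold pr; ring|].
          specialize (Ss s Hs).
          rewrite (pr_plus a b (fun y => -2 * Pst (de s) y) (fun _ => gg s)), pr_scal, pr_P, pr_const by auto with sm.
          destruct a as [|a]; destruct b as [|b]; try lia; ring.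
        * intros y Hy. assert (Hyz := S3_nonzero y Hy). specialize (Hd (st s y) (conj Hs Hyz)). apply dw_time in Hd; auto.
          apply (dw_half_unique (fun u => G (st u y)) s); auto.
          apply (dw_ext half (fun u : R_NormedModule => de u y * ker a b x y)); [intros u _; unfold G, st; simpl; now rewrite !ext_S3|exact Hs|].
          replace ((-2 * Pst (de s) y + gg s) * ker a b x y) with ((-2 * Pst (de s) y + gg s) * ker a b x y + de s y * 0) by ring.
          apply (dw_mult half (fun u : R_NormedModule => de u y) (fun _ => ker a b x y)); [now apply Dd|apply dw_const].
    - rewrite (pr_ext a b (de 0) (fun _ => 0)); [|intros y Hy; unfold de; rewrite H0 by auto; ring].
      rewrite pr_const by auto. destruct a; destruct b; auto. }
  (* Only the block of degree 0, the mean value, is left in the expansion. *)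
  assert (Cst : forall t x, 0 <= t -> S3 x -> de t x = / Vol * IS (de t)).
  { intros t x Ht Hx. rewrite <- (mult_op_one (de t) x (Ss t Ht) Hx). unfold mult_op. rewrite Series_first.
    - unfold blk. simpl. unfold one_mult, pr. rewrite (IS_ext _ (de t)) by (intros; rewrite ker_00; ring). simpl. field.
      generalize Vol_pos; lra.
    - intros k. unfold blk. rewrite (rsum_ext _ (fun _ => 0 * 0)); [rewrite rsum_scal; ring|].
      intros q Hq. rewrite Z; auto; [ring|lia]. }
  (* Adding a constant to a solution changes neither the rate nor [Pst]. *)
  assert (G0 : forall t, 0 <= t -> gg t = 0 /\ forall p, S3 p -> Pst (de t) p = 0).
  { intros t Ht. set (K := / Vol * IS (de t)).
    assert (Em : forall p, S3 p -> m t p = l t p + K) by (intros p Hp; generalize (Cst t p Ht Hp); fold K; unfold de; lra).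
    split.
    - unfold gg. rewrite (rr_ext (m t) (fun p => l t p + K) (Ssm t Ht) (smooth_S3_plus _ _ (Ssl t Ht) (smooth_S3_const K)) Em).
      rewrite rr_shift by auto. ring.
    - intros p Hp. rewrite Pm by auto. rewrite (Pst_ext (m t) (fun p => l t p + K)) by auto. rewrite Pst_shift. ring. }
  intros t p Ht Hp.
  assert (E : de t p = de 0 p).
  { apply (half_const (fun s => de s p)); auto.
    - apply smooth_on_cont.
      apply (smooth_pull (W := spacetime) half Dt (fun s : R_NormedModule => st s p) (fun v : R_NormedModule => st v zero) (fun y => ext (de (fst y)) (snd y))) in Sd.
      + apply smooth_on_ext with (2 := Sd). intros s _. simpl. now apply ext_S3.
      + intros z v h. rewrite half_line. unfold st. change ((z + h * v, p) = (z + h * v, plus p (scal h (zero : C2)))). f_equal.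
        apply cc_ext; intros; rewrite cc_plus, cc_scal, cc_zero; ring.
      + intros z P [e He]. exists e. intros z' Hz'. apply He. split; [exact Hz'|apply (ball_center (p : C2) e)].
      + intros z Hz. split; [exact Hz|now apply S3_nonzero].
    - intros s Hs. specialize (Dd s p Hs Hp). destruct (G0 s Hs) as [E1 E2]. rewrite E1, E2 in Dd by auto.
      replace (-2 * 0 + 0) with 0 in Dd by ring. exact Dd. }
  unfold de in E. rewrite H0 in E by auto. lra.
Qed.

(** * The limit as t tends to infinity *)

Definition minf (p q : nat) : R := match p, q with O, _ => 1 | _, O => 1 | _, _ => 0 end.

Lemma minf_bounded : bounded_by 1 minf.
Proof. intros [|p] [|q]; unfold minf; rewrite ?Rabs_R1, ?Rabs_R0; lra. Qed.

(** If p q = 0 both multipliers equal 1; otherwise [lam p q] is at least 16, so the rate e^(-t)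
    holds with room to spare, uniformly in (p, q). *)
Lemma et_minf t p q : 0 <= t -> Rabs (et t p q - minf p q) <= exp (- t).
Proof.
  intros Ht. unfold et, minf, lam. assert (He := exp_pos (- t)).
  destruct p as [|p]; [|destruct q as [|q]].
  - replace (- (2 * t * (4 * INR 0 * INR q * (INR 0 + 1) * (INR q + 1)))) with 0 by (simpl; ring). rewrite exp_0, Rminus_diag_eq, Rabs_R0; auto. lra.
  - replace (- (2 * t * (4 * INR (S p) * INR 0 * (INR (S p) + 1) * (INR 0 + 1)))) with 0 by (simpl; ring). rewrite exp_0, Rminus_diag_eq, Rabs_R0; auto. lra.
  - rewrite Rminus_0_r, Rabs_pos_eq by (left; apply exp_pos).
    assert (H : t <= 2 * t * (4 * INR (S p) * INR (S q) * (INR (S p) + 1) * (INR (S q) + 1))).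
    { rewrite !S_INR. generalize (pos_INR p) (pos_INR q). intros.
      assert (1 <= (INR p + 1) * (INR q + 1)) by nra. assert (1 <= (INR p + 1 + 1) * (INR q + 1 + 1)) by nra.
      replace (2 * t * (4 * (INR p + 1) * (INR q + 1) * (INR p + 1 + 1) * (INR q + 1 + 1))) with (t * (8 * (((INR p + 1) * (INR q + 1)) * ((INR p + 1 + 1) * (INR q + 1 + 1))))) by ring.
      rewrite <- (Rmult_1_r t) at 1. apply Rmult_le_compat_l; auto. nra. }
    destruct (Req_dec (- t) (- (2 * t * (4 * INR (S p) * INR (S q) * (INR (S p) + 1) * (INR (S q) + 1))))) as [->|N]; [lra|].
    left. apply exp_increasing. lra.
Qed.

Definition uinf (g : C2 -> R) : C2 -> R := mult_op minf g.
Definition cinf (g : C2 -> R) : R := - / 4 * (ln (IE (uinf g)) - ln (IE (usol g 0))).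
Definition laminf (g : C2 -> R) (p : C2) : R := uinf g p + cinf g.

Lemma smooth_uinf g : smooth_S3 g -> smooth_S3 (uinf g).
Proof. intros. apply (smooth_mult_op 1); auto using minf_bounded. lra. Qed.

Lemma smooth_laminf g : smooth_S3 g -> smooth_S3 (laminf g).
Proof. intros. apply smooth_S3_plus; [now apply smooth_uinf|apply smooth_S3_const]. Qed.

(** The multipliers [minf] and [lam] have disjoint supports, and [Pst] ignores the additive
    constant. *)
Lemma Pst_laminf g p : smooth_S3 g -> S3 p -> Pst (laminf g) p = 0.
Proof.
  intros Hg Hp. unfold laminf. rewrite Pst_shift. unfold uinf.
  rewrite (Pst_mult_op 1), mult_op_Pst by (auto using minf_bounded; lra).
  rewrite (Series_ext _ (fun _ => 0 * 0)); [rewrite Series_scal_l; ring|].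
  intros k. unfold blk. rewrite (rsum_ext _ (fun _ => 0 * 0)); [rewrite rsum_scal; ring|].
  intros q _. unfold minf, lam. destruct (k - q)%nat; destruct q; simpl; ring.
Qed.

Lemma exp_lip a b M : a <= M -> b <= M -> Rabs (exp a - exp b) <= exp M * Rabs (a - b).
Proof.
  intros Ha Hb. destruct (MVT_abs exp exp b a) as [c [E Hc]]; [intros; apply derivable_pt_lim_exp|].
  rewrite E. apply Rmult_le_compat_r; [apply Rabs_pos|].
  rewrite Rabs_pos_eq by (left; apply exp_pos).
  assert (c <= M) by (revert Hc; unfold Rmin, Rmax; destruct (Rle_dec b a); lra).
  destruct (Req_dec c M) as [->|N]; [lra|]. left. apply exp_increasing. lra.
Qed.

Lemma usol_uinf g : smooth_S3 g -> exists C, 0 < C /\ (forall t x, 0 <= t -> S3 x -> Rabs (usol g t x - uinf g x) <= C * exp (- t)).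
Proof.
  intros Hg. destruct (Good_lip _ (Good_base g Hg)) as [C [HC H]]. exists (C + 1). split; [lra|].
  intros t x Ht Hx. specialize (H (exp (- t)) (et t) minf x (Rlt_le _ _ (exp_pos _)) (et_bounded t Ht) minf_bounded (fun p q => et_minf t p q Ht) Hx).
  rewrite !ext_S3 in H by auto. generalize (exp_pos (- t)). unfold usol, uinf. nra.
Qed.

Lemma exp_neg_lim : filterlim (fun t => exp (- t)) (Rbar_locally p_infty) (locally 0).
Proof.
  apply (filterlim_comp _ _ _ Ropp exp _ (Rbar_locally m_infty)).
  - apply (filterlim_Rbar_opp p_infty).
  - apply is_lim_exp_m.
Qed.

Lemma IE_lim g : smooth_S3 g -> filterlim (fun t => IE (usol g t)) (Rbar_locally p_infty) (locally (IE (uinf g))).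
Proof.
  intros Hg. destruct (usol_uinf g Hg) as [C [HC H]]. destruct (mult_op_bound g Hg) as [M [HM0 HM]].
  set (K := exp (4 * M) * (4 * C) * Vol).
  assert (HV := Vol_pos). assert (HK : 0 < K).
  { unfold K. repeat apply Rmult_lt_0_compat; auto; try lra. apply exp_pos. }
  apply filterlim_R; [apply Rbar_locally_filter|]. intros eps He.
  assert (F := flim_elim exp_neg_lim (eps / K) (Rdiv_lt_0_compat _ _ He HK)).
  assert (F2 : Rbar_locally p_infty (fun t => 0 <= t)) by (exists 0; intros; lra).
  generalize (filter_and _ _ F F2). apply filter_imp. intros t [H1 Ht].
  rewrite Rminus_0_r, Rabs_pos_eq in H1 by (left; apply exp_pos).
  assert (Hu := smooth_usol g t Hg Ht). assert (Hi := smooth_uinf g Hg).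
  unfold IE. rewrite <- IS_minus by auto with sm.
  apply Rle_lt_trans with (exp (4 * M) * (4 * (C * exp (- t))) * Vol).
  - apply IS_abs; [auto with sm|]. intros x Hx.
    assert (Hb : forall m, bounded_by 1 m -> 4 * mult_op m g x <= 4 * M).
    { intros m Hm. specialize (HM 1 m x ltac:(lra) Hm Hx). apply Rabs_le_between in HM. lra. }
    eapply Rle_trans; [apply (exp_lip _ _ (4 * M)); apply Hb; auto using et_bounded, minf_bounded|].
    apply Rmult_le_compat_l; [left; apply exp_pos|].
    rewrite <- Rmult_minus_distr_l, Rabs_mult, (Rabs_pos_eq 4) by lra. apply Rmult_le_compat_l; [lra|]. now apply H.
  - replace (exp (4 * M) * (4 * (C * exp (- t))) * Vol) with (K * exp (- t)) by (unfold K; ring).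
    replace eps with (K * (eps / K)) by (field; lra). now apply Rmult_lt_compat_l.
Qed.

Lemma cc_lim_inf g : smooth_S3 g -> filterlim (fun t => cc_t g t) (Rbar_locally p_infty) (locally (cinf g)).
Proof.
  intros Hg. unfold cc_t, cinf.
  apply (filterlim_Rmult _ (fun _ => - / 4)); [apply filterlim_const|].
  apply (filterlim_Rplus _ (fun t => ln (IE (usol g t)))); [|apply filterlim_const].
  eapply filterlim_comp; [apply (IE_lim g Hg)|].
  apply (ex_derive_continuous (V := R_NormedModule) ln). eexists. apply is_derive_ln. apply IE_pos. now apply smooth_uinf.
Qed.

(** The normalizing constant enters the uniform distance, but none of the derivatives. *)
Lemma iterD_shift s F (c : R) x : iterD s (fun y => F y + c) x = iterD s F x + match s with nil => c | _ => 0 end.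
Proof.
  revert x. induction s as [|v s IH]; intros x; simpl; auto.
  rewrite Rplus_0_r. unfold dirD, Derive. f_equal. apply Lim_ext. intros h. rewrite !IH. f_equal. ring.
Qed.

(** By [Good_iterD] the derivatives are fixed expressions in the multiplier, Lipschitz by
    [Good_lip], so the uniform estimate [et_minf] transfers to each of them. *)
Lemma lamsol_cvg g : smooth_S3 g -> smooth_cvg (lamsol g) (laminf g).
Proof.
  intros Hg s eps He. destruct (Good_iterD s g Hg) as [O [HO E]]. destruct (Good_lip O HO) as [C [HC HL]].
  assert (Hp : 0 < eps / (2 * (C + 1))) by (apply Rdiv_lt_0_compat; lra).
  assert (F1 := flim_elim exp_neg_lim _ Hp). assert (F2 := flim_elim (cc_lim_inf g Hg) (eps / 2) ltac:(lra)).
  destruct (filter_and _ _ F1 F2) as [t0 H0]. exists (t0 + 1). intros t Ht Ht0 p Hp'.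
  destruct (H0 t ltac:(lra)) as [H1 H2].
  rewrite Rminus_0_r, Rabs_pos_eq in H1 by (left; apply exp_pos).
  change (ext (lamsol g t)) with (fun x => ext (mult_op (et t) g) x + cc_t g t).
  change (ext (laminf g)) with (fun x => ext (mult_op minf g) x + cinf g).
  rewrite !iterD_shift. assert (Hc : cone0 p) by now apply cone0_nz, S3_nonzero.
  rewrite !E by auto using et_bounded, minf_bounded.
  assert (K := HL (exp (- t)) (et t) minf p (Rlt_le _ _ (exp_pos _)) (et_bounded t Ht) minf_bounded (fun a b => et_minf t a b Ht) Hp').
  assert (K2 : C * exp (- t) < eps / 2).
  { apply Rle_lt_trans with ((C + 1) * exp (- t)); [generalize (exp_pos (- t)); nra|].
    replace (eps / 2) with ((C + 1) * (eps / (2 * (C + 1)))) by (field; lra). apply Rmult_lt_compat_l; lra. }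
  apply Rabs_le_between in K. apply Rabs_def2 in H2. destruct s; apply Rabs_def1; lra.
Qed.

Lemma C_eq (a b : C) : Re a = Re b -> Im a = Im b -> a = b.
Proof. destruct a, b; simpl; intros -> ->; reflexivity. Qed.

Lemma Ci2 : (Ci * Ci)%C = (- (1))%C.
Proof. apply C_eq; simpl; ring. Qed.

Ltac cring := apply C_eq; simpl; ring.
(** * Complex functions and the derivations T, Z, Zbar *)

Lemma scf_const U c : smooth_cfun U (fun _ => c).
Proof. split; apply smooth_fun_const. Qed.

Lemma scf_real U f : smooth_fun U f -> smooth_cfun U (fun p => RtoC (f p)).
Proof. intros H. split; [exact H|apply smooth_fun_const]. Qed.

Lemma scf_plus U f g : smooth_cfun U f -> smooth_cfun U g -> smooth_cfun U (fun p => (f p + g p)%C).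
Proof. intros [H1 H2] [H3 H4]. split; now apply smooth_fun_plus. Qed.

Lemma scf_opp U f : smooth_cfun U f -> smooth_cfun U (fun p => (- f p)%C).
Proof. intros [H1 H2]. split; now apply smooth_fun_opp. Qed.

Lemma scf_minus U f g : smooth_cfun U f -> smooth_cfun U g -> smooth_cfun U (fun p => (f p - g p)%C).
Proof. intros. apply scf_plus; auto. now apply scf_opp. Qed.

Lemma scf_mult U f g : smooth_cfun U f -> smooth_cfun U g -> smooth_cfun U (fun p => (f p * g p)%C).
Proof.
  intros [H1 H2] [H3 H4]. split; simpl; [apply smooth_fun_minus|apply smooth_fun_plus]; now apply smooth_fun_mult.
Qed.

Lemma scf_conj U f : smooth_cfun U f -> smooth_cfun U (fun p => Cconj (f p)).
Proof. intros [H1 H2]. split; [exact H1|now apply smooth_fun_opp]. Qed.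

Lemma scf_ext U f g : (forall p, S3 p -> U p -> f p = g p) -> smooth_cfun U f -> smooth_cfun U g.
Proof.
  intros E [H1 H2]. split; [apply smooth_fun_ext with (2 := H1)|apply smooth_fun_ext with (2 := H2)]; intros; now rewrite E.
Qed.

Definition cDv (A : C2 -> C2) (f : C2 -> C) (p : C2) : C :=
  (Dv A (fun q => Re (f q)) p, Dv A (fun q => Im (f q)) p).

Lemma scf_cDv U A f : open_S3 U -> lin A -> smooth_cfun U f -> smooth_cfun U (cDv A f).
Proof. intros HO HA [H1 H2]. split; now apply smooth_Dv. Qed.

Inductive letter := LT | LZ | LB.

Definition bar (d : letter) : letter := match d with LT => LT | LZ => LB | LB => LZ end.

Definition Dl (d : letter) (f : C2 -> C) (p : C2) : C :=
  match d with
  | LT => cDv fieldT f p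
  | LZ => (/ 2 * (cDv fieldX f p - Ci * cDv fieldY f p))%C
  | LB => (/ 2 * (cDv fieldX f p + Ci * cDv fieldY f p))%C
  end.

Lemma scf_Dl U d f : open_S3 U -> smooth_cfun U f -> smooth_cfun U (Dl d f).
Proof.
  intros HO H. destruct d; unfold Dl.
  - apply scf_cDv; auto using lin_fieldT.
  - apply scf_mult; [apply scf_const|]. apply scf_minus; [|apply scf_mult; [apply scf_const|]]; apply scf_cDv; auto using lin_fieldX, lin_fieldY.
  - apply scf_mult; [apply scf_const|]. apply scf_plus; [|apply scf_mult; [apply scf_const|]]; apply scf_cDv; auto using lin_fieldX, lin_fieldY.
Qed.

Section Calculus.
Context (U : C2 -> Prop) (HO : open_S3 U) (p : C2) (Sp : S3 p) (Up : U p).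

Lemma Dv_plus_U A f g : smooth_fun U f -> smooth_fun U g -> Dv A (fun q => f q + g q) p = Dv A f p + Dv A g p.
Proof. intros. apply (dirD_plus (cone U)); auto. now apply cone_S3. Qed.

Lemma Dv_mult_U A f g : smooth_fun U f -> smooth_fun U g -> Dv A (fun q => f q * g q) p = Dv A f p * g p + f p * Dv A g p.
Proof.
  intros. rewrite <- (ext_S3 g p Sp), <- (ext_S3 f p Sp).
  apply (dirD_mult (cone U)); auto. now apply cone_S3.
Qed.

Lemma Dv_const_U A c : Dv A (fun _ => c) p = 0.
Proof. exact (dirD_const c p (A p)). Qed.

Lemma Dv_opp_U A f : smooth_fun U f -> Dv A (fun q => - f q) p = - Dv A f p.
Proof.
  intros. transitivity (Dv A (fun q => -1 * f q) p).
  - apply (dirD_ext_U U); auto. intros; ring.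
  - rewrite Dv_mult_U, Dv_const_U; auto using smooth_fun_const. ring.
Qed.

Lemma Dv_ext_U A f g : (forall q, S3 q -> U q -> f q = g q) -> Dv A f p = Dv A g p.
Proof. intros. now apply (dirD_ext_U U). Qed.

Lemma cDv_ext A f g : (forall q, S3 q -> U q -> f q = g q) -> cDv A f p = cDv A g p.
Proof. intros E. apply C_eq; apply Dv_ext_U; intros; now rewrite E. Qed.

Lemma cDv_plus A f g : smooth_cfun U f -> smooth_cfun U g -> cDv A (fun q => (f q + g q)%C) p = (cDv A f p + cDv A g p)%C.
Proof. intros [H1 H2] [H3 H4]. apply C_eq; simpl; now rewrite Dv_plus_U. Qed.

Lemma cDv_const A c : cDv A (fun _ => c) p = RtoC 0.
Proof. apply C_eq; [exact (Dv_const_U A (Re c))|exact (Dv_const_U A (Im c))]. Qed.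

Lemma cDv_mult A f g : smooth_cfun U f -> smooth_cfun U g ->
  cDv A (fun q => (f q * g q)%C) p = (cDv A f p * g p + f p * cDv A g p)%C.
Proof.
  intros [H1 H2] [H3 H4]. unfold cDv.
  assert (E1 : Dv A (fun q => Re (f q * g q)%C) p = Dv A (fun q => Re (f q)) p * Re (g p) + Re (f p) * Dv A (fun q => Re (g q)) p
    - (Dv A (fun q => Im (f q)) p * Im (g p) + Im (f p) * Dv A (fun q => Im (g q)) p)).
  { transitivity (Dv A (fun q => Re (f q) * Re (g q) + - (Im (f q) * Im (g q))) p); [reflexivity|].
    rewrite Dv_plus_U, Dv_opp_U, !Dv_mult_U by auto using smooth_fun_mult, smooth_fun_opp. ring. }
  assert (E2 : Dv A (fun q => Im (f q * g q)%C) p = Dv A (fun q => Re (f q)) p * Im (g p) + Re (f p) * Dv A (fun q => Im (g q)) p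
    + (Dv A (fun q => Im (f q)) p * Re (g p) + Im (f p) * Dv A (fun q => Re (g q)) p)).
  { transitivity (Dv A (fun q => Re (f q) * Im (g q) + Im (f q) * Re (g q)) p); [reflexivity|].
    rewrite Dv_plus_U, !Dv_mult_U by auto using smooth_fun_mult. ring. }
  rewrite E1, E2. unfold Re, Im. cring.
Qed.

Lemma cDv_conj A f : smooth_cfun U f -> cDv A (fun q => Cconj (f q)) p = Cconj (cDv A f p).
Proof. intros [H1 H2]. apply C_eq; simpl; [reflexivity|]. now rewrite <- Dv_opp_U. Qed.

Lemma Dl_ext d f g : (forall q, S3 q -> U q -> f q = g q) -> Dl d f p = Dl d g p.
Proof. intros E. destruct d; unfold Dl; now rewrite ?(cDv_ext _ f g). Qed.

Lemma Dl_plus d f g : smooth_cfun U f -> smooth_cfun U g -> Dl d (fun q => (f q + g q)%C) p = (Dl d f p + Dl d g p)%C.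
Proof. intros. destruct d; unfold Dl; rewrite !cDv_plus by auto; ring. Qed.

Lemma Dl_const d c : Dl d (fun _ => c) p = RtoC 0.
Proof. destruct d; unfold Dl; rewrite !cDv_const; ring. Qed.

Lemma Dl_mult d f g : smooth_cfun U f -> smooth_cfun U g ->
  Dl d (fun q => (f q * g q)%C) p = (Dl d f p * g p + f p * Dl d g p)%C.
Proof. intros. destruct d; unfold Dl; rewrite !cDv_mult by auto; ring. Qed.

Lemma Dl_scal d c f : smooth_cfun U f -> Dl d (fun q => (c * f q)%C) p = (c * Dl d f p)%C.
Proof. intros. rewrite Dl_mult, Dl_const by auto using scf_const. ring. Qed.

Lemma Dl_opp d f : smooth_cfun U f -> Dl d (fun q => (- f q)%C) p = (- Dl d f p)%C.
Proof.
  intros. rewrite (Dl_ext d _ (fun q => (- (1)) * f q)%C) by (intros; ring). rewrite Dl_scal by auto. ring.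
Qed.

Lemma Dl_conj d f : smooth_cfun U f -> Dl d (fun q => Cconj (f q)) p = Cconj (Dl (bar d) f p).
Proof.
  intros. destruct d; unfold Dl, bar; rewrite !cDv_conj by auto; auto;
  rewrite !Cmult_conj, ?Cplus_conj, ?Cminus_conj, !Cmult_conj.
  all: apply C_eq; simpl; field.
Qed.

Lemma Dv_exp_U A f : smooth_fun U f -> Dv A (fun q => exp (f q)) p = exp (f p) * Dv A f p.
Proof.
  intros. rewrite <- (ext_S3 f p Sp). apply (dirD_exp (cone U)); auto. now apply cone_S3.
Qed.

Lemma Dl_exp d f : smooth_fun U f -> Dl d (fun q => RtoC (exp (f q))) p = (RtoC (exp (f p)) * Dl d (fun q => RtoC (f q)) p)%C.
Proof.
  intros H.
  assert (E : forall A, cDv A (fun q => RtoC (exp (f q))) p = (RtoC (exp (f p)) * cDv A (fun q => RtoC (f q)) p)%C).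
  { intros A.
    apply C_eq; [transitivity (exp (f p) * Dv A f p - 0 * Dv A (fun _ => 0) p); [transitivity (Dv A (fun q => exp (f q)) p); [reflexivity|rewrite Dv_exp_U by auto; ring]|reflexivity]|].
    transitivity (exp (f p) * Dv A (fun _ => 0) p + 0 * Dv A f p); [|reflexivity].
    transitivity (Dv A (fun _ => 0) p); [reflexivity|]. rewrite Dv_const_U. ring. }
  destruct d; unfold Dl; rewrite !E; ring.
Qed.

End Calculus.

Ltac gen_C t := let z := fresh "z" in set (z := t) in *; clearbody z.

Lemma cDv_bracket U A B f p (c : R) (E : C2 -> C2) : open_S3 U -> S3 p -> U p -> smooth_cfun U f ->
  (forall g, smooth_fun U g -> Dv A (Dv B g) p - Dv B (Dv A g) p = c * Dv E g p) ->
  (cDv A (cDv B f) p - cDv B (cDv A f) p)%C = (RtoC c * cDv E f p)%C.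
Proof.
  intros HO Sp Up [H1 H2] H. apply C_eq.
  - transitivity (Dv A (Dv B (fun q => Re (f q))) p - Dv B (Dv A (fun q => Re (f q))) p); [reflexivity|].
    rewrite H by auto. cbn. ring.
  - transitivity (Dv A (Dv B (fun q => Im (f q))) p - Dv B (Dv A (fun q => Im (f q))) p); [reflexivity|].
    rewrite H by auto. cbn. ring.
Qed.

Section Frame.
Context (U : C2 -> Prop) (HO : open_S3 U) (p : C2) (Sp : S3 p) (Up : U p).

Lemma cone_p : cone U p.
Proof. now apply cone_S3. Qed.

Lemma cbr_TX f : smooth_cfun U f -> (cDv fieldT (cDv fieldX f) p - cDv fieldX (cDv fieldT f) p)%C = (RtoC (-2) * cDv fieldY f p)%C.
Proof. intros. apply (cDv_bracket U); auto. intros. apply (bracket_TX U); auto using cone_p. Qed.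
Lemma cbr_XY f : smooth_cfun U f -> (cDv fieldX (cDv fieldY f) p - cDv fieldY (cDv fieldX f) p)%C = (RtoC (-2) * cDv fieldT f p)%C.
Proof. intros. apply (cDv_bracket U); auto. intros. apply (bracket_XY U); auto using cone_p. Qed.
Lemma cbr_TY f : smooth_cfun U f -> (cDv fieldT (cDv fieldY f) p - cDv fieldY (cDv fieldT f) p)%C = (RtoC 2 * cDv fieldX f p)%C.
Proof. intros. apply (cDv_bracket U); auto. intros. apply (bracket_TY U); auto using cone_p. Qed.

Lemma cDv_comb A c F d G : smooth_cfun U F -> smooth_cfun U G ->
  cDv A (fun q => (c * (F q + d * G q))%C) p = (c * (cDv A F p + d * cDv A G p))%C.
Proof.
  intros HF HG.
  rewrite (cDv_mult U HO p Sp Up) by auto using scf_const, scf_plus, scf_mult.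
  rewrite (cDv_plus U HO p Sp Up) by auto using scf_const, scf_plus, scf_mult.
  rewrite (cDv_mult U HO p Sp Up) by auto using scf_const, scf_plus, scf_mult.
  rewrite !cDv_const. ring.
Qed.

Lemma C_move (a b c : C) : (a - b = c)%C -> a = (b + c)%C.
Proof. intros <-. ring. Qed.

Lemma Dl_LZ f : Dl LZ f = (fun q => / 2 * (cDv fieldX f q + (- Ci) * cDv fieldY f q))%C.
Proof. extensionality q. unfold Dl. ring. Qed.

(** Since [X, Y] = -2 T, the bracket [Z, Zbar] = (i / 2) [X, Y] is - i T. *)
Lemma Dl_ZB f : smooth_cfun U f -> Dl LZ (Dl LB f) p = (Dl LB (Dl LZ f) p - Ci * Dl LT f p)%C.
Proof.
  intros H. assert (HX := scf_cDv U fieldX f HO lin_fieldX H). assert (HY := scf_cDv U fieldY f HO lin_fieldY H).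
  rewrite (Dl_LZ f). unfold Dl. rewrite !cDv_comb by auto.
  rewrite (C_move _ _ _ (cbr_XY f H)).
  gen_C (cDv fieldX (cDv fieldX f) p). gen_C (cDv fieldY (cDv fieldX f) p). gen_C (cDv fieldY (cDv fieldY f) p). gen_C (cDv fieldT f p).
  destruct z, z0, z1, z2. apply C_eq; simpl; field.
Qed.

Lemma Dl_TZ f : smooth_cfun U f -> Dl LZ (Dl LT f) p = (Dl LT (Dl LZ f) p + 2 * Ci * Dl LZ f p)%C.
Proof.
  intros H. assert (HX := scf_cDv U fieldX f HO lin_fieldX H). assert (HY := scf_cDv U fieldY f HO lin_fieldY H).
  rewrite !(Dl_LZ f). unfold Dl. rewrite !cDv_comb by auto.
  rewrite (C_move _ _ _ (cbr_TX f H)), (C_move _ _ _ (cbr_TY f H)).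
  gen_C (cDv fieldX f p). gen_C (cDv fieldY f p). gen_C (cDv fieldX (cDv fieldT f) p). gen_C (cDv fieldY (cDv fieldT f) p).
  destruct z, z0, z1, z2. apply C_eq; simpl; field.
Qed.

Lemma Dl_TB f : smooth_cfun U f -> Dl LB (Dl LT f) p = (Dl LT (Dl LB f) p - 2 * Ci * Dl LB f p)%C.
Proof.
  intros H. assert (HX := scf_cDv U fieldX f HO lin_fieldX H). assert (HY := scf_cDv U fieldY f HO lin_fieldY H).
  unfold Dl. rewrite !cDv_comb by auto.
  rewrite (C_move _ _ _ (cbr_TX f H)), (C_move _ _ _ (cbr_TY f H)).
  gen_C (cDv fieldX f p). gen_C (cDv fieldY f p). gen_C (cDv fieldX (cDv fieldT f) p). gen_C (cDv fieldY (cDv fieldT f) p).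
  destruct z, z0, z1, z2. apply C_eq; simpl; field.
Qed.

End Frame.

(** * The coframe and forms *)

(** The coframe dual to T, Z = (X - i Y) / 2 and Zbar, extended by 0 to the radial direction. *)
Definition ka (d : letter) : Defs.form1 := fun p v =>
  match d with
  | LT => RtoC (dot v (fieldT p))
  | LZ => (dot v (fieldX p), dot v (fieldY p))
  | LB => (dot v (fieldX p), - dot v (fieldY p))
  end.

Lemma ka_zero d p : ka d p zero = RtoC 0.
Proof.
  unfold ka. assert (E0 : forall x, dot zero x = 0) by (intros x; unfold dot, sum4; rewrite !cc_zero; ring).
  destruct d; rewrite !E0; apply C_eq; simpl; ring.
Qed.

(* Coefficients of a form in the coframe dual to T, Z, Zbar. *)
Definition cp (a : Defs.form1) (d : letter) (q : C2) : C :=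
  match d with
  | LT => a q (fieldT q)
  | LZ => (/ 2 * (a q (fieldX q) - Ci * a q (fieldY q)))%C
  | LB => (/ 2 * (a q (fieldX q) + Ci * a q (fieldY q)))%C
  end.

Lemma tangent_dot p v : tangent p v <-> dot v p = 0.
Proof.
  unfold tangent, dot, sum4. destruct p as [[a b] [c d]], v as [[a' b'] [c' d']]. simpl. split; intros H; lra.
Qed.

(** The vectors p, T p, X p, Y p are orthogonal of equal length, which is 1 on the sphere. *)
Lemma full_decomp p v : S3 p -> v = plus (plus (scal (dot v p) p) (scal (dot v (fieldT p)) (fieldT p)))
   (plus (scal (dot v (fieldX p)) (fieldX p)) (scal (dot v (fieldY p)) (fieldY p))).
Proof.
  intros Hp. apply S3_nsq in Hp.
  assert (E : forall i, (i < 4)%nat -> nsq p * cc i v = cc i (plus (plus (scal (dot v p) p) (scal (dot v (fieldT p)) (fieldT p)))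
   (plus (scal (dot v (fieldX p)) (fieldX p)) (scal (dot v (fieldY p)) (fieldY p))))).
  { intros i Hi. rewrite !cc_plus, !cc_scal. unfold nsq, dot, sum4, fieldT, fieldX, fieldY, mkv.
    destruct i as [|[|[|[|i]]]]; try lia; simpl; ring. }
  apply cc_ext. intros i Hi. rewrite <- E by auto. rewrite Hp. ring.
Qed.

Lemma tangent_decomp p v : S3 p -> tangent p v -> v = plus (scal (dot v (fieldT p)) (fieldT p))
   (plus (scal (dot v (fieldX p)) (fieldX p)) (scal (dot v (fieldY p)) (fieldY p))).
Proof.
  intros Hp Hv. apply tangent_dot in Hv. rewrite (full_decomp p v Hp) at 1. rewrite Hv.
  apply cc_ext. intros i Hi. rewrite !cc_plus, !cc_scal. ring.
Qed.

Section Forms.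
Context (U : C2 -> Prop) (HO : open_S3 U).

Lemma lf_plus a p v w : linear_form U a -> S3 p -> U p -> a p (plus v w) = (a p v + a p w)%C.
Proof.
  intros H Sp Up. rewrite <- (Cmult_1_l (a p v)). change (RtoC 1) with (RtoC 1). rewrite <- H by auto. f_equal. f_equal. symmetry; apply scal_one_C2.
Qed.

Lemma lf_zero a p : linear_form U a -> S3 p -> U p -> a p zero = RtoC 0.
Proof.
  intros H Sp Up. assert (E := lf_plus a p zero zero H Sp Up). rewrite plus_zero_l in E.
  apply (f_equal (fun z => z - a p zero)%C) in E. ring_simplify in E. now rewrite <- E.
Qed.

Lemma lf_scal a p (c : R) v : linear_form U a -> S3 p -> U p -> a p (scal c v) = (RtoC c * a p v)%C.
Proof.
  intros H Sp Up. rewrite <- (plus_zero_r (scal c v)). rewrite H, (lf_zero a) by auto. ring.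
Qed.

Lemma form_full a p v : linear_form U a -> S3 p -> U p ->
  a p v = (RtoC (dot v p) * a p p + (ka LT p v * cp a LT p + ka LZ p v * cp a LZ p + ka LB p v * cp a LB p))%C.
Proof.
  intros H Sp Up. rewrite (full_decomp p v Sp) at 1. rewrite !(lf_plus a), !(lf_scal a) by auto.
  unfold ka, cp. destruct (a p p), (a p (fieldT p)), (a p (fieldX p)), (a p (fieldY p)). apply C_eq; simpl; field.
Qed.

Lemma form_frame a p v : linear_form U a -> S3 p -> U p -> tangent p v ->
  a p v = (ka LT p v * cp a LT p + ka LZ p v * cp a LZ p + ka LB p v * cp a LB p)%C.
Proof.
  intros H Sp Up Hv. rewrite (form_full a) by auto. apply tangent_dot in Hv. rewrite Hv. ring.
Qed.

Lemma dS_frame f p V : smooth_cfun U f -> S3 p -> U p ->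
  dS f p V = (capp (ka LT) p V * Dl LT f p + capp (ka LZ) p V * Dl LZ f p + capp (ka LB) p V * Dl LB f p)%C.
Proof.
  intros [H1 H2] Sp Up. assert (Hc := cone_S3 U p Sp Up). assert (Hn := proj1 (S3_nsq p) Sp).
  assert (E : forall v, cdirD v (ext f) p = (ka LT p v * Dl LT f p + ka LZ p v * Dl LZ f p + ka LB p v * Dl LB f p)%C).
  { intros v. unfold cdirD.
    transitivity ((dirD v (ext (fun q => Re (f q))) p, dirD v (ext (fun q => Im (f q))) p) : C); [reflexivity|].
    rewrite !(dirD_fields U) by auto. rewrite Hn. rewrite !ext_S3 by auto.
    unfold Dl, ka, cDv.
    set (x1 := Dv fieldX (fun q => Re (f q)) p). set (x2 := Dv fieldX (fun q => Im (f q)) p).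
    set (y1 := Dv fieldY (fun q => Re (f q)) p). set (y2 := Dv fieldY (fun q => Im (f q)) p).
    apply C_eq; simpl; field. }
  unfold dS. rewrite !E. unfold capp. ring.
Qed.

End Forms.

Lemma dot_plus_r x y y' : dot x (plus y y') = dot x y + dot x y'.
Proof. unfold dot, sum4. rewrite !cc_plus. ring. Qed.
Lemma dot_scal_r (r : R) x y : dot x (scal r y) = r * dot x y.
Proof. unfold dot, sum4. rewrite !cc_scal. ring. Qed.
Lemma dot_comm x y : dot x y = dot y x.
Proof. unfold dot, sum4. ring. Qed.

Lemma smooth_fun_dot U w A : lin A -> smooth_fun U (fun q => dot w (A q)).
Proof.
  intros HA. apply smooth_fun_ext with (fun q => sum4 (fun i => cc i w * sum4 (fun j => cc j q * cc i (A (ev j))))).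
  - intros q _ _. unfold dot. unfold sum4 at 1. rewrite <- !(cc_lin A _ q HA). reflexivity.
  - unfold sum4. repeat apply smooth_fun_plus; apply smooth_fun_mult; try apply smooth_fun_const;
    repeat apply smooth_fun_plus; apply smooth_fun_mult; try apply smooth_fun_const; apply smooth_fun_cc.
Qed.

Lemma Dv_dot B w A p : rot_field B -> lin A -> S3 p -> Dv B (fun q => dot w (A q)) p = dot w (A (B p)).
Proof.
  intros HB HA Hp. assert (H := Dv_flow B _ p HB (smooth_fun_dot _ w A HA) Hp).
  apply is_derive_unique in H. rewrite <- H. apply is_derive_unique.
  apply is_derive_ext with (fun s => cos s * dot w (A p) + sin s * dot w (A (B p))).
  - intros s. unfold flow. destruct HA as [H1 H2]. now rewrite H1, !H2, dot_plus_r, !dot_scal_r.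
  - auto_derive; auto. rewrite cos_0, sin_0. ring.
Qed.

Lemma lin_id : lin (fun x => x).
Proof. split; reflexivity. Qed.

Lemma dirD_dot v w A p : lin A -> S3 p -> tangent p v -> dirD v (ext (fun q => dot w (A q))) p = dot w (A v).
Proof.
  intros HA Sp Hv.
  rewrite (dirD_fields (fun _ => True)); [|apply cone0_open|now apply smooth_fun_dot|now apply cone_S3].
  rewrite !ext_S3, !Dv_dot by auto using rot_fieldT, rot_fieldX, rot_fieldY.
  rewrite (proj1 (S3_nsq p) Sp). rewrite (tangent_decomp p v Sp Hv) at 4.
  destruct HA as [H1 H2]. rewrite !H1, !H2, !dot_plus_r, !dot_scal_r. field.
Qed.

Lemma scf_form U a v : smooth_form U a -> smooth_cfun U (fun q => a q v).
Proof. intros [_ H]. apply H. Qed.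

Lemma form_basis U a q v : smooth_form U a -> S3 q -> U q ->
  a q v = (RtoC (cc 0 v) * a q (ev 0) + RtoC (cc 1 v) * a q (ev 1) + RtoC (cc 2 v) * a q (ev 2) + RtoC (cc 3 v) * a q (ev 3))%C.
Proof.
  intros [H _] Sq Uq. rewrite (cc_basis v) at 1. now rewrite !(lf_plus U a), !(lf_scal U a).
Qed.

Lemma scf_form_lin U a A : lin A -> smooth_form U a -> smooth_cfun U (fun q => a q (A q)).
Proof.
  intros HA H. apply scf_ext with (fun q => RtoC (cc 0 (A q)) * a q (ev 0) + RtoC (cc 1 (A q)) * a q (ev 1) + RtoC (cc 2 (A q)) * a q (ev 2) + RtoC (cc 3 (A q)) * a q (ev 3))%C.
  - intros q Sq Uq. symmetry. now apply (form_basis U).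
  - assert (K : forall i, smooth_cfun U (fun q => (RtoC (cc i (A q)) * a q (ev i))%C)).
    { intros i. apply scf_mult; [|now apply scf_form]. apply scf_real.
      apply smooth_fun_ext with (fun q => dot (ev i) (A q)).
      - intros q _ _. unfold dot, sum4, ev, mkv. destruct i as [|[|[|i]]]; simpl; ring.
      - now apply smooth_fun_dot. }
    repeat apply scf_plus; apply K.
Qed.

Lemma scf_cp U a d : smooth_form U a -> smooth_cfun U (cp a d).
Proof.
  intros H. assert (HT := scf_form_lin U a _ lin_fieldT H). assert (HX := scf_form_lin U a _ lin_fieldX H).
  assert (HY := scf_form_lin U a _ lin_fieldY H).
  destruct d; unfold cp; auto; apply scf_mult; auto using scf_const; [apply scf_minus|apply scf_plus]; auto; apply scf_mult; auto using scf_const.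
Qed.

(* Coefficients of [d1 a] in the coframe; the last term comes from the bracket of the two fields. *)
Definition cd (a : Defs.form1) (d e : letter) (p : C2) : C :=
  (Dl d (cp a e) p - Dl e (cp a d) p + match d, e with
     | LT, LZ => 2 * Ci * cp a LZ p
     | LT, LB => - (2 * Ci * cp a LB p)
     | LZ, LB => Ci * cp a LT p
     | _, _ => RtoC 0 end)%C.

(** The multiplication table of the quaternions in the moving frame; the component along p
    disappears because w is tangent. *)
Lemma dot_fields p v w : S3 p -> tangent p v -> tangent p w ->
  dot w (fieldT v) = dot v (fieldX p) * dot w (fieldY p) - dot v (fieldY p) * dot w (fieldX p) /\
  dot w (fieldX v) = dot v (fieldY p) * dot w (fieldT p) - dot v (fieldT p) * dot w (fieldY p) /\
  dot w (fieldY v) = dot v (fieldT p) * dot w (fieldX p) - dot v (fieldX p) * dot w (fieldT p).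
Proof.
  intros Sp Hv Hw. apply tangent_dot in Hw. rewrite (tangent_decomp p v Sp Hv) at 1 4 7.
  destruct lin_fieldT as [T1 T2], lin_fieldX as [X1 X2], lin_fieldY as [Y1 Y2].
  rewrite !T1, !T2, !X1, !X2, !Y1, !Y2, !dot_plus_r, !dot_scal_r.
  assert (E : dot w (fieldT (fieldT p)) = - dot w p /\ dot w (fieldT (fieldX p)) = dot w (fieldY p) /\ dot w (fieldT (fieldY p)) = - dot w (fieldX p)
     /\ dot w (fieldX (fieldT p)) = - dot w (fieldY p) /\ dot w (fieldX (fieldX p)) = - dot w p /\ dot w (fieldX (fieldY p)) = dot w (fieldT p)
     /\ dot w (fieldY (fieldT p)) = dot w (fieldX p) /\ dot w (fieldY (fieldX p)) = - dot w (fieldT p) /\ dot w (fieldY (fieldY p)) = - dot w p).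
  { unfold dot, sum4, fieldT, fieldX, fieldY, mkv; simpl. repeat split; ring. }
  destruct E as [-> [-> [-> [-> [-> [-> [-> [-> ->]]]]]]]]. rewrite Hw. repeat split; ring.
Qed.

Section D1.
Context (U : C2 -> Prop) (HO : open_S3 U) (p : C2) (Sp : S3 p) (Up : U p).

Lemma cdirD_plus f g v : smooth_cfun U f -> smooth_cfun U g ->
  cdirD v (ext (fun q => f q + g q)%C) p = (cdirD v (ext f) p + cdirD v (ext g) p)%C.
Proof.
  intros [H1 H2] [H3 H4]. assert (Hc := cone_p U p Sp Up).
  apply C_eq; [apply (dirD_plus (cone U) (ext (fun q => Re (f q))) (ext (fun q => Re (g q))))|
    apply (dirD_plus (cone U) (ext (fun q => Im (f q))) (ext (fun q => Im (g q))))]; auto.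
Qed.

Lemma cdirD_rmult (r : C2 -> R) f v : smooth_fun U r -> smooth_cfun U f ->
  cdirD v (ext (fun q => RtoC (r q) * f q)%C) p = (RtoC (dirD v (ext r) p) * f p + RtoC (r p) * cdirD v (ext f) p)%C.
Proof.
  intros Hr [H1 H2]. assert (Hc := cone_p U p Sp Up).
  assert (K : forall g, smooth_fun U g -> dirD v (fun y => ext r y * ext g y) p = dirD v (ext r) p * g p + r p * dirD v (ext g) p).
  { intros g Hg. rewrite (dirD_mult (cone U)) by auto. now rewrite !ext_S3. }
  apply C_eq.
  - transitivity (dirD v (fun y => ext r y * ext (fun q => Re (f q)) y) p).
    + apply (dirD_ext_open (cone U)); auto. intros y _. unfold ext. simpl. unfold Re. ring.
    + rewrite K by auto.
      transitivity ((dirD v (ext r) p * Re (f p) - 0 * Im (f p)) + (r p * dirD v (ext (fun q => Re (f q))) p - 0 * dirD v (ext (fun q => Im (f q))) p)); [ring|reflexivity].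
  - transitivity (dirD v (fun y => ext r y * ext (fun q => Im (f q)) y) p).
    + apply (dirD_ext_open (cone U)); auto. intros y _. unfold ext. simpl. unfold Im. ring.
    + rewrite K by auto.
      transitivity ((dirD v (ext r) p * Im (f p) + 0 * Re (f p)) + (r p * dirD v (ext (fun q => Im (f q))) p + 0 * dirD v (ext (fun q => Re (f q))) p)); [ring|reflexivity].
Qed.

Lemma cdirD_ext f g v : (forall q, S3 q -> U q -> f q = g q) -> cdirD v (ext f) p = cdirD v (ext g) p.
Proof.
  intros E. apply C_eq; [apply (dirD_ext_U U (fun q => Re (f q)) (fun q => Re (g q)))|
    apply (dirD_ext_U U (fun q => Im (f q)) (fun q => Im (g q)))]; auto; intros; now rewrite E.
Qed.

Lemma cdirD_real f v : smooth_cfun U f ->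
  cdirD v (ext f) p = (ka LT p v * Dl LT f p + ka LZ p v * Dl LZ f p + ka LB p v * Dl LB f p)%C.
Proof.
  intros H. assert (E := dS_frame U HO f p (cplx v) H Sp Up).
  unfold dS, cplx, capp in E; simpl fst in E; simpl snd in E.
  rewrite !ka_zero in E.
  assert (Z2 : cdirD zero (ext f) p = RtoC 0).
  { assert (K : forall g, dirD zero g p = 0).
    { intros g. unfold dirD. transitivity (Derive (fun _ => g p) 0); [|apply Derive_const]. apply Derive_ext. intros h. f_equal.
      apply cc_ext; intros; rewrite cc_plus, cc_scal, cc_zero; ring. }
    apply C_eq; apply K. }
  rewrite Z2 in E. rewrite Cmult_0_r, Cplus_0_r in E. rewrite E. ring.
Qed.

(** In [d1] the vector w is constant in C^2 while the frame moves with the base point, which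
    produces the terms with [fieldT v], [fieldX v], [fieldY v]: they carry the brackets of the
    frame. The term [dot w v] is symmetric and cancels in [d1_frame]. *)
Lemma d1_half a v w : smooth_form U a -> tangent p v ->
  cdirD v (ext (fun q => a q w)) p =
   (RtoC (dot w p) * cdirD v (ext (fun q => a q q)) p + RtoC (dot w v) * a p p +
   (RtoC (dot w (fieldT p)) * cdirD v (ext (fun q => a q (fieldT q))) p + RtoC (dot w (fieldT v)) * a p (fieldT p)) +
   (RtoC (dot w (fieldX p)) * cdirD v (ext (fun q => a q (fieldX q))) p + RtoC (dot w (fieldX v)) * a p (fieldX p)) +
   (RtoC (dot w (fieldY p)) * cdirD v (ext (fun q => a q (fieldY q))) p + RtoC (dot w (fieldY v)) * a p (fieldY p)))%C.
Proof.
  intros Ha Hv.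
  rewrite (cdirD_ext _ (fun q => (RtoC (dot w q) * a q q + RtoC (dot w (fieldT q)) * a q (fieldT q)) + (RtoC (dot w (fieldX q)) * a q (fieldX q) +
     RtoC (dot w (fieldY q)) * a q (fieldY q)))%C).
  2:{ intros q Sq Uq. rewrite (full_decomp q w Sq) at 1. destruct Ha as [Ha _].
      rewrite !(lf_plus U a), !(lf_scal U a) by auto. reflexivity. }
  assert (S0 : smooth_fun U (fun q => dot w q)) by apply (smooth_fun_dot U w _ lin_id).
  assert (S1 := smooth_fun_dot U w _ lin_fieldT). assert (S2 := smooth_fun_dot U w _ lin_fieldX). assert (S3' := smooth_fun_dot U w _ lin_fieldY).
  assert (A0 : smooth_cfun U (fun q => a q q)) by apply (scf_form_lin U a _ lin_id Ha).
  assert (A1 := scf_form_lin U a _ lin_fieldT Ha). assert (A2 := scf_form_lin U a _ lin_fieldX Ha). assert (A3 := scf_form_lin U a _ lin_fieldY Ha).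
  assert (M : forall r f, smooth_fun U r -> smooth_cfun U f -> smooth_cfun U (fun q => RtoC (r q) * f q)%C) by (intros; apply scf_mult; auto using scf_real).
  assert (B0 := M _ _ S0 A0). assert (B1 := M _ _ S1 A1). assert (B2 := M _ _ S2 A2). assert (B3 := M _ _ S3' A3).
  rewrite (cdirD_plus _ _ v (scf_plus _ _ _ B0 B1) (scf_plus _ _ _ B2 B3)), (cdirD_plus _ _ v B0 B1), (cdirD_plus _ _ v B2 B3).
  rewrite (cdirD_rmult _ _ v S0 A0), (cdirD_rmult _ _ v S1 A1), (cdirD_rmult _ _ v S2 A2), (cdirD_rmult _ _ v S3' A3).
  rewrite (dirD_dot v w _ p lin_fieldT), (dirD_dot v w _ p lin_fieldX), (dirD_dot v w _ p lin_fieldY), (dirD_dot v w _ p lin_id) by auto. ring.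
Qed.

Lemma d1_frame a v w : smooth_form U a -> tangent p v -> tangent p w ->
  Defs.d1 a p v w = ((ka LT p v * ka LZ p w - ka LZ p v * ka LT p w) * cd a LT LZ p
    + (ka LT p v * ka LB p w - ka LB p v * ka LT p w) * cd a LT LB p
    + (ka LZ p v * ka LB p w - ka LB p v * ka LZ p w) * cd a LZ LB p)%C.
Proof.
  intros Ha Hv Hw. unfold Defs.d1. rewrite !d1_half by auto.
  destruct (dot_fields p v w Sp Hv Hw) as [E1 [E2 E3]]. destruct (dot_fields p w v Sp Hw Hv) as [E4 [E5 E6]].
  rewrite E1, E2, E3, E4, E5, E6. rewrite (dot_comm v w).
  assert (Z1 := proj1 (tangent_dot p v) Hv). assert (Z2 := proj1 (tangent_dot p w) Hw). rewrite Z1, Z2.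
  assert (A1 := scf_form_lin U a _ lin_fieldT Ha). assert (A2 := scf_form_lin U a _ lin_fieldX Ha). assert (A3 := scf_form_lin U a _ lin_fieldY Ha).
  rewrite !(cdirD_real (fun q => a q (fieldT q))), !(cdirD_real (fun q => a q (fieldX q))), !(cdirD_real (fun q => a q (fieldY q))) by auto.
  unfold cd.
  assert (EX : forall d, Dl d (fun q => a q (fieldX q)) p = (Dl d (cp a LZ) p + Dl d (cp a LB) p)%C).
  { intros d. rewrite <- (Dl_plus U HO p Sp Up) by auto using scf_cp. apply (Dl_ext U HO p Sp Up). intros q _ _. unfold cp. field. }
  assert (EY : forall d, Dl d (fun q => a q (fieldY q)) p = (Ci * Dl d (cp a LZ) p + (- Ci) * Dl d (cp a LB) p)%C).
  { intros d. rewrite <- !(Dl_scal U HO p Sp Up) by auto using scf_cp.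
    rewrite <- (Dl_plus U HO p Sp Up) by auto using scf_mult, scf_const, scf_cp. apply (Dl_ext U HO p Sp Up). intros q _ _. unfold cp.
    destruct (a q (fieldX q)), (a q (fieldY q)). apply C_eq; simpl; field. }
  assert (ET : forall d, Dl d (fun q => a q (fieldT q)) p = Dl d (cp a LT) p) by reflexivity.
  rewrite !EX, !EY, (ET LT), (ET LZ), (ET LB). rewrite !Cmult_0_l, !Cplus_0_l.
  generalize (RtoC (dot w v) * a p p)%C.
  assert (PX : a p (fieldX p) = (cp a LZ p + cp a LB p)%C) by (unfold cp; field).
  assert (PY : a p (fieldY p) = (Ci * cp a LZ p - Ci * cp a LB p)%C).
  { unfold cp. destruct (a p (fieldX p)), (a p (fieldY p)). apply C_eq; simpl; field. }
  rewrite PX, PY. change (a p (fieldT p)) with (cp a LT p).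
  generalize (cp a LT p) (cp a LZ p) (cp a LB p).
  generalize (Dl LT (cp a LT) p) (Dl LT (cp a LZ) p) (Dl LT (cp a LB) p).
  generalize (Dl LZ (cp a LT) p) (Dl LZ (cp a LZ) p) (Dl LZ (cp a LB) p).
  generalize (Dl LB (cp a LT) p) (Dl LB (cp a LZ) p) (Dl LB (cp a LB) p).
  intros c1 c2 c3 c4 c5 c6 c7 c8 c9 a1 a2 a3 nn.
  unfold ka. generalize (dot v (fieldT p)) (dot v (fieldX p)) (dot v (fieldY p)) (dot w (fieldT p)) (dot w (fieldX p)) (dot w (fieldY p)).
  intros t x y t' x' y'.
  destruct c1, c2, c3, c4, c5, c6, c7, c8, c9, a1, a2, a3, nn. apply C_eq; simpl; ring.
Qed.

End D1.

(** The differential of u at p is v -> 2 <p, v>, and the combination of its (0,1) and (1,0) parts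
    composes it with the complex structure. *)
Lemma theta0_eq p v : theta0 p v = RtoC (dot v (fieldT p)).
Proof.
  assert (E : forall w, cdirD w u_def p = RtoC (2 * dot p w)).
  { intros w. apply C_eq; simpl.
    - assert (H : forall h : R, nsq p + 2 * h * dot p w + h * h * nsq w - 1 = Re (u_def (plus p (scal h w)))).
      { intros h. transitivity (Cmod (z0 (plus p (scal h w))) ^ 2 + Cmod (z1 (plus p (scal h w))) ^ 2 - 1); [|reflexivity].
        rewrite nsq_Cmod. unfold nsq, dot, sum4. rewrite !cc_plus, !cc_scal. ring. }
      apply is_derive_unique. apply (is_derive_ext _ _ _ _ H). auto_derive; auto. ring.
    - exact (dirD_const 0 p w). }
  unfold theta0, del, delbar. rewrite !E.
  replace (dot v (fieldT p)) with (- dot p (Jmul v)).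
  - apply C_eq; simpl; field.
  - destruct p as [[a b] [c d]], v as [[a' b'] [c' d']]. unfold dot, sum4, fieldT, Jmul, mkv; simpl. ring.
Qed.

Lemma smooth_theta0 U : smooth_form U theta0.
Proof.
  split.
  - intros p c v w _ _. rewrite !theta0_eq, dot_plus, dot_scal. apply C_eq; simpl; ring.
  - intros v. apply scf_ext with (fun p => RtoC (dot v (fieldT p))); [intros; now rewrite theta0_eq|].
    apply scf_real. apply smooth_fun_dot, lin_fieldT.
Qed.

Lemma ka_fields p : S3 p ->
  (ka LT p (fieldT p) = RtoC 1 /\ ka LZ p (fieldT p) = RtoC 0 /\ ka LB p (fieldT p) = RtoC 0) /\
  (ka LT p (fieldX p) = RtoC 0 /\ ka LZ p (fieldX p) = RtoC 1 /\ ka LB p (fieldX p) = RtoC 1) /\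
  (ka LT p (fieldY p) = RtoC 0 /\ ka LZ p (fieldY p) = Ci /\ ka LB p (fieldY p) = (- Ci)%C).
Proof.
  intros Sp. apply S3_nsq in Sp.
  assert (E : dot (fieldT p) (fieldT p) = 1 /\ dot (fieldX p) (fieldX p) = 1 /\ dot (fieldY p) (fieldY p) = 1).
  { rewrite <- Sp. unfold nsq, dot, sum4, fieldT, fieldX, fieldY, mkv; simpl. repeat split; ring. }
  assert (E2 : dot (fieldT p) (fieldX p) = 0 /\ dot (fieldT p) (fieldY p) = 0 /\ dot (fieldX p) (fieldT p) = 0 /\
     dot (fieldX p) (fieldY p) = 0 /\ dot (fieldY p) (fieldT p) = 0 /\ dot (fieldY p) (fieldX p) = 0).
  { unfold dot, sum4, fieldT, fieldX, fieldY, mkv; simpl. repeat split; ring. }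
  unfold ka. destruct E as [-> [-> ->]]. destruct E2 as [-> [-> [-> [-> [-> ->]]]]].
  repeat split; apply C_eq; simpl; ring.
Qed.

Lemma cp_theta0 p : S3 p -> cp theta0 LT p = RtoC 1 /\ cp theta0 LZ p = RtoC 0 /\ cp theta0 LB p = RtoC 0.
Proof.
  intros Sp. destruct (ka_fields p Sp) as [[E1 _] [[E2 _] [E3 _]]]. unfold ka in *. unfold cp. rewrite !theta0_eq, E1, E2, E3.
  repeat split; ring.
Qed.

Lemma cd_theta0 p : S3 p -> cd theta0 LT LZ p = RtoC 0 /\ cd theta0 LT LB p = RtoC 0 /\ cd theta0 LZ LB p = Ci.
Proof.
  intros Sp. assert (HO := cone0_open).
  assert (E : forall d e, Dl d (cp theta0 e) p = RtoC 0).
  { intros d e. rewrite (Dl_ext _ HO p Sp I d (cp theta0 e) (fun _ => cp theta0 e p)); [apply Dl_const|].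
    intros q Sq _. destruct (cp_theta0 p Sp) as [E1 [E2 E3]]. destruct (cp_theta0 q Sq) as [F1 [F2 F3]].
    destruct e; congruence. }
  unfold cd. rewrite !E. destruct (cp_theta0 p Sp) as [-> [-> ->]].
  repeat split; ring.
Qed.

Lemma d1_theta0 p v w : S3 p -> tangent p v -> tangent p w ->
  Defs.d1 theta0 p v w = RtoC (2 * (dot v (fieldX p) * dot w (fieldY p) - dot v (fieldY p) * dot w (fieldX p))).
Proof.
  intros Sp Hv Hw. rewrite (d1_frame (fun _ => True) cone0_open p Sp I) by auto using smooth_theta0.
  destruct (cd_theta0 p Sp) as [-> [-> ->]]. unfold ka. apply C_eq; simpl; ring.
Qed.

Lemma volume_hopf x y z : wedge12 theta0 (Defs.d1 theta0) (hopf x y z) (hopf_a x y z) (hopf_eta x y z) (hopf_b x y z) = RtoC (wgt x).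
Proof.
  assert (Sp := hopf_S3 x y z).
  assert (T : tangent (hopf x y z) (hopf_a x y z) /\ tangent (hopf x y z) (hopf_eta x y z) /\ tangent (hopf x y z) (hopf_b x y z)).
  { unfold tangent, hopf, hopf_a, hopf_eta, hopf_b, mk2, z0, z1; simpl.
    assert (E1 := sin2_cos2 y). assert (E2 := sin2_cos2 z). unfold Rsqr in *.
    repeat split; try ring.
    transitivity (cos x * sin x * ((sin z * sin z + cos z * cos z) - (sin y * sin y + cos y * cos y))); [ring|]. rewrite E1, E2. ring. }
  destruct T as [T1 [T2 T3]]. unfold wedge12. rewrite !d1_theta0, !theta0_eq by auto.
  assert (E0 := sin2_cos2 x). assert (E1 := sin2_cos2 y). assert (E2 := sin2_cos2 z). unfold Rsqr in *.
  (* The cosine and the sine of y + z. In the frame T, X, Y the coordinate vectors depend on the two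
     angles through this sum only. *)
  set (c := cos y * cos z - sin y * sin z). set (s := sin y * cos z + cos y * sin z).
  assert (Ecs : c * c + s * s = 1).
  { transitivity ((sin y * sin y + cos y * cos y) * (sin z * sin z + cos z * cos z)); [unfold c, s; ring|rewrite E1, E2; ring]. }
  set (p := hopf x y z) in *. set (u := hopf_a x y z) in *. set (v := hopf_eta x y z) in *. set (w := hopf_b x y z) in *.
  assert (A1 : dot u (fieldT p) = cos x * cos x * (sin y * sin y + cos y * cos y)) by (unfold p, u, dot, sum4, fieldT, hopf, hopf_a, mk2, mkv; simpl; ring).
  assert (A2 : dot u (fieldX p) = cos x * sin x * s) by (unfold s, p, u, dot, sum4, fieldX, hopf, hopf_a, mk2, mkv; simpl; ring).
  assert (A3 : dot u (fieldY p) = - (cos x * sin x * c)) by (unfold c, p, u, dot, sum4, fieldY, hopf, hopf_a, mk2, mkv; simpl; ring).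
  assert (B1 : dot v (fieldT p) = 0) by (unfold p, v, dot, sum4, fieldT, hopf, hopf_eta, mk2, mkv; simpl; ring).
  assert (B2 : dot v (fieldX p) = (sin x * sin x + cos x * cos x) * c) by (unfold c, p, v, dot, sum4, fieldX, hopf, hopf_eta, mk2, mkv; simpl; ring).
  assert (B3 : dot v (fieldY p) = (sin x * sin x + cos x * cos x) * s) by (unfold s, p, v, dot, sum4, fieldY, hopf, hopf_eta, mk2, mkv; simpl; ring).
  assert (C1 : dot w (fieldT p) = sin x * sin x * (sin z * sin z + cos z * cos z)) by (unfold p, w, dot, sum4, fieldT, hopf, hopf_b, mk2, mkv; simpl; ring).
  assert (C2' : dot w (fieldX p) = - (cos x * sin x * s)) by (unfold s, p, w, dot, sum4, fieldX, hopf, hopf_b, mk2, mkv; simpl; ring).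
  assert (C3 : dot w (fieldY p) = cos x * sin x * c) by (unfold c, p, w, dot, sum4, fieldY, hopf, hopf_b, mk2, mkv; simpl; ring).
  rewrite A1, A2, A3, B1, B2, B3, C1, C2', C3, E0, E1, E2. unfold wgt. apply C_eq; simpl; [|ring].
  transitivity (2 * (sin x * cos x) * (c * c + s * s) * (sin x * sin x + cos x * cos x)); [ring|rewrite Ecs, E0; ring].
Qed.

Lemma int_mu0_IS f : int_mu0 f = IS f.
Proof.
  rewrite IS_eq. unfold int_mu0, int_S3, I3, Ie, Ia, Ib.
  apply RInt_ext; intros x _. apply RInt_ext; intros y _. apply RInt_ext; intros z _.
  rewrite volume_hopf. cbn. ring.
Qed.

(** * Pseudohermitian frames of theta0 *)

Section Frame0.
Context (U : C2 -> Prop) (HO : open_S3 U) (F : frame_data) (PF : pseudohermitian_frame U theta0 F).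

Lemma frame0_T p : S3 p -> U p -> fr_T F p = fieldT p.
Proof.
  intros Sp Up. destruct (pf_T _ _ _ PF p Sp Up) as [H1 [H2 H3]].
  rewrite (tangent_decomp p _ Sp H1). rewrite theta0_eq in H2. apply (f_equal Re) in H2. simpl in H2.
  assert (TX : tangent p (fieldX p)) by (apply tangent_dot; unfold dot, sum4, fieldX, mkv; simpl; ring).
  assert (TY : tangent p (fieldY p)) by (apply tangent_dot; unfold dot, sum4, fieldY, mkv; simpl; ring).
  assert (KX := H3 _ TX). assert (KY := H3 _ TY). rewrite d1_theta0 in KX, KY by auto.
  destruct (ka_fields p Sp) as [_ [[_ [KX2 _]] [_ [KY2 _]]]]. unfold ka in KX2, KY2.
  injection KX2 as X1 X2. injection KY2 as Y1 Y2. rewrite X1, X2 in KX. rewrite Y1, Y2 in KY.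
  apply (f_equal Re) in KX. apply (f_equal Re) in KY. simpl in KX, KY.
  rewrite H2. replace (dot (fr_T F p) (fieldX p)) with 0 by lra. replace (dot (fr_T F p) (fieldY p)) with 0 by lra.
  apply cc_ext; intros. rewrite !cc_plus, !cc_scal. ring.
Qed.

Definition al (p : C2) : C := capp (ka LZ) p (fr_Z F p).

Lemma fieldT_J v : Jmul v = fieldT v.
Proof. destruct v as [[a b] [c d]]. unfold Jmul, fieldT, mk2, mkv; simpl. f_equal; apply C_eq; simpl; ring. Qed.

Lemma dot_T_X v p : dot (fieldT v) (fieldX p) = - dot v (fieldY p).
Proof. unfold dot, sum4, fieldT, fieldX, fieldY, mkv; simpl; ring. Qed.
Lemma dot_T_Y v p : dot (fieldT v) (fieldY p) = dot v (fieldX p).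
Proof. unfold dot, sum4, fieldT, fieldX, fieldY, mkv; simpl; ring. Qed.
Lemma dot_T_p v p : dot (fieldT v) p = - dot v (fieldT p).
Proof. unfold dot, sum4, fieldT, mkv; simpl; ring. Qed.
Lemma dot_opp x y : dot (opp x) y = - dot x y.
Proof. unfold dot, sum4. rewrite !cc_opp. ring. Qed.

(** A vector of type (1,0) is determined by its real part u as u - i J u; being tangent together
    with its imaginary part, it has no component along T, so Z_1 is a multiple of Z. *)
Lemma frame0_Z p : S3 p -> U p ->
  capp (ka LT) p (fr_Z F p) = RtoC 0 /\ capp (ka LB) p (fr_Z F p) = RtoC 0 /\
  capp (ka LT) p (frZbar F p) = RtoC 0 /\ capp (ka LZ) p (frZbar F p) = RtoC 0 /\ capp (ka LB) p (frZbar F p) = Cconj (al p).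
Proof.
  intros Sp Up. destruct (pf_Z _ _ _ PF p Sp Up) as [[H1 H2] H3].
  assert (J1 := f_equal fst H3).
  change (Jmul (fst (fr_Z F p)) = opp (snd (fr_Z F p))) in J1. rewrite fieldT_J in J1.
  unfold frZbar, Vconj, al, capp. destruct (fr_Z F p) as [u v]. simpl in *.
  assert (E : v = opp (fieldT u)) by (rewrite J1; apply cc_ext; intros; rewrite !cc_opp; ring).
  apply tangent_dot in H2. rewrite E, dot_opp, dot_T_p in H2. assert (T0 : dot u (fieldT p) = 0) by lra.
  assert (T1 : dot (fieldT u) (fieldT p) = 0).
  { apply tangent_dot in H1. rewrite <- H1. unfold dot, sum4, fieldT, mkv; simpl. ring. }
  rewrite E, !dot_opp, T0, T1, dot_T_X, dot_T_Y.
  repeat split; apply C_eq; simpl; ring.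
Qed.

End Frame0.

(** The values of an alternating 2-form on pairs among T, Z, Zbar, hence its coefficients in the
    coframe. Applying this to both sides of a structure equation gives scalar equations. *)
Definition c2 (w : C2 -> C2 -> C2 -> C) (d e : letter) (p : C2) : C :=
  match d, e with
  | LT, LZ => (/ 2 * (w p (fieldT p) (fieldX p) - Ci * w p (fieldT p) (fieldY p)))%C
  | LT, LB => (/ 2 * (w p (fieldT p) (fieldX p) + Ci * w p (fieldT p) (fieldY p)))%C
  | LZ, LB => (/ 2 * Ci * w p (fieldX p) (fieldY p))%C
  | _, _ => RtoC 0
  end.

Definition pair_ok (d e : letter) : Prop := (d = LT /\ e = LZ) \/ (d = LT /\ e = LB) \/ (d = LZ /\ e = LB).

Lemma tangent_fieldT p : tangent p (fieldT p).
Proof. apply tangent_dot; unfold dot, sum4, fieldT, mkv; simpl; ring. Qed.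
Lemma tangent_fieldX p : tangent p (fieldX p).
Proof. apply tangent_dot; unfold dot, sum4, fieldX, mkv; simpl; ring. Qed.
Lemma tangent_fieldY p : tangent p (fieldY p).
Proof. apply tangent_dot; unfold dot, sum4, fieldY, mkv; simpl; ring. Qed.

Lemma c2_ext w w' d e p : (forall u v, tangent p u -> tangent p v -> w p u v = w' p u v) -> c2 w d e p = c2 w' d e p.
Proof.
  intros H. unfold c2. rewrite !(H (fieldT p)), !(H (fieldX p)) by auto using tangent_fieldT, tangent_fieldX, tangent_fieldY. reflexivity.
Qed.

Lemma c2_d1 U a d e p : open_S3 U -> S3 p -> U p -> smooth_form U a -> pair_ok d e -> c2 (Defs.d1 a) d e p = cd a d e p.
Proof.
  intros HO Sp Up Ha H. unfold c2. rewrite !(d1_frame U HO p Sp Up) by auto using tangent_fieldT, tangent_fieldX, tangent_fieldY.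
  destruct (ka_fields p Sp) as [[E1 [E2 E3]] [[E4 [E5 E6]] [E7 [E8 E9]]]]. rewrite E1, E2, E3, E4, E5, E6, E7, E8, E9.
  destruct H as [[-> ->]|[[-> ->]|[-> ->]]]; gen_C (cd a LT LZ p); gen_C (cd a LT LB p); gen_C (cd a LZ LB p);
  destruct z, z0, z1; apply C_eq; simpl; field.
Qed.

Lemma cp_X a p : a p (fieldX p) = (cp a LZ p + cp a LB p)%C.
Proof. unfold cp. field. Qed.
Lemma cp_Y a p : a p (fieldY p) = (Ci * cp a LZ p - Ci * cp a LB p)%C.
Proof. unfold cp. destruct (a p (fieldX p)), (a p (fieldY p)). apply C_eq; simpl; field. Qed.

Lemma c2_wedge a b d e p : pair_ok d e -> c2 (wedge11 a b) d e p = (cp a d p * cp b e p - cp a e p * cp b d p)%C.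
Proof.
  intros H. unfold c2, wedge11. rewrite !cp_X, !cp_Y. change (a p (fieldT p)) with (cp a LT p). change (b p (fieldT p)) with (cp b LT p).
  destruct H as [[-> ->]|[[-> ->]|[-> ->]]]; gen_C (cp a LT p); gen_C (cp a LZ p); gen_C (cp a LB p); gen_C (cp b LT p); gen_C (cp b LZ p); gen_C (cp b LB p);
  destruct z, z0, z1, z2, z3, z4; apply C_eq; simpl; field.
Qed.

Lemma c2_lin (A B : C) u v d e p : c2 (fun p x y => (A * u p x y + B * v p x y)%C) d e p = (A * c2 u d e p + B * c2 v d e p)%C.
Proof. unfold c2. destruct d, e; ring. Qed.

Lemma cp_conj a d p : cp (fconj a) d p = Cconj (cp a (bar d) p).
Proof.
  unfold cp, fconj, bar. destruct d; auto; destruct (a p (fieldX p)), (a p (fieldY p)); apply C_eq; simpl; field.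
Qed.

Lemma lf_conj U a : linear_form U a -> linear_form U (fconj a).
Proof. intros H p c v w Sp Up. unfold fconj. rewrite H by auto. rewrite Cplus_conj, Cmult_conj. f_equal. f_equal. apply C_eq; simpl; ring. Qed.

Lemma capp_frame U a p V : linear_form U a -> S3 p -> U p -> ctangent p V ->
  capp a p V = (capp (ka LT) p V * cp a LT p + capp (ka LZ) p V * cp a LZ p + capp (ka LB) p V * cp a LB p)%C.
Proof.
  intros H Sp Up [H1 H2]. unfold capp. rewrite (form_frame U a p (fst V)), (form_frame U a p (snd V)) by auto. ring.
Qed.

Lemma tangent_opp p v : tangent p v -> tangent p (opp v).
Proof. intros H. apply tangent_dot in H. apply tangent_dot. rewrite dot_opp, H. ring. Qed.

Lemma Dl_Lop U f p : open_S3 U -> S3 p -> U p -> smooth_S3 f ->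
  (Dl LB (Dl LZ (fun q => RtoC (f q))) p + Dl LZ (Dl LB (fun q => RtoC (f q))) p)%C = RtoC (/ 2 * Lop f p).
Proof.
  intros HO Sp Up Hf. assert (Hu := smooth_S3_fun U f Hf). assert (Hc := scf_real U f Hu).
  rewrite (Lop_XY U f p HO Hu (cone_p U p Sp Up)).
  rewrite (Dl_ZB U HO p Sp Up _ Hc).
  rewrite (Dl_LZ (fun q => RtoC (f q))). unfold Dl.
  assert (HX := scf_cDv U fieldX _ HO lin_fieldX Hc). assert (HY := scf_cDv U fieldY _ HO lin_fieldY Hc).
  rewrite !(cDv_comb U HO p Sp Up) by auto. rewrite (C_move _ _ _ (cbr_XY U HO p Sp Up _ Hc)).
  assert (R : forall A B, cDv A (cDv B (fun q => RtoC (f q))) p = RtoC (Dv A (Dv B f) p)).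
  { intros A B. apply C_eq; [reflexivity|].
    transitivity (Dv A (fun q => Dv B (fun _ => 0) q) p); [reflexivity|].
    assert (E : (fun q => Dv B (fun _ => 0) q) = (fun _ => 0)) by (extensionality q; apply (dirD_const 0 q (B q))). rewrite E.
    apply (dirD_const 0 p (A p)). }
  assert (RT : cDv fieldT (fun q => RtoC (f q)) p = RtoC (Dv fieldT f p)).
  { apply C_eq; [reflexivity|]. exact (dirD_const 0 p (fieldT p)). }
  rewrite !R, RT. apply C_eq; simpl; field.
Qed.

Section Frame0.
Context (U : C2 -> Prop) (HO : open_S3 U) (F : frame_data) (PF : pseudohermitian_frame U theta0 F).

Let th := fr_theta1 F.
Let om := fr_omega F.
Let be : C2 -> C := cp th LZ.

Lemma ct_Z p : S3 p -> U p -> ctangent p (fr_Z F p) /\ ctangent p (frZbar F p).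
Proof.
  intros Sp Up. destruct (pf_Z _ _ _ PF p Sp Up) as [H _]. split; auto. destruct H as [H1 H2]. split; [exact H1|now apply tangent_opp].
Qed.

(** Duality leaves theta^1 = be times the standard form and Z_1 = Z / be; the normalization d theta
    = i theta^1 /\ conj theta^1 forces |be| = 1. A frame is thus standard up to a phase. *)
Lemma frame0_theta1 p : S3 p -> U p -> cp th LT p = RtoC 0 /\ cp th LB p = RtoC 0 /\ al F p = Cconj (be p) /\ (be p * Cconj (be p))%C = RtoC 1.
Proof.
  intros Sp Up. assert (Hs := pf_smooth_theta1 _ _ _ PF). fold th in Hs. destruct Hs as [Hl Hs].
  destruct (pf_dual _ _ _ PF p Sp Up) as [_ [_ [D1 [D2 D3]]]]. fold th in D1, D2, D3.
  destruct (ct_Z p Sp Up) as [C1 C2']. rewrite (frame0_T U F PF p Sp Up) in D1.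
  rewrite (capp_frame U th p _ Hl Sp Up C1) in D2. rewrite (capp_frame U th p _ Hl Sp Up C2') in D3.
  destruct (frame0_Z U F PF p Sp Up) as [E1 [E2 [E3 [E4 E5]]]]. rewrite E1, E2 in D2. rewrite E3, E4, E5 in D3.
  fold (al F p) in D2. fold be in D2, D3. change (th p (fieldT p)) with (cp th LT p) in D1. rewrite D1 in *.
  assert (D4 : (al F p * be p)%C = RtoC 1) by (rewrite <- D2; ring).
  assert (D5 : (Cconj (al F p) * cp th LB p)%C = RtoC 0) by (rewrite <- D3; ring).
  assert (D6 : cp th LB p = RtoC 0).
  { transitivity (Cconj (be p) * (Cconj (al F p) * cp th LB p))%C; [|rewrite D5; ring].
    transitivity (Cconj (al F p * be p) * cp th LB p)%C; [rewrite D4|rewrite Cmult_conj; ring].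
    replace (Cconj (RtoC 1)) with (RtoC 1) by (apply C_eq; simpl; ring). ring. }
  assert (D7 : (be p * Cconj (be p))%C = RtoC 1).
  { assert (K := c2_ext (Defs.d1 theta0) (fun p x y => (Ci * wedge11 th (fconj th) p x y + RtoC 0 * wedge11 th th p x y)%C) LZ LB p).
    rewrite (c2_d1 U) in K by (auto using smooth_theta0; unfold pair_ok; auto).
    rewrite c2_lin, c2_wedge in K by (unfold pair_ok; auto). rewrite !cp_conj in K. simpl bar in K.
    destruct (cd_theta0 p Sp) as [_ [_ G]]. rewrite G, D6 in K. fold be in K.
    assert (K2 : Ci = (Ci * (be p * Cconj (be p)))%C).
    { rewrite K at 1.
      - ring.
      - intros u v Hu Hv. rewrite (pf_dtheta _ _ _ PF p u v Sp Up Hu Hv). fold th. ring. }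
    apply (f_equal (fun z => - Ci * z)%C) in K2.
    transitivity (- Ci * (Ci * (be p * Cconj (be p))))%C; [|rewrite <- K2; apply C_eq; simpl; ring].
    destruct (be p * Cconj (be p))%C. apply C_eq; simpl; ring. }
  repeat split; auto.
  transitivity (al F p * (be p * Cconj (be p)))%C; [rewrite D7; ring|]. rewrite Cmult_assoc, D4. ring.
Qed.

Lemma scf_be : smooth_cfun U be.
Proof. apply scf_cp. exact (pf_smooth_theta1 _ _ _ PF). Qed.

(** The derivative of |be|^2 = 1. *)
Lemma D_be p d : S3 p -> U p -> (Dl d (fun q => Cconj (be q)) p * be p)%C = (- (Cconj (be p) * Dl d be p))%C.
Proof.
  intros Sp Up. assert (H := Dl_mult U HO p Sp Up d be (fun q => Cconj (be q)) scf_be (scf_conj U be scf_be)).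
  rewrite (Dl_ext U HO p Sp Up d _ (fun _ => RtoC 1)) in H by (intros; now apply frame0_theta1).
  rewrite Dl_const in H.
  transitivity (Dl d be p * Cconj (be p) + be p * Dl d (fun q => Cconj (be q)) p - Cconj (be p) * Dl d be p)%C; [ring|].
  rewrite <- H. ring.
Qed.

(** Compare coefficients in the equation for d theta^1: the pair (T, Zbar) gives A = 0, the pairs
    (T, Z) and (Z, Zbar) give two components of omega, and omega + conj omega = 0 gives the third.
    In sum, omega = - d be / be - 2 i theta0. *)
Lemma frame0_omega p : S3 p -> U p -> fr_A F p = RtoC 0 /\
  cp om LT p = (- (Cconj (be p) * Dl LT be p) - 2 * Ci)%C /\
  cp om LB p = (- (Cconj (be p) * Dl LB be p))%C /\ cp om LZ p = (- (Cconj (be p) * Dl LZ be p))%C.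
Proof.
  intros Sp Up. destruct (frame0_theta1 p Sp Up) as [E1 [E2 [_ E4]]].
  assert (HD : forall d, Dl d (cp th LT) p = RtoC 0 /\ Dl d (cp th LB) p = RtoC 0).
  { intros d. rewrite (Dl_ext U HO p Sp Up d (cp th LT) (fun _ => RtoC 0)), (Dl_ext U HO p Sp Up d (cp th LB) (fun _ => RtoC 0)), !Dl_const; auto;
    intros; now apply frame0_theta1. }
  assert (K : forall d e, pair_ok d e -> cd th d e p = (RtoC 1 * (cp th d p * cp om e p - cp th e p * cp om d p) +
     fr_A F p * (cp theta0 d p * Cconj (cp th (bar e) p) - cp theta0 e p * Cconj (cp th (bar d) p)))%C).
  { intros d e Hde. rewrite <- (c2_d1 U) by (auto; exact (pf_smooth_theta1 _ _ _ PF)).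
    rewrite <- !cp_conj, <- !c2_wedge, <- c2_lin by auto. apply c2_ext. intros u v Hu Hv.
    rewrite Cmult_1_l. exact (pf_dtheta1 _ _ _ PF p u v Sp Up Hu Hv). }
  destruct (cp_theta0 p Sp) as [T1 [T2 T3]].
  assert (KTB := K LT LB (or_intror (or_introl (conj eq_refl eq_refl)))).
  assert (KTZ := K LT LZ (or_introl (conj eq_refl eq_refl))).
  assert (KZB := K LZ LB (or_intror (or_intror (conj eq_refl eq_refl)))).
  unfold cd in KTB, KTZ, KZB. simpl bar in KTB, KTZ, KZB.
  destruct (HD LT) as [H1 H2]. destruct (HD LZ) as [H3 H4]. destruct (HD LB) as [H5 H6].
  fold be in KTB, KTZ, KZB. rewrite T1, T2, T3, ?E1, ?E2, ?H1, ?H2, ?H3, ?H4, ?H5, ?H6 in *.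
  assert (A0 : fr_A F p = RtoC 0).
  { transitivity (fr_A F p * (be p * Cconj (be p)))%C; [rewrite E4; ring|].
    transitivity (be p * (fr_A F p * Cconj (be p)))%C; [ring|].
    replace (fr_A F p * Cconj (be p))%C with (RtoC 0); [ring|].
    transitivity (0 - 0 + - (2 * Ci * 0))%C; [ring|]. rewrite KTB. ring. }
  rewrite A0 in *.
  assert (OB : cp om LB p = (- (Cconj (be p) * Dl LB be p))%C).
  { transitivity ((be p * Cconj (be p)) * cp om LB p)%C; [rewrite E4; ring|].
    transitivity (Cconj (be p) * (0 - Dl LB be p + Ci * 0))%C; [rewrite KZB|]; ring. }
  repeat split; auto.
  - transitivity ((be p * Cconj (be p)) * cp om LT p)%C; [rewrite E4; ring|].
    transitivity (- (Cconj (be p) * (Dl LT be p - 0 + 2 * Ci * be p)))%C; [rewrite KTZ; ring|].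
    transitivity (- (Cconj (be p) * Dl LT be p) - 2 * Ci * (be p * Cconj (be p)))%C; [ring|rewrite E4; ring].
  - assert (EO : cp om LZ p = (- Cconj (cp om LB p))%C).
    { change LB with (bar LZ). rewrite <- cp_conj.
      transitivity (cp om LZ p + cp (fconj om) LZ p - cp (fconj om) LZ p)%C; [ring|].
      assert (G : (cp om LZ p + cp (fconj om) LZ p)%C = RtoC 0).
      { unfold cp.
        transitivity (/ 2 * ((om p (fieldX p) + fconj om p (fieldX p)) - Ci * (om p (fieldY p) + fconj om p (fieldY p))))%C; [ring|].
        unfold om. rewrite !(pf_omega _ _ _ PF p _ Sp Up) by auto using tangent_fieldX, tangent_fieldY. ring. }
      rewrite G. ring. }
    rewrite EO, OB. rewrite Copp_conj, Cmult_conj, Cconj_conj.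
    change LB with (bar LZ). rewrite <- (Dl_conj U HO p Sp Up LZ be scf_be).
    transitivity (Dl LZ (fun q => Cconj (be q)) p * be p)%C; [ring|now apply D_be].
Qed.

Lemma frame0_A11 p : S3 p -> U p -> A_11 F p = RtoC 0.
Proof. intros Sp Up. unfold A_11, A_bb. rewrite (proj1 (frame0_omega p Sp Up)). apply C_eq; simpl; ring. Qed.

Lemma cov_zero a b V f p : S3 p -> U p -> (forall q, S3 q -> U q -> f q = RtoC 0) -> cov F a b V f p = RtoC 0.
Proof.
  intros Sp Up H. unfold cov. rewrite (H p Sp Up).
  assert (Hf : smooth_cfun U f) by (apply scf_ext with (fun _ => RtoC 0); [intros; now rewrite H|apply scf_const]).
  rewrite (dS_frame U HO f p (V p) Hf Sp Up).
  rewrite !(Dl_ext U HO p Sp Up _ f (fun _ => RtoC 0)) by auto. rewrite !Dl_const. ring.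
Qed.

(** The phase part d be / be of omega is closed, and the rest contributes -2 i d theta0 = 2 theta^1
    /\ conj theta^1. *)
Lemma frame0_W p : S3 p -> U p -> fr_W F p = 2.
Proof.
  intros Sp Up. destruct (frame0_theta1 p Sp Up) as [E1 [E2 [_ E4]]].
  assert (Hs : smooth_form U om) by exact (pf_smooth_omega _ _ _ PF).
  assert (K : cd om LZ LB p = (RtoC (fr_W F p) * (be p * Cconj (be p) - cp th LB p * Cconj (cp th LB p)) + RtoC 0 * (be p * Cconj (be p) - cp th LB p * Cconj (cp th LB p)))%C).
  { rewrite <- (c2_d1 U) by (auto; unfold pair_ok; auto).
    rewrite (c2_ext _ (fun p' x y => (RtoC (fr_W F p) * wedge11 th (fconj th) p' x y + RtoC 0 * wedge11 th (fconj th) p' x y)%C)).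
    - rewrite c2_lin, c2_wedge by (unfold pair_ok; auto). rewrite !cp_conj. simpl bar. reflexivity.
    - intros u v Hu Hv. unfold om. rewrite (pf_domega _ _ _ PF p u v Sp Up Hu Hv). fold th.
      assert (Z : A_11_b F p = RtoC 0) by exact (cov_zero 2 0 _ _ p Sp Up frame0_A11). rewrite Z.
      f_equal. rewrite Cmult_0_l. simpl Im. ring. }
  rewrite E2, E4 in K.
  assert (HZ : Dl LZ (cp om LB) p = (- (Dl LZ (fun q => Cconj (be q)) p * Dl LB be p + Cconj (be p) * Dl LZ (Dl LB be) p))%C).
  { rewrite (Dl_ext U HO p Sp Up LZ _ (fun q => (- (Cconj (be q) * Dl LB be q))%C)) by (intros; now apply frame0_omega).
    rewrite (Dl_opp U HO p Sp Up), (Dl_mult U HO p Sp Up) by auto using scf_mult, scf_conj, scf_be, scf_Dl. reflexivity. }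
  assert (HB : Dl LB (cp om LZ) p = (- (Dl LB (fun q => Cconj (be q)) p * Dl LZ be p + Cconj (be p) * Dl LB (Dl LZ be) p))%C).
  { rewrite (Dl_ext U HO p Sp Up LB _ (fun q => (- (Cconj (be q) * Dl LZ be q))%C)) by (intros; now apply frame0_omega).
    rewrite (Dl_opp U HO p Sp Up), (Dl_mult U HO p Sp Up) by auto using scf_mult, scf_conj, scf_be, scf_Dl. reflexivity. }
  unfold cd in K. rewrite HZ, HB in K. rewrite (Dl_ZB U HO p Sp Up be scf_be) in K.
  destruct (frame0_omega p Sp Up) as [_ [O1 _]]. rewrite O1 in K.
  assert (X : forall d e, (Dl d (fun q => Cconj (be q)) p * Dl e be p)%C = (- (Cconj (be p) * Cconj (be p) * Dl d be p * Dl e be p))%C).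
  { intros d e. transitivity ((be p * Cconj (be p)) * (Dl d (fun q => Cconj (be q)) p * Dl e be p))%C; [rewrite E4; ring|].
    transitivity (Cconj (be p) * (Dl d (fun q => Cconj (be q)) p * be p) * Dl e be p)%C; [ring|]. rewrite D_be by auto. ring. }
  rewrite !X in K.
  assert (R : RtoC (fr_W F p) = RtoC 2).
  { transitivity (fr_W F p * (1 - 0 * Cconj 0) + 0 * (1 - 0 * Cconj 0))%C; [ring|]. rewrite <- K.
    transitivity (- (2) * (Ci * Ci))%C; [ring|rewrite Ci2; apply C_eq; simpl; ring]. }
  now injection R.
Qed.

Lemma dS_Z f p : S3 p -> U p -> smooth_cfun U f ->
  dS f p (fr_Z F p) = (Cconj (be p) * Dl LZ f p)%C /\ dS f p (frZbar F p) = (be p * Dl LB f p)%C /\ dS f p (frTc F p) = Dl LT f p.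
Proof.
  intros Sp Up Hf. rewrite !(dS_frame U HO f p) by auto. destruct (frame0_Z U F PF p Sp Up) as [E1 [E2 [E3 [E4 E5]]]].
  destruct (frame0_theta1 p Sp Up) as [_ [_ [A _]]]. rewrite E1, E2, E3, E4, E5. fold (al F p). rewrite A, Cconj_conj.
  unfold frTc. rewrite (frame0_T U F PF p Sp Up). unfold cplx, capp. simpl fst; simpl snd.
  destruct (ka_fields p Sp) as [[K1 [K2 K3]] _]. rewrite K1, K2, K3.
  rewrite !ka_zero. repeat split; ring.
Qed.

(** Independence of the phase: the derivatives of [be] that arise from Z_1 = conj be Z cancel
    against the connection terms. *)
Lemma frame0_sublap f p : S3 p -> U p -> smooth_cfun U f -> sublap F f p = (Dl LB (Dl LZ f) p + Dl LZ (Dl LB f) p)%C.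
Proof.
  intros Sp Up Hf. unfold sublap.
  assert (E1 : forall q, S3 q -> U q -> f_1 F f q = (Cconj (be q) * Dl LZ f q)%C).
  { intros q Sq Uq. unfold f_1, cov. rewrite (proj1 (dS_Z f q Sq Uq Hf)). simpl INR. ring. }
  assert (E2 : forall q, S3 q -> U q -> f_b F f q = (be q * Dl LB f q)%C).
  { intros q Sq Uq. unfold f_b, cov. rewrite (proj1 (proj2 (dS_Z f q Sq Uq Hf))). simpl INR. ring. }
  assert (SZ := scf_Dl U LZ f HO Hf). assert (SB := scf_Dl U LB f HO Hf). assert (Sb := scf_be). assert (Sc := scf_conj U be Sb).
  assert (S1 : smooth_cfun U (f_1 F f)) by (apply scf_ext with (fun q => Cconj (be q) * Dl LZ f q)%C; [intros; now rewrite E1|now apply scf_mult]).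
  assert (S2 : smooth_cfun U (f_b F f)) by (apply scf_ext with (fun q => be q * Dl LB f q)%C; [intros; now rewrite E2|now apply scf_mult]).
  destruct (frame0_theta1 p Sp Up) as [_ [_ [A E4]]]. destruct (frame0_omega p Sp Up) as [_ [_ [OB OZ]]].
  destruct (frame0_Z U F PF p Sp Up) as [F1 [F2 [F3 [F4 F5]]]]. destruct (ct_Z p Sp Up) as [CZ CB].
  assert (Ho : linear_form U om) by apply (pf_smooth_omega _ _ _ PF).
  unfold f_1b, f_b1, cov. rewrite (proj1 (proj2 (dS_Z _ p Sp Up S1))), (proj1 (dS_Z _ p Sp Up S2)).
  fold om. rewrite (capp_frame U om p _ Ho Sp Up CB), (capp_frame U (fconj om) p _ (lf_conj U om Ho) Sp Up CZ).
  fold (al F p). rewrite F1, F2, F3, F4, F5. fold (al F p). rewrite A, Cconj_conj.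
  rewrite !cp_conj. simpl bar. rewrite OB.
  rewrite (Dl_ext U HO p Sp Up LB _ _ E1), (Dl_ext U HO p Sp Up LZ _ _ E2), E1, E2 by auto.
  rewrite !(Dl_mult U HO p Sp Up) by auto. simpl INR.
  assert (D1 := D_be p LB Sp Up). assert (D2 := D_be p LZ Sp Up).
  rewrite Copp_conj, Cmult_conj, Cconj_conj. change (Cconj (Dl LB be p)) with (Cconj (Dl (bar LZ) be p)). rewrite <- (Dl_conj U HO p Sp Up LZ be Sb).
  gen_C (Dl LB (Dl LZ f) p). gen_C (Dl LZ (Dl LB f) p).
  gen_C (Dl LB f p). gen_C (Dl LZ f p).
  gen_C (Dl LB (fun q => Cconj (be q)) p). gen_C (Dl LZ (fun q => Cconj (be q)) p). gen_C (Dl LB be p). gen_C (Dl LZ be p).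
  transitivity ((be p * Cconj (be p)) * (z + z0) + (z3 * be p + (be p * Cconj (be p)) * (Cconj (be p) * z5)) * z2
    + (be p * Cconj (be p) * (z4 * be p) + Cconj (be p) * z6) * z1)%C; [ring|].
  rewrite E4, D1, !Cmult_1_l, D2. ring.
Qed.

Lemma frame0_Q p : S3 p -> U p -> Q_of F p = RtoC 0.
Proof.
  intros Sp Up. assert (W : smooth_cfun U (fun q => RtoC (fr_W F q))) by (apply scf_real; exact (pf_smooth_W _ _ _ PF)).
  unfold Q_of. rewrite (frame0_sublap _ p Sp Up W).
  assert (Z : forall q, S3 q -> U q -> forall d, Dl d (fun q => RtoC (fr_W F q)) q = RtoC 0).
  { intros q Sq Uq d. rewrite (Dl_ext U HO q Sq Uq d _ (fun _ => RtoC 2)); [apply Dl_const|]. intros; now rewrite frame0_W. }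
  rewrite (Dl_ext U HO p Sp Up LB _ (fun _ => RtoC 0)), (Dl_ext U HO p Sp Up LZ _ (fun _ => RtoC 0)), !Dl_const by (intros; now apply Z).
  assert (A : A_11_bb F p = RtoC 0).
  { exact (cov_zero 2 1 _ _ p Sp Up (fun q Sq Uq => cov_zero 2 0 _ _ q Sq Uq frame0_A11)). }
  rewrite A. apply C_eq; simpl; ring.
Qed.

Lemma sublap_Lop f p : S3 p -> U p -> smooth_S3 f -> sublap F (fun q => RtoC (f q)) p = RtoC (/ 2 * Lop f p).
Proof.
  intros Sp Up Hf. rewrite frame0_sublap by (auto using scf_real, smooth_S3_fun). now apply (Dl_Lop U).
Qed.

Lemma sublap_ext f g p : S3 p -> U p -> smooth_cfun U f -> (forall q, S3 q -> U q -> f q = g q) -> sublap F f p = sublap F g p.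
Proof.
  intros Sp Up Hf E. assert (Hg := scf_ext U f g E Hf). rewrite !frame0_sublap by auto.
  assert (E2 : forall d q, S3 q -> U q -> Dl d f q = Dl d g q) by (intros d q Sq Uq; now apply (Dl_ext U HO)).
  now rewrite !(Dl_ext U HO p Sp Up _ _ _ (E2 _)).
Qed.

Lemma frame0_P l p : S3 p -> U p -> smooth_S3 l -> P_of F l p = RtoC (Pst l p).
Proof.
  intros Sp Up Hl. assert (Hc := scf_real U l (smooth_S3_fun U l Hl)).
  assert (HL : smooth_S3 (fun q => / 2 * Lop l q)) by auto with sm.
  unfold P_of.
  rewrite (sublap_ext _ (fun q => RtoC (/ 2 * Lop l q))); auto.
  - rewrite sublap_Lop by auto.
    assert (A0 : A_bb F p = RtoC 0) by (apply (proj1 (frame0_omega p Sp Up))).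
    assert (A1 : A_bb_1 F p = RtoC 0) by exact (cov_zero 0 2 _ _ p Sp Up (fun q Sq Uq => proj1 (frame0_omega q Sq Uq))).
    rewrite A0, A1.
    assert (T1 : forall g q, S3 q -> U q -> smooth_fun U g -> T_deriv F (fun q => RtoC (g q)) q = RtoC (Dv fieldT g q)).
    { intros g q Sq Uq Hg. unfold T_deriv. rewrite (proj2 (proj2 (dS_Z _ q Sq Uq (scf_real U g Hg)))).
      apply C_eq; [reflexivity|exact (dirD_const 0 q (fieldT q))]. }
    assert (Hu := smooth_S3_fun U l Hl). assert (HTl := smooth_Dv U fieldT l HO lin_fieldT Hu).
    assert (ST : smooth_cfun U (T_deriv F (fun q => RtoC (l q)))).
    { apply scf_ext with (fun q => RtoC (Dv fieldT l q)); [intros; now rewrite T1|now apply scf_real]. }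
    assert (T2 : T_deriv F (T_deriv F (fun q => RtoC (l q))) p = RtoC (Dv fieldT (Dv fieldT l) p)).
    { unfold T_deriv at 1. rewrite (proj2 (proj2 (dS_Z _ p Sp Up ST))).
      rewrite (Dl_ext U HO p Sp Up LT _ (fun q => RtoC (Dv fieldT l q))) by (intros; now apply T1).
      apply C_eq; [reflexivity|exact (dirD_const 0 p (fieldT p))]. }
    rewrite T2. unfold Pst.
    assert (EL : Lop (fun q => / 2 * Lop l q) p = / 2 * Lop (Lop l) p).
    { rewrite !(Lop_XY U _ p HO) by (auto using cone_p, smooth_S3_fun with sm).
      assert (D : forall A g q, S3 q -> U q -> smooth_fun U g -> Dv A (fun q => / 2 * g q) q = / 2 * Dv A g q).
      { intros A g q Sq Uq Hg. rewrite (Dv_mult_U U HO q Sq Uq), (Dv_const_U q) by auto using smooth_fun_const. ring. }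
      assert (HLu := smooth_S3_fun U _ (smooth_Lop l Hl)).
      assert (D2 : forall A, lin A -> Dv A (Dv A (fun q => / 2 * Lop l q)) p = / 2 * Dv A (Dv A (Lop l)) p).
      { intros A HA. rewrite (Dv_ext_U U HO p Sp Up A _ (fun q => / 2 * Dv A (Lop l) q)) by (intros; now apply D).
        apply D; auto. now apply smooth_Dv. }
      rewrite !D2 by auto using lin_fieldX, lin_fieldY. ring. }
    rewrite EL. apply C_eq; simpl; field.
  - apply scf_ext with (fun q => RtoC (/ 2 * Lop l q)); [intros; now rewrite sublap_Lop|]. apply scf_real. now apply smooth_S3_fun.
  - intros. now apply sublap_Lop.
Qed.

End Frame0.

Lemma Q0_zero Q0 p : is_Q_curvature theta0 Q0 -> S3 p -> Q0 p = 0.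
Proof.
  intros H Sp. destruct (H p Sp) as [U [F [HO [Up [PF E]]]]]. rewrite (frame0_Q U HO F PF p Sp Up) in E. now injection E.
Qed.

Lemma P0_Pst P0 l p : is_Paneitz theta0 P0 -> smooth_S3 l -> S3 p -> P0 l p = Pst l p.
Proof.
  intros H Hl Sp. destruct (H l Hl p Sp) as [U [F [HO [Up [PF E]]]]]. rewrite (frame0_P U HO F PF l p Sp Up Hl) in E. now injection E.
Qed.

(** * Symbolic jets of the conformal factor *)

Lemma bar_bar d : bar (bar d) = d.
Proof. now destruct d. Qed.

(* Polynomials in exp f, exp (-f) and the jets of f along words in T, Z, Zbar. *)
Inductive jexp : Type :=
  | e0 | eC (c : C) | eJ (w : list letter) | eP | eM | eAdd (a b : jexp) | eMul (a b : jexp).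

(** Zeros are erased while expressions are built, which keeps the later polynomial identities
    small. *)
Definition sAdd (a b : jexp) : jexp := match a, b with e0, _ => b | _, e0 => a | _, _ => eAdd a b end.
Definition sMul (a b : jexp) : jexp := match a, b with e0, _ => e0 | _, e0 => e0 | _, _ => eMul a b end.

Fixpoint der (d : letter) (e : jexp) : jexp :=
  match e with
  | e0 => e0
  | eC _ => e0
  | eJ w => eJ (d :: w)
  | eP => eMul eP (eJ (d :: nil))
  | eM => eMul (eC (RtoC (-1))) (eMul eM (eJ (d :: nil)))
  | eAdd a b => sAdd (der d a) (der d b)
  | eMul a b => sAdd (sMul (der d a) b) (sMul a (der d b))
  end.

Fixpoint cj (e : jexp) : jexp :=
  match e with
  | e0 => e0
  | eC c => eC (Cconj c)
  | eJ w => eJ (map bar w)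
  | eP => eP
  | eM => eM
  | eAdd a b => eAdd (cj a) (cj b)
  | eMul a b => eMul (cj a) (cj b)
  end.

Definition eSub (a b : jexp) : jexp := sAdd a (sMul (eC (RtoC (-1))) b).

Section Eval.
Context (f : C2 -> R) (Hf : smooth_S3 f).

Definition jet (w : list letter) : C2 -> C := fold_right Dl (fun q : C2 => RtoC (f q)) w.

Fixpoint eval (e : jexp) (p : C2) : C :=
  match e with
  | e0 => RtoC 0
  | eC c => c
  | eJ w => jet w p
  | eP => RtoC (exp (f p))
  | eM => RtoC (exp (- f p))
  | eAdd a b => (eval a p + eval b p)%C
  | eMul a b => (eval a p * eval b p)%C
  end.

Lemma eval_sAdd a b p : eval (sAdd a b) p = (eval a p + eval b p)%C.
Proof. destruct a; cbn [sAdd]; [cbn [eval]; ring| | | | | |]; destruct b; cbn [eval]; try reflexivity; ring. Qed.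

Lemma eval_sMul a b p : eval (sMul a b) p = (eval a p * eval b p)%C.
Proof. destruct a; cbn [sMul]; [cbn [eval]; ring| | | | | |]; destruct b; cbn [eval]; try reflexivity; ring. Qed.

Lemma eval_sub a b p : eval (eSub a b) p = (eval a p - eval b p)%C.
Proof. unfold eSub. rewrite eval_sAdd, eval_sMul. cbn [eval]. replace (RtoC (-1)) with (- (1))%C by (apply C_eq; simpl; ring). ring. Qed.

Notation UT := (fun _ : C2 => True).

Lemma smooth_jet w : smooth_cfun UT (jet w).
Proof.
  induction w; simpl; [now apply scf_real|]. apply scf_Dl; auto. apply cone0_open.
Qed.

Lemma smooth_eval e : smooth_cfun UT (eval e).
Proof.
  induction e; simpl.
  - apply scf_const.
  - apply scf_const.
  - apply smooth_jet.
  - apply scf_real. now apply smooth_fun_exp.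
  - apply scf_real. apply smooth_fun_exp. now apply smooth_fun_opp.
  - now apply scf_plus.
  - now apply scf_mult.
Qed.

Lemma Dl_eval d e p : S3 p -> Dl d (eval e) p = eval (der d e) p.
Proof.
  intros Sp. assert (HO := cone0_open). induction e; cbn [der]; rewrite ?eval_sAdd, ?eval_sMul.
  - apply (Dl_const p d).
  - apply (Dl_const p d).
  - reflexivity.
  - exact (Dl_exp UT HO p Sp I d f Hf).
  - transitivity (RtoC (exp (- f p)) * Dl d (fun q => RtoC (- f q)) p)%C; [exact (Dl_exp UT HO p Sp I d _ (smooth_fun_opp _ _ Hf))|].
    rewrite (Dl_ext UT HO p Sp I d _ (fun q => (- RtoC (f q))%C)) by (intros; apply C_eq; simpl; ring).
    rewrite (Dl_opp UT HO p Sp I) by now apply scf_real.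
    transitivity (- (1) * (RtoC (exp (- f p)) * Dl d (fun q => RtoC (f q)) p))%C; [ring|].
    replace (- (1))%C with (RtoC (-1)) by (apply C_eq; simpl; ring). reflexivity.
  - rewrite <- IHe1, <- IHe2. exact (Dl_plus UT HO p Sp I d _ _ (smooth_eval e1) (smooth_eval e2)).
  - rewrite <- IHe1, <- IHe2. exact (Dl_mult UT HO p Sp I d _ _ (smooth_eval e1) (smooth_eval e2)).
Qed.

Lemma conj_jet w p : S3 p -> Cconj (jet w p) = jet (map bar w) p.
Proof.
  revert p. induction w as [|d w IH]; intros p Sp; simpl; [apply C_eq; simpl; ring|].
  rewrite <- (bar_bar d) at 1. rewrite <- (Dl_conj UT cone0_open p Sp I (bar d)) by apply smooth_jet.
  apply (Dl_ext UT cone0_open p Sp I). intros; now apply IH.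
Qed.

Lemma conj_eval e p : S3 p -> Cconj (eval e p) = eval (cj e) p.
Proof.
  intros Sp. induction e; simpl; auto.
  - apply C_eq; simpl; ring.
  - now apply conj_jet.
  - apply C_eq; simpl; ring.
  - apply C_eq; simpl; ring.
  - now rewrite Cplus_conj, IHe1, IHe2.
  - now rewrite Cmult_conj, IHe1, IHe2.
Qed.

Definition jets_rel (w1 w2 w3 : list letter) (c : C) : Prop :=
  forall p, S3 p -> jet w1 p = (jet w2 p + c * jet w3 p)%C.

Lemma jets_rel_cons d w1 w2 w3 c : jets_rel w1 w2 w3 c -> jets_rel (d :: w1) (d :: w2) (d :: w3) c.
Proof.
  intros H p Sp. simpl. rewrite (Dl_ext UT cone0_open p Sp I d (jet w1) (fun q => jet w2 q + c * jet w3 q)%C) by (intros; now apply H).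
  rewrite (Dl_plus UT cone0_open p Sp I), (Dl_scal UT cone0_open p Sp I) by auto using smooth_jet, scf_mult, scf_const. reflexivity.
Qed.

Lemma jets_rel_app u w1 w2 w3 c : jets_rel w1 w2 w3 c -> jets_rel (u ++ w1) (u ++ w2) (u ++ w3) c.
Proof. intros H. induction u; simpl; auto. now apply jets_rel_cons. Qed.

(** This and the next two relations, applied inside a word after any prefix u, bring every jet to a
    normal form with the letters T first, then Zbar, then Z, so that equal polynomials in jets
    become syntactically comparable. *)
Lemma jet_ZB u w : jets_rel (u ++ LZ :: LB :: w) (u ++ LB :: LZ :: w) (u ++ LT :: w) (- Ci)%C.
Proof. apply jets_rel_app. intros p Sp. change (Dl LZ (Dl LB (jet w)) p = (Dl LB (Dl LZ (jet w)) p + - Ci * Dl LT (jet w) p)%C). rewrite (Dl_ZB UT cone0_open p Sp I) by apply smooth_jet. ring. Qed.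
Lemma jet_ZT u w : jets_rel (u ++ LZ :: LT :: w) (u ++ LT :: LZ :: w) (u ++ LZ :: w) (2 * Ci)%C.
Proof. apply jets_rel_app. intros p Sp. apply (Dl_TZ UT cone0_open p Sp I), smooth_jet. Qed.
Lemma jet_BT u w : jets_rel (u ++ LB :: LT :: w) (u ++ LT :: LB :: w) (u ++ LB :: w) (- (2 * Ci))%C.
Proof. apply jets_rel_app. intros p Sp. change (Dl LB (Dl LT (jet w)) p = (Dl LT (Dl LB (jet w)) p + - (2 * Ci) * Dl LB (jet w) p)%C). rewrite (Dl_TB UT cone0_open p Sp I) by apply smooth_jet. ring. Qed.

(** * Forms and vector fields with symbolic coefficients *)

Record jexp3 := Jexp3 { xT : jexp; xZ : jexp; xB : jexp }.
Definition sel (a : jexp3) (d : letter) : jexp := match d with LT => xT a | LZ => xZ a | LB => xB a end.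
Definition cj3 (a : jexp3) : jexp3 := Jexp3 (cj (xT a)) (cj (xB a)) (cj (xZ a)).
Definition fm (a : jexp3) : Defs.form1 := fun p v =>
  (ka LT p v * eval (xT a) p + ka LZ p v * eval (xZ a) p + ka LB p v * eval (xB a) p)%C.

Lemma ka_lin d p (c : R) v w : ka d p (plus (scal c v) w) = (RtoC c * ka d p v + ka d p w)%C.
Proof. unfold ka. destruct d; rewrite !dot_plus, !dot_scal; apply C_eq; simpl; ring. Qed.

Lemma smooth_ka d v : smooth_cfun UT (fun p => ka d p v).
Proof.
  destruct d; unfold ka; split; simpl; try apply smooth_fun_const; try apply smooth_fun_opp; apply smooth_fun_dot;
  auto using lin_fieldT, lin_fieldX, lin_fieldY.
Qed.

Lemma smooth_fm a : smooth_form UT (fm a).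
Proof.
  split.
  - intros p c v w _ _. unfold fm. rewrite !ka_lin. ring.
  - intros v. unfold fm. repeat apply scf_plus; apply scf_mult; auto using smooth_eval, smooth_ka.
Qed.

Lemma cp_fm a d p : S3 p -> cp (fm a) d p = eval (sel a d) p.
Proof.
  intros Sp. destruct (ka_fields p Sp) as [[E1 [E2 E3]] [[E4 [E5 E6]] [E7 [E8 E9]]]].
  unfold cp, fm. destruct d; rewrite ?E1, ?E2, ?E3, ?E4, ?E5, ?E6, ?E7, ?E8, ?E9; simpl sel.
  - ring.
  - destruct (eval (xT a) p), (eval (xZ a) p), (eval (xB a) p). apply C_eq; simpl; field.
  - destruct (eval (xT a) p), (eval (xZ a) p), (eval (xB a) p). apply C_eq; simpl; field.
Qed.

Lemma ka_conj d p v : Cconj (ka d p v) = ka (bar d) p v.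
Proof. destruct d; apply C_eq; simpl; ring. Qed.

Lemma fconj_fm a p v : S3 p -> fconj (fm a) p v = fm (cj3 a) p v.
Proof. intros Sp. unfold fconj, fm. rewrite !Cplus_conj, !Cmult_conj, !conj_eval, !ka_conj by auto. simpl. ring. Qed.

Definition cdx (a : jexp3) (d e : letter) : jexp :=
  sAdd (eSub (der d (sel a e)) (der e (sel a d)))
   match d, e with
   | LT, LZ => sMul (eC (2 * Ci)%C) (xZ a)
   | LT, LB => sMul (eC (- (2 * Ci))%C) (xB a)
   | LZ, LB => sMul (eC Ci) (xT a)
   | _, _ => e0 end.

Lemma cd_fm a d e p : S3 p -> cd (fm a) d e p = eval (cdx a d e) p.
Proof.
  intros Sp. unfold cd, cdx.
  rewrite (Dl_ext UT cone0_open p Sp I d _ (eval (sel a e))), (Dl_ext UT cone0_open p Sp I e _ (eval (sel a d))) by (intros; now apply cp_fm).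
  rewrite !Dl_eval, eval_sAdd, eval_sub by auto.
  destruct d, e; rewrite ?cp_fm, ?eval_sMul by auto; cbn [eval sel]; ring.
Qed.

Definition kk (d e : letter) (p v w : C2) : C := (ka d p v * ka e p w - ka e p v * ka d p w)%C.
Definition comb (x : letter -> letter -> jexp) (p v w : C2) : C :=
  (kk LT LZ p v w * eval (x LT LZ) p + kk LT LB p v w * eval (x LT LB) p + kk LZ LB p v w * eval (x LZ LB) p)%C.

Lemma d1_fm a p v w : S3 p -> tangent p v -> tangent p w -> Defs.d1 (fm a) p v w = comb (cdx a) p v w.
Proof.
  intros Sp Hv Hw. rewrite (d1_frame UT cone0_open p Sp I) by auto using smooth_fm. rewrite !cd_fm by auto. reflexivity.
Qed.

Definition wx (a b : jexp3) (d e : letter) : jexp := eSub (sMul (sel a d) (sel b e)) (sMul (sel a e) (sel b d)).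

Lemma wedge_fm a b p v w : wedge11 (fm a) (fm b) p v w = comb (wx a b) p v w.
Proof.
  unfold wedge11, fm, comb, kk, wx. rewrite !eval_sub, !eval_sMul. cbn [sel]. ring.
Qed.

Lemma comb_ext x y p v w : (forall d e, pair_ok d e -> eval (x d e) p = eval (y d e) p) -> comb x p v w = comb y p v w.
Proof. intros H. unfold comb. rewrite !H by (unfold pair_ok; auto). reflexivity. Qed.

Definition has_coefs (V : C2 -> CC2) (a : jexp3) : Prop := forall p, S3 p -> forall d, capp (ka d) p (V p) = eval (sel a d) p.

Lemma dS_eval V a e p : has_coefs V a -> S3 p ->
  dS (eval e) p (V p) = (eval (xT a) p * eval (der LT e) p + eval (xZ a) p * eval (der LZ e) p + eval (xB a) p * eval (der LB e) p)%C.
Proof.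
  intros H Sp. rewrite (dS_frame UT cone0_open) by auto using smooth_eval. rewrite !(H p Sp), !Dl_eval by auto. reflexivity.
Qed.

Definition pairing (a V : jexp3) : jexp := sAdd (sAdd (sMul (xT V) (xT a)) (sMul (xZ V) (xZ a))) (sMul (xB V) (xB a)).

Lemma capp_fm a V b p : has_coefs V b -> S3 p -> capp (fm a) p (V p) = eval (pairing a b) p.
Proof.
  intros H Sp. assert (E1 := H p Sp LT). assert (E2 := H p Sp LZ). assert (E3 := H p Sp LB). cbn [sel] in E1, E2, E3.
  unfold pairing. rewrite !eval_sAdd, !eval_sMul. rewrite <- E1, <- E2, <- E3. unfold capp, fm. ring.
Qed.

(** The value at 0 is [e0], so that [sMul] erases the connection terms of a component without
    indices. *)
Definition nx (n : nat) : jexp := match n with O => e0 | _ => eC (RtoC (INR n)) end.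

Definition covx (om : jexp3) (a b : nat) (V : jexp3) (e : jexp) : jexp :=
  eSub (sAdd (sAdd (sMul (xT V) (der LT e)) (sMul (xZ V) (der LZ e))) (sMul (xB V) (der LB e)))
    (sMul (sAdd (sMul (nx a) (pairing om V)) (sMul (nx b) (pairing (cj3 om) V))) e).

Lemma capp_fconj a p V : S3 p -> capp (fconj (fm a)) p V = capp (fm (cj3 a)) p V.
Proof. intros Sp. unfold capp. now rewrite !fconj_fm. Qed.

(** Covariant derivatives see the component only through its values on the sphere, so torsion,
    curvature and their derivatives may be replaced by symbolic expressions one after the other. *)
Lemma cov_eval F om V v a b g e p : fr_omega F = fm om -> has_coefs V v -> S3 p ->
  (forall q, S3 q -> g q = eval e q) -> cov F a b V g p = eval (covx om a b v e) p.
Proof.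
  intros HF HV Sp E. unfold cov. rewrite HF, capp_fconj, !(capp_fm _ _ _ _ HV Sp), E by auto.
  replace (dS g p (V p)) with (dS (eval e) p (V p)).
  - rewrite (dS_eval _ _ _ _ HV Sp). unfold covx. rewrite !eval_sub, !eval_sMul, !eval_sAdd, !eval_sMul.
    assert (N : forall n, eval (nx n) p = RtoC (INR n)) by (intros [|n]; reflexivity). rewrite !N. ring.
  - unfold dS. rewrite !(cdirD_ext UT cone0_open p Sp I g (eval e)) by (intros; now apply E). reflexivity.
Qed.

End Eval.

(** * The frame of a conformal contact form *)

Import ListNotations.

Definition zx : jexp := e0.
Definition thx : jexp3 := Jexp3 (eMul eP eP) zx zx.
(** theta^1 is e^f times the standard form corrected by 2 i f_(1bar) theta0; the correction absorbs
    the term 2 df /\ theta0 of d (e^(2f) theta0). *)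
Definition t1x : jexp3 := Jexp3 (eMul (eC (2 * Ci)%C) (eMul eP (eJ [LB]))) eP zx.
Definition lapx : jexp := eAdd (eJ [LZ; LB]) (eJ [LB; LZ]).
(** [omx], [Ax] and [Wx] are the conformal transformation laws of connection, torsion and curvature,
    with the standard values -2 i theta0, 0 and 2 inserted. In particular W = e^(-2f) (2 - 4 Lap_b f
    - 8 f_1 f_(1bar)). *)
Definition omx : jexp3 := Jexp3 (eAdd (eAdd (eMul (eC Ci) lapx) (eMul (eC (8 * Ci)%C) (eMul (eJ [LZ]) (eJ [LB])))) (eC (- (2 * Ci))%C))
  (eMul (eC (RtoC 3)) (eJ [LZ])) (eMul (eC (- (3))%C) (eJ [LB])).
Definition Ax : jexp := eMul (eMul eM eM) (eAdd (eMul (eC (- (2 * Ci))%C) (eJ [LB; LB])) (eMul (eC (4 * Ci)%C) (eMul (eJ [LB]) (eJ [LB])))).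
Definition Wx : jexp := eMul (eMul eM eM) (eSub (eC (RtoC 2)) (eAdd (eMul (eC (RtoC 4)) lapx) (eMul (eC (RtoC 8)) (eMul (eJ [LZ]) (eJ [LB]))))).
Definition Zx : jexp3 := Jexp3 zx eM zx.
Definition Bx : jexp3 := Jexp3 zx zx eM.
Definition Tx : jexp3 := Jexp3 (eMul eM eM) (eMul (eC (- (2 * Ci))%C) (eMul (eMul eM eM) (eJ [LB]))) (eMul (eC (2 * Ci)%C) (eMul (eMul eM eM) (eJ [LZ]))).
Definition A11bx : jexp := covx omx 2 0 Bx (cj Ax).
Definition A11bbx : jexp := covx omx 2 1 Bx A11bx.
Definition sublapx (e : jexp) : jexp := eAdd (covx omx 1 0 Bx (covx omx 0 0 Zx e)) (covx omx 0 1 Zx (covx omx 0 0 Bx e)).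
(** The four words of length 4 expand the square of Z Zbar + Zbar Z. *)
Definition Px : jexp := eAdd (eAdd (eAdd (eJ [LB;LZ;LB;LZ]) (eJ [LB;LZ;LZ;LB])) (eAdd (eJ [LZ;LB;LB;LZ]) (eJ [LZ;LB;LZ;LB]))) (eJ [LT;LT]).
(* The Q-curvature of the frame is -2/3 of this expression. *)
Definition Qx : jexp := eAdd (sublapx Wx) (eMul (eC (- Ci)%C) (eSub A11bbx (cj A11bbx))).

Section Conf.
Context (f : C2 -> R) (Hf : smooth_S3 f) (p : C2) (Sp : S3 p).

(** The commutation rules with zero, one or two explicit letters in front, in the shape required for
    rewriting; the fourth-order expressions below contain no longer prefix. *)
Lemma ZB0 w : jet f (LZ :: LB :: w) p = (jet f (LB :: LZ :: w) p - Ci * jet f (LT :: w) p)%C.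
Proof. assert (H := jet_ZB f Hf [] w p Sp). cbn [app] in H. rewrite H. ring. Qed.
Lemma ZB1 a w : jet f (a :: LZ :: LB :: w) p = (jet f (a :: LB :: LZ :: w) p - Ci * jet f (a :: LT :: w) p)%C.
Proof. assert (H := jet_ZB f Hf [a] w p Sp). cbn [app] in H. rewrite H. ring. Qed.
Lemma ZB2 a b w : jet f (a :: b :: LZ :: LB :: w) p = (jet f (a :: b :: LB :: LZ :: w) p - Ci * jet f (a :: b :: LT :: w) p)%C.
Proof. assert (H := jet_ZB f Hf [a; b] w p Sp). cbn [app] in H. rewrite H. ring. Qed.
Lemma ZT0 w : jet f (LZ :: LT :: w) p = (jet f (LT :: LZ :: w) p + 2 * Ci * jet f (LZ :: w) p)%C.
Proof. assert (H := jet_ZT f Hf [] w p Sp). cbn [app] in H. rewrite H. ring. Qed.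
Lemma ZT1 a w : jet f (a :: LZ :: LT :: w) p = (jet f (a :: LT :: LZ :: w) p + 2 * Ci * jet f (a :: LZ :: w) p)%C.
Proof. assert (H := jet_ZT f Hf [a] w p Sp). cbn [app] in H. rewrite H. ring. Qed.
Lemma BT0 w : jet f (LB :: LT :: w) p = (jet f (LT :: LB :: w) p - 2 * Ci * jet f (LB :: w) p)%C.
Proof. assert (H := jet_BT f Hf [] w p Sp). cbn [app] in H. rewrite H. ring. Qed.
Lemma BT1 a w : jet f (a :: LB :: LT :: w) p = (jet f (a :: LT :: LB :: w) p - 2 * Ci * jet f (a :: LB :: w) p)%C.
Proof. assert (H := jet_BT f Hf [a] w p Sp). cbn [app] in H. rewrite H. ring. Qed.

Lemma exp_PM : (RtoC (exp (f p)) * RtoC (exp (- f p)))%C = (1)%C.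
Proof. rewrite <- RtoC_mult, <- exp_plus. replace (f p + - f p) with 0 by ring. now rewrite exp_0. Qed.

Lemma conj_R r : Cconj (RtoC r) = RtoC r.
Proof. apply C_eq; simpl; ring. Qed.
Lemma conj_Ci : Cconj Ci = (- Ci)%C.
Proof. apply C_eq; simpl; ring. Qed.
Lemma R2C : RtoC 2 = (1 + 1)%C. Proof. apply C_eq; simpl; ring. Qed.
Lemma R3C : RtoC 3 = (1 + 1 + 1)%C. Proof. apply C_eq; simpl; ring. Qed.
Lemma R4C : RtoC 4 = ((1 + 1) * (1 + 1))%C. Proof. apply C_eq; simpl; ring. Qed.
Lemma R8C : RtoC 8 = ((1 + 1) * (1 + 1) * (1 + 1))%C. Proof. apply C_eq; simpl; ring. Qed.
Lemma Rm1 : RtoC (-1) = (- (1))%C. Proof. apply C_eq; simpl; ring. Qed.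
Lemma INR_0C : RtoC (INR 0) = RtoC 0. Proof. reflexivity. Qed.
Lemma INR_1C : RtoC (INR 1) = RtoC 1. Proof. reflexivity. Qed.
Lemma INR_2C : RtoC (INR 2) = (1 + 1)%C. Proof. apply C_eq; simpl; ring. Qed.

Ltac ex_simpl := repeat progress (cbn [eval der cj sel xT xZ xB cj3 map bar fst snd sAdd sMul nx];
   unfold thx, t1x, omx, Ax, Wx, Zx, Bx, Tx, A11bx, A11bbx, sublapx, Px, Qx, lapx, zx, cdx, wx, covx, pairing, eSub).
Ltac nrm := ex_simpl;
  repeat first [rewrite ZB0|rewrite ZB1|rewrite ZB2|rewrite ZT0|rewrite ZT1|rewrite BT0|rewrite BT1];
  repeat first [rewrite Cmult_conj|rewrite Copp_conj|rewrite conj_R|rewrite conj_Ci];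
  rewrite ?INR_0C, ?INR_1C, ?INR_2C, ?R2C, ?R3C, ?R4C, ?R8C, ?Rm1.
(** Once the jets are in normal form the only relations left among the atoms are i^2 = -1 and e^f
    e^(-f) = 1; with the exponentials turned into variables, [ring] takes both as rewrite rules. *)
Ltac fin := let Hi := fresh in let Hx := fresh in assert (Hi := Ci2); assert (Hx := exp_PM);
  generalize dependent (RtoC (exp (f p))); generalize dependent (RtoC (exp (- f p))); intros; ring [Hi Hx].

Lemma chk_th d e : pair_ok d e -> eval f (cdx thx d e) p = (Ci * eval f (wx t1x (cj3 t1x) d e) p)%C.
Proof. intros [[-> ->]|[[-> ->]|[-> ->]]]; nrm; fin. Qed.

Lemma chk_t1 d e : pair_ok d e -> eval f (cdx t1x d e) p = eval f (eAdd (wx t1x omx d e) (eMul Ax (wx thx (cj3 t1x) d e))) p.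
Proof. intros [[-> ->]|[[-> ->]|[-> ->]]]; nrm; fin. Qed.

Lemma chk_om_conj d : (eval f (sel omx d) p + eval f (sel (cj3 omx) d) p)%C = RtoC 0.
Proof. destruct d; nrm; fin. Qed.

(** The curvature equation, where 2 i Im of the torsion term is written as that term minus its
    conjugate. *)
Lemma chk_om d e : pair_ok d e -> eval f (cdx omx d e) p =
  eval f (eAdd (eMul Wx (wx t1x (cj3 t1x) d e)) (eSub (eMul A11bx (wx t1x thx d e)) (eMul (cj A11bx) (wx (cj3 t1x) (cj3 thx) d e)))) p.
Proof. intros [[-> ->]|[[-> ->]|[-> ->]]]; nrm; fin. Qed.

Lemma chk_W : eval f (cj Wx) p = eval f Wx p.
Proof. nrm; fin. Qed.

(** The transformation law of the Q-curvature with vanishing initial term: multiplied by -2/3 the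
    right side is 2 e^(-4f) P_0 f. *)
Lemma chk_Q : eval f Qx p = (- (1 + 1 + 1) * eval f (eMul (eMul (eMul eM eM) (eMul eM eM)) Px) p)%C.
Proof. nrm. fin. Qed.

End Conf.

Section Conf.
Context (f : C2 -> R) (Hf : smooth_S3 f).
Notation UT := (fun _ : C2 => True).

(** The coefficients [Tx] in the real frame: 2 i (f_Z Zbar - f_Zbar Z) = (Y f) X - (X f) Y. *)
Definition confT (p : C2) : C2 :=
  scal (exp (- f p) * exp (- f p)) (plus (fieldT p) (plus (scal (Dv fieldY f p) (fieldX p)) (scal (- Dv fieldX f p) (fieldY p)))).
Definition confZ (p : C2) : CC2 := (scal (/ 2 * exp (- f p)) (fieldX p), scal (- (/ 2 * exp (- f p))) (fieldY p)).

(** The curvature field has to be real; [chk_W] shows that taking the real part loses nothing. *)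
Definition confF : frame_data := FrameData confT confZ (fm f t1x) (fm f omx) (eval f Ax) (fun p => Re (eval f Wx p)).

Lemma conformal_fm : conformal f = fm f thx.
Proof.
  extensionality p. extensionality v. unfold conformal, fm. rewrite theta0_eq. simpl eval.
  replace (2 * f p) with (f p + f p) by ring. rewrite exp_plus, RtoC_mult. unfold ka. ring.
Qed.

Lemma ka_scal d p (c : R) v : ka d p (scal c v) = (RtoC c * ka d p v)%C.
Proof. unfold ka. destruct d; rewrite !dot_scal; apply C_eq; simpl; ring. Qed.
Lemma ka_plus d p v w : ka d p (plus v w) = (ka d p v + ka d p w)%C.
Proof. unfold ka. destruct d; rewrite !dot_plus; apply C_eq; simpl; ring. Qed.
Lemma ka_opp d p v : ka d p (opp v) = (- ka d p v)%C.
Proof. unfold ka. destruct d; rewrite !dot_opp; apply C_eq; simpl; ring. Qed.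
Lemma jet1 p : jet f [LZ] p = (/ 2 * (RtoC (Dv fieldX f p) - Ci * RtoC (Dv fieldY f p)))%C /\
  jet f [LB] p = (/ 2 * (RtoC (Dv fieldX f p) + Ci * RtoC (Dv fieldY f p)))%C.
Proof.
  assert (R : forall A, cDv A (fun q => RtoC (f q)) p = RtoC (Dv A f p)).
  { intros A. apply C_eq; [reflexivity|exact (dirD_const 0 p (A p))]. }
  split; unfold jet; cbn [fold_right]; unfold Dl; now rewrite !R.
Qed.

Lemma coefs_Z : has_coefs f confZ Zx.
Proof.
  intros p Sp d. destruct (ka_fields p Sp) as [_ [[E4 [E5 E6]] [E7 [E8 E9]]]].
  unfold confZ, capp. cbn [fst snd]. rewrite !ka_scal. destruct d; rewrite ?E4, ?E5, ?E6, ?E7, ?E8, ?E9; unfold Zx, zx; cbn [sel xT xZ xB eval];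
  apply C_eq; simpl; field.
Qed.

Lemma coefs_B : has_coefs f (frZbar confF) Bx.
Proof.
  intros p Sp d. destruct (ka_fields p Sp) as [_ [[E4 [E5 E6]] [E7 [E8 E9]]]].
  unfold frZbar, confF, confZ, Vconj, capp. cbn [fst snd fr_Z]. rewrite ka_opp, !ka_scal. destruct d; rewrite ?E4, ?E5, ?E6, ?E7, ?E8, ?E9; unfold Bx, zx; cbn [sel xT xZ xB eval];
  apply C_eq; simpl; field.
Qed.

Lemma ka_confT d p : S3 p -> ka d p (confT p) = eval f (sel Tx d) p.
Proof.
  intros Sp. destruct (ka_fields p Sp) as [[E1 [E2 E3]] [[E4 [E5 E6]] [E7 [E8 E9]]]].
  unfold confT. rewrite !ka_scal, !ka_plus, !ka_scal.
  destruct (jet1 p) as [J1 J2].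
  destruct d; rewrite ?E1, ?E2, ?E3, ?E4, ?E5, ?E6, ?E7, ?E8, ?E9; unfold Tx; cbn [sel xT xZ xB eval]; rewrite ?J1, ?J2; apply C_eq; simpl; field.
Qed.

Lemma scf_z (A : C2 -> C2) : (forall i, (i < 4)%nat -> smooth_fun UT (fun p => cc i (A p))) ->
  smooth_cfun UT (fun p => z0 (A p)) /\ smooth_cfun UT (fun p => z1 (A p)).
Proof.
  intros H. split; split; [apply (H 0%nat)|apply (H 1%nat)|apply (H 2%nat)|apply (H 3%nat)]; lia.
Qed.

Lemma scf_z_lin (A : C2 -> C2) i : lin A -> smooth_fun UT (fun p => cc i (A p)).
Proof.
  intros HA. apply smooth_fun_ext with (fun q => dot (ev i) (A q)).
  - intros q _ _. unfold dot, sum4, ev, mkv. destruct i as [|[|[|i]]]; simpl; ring.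
  - now apply smooth_fun_dot.
Qed.

Lemma smooth_exp_neg : smooth_fun UT (fun p => exp (- f p)).
Proof. apply smooth_fun_exp. now apply smooth_fun_opp. Qed.

Lemma smooth_confT i : smooth_fun UT (fun p => cc i (confT p)).
Proof.
  apply smooth_fun_ext with (fun p => (exp (- f p) * exp (- f p)) * (cc i (fieldT p) + (Dv fieldY f p * cc i (fieldX p) + - Dv fieldX f p * cc i (fieldY p)))).
  - intros p _ _. unfold confT. now rewrite cc_scal, !cc_plus, !cc_scal.
  - assert (HX := smooth_S3_Dv fieldX f lin_fieldX Hf). assert (HY := smooth_S3_Dv fieldY f lin_fieldY Hf). assert (He := smooth_exp_neg).
    apply smooth_fun_mult; [now apply smooth_fun_mult|].
    apply smooth_fun_plus; [apply scf_z_lin, lin_fieldT|].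
    apply smooth_fun_plus; apply smooth_fun_mult; try (apply scf_z_lin; auto using lin_fieldX, lin_fieldY); auto. now apply smooth_fun_opp.
Qed.

Lemma smooth_scal_lin (r : C2 -> R) A i : smooth_fun UT r -> lin A -> smooth_fun UT (fun p => cc i (scal (r p) (A p))).
Proof.
  intros Hr HA. apply smooth_fun_ext with (fun p => r p * cc i (A p)); [intros; now rewrite cc_scal|].
  apply smooth_fun_mult; auto. now apply scf_z_lin.
Qed.

Lemma tangent_plus p v w : tangent p v -> tangent p w -> tangent p (plus v w).
Proof. rewrite !tangent_dot, dot_plus. lra. Qed.
Lemma tangent_scal p (c : R) v : tangent p v -> tangent p (scal c v).
Proof. rewrite !tangent_dot, dot_scal. intros ->. ring. Qed.

Lemma tangent_confT p : tangent p (confT p).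
Proof. unfold confT. auto using tangent_plus, tangent_scal, tangent_fieldT, tangent_fieldX, tangent_fieldY. Qed.

Lemma ct_confZ p : ctangent p (confZ p).
Proof. split; unfold confZ; cbn [fst snd]; auto using tangent_scal, tangent_fieldX, tangent_fieldY. Qed.

Lemma A11_eval p : S3 p -> A_11 confF p = eval f (cj Ax) p.
Proof. intros Sp. unfold A_11, A_bb, confF. cbn [fr_A]. now rewrite (conj_eval f Hf). Qed.

Lemma A11b_eval p : S3 p -> A_11_b confF p = eval f A11bx p.
Proof. intros Sp. unfold A_11_b. apply (cov_eval f Hf confF omx (frZbar confF)); auto using coefs_B, A11_eval. Qed.

Lemma A11bb_eval p : S3 p -> A_11_bb confF p = eval f A11bbx p.
Proof. intros Sp. unfold A_11_bb. apply (cov_eval f Hf confF omx (frZbar confF)); auto using coefs_B, A11b_eval. Qed.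

Lemma W_eval p : S3 p -> RtoC (fr_W confF p) = eval f Wx p.
Proof.
  intros Sp. unfold confF. cbn [fr_W]. assert (E := chk_W f Hf p Sp). rewrite <- (conj_eval f Hf) in E by auto.
  apply (f_equal Im) in E. destruct (eval f Wx p) as [a b]. simpl in *. apply C_eq; simpl; lra.
Qed.

Lemma eval_eAdd a b p : eval f (eAdd a b) p = (eval f a p + eval f b p)%C.
Proof. reflexivity. Qed.

Lemma sublap_eval g e p : S3 p -> (forall q, S3 q -> g q = eval f e q) -> sublap confF g p = eval f (sublapx e) p.
Proof.
  intros Sp H.
  assert (E1 : forall q, S3 q -> f_1 confF g q = eval f (covx omx 0 0 Zx e) q).
  { intros q Sq. exact (cov_eval f Hf confF omx (fr_Z confF) Zx 0 0 g e q eq_refl coefs_Z Sq H). }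
  assert (E2 : forall q, S3 q -> f_b confF g q = eval f (covx omx 0 0 Bx e) q).
  { intros q Sq. exact (cov_eval f Hf confF omx (frZbar confF) Bx 0 0 g e q eq_refl coefs_B Sq H). }
  assert (E3 := cov_eval f Hf confF omx (frZbar confF) Bx 1 0 (f_1 confF g) (covx omx 0 0 Zx e) p eq_refl coefs_B Sp E1).
  assert (E4 := cov_eval f Hf confF omx (fr_Z confF) Zx 0 1 (f_b confF g) (covx omx 0 0 Bx e) p eq_refl coefs_Z Sp E2).
  unfold sublap, f_1b, f_b1. rewrite E3, E4. unfold sublapx. rewrite eval_eAdd. reflexivity.
Qed.

Lemma sub_conj (z : C) : (2 * Ci * RtoC (Im z))%C = (z - Cconj z)%C.
Proof. destruct z. apply C_eq; simpl; ring. Qed.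

(** The structure equations are compared coefficient by coefficient in the standard coframe, where
    they are the symbolic identities [chk_th], [chk_t1], [chk_om_conj] and [chk_om]. *)
Lemma conf_frame : pseudohermitian_frame UT (conformal f) confF.
Proof.
  constructor.
  - apply (scf_z confT). intros; apply smooth_confT.
  - assert (He : smooth_fun UT (fun p => / 2 * exp (- f p))) by (apply smooth_fun_mult; [apply smooth_fun_const|apply smooth_exp_neg]).
    destruct (scf_z (fun p => fst (confZ p))) as [H1 H2].
    { intros. apply (smooth_scal_lin (fun p => / 2 * exp (- f p))); auto using lin_fieldX. }
    destruct (scf_z (fun p => snd (confZ p))) as [H3 H4].
    { intros. apply (smooth_scal_lin (fun p => - (/ 2 * exp (- f p)))); auto using lin_fieldY, smooth_fun_opp. }
    auto.
  - apply (smooth_fm f Hf).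
  - apply (smooth_fm f Hf).
  - apply (smooth_eval f Hf).
  - apply (smooth_eval f Hf Wx).
  - intros p Sp _. rewrite conformal_fm. cbn [fr_T confF]. split; [apply tangent_confT|]. split.
    + unfold fm. rewrite !ka_confT by auto. unfold Tx, thx, zx. cbn [sel xT xZ xB eval].
      transitivity ((RtoC (exp (f p)) * RtoC (exp (- f p))) * (RtoC (exp (f p)) * RtoC (exp (- f p))))%C; [ring|].
      rewrite exp_PM. ring.
    + intros v Hv. rewrite (d1_fm f Hf) by auto using tangent_confT. unfold comb, kk. rewrite !ka_confT by auto.
      assert (E : forall d e, pair_ok d e -> eval f (cdx thx d e) p = (Ci * eval f (wx t1x (cj3 t1x) d e) p)%C) by (intros; now apply chk_th).
      rewrite !E by (unfold pair_ok; auto). unfold wx, Tx, t1x, cj3, zx.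
      rewrite !eval_sub, !eval_sMul by auto. cbn [sel xT xZ xB eval cj map bar].
      gen_C (ka LT p v). gen_C (ka LZ p v). gen_C (ka LB p v). gen_C (jet f [LB] p). gen_C (jet f [LZ] p).
      rewrite !Cmult_conj. replace (Cconj (RtoC 2)) with (RtoC 2) by (apply C_eq; simpl; ring). replace (Cconj Ci) with (- Ci)%C by (apply C_eq; simpl; ring).
      assert (Hi := Ci2).
      assert (Hx := exp_PM f p). gen_C (RtoC (exp (f p))). gen_C (RtoC (exp (- f p))). ring [Hi Hx].
  - intros p Sp _. cbn [fr_Z confF]. split; [apply ct_confZ|].
    unfold JmulV, imulV, confZ. cbn [fst snd]. rewrite !fieldT_J.
    f_equal; ccx; unfold fieldT, fieldX, fieldY, mkv; simpl; unfold scal, mult, opp; simpl; unfold prod_scal, mult; simpl; ring.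
  - intros p Sp _. rewrite conformal_fm.
    assert (CZ := capp_fm f thx (fr_Z confF) Zx p coefs_Z Sp). assert (CB := capp_fm f thx (frZbar confF) Bx p coefs_B Sp).
    assert (DZ := capp_fm f t1x (fr_Z confF) Zx p coefs_Z Sp). assert (DB := capp_fm f t1x (frZbar confF) Bx p coefs_B Sp).
    cbn [fr_theta1 fr_T confF] in *. cbn [fr_Z] in *. rewrite CZ, CB, DZ, DB.
    repeat split; unfold pairing, thx, t1x, Zx, Bx, zx; cbn [xT xZ xB sAdd sMul eval]; try reflexivity.
    + unfold fm. rewrite !ka_confT by auto. unfold Tx. cbn [sel xT xZ xB eval]. ring.
    + rewrite <- exp_PM with (f := f) (p := p). ring.
  - intros p v w Sp _ Hv Hw. rewrite conformal_fm. rewrite (d1_fm f Hf) by auto.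
    rewrite (comb_ext f _ (fun d e => eMul (eC Ci) (wx t1x (cj3 t1x) d e))).
    + cbn [fr_theta1 confF]. unfold wedge11. rewrite !(fconj_fm f Hf) by auto. change (fm f t1x p v * fm f (cj3 t1x) p w - fm f t1x p w * fm f (cj3 t1x) p v)%C with (wedge11 (fm f t1x) (fm f (cj3 t1x)) p v w).
      rewrite wedge_fm. unfold comb. cbn [eval]. ring.
    + intros d e H. cbn [eval]. now apply chk_th.
  - intros p v w Sp _ Hv Hw. rewrite conformal_fm. cbn [fr_theta1 fr_omega fr_A confF]. rewrite (d1_fm f Hf) by auto.
    assert (E : wedge11 (fm f thx) (fconj (fm f t1x)) p v w = wedge11 (fm f thx) (fm f (cj3 t1x)) p v w).
    { unfold wedge11. now rewrite !(fconj_fm f Hf). }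
    rewrite E, !wedge_fm.
    rewrite (comb_ext f _ (fun d e => eAdd (wx t1x omx d e) (eMul Ax (wx thx (cj3 t1x) d e)))) by (intros; now apply chk_t1).
    unfold comb. cbn [eval]. ring.
  - intros p v Sp _ Hv. cbn [fr_omega confF]. rewrite (fconj_fm f Hf) by auto. unfold fm.
    assert (E := chk_om_conj f Hf p Sp). assert (ET := E LT). assert (EZ := E LZ). assert (EB := E LB). cbn [sel] in ET, EZ, EB.
    transitivity (ka LT p v * (eval f (xT omx) p + eval f (xT (cj3 omx)) p) + ka LZ p v * (eval f (xZ omx) p + eval f (xZ (cj3 omx)) p)
      + ka LB p v * (eval f (xB omx) p + eval f (xB (cj3 omx)) p))%C; [ring|]. rewrite ET, EZ, EB. ring.
  - intros p v w Sp _ Hv Hw. rewrite conformal_fm, W_eval, A11b_eval by auto. cbn [fr_theta1 fr_omega confF]. rewrite (d1_fm f Hf), sub_conj by auto.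
    assert (E : forall a b, wedge11 (fm f a) (fconj (fm f b)) p v w = wedge11 (fm f a) (fm f (cj3 b)) p v w).
    { intros a b. unfold wedge11. now rewrite !(fconj_fm f Hf). }
    assert (E2 : Cconj (wedge11 (fm f t1x) (fm f thx) p v w) = wedge11 (fm f (cj3 t1x)) (fm f (cj3 thx)) p v w).
    { unfold wedge11. rewrite <- !(fconj_fm f Hf) by auto. unfold fconj. now rewrite Cminus_conj, !Cmult_conj. }
    rewrite Cmult_conj, E, E2, (conj_eval f Hf), !wedge_fm by auto.
    rewrite (comb_ext f _ _ p v w (fun d e H => chk_om f Hf p Sp d e H)).
    unfold comb. cbn [eval]. rewrite !eval_sub. cbn [eval]. ring.
Qed.

End Conf.

(** * The Q-curvature of a conformal contact form *)

Lemma eval_Px f p : smooth_S3 f -> S3 p -> eval f Px p = RtoC (Pst f p).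
Proof.
  intros Hf Sp. assert (HO := cone0_open).
  set (UT := fun _ : C2 => True) in *.
  assert (E : forall g q, smooth_S3 g -> S3 q -> (Dl LB (Dl LZ (fun q => RtoC (g q))) q + Dl LZ (Dl LB (fun q => RtoC (g q))) q)%C = RtoC (/ 2 * Lop g q)).
  { intros g q Hg Sq. now apply (Dl_Lop UT). }
  assert (HL : smooth_S3 (fun q => / 2 * Lop f q)) by auto with sm.
  assert (S : forall w, smooth_cfun UT (jet f w)) by (intros; now apply smooth_jet).
  (* The inner two letters combine to the sub-Laplacian, half of [Lop], under the outer two. *)
  assert (K : forall d e, (jet f [d; e; LB; LZ] p + jet f [d; e; LZ; LB] p)%C = Dl d (Dl e (fun q => RtoC (/ 2 * Lop f q))) p).
  { intros d e. transitivity (Dl d (Dl e (fun q => jet f [LB; LZ] q + jet f [LZ; LB] q)%C) p).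
    - transitivity (Dl d (fun q => jet f [e; LB; LZ] q + jet f [e; LZ; LB] q)%C p); [symmetry; now apply (Dl_plus UT HO p Sp I d)|].
      apply (Dl_ext UT HO p Sp I). intros q Sq _. symmetry. exact (Dl_plus UT HO q Sq I e _ _ (S _) (S _)).
    - apply (Dl_ext UT HO p Sp I). intros q Sq _. apply (Dl_ext UT HO q Sq I). intros q' Sq' _. now apply E. }
  unfold Px. cbn [eval]. rewrite !K, E by auto.
  assert (EL : Lop (fun q => / 2 * Lop f q) p = / 2 * Lop (Lop f) p).
  { assert (D : forall A g q, lin A -> smooth_S3 g -> S3 q -> Dv A (fun q => / 2 * g q) q = / 2 * Dv A g q).
    { intros A g q HA Hg Sq. apply (Dv_scal A); auto. }
    assert (D2 : forall A, lin A -> Dv A (Dv A (fun q => / 2 * Lop f q)) p = / 2 * Dv A (Dv A (Lop f)) p).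
    { intros A HA. rewrite (Dv_ext_S3 A _ (fun q => / 2 * Dv A (Lop f) q)) by (auto; intros; apply D; auto with sm).
      apply D; auto with sm. }
    unfold Lop at 1 3. rewrite !D2 by auto with sm. ring. }
  rewrite EL. unfold Pst.
  assert (ET : jet f [LT; LT] p = RtoC (Dv fieldT (Dv fieldT f) p)).
  { unfold jet. cbn [fold_right Dl]. apply C_eq; [reflexivity|].
    transitivity (Dv fieldT (fun q => Dv fieldT (fun _ => 0) q) p); [reflexivity|].
    assert (E0 : (fun q => Dv fieldT (fun _ => 0) q) = (fun _ => 0)) by (extensionality q; apply (dirD_const 0 q (fieldT q))). rewrite E0.
    apply (dirD_const 0 p (fieldT p)). }
  rewrite ET. apply C_eq; simpl; field.
Qed.

Lemma Q_conformal f p : smooth_S3 f -> S3 p -> Q_of (confF f) p = RtoC (2 * exp (- f p) ^ 4 * Pst f p).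
Proof.
  intros Hf Sp. unfold Q_of. rewrite (sublap_eval f Hf _ Wx p Sp (W_eval f Hf)), (A11bb_eval f Hf p Sp).
  assert (EQ : (eval f (sublapx Wx) p + RtoC (2 * Im (eval f A11bbx p)))%C = eval f Qx p).
  { unfold Qx. rewrite eval_eAdd. f_equal.
    (* Twice the imaginary part is - i times the difference with the conjugate, which is how [Qx]
       encodes it. *)
    transitivity (- Ci * (eval f A11bbx p - Cconj (eval f A11bbx p)))%C; [destruct (eval f A11bbx p); apply C_eq; simpl; ring|].
    rewrite (conj_eval f Hf) by auto. rewrite <- eval_sub. reflexivity. }
  rewrite EQ, (chk_Q f Hf p Sp). cbn [eval]. rewrite eval_Px by auto. apply C_eq; simpl; field.
Qed.

Lemma Q_conformal_zero f : smooth_S3 f -> (forall p, S3 p -> Pst f p = 0) -> is_Q_curvature (conformal f) (fun _ => 0).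
Proof.
  intros Hf H p Sp. exists (fun _ => True), (confF f). split; [apply cone0_open|]. split; [exact I|]. split; [now apply conf_frame|].
  rewrite Q_conformal, H by auto. f_equal. ring.
Qed.

(** On the vectors T, X, Y of the standard frame the volume form theta /\ d theta takes the value 2
    e^(4f). *)
Lemma contact_conformal f : smooth_S3 f -> contact_form (conformal f).
Proof.
  intros Hf. split; [rewrite conformal_fm; now apply smooth_fm|]. split.
  - intros p v _. unfold conformal. rewrite theta0_eq. simpl. ring.
  - intros p Sp. exists (fieldT p), (fieldX p), (fieldY p).
    split; [apply tangent_fieldT|]. split; [apply tangent_fieldX|]. split; [apply tangent_fieldY|].
    rewrite conformal_fm. unfold wedge12. rewrite !(d1_fm f Hf) by auto using tangent_fieldT, tangent_fieldX, tangent_fieldY.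
    unfold comb, kk, fm. destruct (ka_fields p Sp) as [[E1 [E2 E3]] [[E4 [E5 E6]] [E7 [E8 E9]]]].
    rewrite E1, E2, E3, E4, E5, E6, E7, E8, E9. unfold cdx, thx, zx. cbn [sel xT xZ xB eval der sAdd sMul eSub eSub].
    assert (H := exp_pos (f p)).
    intros K. apply (f_equal Re) in K. simpl in K.
    assert (0 < exp (f p) * exp (f p) * (exp (f p) * exp (f p))) by (repeat apply Rmult_lt_0_compat; auto).
    ring_simplify in K. nra.
Qed.

Theorem corollary1p1 (Q0 : C2 -> R) (P0 : (C2 -> R) -> C2 -> R)
    (HQ0 : is_Q_curvature theta0 Q0) (HP0 : is_Paneitz theta0 P0)
    (lambda0 : C2 -> R) (Hsmooth : smooth_S3 lambda0)
    (Hvol : int_mu0 (fun p => exp (4 * lambda0 p)) = int_mu0 (fun _ => 1)) :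
  exists lambda : R -> C2 -> R,
    flow_solution Q0 P0 lambda0 lambda /\
    (forall mu : R -> C2 -> R, flow_solution Q0 P0 lambda0 mu ->
       forall t p, 0 <= t -> S3 p -> mu t p = lambda t p) /\
    exists lambda_inf : C2 -> R,
      smooth_S3 lambda_inf /\
      smooth_cvg lambda lambda_inf /\
      contact_form (conformal lambda_inf) /\
      is_Q_curvature (conformal lambda_inf) (fun _ => 0).
Proof.
  (* The frame computations turn the given operators and integrals into [Pst], [IS] and [rr] on
     smooth functions, where the explicit solution lives. *)
  assert (RR : forall l, smooth_S3 l -> flow_r Q0 P0 l = rr l).
  { intros l Hl. unfold flow_r, rr, IE. rewrite !int_mu0_IS. f_equal. apply IS_ext. intros p Sp.
    rewrite (Q0_zero Q0 p HQ0 Sp), (P0_Pst P0 l p HP0 Hl Sp). ring. }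
  assert (RHS : forall l p, smooth_S3 l -> S3 p -> - (Q0 p + 2 * P0 l p) + flow_r Q0 P0 l = -2 * Pst l p + rr l).
  { intros l p Hl Sp. rewrite (Q0_zero Q0 p HQ0 Sp), (P0_Pst P0 l p HP0 Hl Sp), RR by auto. ring. }
  assert (Hlam := smooth_lamsol lambda0 Hsmooth).
  exists (lamsol lambda0). split; [|split].
  - split; [exact Hlam|]. split; [intros; now apply lamsol_0|].
    intros t p Ht Sp. rewrite RHS by (auto; now apply slice_smooth). now apply lamsol_time.
  - intros mu [Smu [Hmu0 Hmu]]. apply unique_flow; auto.
    + intros p Sp. rewrite Hmu0 by auto. now apply lamsol_0.
    + intros t p Ht Sp. now apply lamsol_time.
    + intros t p Ht Sp. rewrite <- RHS by (auto; now apply slice_smooth). now apply Hmu.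
  - exists (laminf lambda0). assert (Hi := smooth_laminf lambda0 Hsmooth).
    split; [exact Hi|]. split; [now apply lamsol_cvg|]. split; [now apply contact_conformal|].
    apply Q_conformal_zero; auto. intros p Sp. now apply Pst_laminf.
Qed.
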